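(* The space $\mathcal{S}$ of polynomial sections of singular solutions is an algebraic family of Harish-Chandra modules for $(\mathfrak{g},K)$. The Wronskian form $\mathrm{Wr}\colon\mathcal{S}\times\mathcal{R}\to\mathcal{O}$ induces an isomorphism of algebraic families of Harish-Chandra modules from $\mathcal{S}$ to the $\theta$-twisted dual of $\mathcal{R}$.
   Context: Fix a real constant $\gamma>0$. Put $\mathbb{R}^3_0=\mathbb{R}^3\setminus\{0\}$, $r=\|x\|$, and $T=-\Delta-2\gamma/r$, viewed in the algebra of linear partial differential operators on $\mathbb{R}^3_0$ with smooth coefficients. Let $\mathcal{O}=\mathbb{C}[T]$ (viewed as polynomial functions of $\lambda\in\mathbb{C}$). Let $L_1=x_2\partial_3-x_3\partial_2$, $L_2=x_3\partial_1-x_1\partial_3$, $L_3=x_1\partial_2-x_2\partial_1$, and let the Runge-Lenz operators be $R_1=\sqrt{-1}(L_3\partial_2-L_2\partial_3-\partial_1+\gamma x_1/r)$, $R_2=\sqrt{-1}(L_1\partial_3-L_3\partial_1-\partial_2+\gamma x_2/r)$, $R_3=\sqrt{-1}(L_2\partial_1-L_1\partial_2-\partial_3+\gamma x_3/r)$. All commute with $T$. $\mathfrak{g}$ is the $\mathcal{O}$-linear span of the $L_i,R_i$; it is a Lie algebra over $\mathcal{O}$ under the commutator, free on these six elements, with $[L_i,L_j]=-\varepsilon_{ijk}L_k$, $[R_i,R_j]=\varepsilon_{ijk}TL_k$, $[L_i,R_j]=-\varepsilon_{ijk}R_k$. $\theta\colon\mathfrak{g}\to\mathfrak{g}$ is the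 $\mathcal{O}$-linear involution with $\theta(L_i)=L_i$, $\theta(R_i)=-R_i$. $K=O(3,\mathbb{C})$ (compact form $O(3)$). $O(3)$ acts on $\mathbb{R}^3_0$ by $A\colon v\mapsto\det(A)^{-1}Av$, hence on functions and, by conjugation, on $\mathfrak{g}$; this extends algebraically to $K$. The infinitesimal action identifies $\mathfrak{k}=\mathfrak{so}(3,\mathbb{C})$ with the span of the $L_i$. An algebraic family of Harish-Chandra modules for $(\mathfrak{g},K)$ is a free $\mathcal{O}$-module $\mathcal{F}$ with a locally finite-dimensional algebraic representation of $K$ by $\mathcal{O}$-module automorphisms, with finitely generated free isotypical summands, and with a $K$-equivariant $\mathcal{O}$-linear Lie algebra action of $\mathfrak{g}$ whose restriction to $\mathfrak{k}$ is the infinitesimal form of the $K$-action. Its dual is $\mathcal{F}^*=\mathrm{Hom}_{\mathcal{O}}(\mathcal{F},\mathcal{O})_{\mathrm{fin}}$ ($K$-finite part, contragredient actions). The $\theta$-twisted dual is $\mathcal{F}^*$ with $X\in\mathfrak{g}$ acting by $\xi\mapsto\theta(X)\xi$. For $\lambda\in\mathbb{C}$, $\mathrm{Sol}(\lambda)=\{\psi\in C^\infty(\mathbb{R}^3_0)_{\mathrm{fin}}: T\psi=\lambda\psi\}$ (fin denotes $K$-finite functions). The radial equation is $r^2\psi''+2r\psi'-\ell(\ell+1)\psi+2\gamma r\psi+\lambda r^2\psi=0$. $F_{\ell,\lambda}$ is its unique solution extending to an entire function of $r$ with $F_{\ell,\lambda}(r)=r^\ell+\text{higher-order terms}$. $G_{\ell,\lambda}$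 is a second solution of the form $G_{\ell,\lambda}=H_{\ell,\lambda}+C_{\ell,\lambda}\log(r)F_{\ell,\lambda}$, with $H_{\ell,\lambda}$ meromorphic with a pole of order $\ell+1$ at $0$, $C_{\ell,\lambda}$ constant, normalized so that the coefficient of $r^{-(\ell+1)}$ is $1$ (it is well defined modulo multiples of $F_{\ell,\lambda}$). $\mathrm{RegSol}(\lambda)\subseteq\mathrm{Sol}(\lambda)$ is the span of the functions $F_{\ell,\lambda}(r)Y_\ell$ with $Y_\ell$ a spherical harmonic of degree $\ell$, $\ell\ge0$; it is $\mathfrak{g}$- and $K$-invariant; $\mathrm{SingSol}(\lambda)=\mathrm{Sol}(\lambda)/\mathrm{RegSol}(\lambda)$. $\mathcal{R}$ is the span of the sections $\lambda\mapsto p(\lambda)F_{\ell,\lambda}Y_\ell\in\mathrm{RegSol}(\lambda)$, and $\mathcal{S}$ is the span of the sections $\lambda\mapsto[p(\lambda)G_{\ell,\lambda}Y_\ell]\in\mathrm{SingSol}(\lambda)$, $p$ polynomial, $Y_\ell$ a spherical harmonic of degree $\ell$. $T$ acts as multiplication by $\lambda$; $\mathfrak{g}$ and $K$ act pointwise in $\lambda$ through their actions on functions on $\mathbb{R}^3_0$. ($\mathcal{R}$ is an algebraic family of Harish-Chandra modules in this way.) The Wronskian form on $\mathrm{Sol}(\lambda)$ is $\mathrm{Wr}(\varphi,\psi)=\frac1{4\pi}\int_{S^2} r^2\bigl(\frac{\partial\varphi}{\partial r}\psi-\varphi\frac{\partial\psi}{\partial r}\bigr)\,d\mathrm{Area}$,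 which is independent of $r$. It vanishes on $\mathrm{RegSol}(\lambda)\times\mathrm{RegSol}(\lambda)$, so it induces a pairing $\mathrm{SingSol}(\lambda)\times\mathrm{RegSol}(\lambda)\to\mathbb{C}$ and, pointwise in $\lambda$, a pairing $\mathcal{S}\times\mathcal{R}\to\mathcal{O}$. *)

(* Defs.v *)
From HB Require Import structures.
From mathcomp Require Import all_boot all_order all_algebra.
From mathcomp Require Import complex.
From mathcomp Require Import all_classical all_reals all_analysis.
From mathcomp.multinomials Require mpoly.
(* The notations of [mpoly] clash with those of the analysis library. *)
Import (canonicals, coercions, hints) mpoly.

(* [R : realType] is an arbitrary model of the real numbers and [R[i]] its field
   of complex numbers.  The indices 1, 2, 3 are the elements 0, 1, 2 of the
   cyclic group ['I_3], so that [(i, i + 1, i + 2)] is always an even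
   permutation. *)

Set Implicit Arguments.
Unset Strict Implicit.
Unset Printing Implicit Defensive.

Import Order.TTheory GRing.Theory Num.Theory.
Import numFieldNormedType.Exports.

Local Open Scope classical_set_scope.
Local Open Scope ring_scope.
Local Open Scope complex_scope.

Section Span.
Variables (K : nzRingType) (V : lmodType K).

Definition lspan (A : set V) : set V :=
  [set v | exists n (c : 'I_n -> K) (a : 'I_n -> V),
     (forall i, A (a i)) /\ v = \sum_i c i *: a i].

Definition lspan_pred (A : set V) : {pred V} := fun v => `[< lspan A v >].

Lemma lspan_submod (A : set V) : submod_closed (lspan_pred A).
Proof.
split=> [|k u v /asboolP[n [c [a [Aa ->]]]] /asboolP[m [d [b [Ab ->]]]]].
  apply/asboolP; exists 0%N, (fun=> 0), (fun=> 0).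
  by split=> [[]//|]; rewrite big_ord0.
apply/asboolP; exists (n + m)%N.
exists (fun i : 'I_(n + m) => match fintype.split i with inl j => k * c j | inr j => d j end).
exists (fun i : 'I_(n + m) => match fintype.split i with inl j => a j | inr j => b j end).
split=> [i|]; first by case: (fintype.split i).
rewrite big_split_ord /= scaler_sumr; congr (_ + _); apply: eq_bigr => i _.
  by rewrite (unsplitK (inl i)) scalerA.
by rewrite (unsplitK (inr i)).
Qed.

HB.instance Definition _ (A : set V) :=
  GRing.isSubmodClosed.Build K V (lspan_pred A) (lspan_submod A).

Definition lspan_type (A : set V) := {v : V | v \in lspan_pred A}.
HB.instance Definition _ (A : set V) :=
  [isSub of lspan_type A for @sval V (fun v => v \in lspan_pred A)].
HB.instance Definition _ (A : set V) := [Choice of lspan_type A by <:].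
HB.instance Definition _ (A : set V) :=
  [SubChoice_isSubLmodule of lspan_type A by <:].

Definition lin_indep (B : set V) : Prop :=
  forall n (b : 'I_n -> V) (c : 'I_n -> K), injective b -> (forall i, B (b i)) ->
    \sum_i c i *: b i = 0 -> forall i, c i = 0.

Definition free_module : Prop :=
  exists B : set V, lin_indep B /\ forall v, lspan B v.

Definition fin_free (E : set V) : Prop :=
  exists n (b : 'I_n -> V), (forall i, E (b i)) /\
    forall v, E v -> exists! c : 'rV[K]_n, v = \sum_i c 0 i *: b i.

End Span.

(* [lquot A] is the quotient of [V] by the submodule spanned by [A]. *)
Section Quotient.
Variables (K : nzRingType) (V : lmodType K) (A : set V).

Definition lquot := Quotient.quot (lspan_pred A).
HB.instance Definition _ := Choice.on lquot.
HB.instance Definition _ := GRing.Zmodule.on lquot.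

Definition lproj (v : V) : lquot := (\pi_(Quotient.quot (lspan_pred A)) v)%qT.

Lemma lprojP u v : lproj u = lproj v <-> lspan A (u - v).
Proof.
rewrite /lproj; split=> [/eqP|Auv]; last apply/eqP.
  by rewrite -Quotient.idealrBE => /asboolP.
by rewrite -Quotient.idealrBE; apply/asboolP.
Qed.

Lemma lproj_surj (q : lquot) : exists v, lproj v = q.
Proof.
by exists (repr (q : Quotient.quot (lspan_pred A))); rewrite /lproj reprK.
Qed.

Lemma lprojD : {morph lproj : u v / u + v}.
Proof. by move=> u v; rewrite /lproj !piE. Qed.

Definition lquot_scale (k : K) (q : lquot) : lquot :=
  lproj (k *: repr (q : Quotient.quot (lspan_pred A))).

Lemma lprojZ k v : lquot_scale k (lproj v) = lproj (k *: v).
Proof.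
apply/lprojP; rewrite -scalerBr; apply/asboolP.
have /asboolP Auv : lspan A (repr (lproj v : Quotient.quot (lspan_pred A)) - v).
  by apply/lprojP; rewrite /lproj reprK.
by rewrite -[X in is_true X]/(_ \in lspan_pred A) rpredZ.
Qed.

Fact lquot_scaleA a b v :
  lquot_scale a (lquot_scale b v) = lquot_scale (a * b) v.
Proof. by have [u <-] := lproj_surj v; rewrite !lprojZ scalerA. Qed.
Fact lquot_scale1 : left_id 1 lquot_scale.
Proof. by move=> v; have [u <-] := lproj_surj v; rewrite lprojZ scale1r. Qed.
Fact lquot_scaleDr : right_distributive lquot_scale +%R.
Proof.
move=> a v w; have [u <-] := lproj_surj v; have [t <-] := lproj_surj w.
by rewrite -lprojD !lprojZ scalerDr lprojD.
Qed.
Fact lquot_scaleDl v : {morph lquot_scale^~ v : a b / a + b}.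
Proof.
by move=> a b; have [u <-] := lproj_surj v; rewrite !lprojZ scalerDl lprojD.
Qed.
HB.instance Definition _ := GRing.Zmodule_isLmodule.Build K lquot
  lquot_scaleA lquot_scale1 lquot_scaleDr lquot_scaleDl.

End Quotient.

(* Sections of a family of vector spaces indexed by the spectral parameter
   [lam]; a polynomial [p] acts by multiplication by the function [p.[lam]], so
   that ['X] acts as multiplication by [lam]. *)
Section Sections.
Variables (R : realType) (V : R[i] -> lmodType R[i]).

Definition sections := forall lam, V lam.
HB.instance Definition _ := gen_eqMixin sections.
HB.instance Definition _ := gen_choiceMixin sections.

Let add (s t : sections) : sections := fun lam => s lam + t lam.
Let opp (s : sections) : sections := fun lam => - s lam.
Let zero : sections := fun=> 0.
Let scale (p : {poly R[i]}) (s : sections) : sections :=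
  fun lam => p.[lam] *: s lam.

Let addA : associative add.
Proof. by move=> ? ? ?; apply: functional_extensionality_dep => l; apply: addrA. Qed.
Let addC : commutative add.
Proof. by move=> ? ?; apply: functional_extensionality_dep => l; apply: addrC. Qed.
Let add0 : left_id zero add.
Proof. by move=> ?; apply: functional_extensionality_dep => l; apply: add0r. Qed.
Let addN : left_inverse zero opp add.
Proof. by move=> ?; apply: functional_extensionality_dep => l; apply: addNr. Qed.
HB.instance Definition _ := GRing.isZmodule.Build sections addA addC add0 addN.

Let scaleA p q s : scale p (scale q s) = scale (p * q) s.
Proof.
by apply: functional_extensionality_dep => l; rewrite /scale scalerA hornerM.
Qed.
Let scale1 : left_id 1 scale.
Proof.
by move=> s; apply: functional_extensionality_dep => l; rewrite /scale hornerC scale1r.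
Qed.
Let scaleDr : right_distributive scale +%R.
Proof.
by move=> p s t; apply: functional_extensionality_dep => l; apply: scalerDr.
Qed.
Let scaleDl s : {morph scale^~ s : p q / p + q}.
Proof.
move=> p q; apply: functional_extensionality_dep => l.
by rewrite /scale hornerD scalerDl.
Qed.
HB.instance Definition _ := GRing.Zmodule_isLmodule.Build {poly R[i]} sections
  scaleA scale1 scaleDr scaleDl.

End Sections.

(* Points of [O(3)] (over the reals) and of [O(3,C)] (over the complexes), and
   the homomorphism [A |-> det(A)^-1 A] onto the special orthogonal group. *)
Definition orthogonal_mx (F : fieldType) (A : 'M[F]_3) : Prop := A^T *m A = 1%:M.
Definition rho (F : fieldType) (A : 'M[F]_3) : 'M[F]_3 := (\det A)^-1 *: A.

Section Family.
Variable R : realType.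
Local Notation C := R[i].
Local Notation O := {poly R[i]}.

(* Polynomial functions of the nine entries of a matrix; their restrictions to
   [O(3,C)] are the regular functions of this algebraic group (the inverse of
   the determinant is the determinant). *)
Definition regfun := mpoly.mpoly (3 * 3) C.
Definition regeval (A : 'M[C]_3) (f : regfun) : C :=
  mpoly.meval (fun k => mxvec A 0 k) f.
(* The differential at the identity matrix.  For skew-symmetric [xi], that is,
   in directions tangent to [O(3,C)], it only depends on the restriction of [f]
   to [O(3,C)]. *)
Definition regdiff (xi : 'M[C]_3) (f : regfun) : C :=
  \sum_k mxvec xi 0 k * regeval 1%:M (mpoly.mderiv k f).

(* The free [C[T]]-module on the [L_i], [R_i]: the pair [(a, b)] stands for
   [\sum_i a_i L_i + \sum_i b_i R_i], and ['X] for [T].  The differential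
   operator that it denotes is [gop] below; [gbracket] is the commutator. *)
Definition galg : lmodType O := ('rV[O]_3 * 'rV[O]_3)%type.

Definition cross (u v : 'rV[O]_3) : 'rV[O]_3 :=
  \row_(k < 3) (u 0 (k + 1) * v 0 (k + 2%:R) - u 0 (k + 2%:R) * v 0 (k + 1)).

(* [L_i,L_j] = - eps_ijk L_k, [R_i,R_j] = eps_ijk T L_k, and
   [L_i,R_j] = [R_i,L_j] = - eps_ijk R_k. *)
Definition gbracket (X Y : galg) : galg :=
  (- cross X.1 Y.1 + 'X *: cross X.2 Y.2, - cross X.1 Y.2 - cross X.2 Y.1).

Definition gtheta (X : galg) : galg := (X.1, - X.2).

(* Conjugation by the action of [A] on functions sends [L_i] to
   [\sum_j (rho A)_ji L_j], and likewise for the [R_i]; the same formula gives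
   the algebraic extension to [O(3,C)]. *)
Definition gAd (A : 'M[C]_3) (X : galg) : galg :=
  let P := (map_mx polyC (rho A))^T in (X.1 *m P, X.2 *m P).

(* The infinitesimal action on functions of a skew-symmetric [xi] is
   [- \sum_(i,j) xi_ij x_j d_i = \sum_k xi_(k+1,k+2) L_k]. *)
Definition so3_to_galg (xi : 'M[C]_3) : galg :=
  (\row_(k < 3) (xi (k + 1) (k + 2%:R))%:P, 0).

Section Representations.
Variables (F : lmodType O) (act : 'M[C]_3 -> F -> F).

(* The complex span of the [w j] is stable under [O(3,C)], which acts on it
   through the matrix [M] of regular functions. *)
Definition regular_frame n (w : 'I_n -> F) (M : 'M[regfun]_n) : Prop :=
  forall A, orthogonal_mx A -> forall j,
    act A (w j) = \sum_i (regeval A (M i j))%:P *: w i.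

Definition locally_algebraic : Prop :=
  forall v, exists n (w : 'I_n -> F) (M : 'M[regfun]_n),
    regular_frame w M /\ exists c : 'I_n -> C, v = \sum_i (c i)%:P *: w i.

Definition irreducible_rep n (tau : 'M[regfun]_n) : Prop :=
  let t A := map_mx (regeval A) tau in
  [/\ (0 < n)%N,
      t 1%:M = 1%:M,
      forall A B, orthogonal_mx A -> orthogonal_mx B -> t (A *m B) = t A *m t B
    & forall U : 'M[C]_n,
        (forall A, orthogonal_mx A -> (U *m (t A)^T <= U)%MS) ->
        U = 0 \/ row_full U].

(* The sum of the images of all equivariant maps from the representation [tau]
   to [F]; such a map is determined by the images [w j] of the basis vectors. *)
Definition isotypic n (tau : 'M[regfun]_n) : set F :=
  lspan [set v | exists w : 'I_n -> F, regular_frame w tau /\ exists j, v = w j].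

End Representations.

Record hc_family (F : lmodType O) := HCFamily {
  kact : 'M[C]_3 -> F -> F;
  gact : galg -> F -> F;
  hc_free : free_module F;
  kact_linear : forall A, orthogonal_mx A -> linear (kact A);
  kact1 : forall v, kact 1%:M v = v;
  kactM : forall A B, orthogonal_mx A -> orthogonal_mx B ->
    forall v, kact (A *m B) v = kact A (kact B v);
  kact_algebraic : locally_algebraic kact;
  kact_isotypic : forall n (tau : 'M[regfun]_n),
    irreducible_rep tau -> fin_free (isotypic kact tau);
  gact_linear : forall X, linear (gact X);
  gact_linearl : forall v, linear (gact^~ v);
  gact_bracket : forall X Y v,
    gact (gbracket X Y) v = gact X (gact Y v) - gact Y (gact X v);
  gact_equivariant : forall A, orthogonal_mx A -> forall X v,
    kact A (gact X v) = gact (gAd A X) (kact A v);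
  gact_infinitesimal : forall n (w : 'I_n -> F) (M : 'M[regfun]_n),
    regular_frame kact w M -> forall xi : 'M[C]_3, xi^T = - xi -> forall j,
    gact (so3_to_galg xi) (w j) = \sum_i (regdiff xi (M i j))%:P *: w i
}.

Definition hc_isomorphism (E F : lmodType O) (aE : hc_family E)
    (aF : hc_family F) (Phi : E -> F) : Prop :=
  [/\ linear Phi, bijective Phi,
      forall A, orthogonal_mx A -> forall v,
        Phi (kact aE A v) = kact aF A (Phi v)
    & forall X v, Phi (gact aE X v) = gact aF X (Phi v)].

Section Dual.
Variables (F : lmodType O) (act : 'M[C]_3 -> F -> F).

Definition kfinite_functional (xi : F -> O) : Prop :=
  exists n (w : 'I_n -> F -> O), forall A, orthogonal_mx A ->
    exists c : 'I_n -> C, forall v,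
      xi (act (invmx A) v) = \sum_i (c i)%:P * w i v.

Definition hc_dual_pred : {pred F -> O^o} := fun xi =>
  `[< (forall p u v, xi (p *: u + v) = p * xi u + xi v) /\
      kfinite_functional xi >].

Lemma hc_dual_submod : submod_closed hc_dual_pred.
Proof.
split.
  apply/asboolP; split=> [p u v|]; first by rewrite mulr0 addr0.
  by exists 0%N, (fun=> fun=> 0) => A _; exists (fun=> 0) => v; rewrite big_ord0.
move=> p f g /asboolP[linf [n [w fw]]] /asboolP[ling [m [u gu]]].
apply/asboolP; split=> [q s t|].
  have E x : (p *: f + g) x = p * f x + g x by [].
  rewrite !E linf ling !mulrDr [p * (q * _)]mulrCA -!addrA; congr (_ + _).
  by rewrite addrCA.
exists (n + m)%N.
exists (fun (i : 'I_(n + m)) v => match fintype.split i with inl j => p * w j v | inr j => u j v end).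
move=> A oA; have [c cE] := fw A oA; have [d dE] := gu A oA.
exists (fun i : 'I_(n + m) => match fintype.split i with inl j => c j | inr j => d j end) => v.
have -> : (p *: f + g) (act (invmx A) v) =
  p * f (act (invmx A) v) + g (act (invmx A) v) by [].
rewrite cE dE big_split_ord /= mulr_sumr; congr (_ + _); apply: eq_bigr => i _.
  by rewrite (unsplitK (inl i)) mulrCA.
by rewrite (unsplitK (inr i)).
Qed.

HB.instance Definition _ :=
  GRing.isSubmodClosed.Build O (F -> O^o) hc_dual_pred hc_dual_submod.

Definition hc_dual := {xi : F -> O^o | xi \in hc_dual_pred}.
HB.instance Definition _ :=
  [isSub of hc_dual for @sval (F -> O^o) (fun xi => xi \in hc_dual_pred)].
HB.instance Definition _ := [Choice of hc_dual by <:].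
HB.instance Definition _ := [SubChoice_isSubLmodule of hc_dual by <:].

End Dual.

Definition is_twisted_dual (F : lmodType O) (aF : hc_family F)
    (aD : hc_family (hc_dual (kact aF))) : Prop :=
  (forall A, orthogonal_mx A -> forall xi v,
     val (kact aD A xi) v = val xi (kact aF (invmx A) v)) /\
  (forall X xi v,
     val (gact aD X xi) v = - val xi (gact aF (gtheta X) v)).

End Family.
Arguments is_twisted_dual {R F} aF aD.

Section Analysis.
Variable R : realType.
Local Notation C := R[i].

(* The norm that the library puts on ['cV_3] is the sup norm. *)
Definition enorm (x : 'cV[R]_3) : R := Num.sqrt (\sum_i x i 0 ^+ 2).

Definition punctured := {x : 'cV[R]_3 | x != 0}.
Definition fun_R3 := punctured -> C^o.

(* Extension by zero at the origin; only the values away from the origin are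
   ever used. *)
Definition ext (f : fun_R3) (x : 'cV[R]_3) : C :=
  if insub x is Some y then f y else 0.

Definition Re_ext (f : fun_R3) : 'cV[R]_3 -> R := fun y => complex.Re (ext f y).
Definition Im_ext (f : fun_R3) : 'cV[R]_3 -> R := fun y => complex.Im (ext f y).

Definition kfun (A : 'M[R]_3) (f : fun_R3) : fun_R3 :=
  fun x => ext f (invmx (rho A) *m val x).

Definition pd (i : 'I_3) (f : fun_R3) : fun_R3 := fun x =>
  'D_(delta_mx i 0) (Re_ext f) (val x) +i* 'D_(delta_mx i 0) (Im_ext f) (val x).

Definition pderivable (f : fun_R3) (x : punctured) (i : 'I_3) : Prop :=
  derivable (Re_ext f) (val x) (delta_mx i 0) /\
  derivable (Im_ext f) (val x) (delta_mx i 0).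

(* All iterated partial derivatives exist and are continuous. *)
Definition smooth (f : fun_R3) : Prop :=
  forall (s : seq 'I_3) (x : punctured), let g := foldr pd f s in
  [/\ {for val x, continuous (Re_ext g)},
      {for val x, continuous (Im_ext g)}
    & forall i, pderivable g x i].

Definition kfinite_fun (f : fun_R3) : Prop :=
  exists n (w : 'I_n -> fun_R3), forall A, orthogonal_mx A ->
    exists c : 'I_n -> C, kfun A f = \sum_i c i *: w i.

Section Operators.
Variable gamma : R.

Definition mul_coord (i : 'I_3) (f : fun_R3) : fun_R3 := fun x => (val x i 0)%:C * f x.
Definition mul_rinv (f : fun_R3) : fun_R3 := fun x => ((enorm (val x))^-1)%:C * f x.

Definition opT (f : fun_R3) : fun_R3 :=
  - (\sum_i pd i (pd i f)) - (2 * gamma)%:C *: mul_rinv f.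
Definition opL (i : 'I_3) (f : fun_R3) : fun_R3 :=
  mul_coord (i + 1) (pd (i + 2%:R) f) - mul_coord (i + 2%:R) (pd (i + 1) f).
Definition opR (i : 'I_3) (f : fun_R3) : fun_R3 :=
  (0 +i* 1) *: (opL (i + 2%:R) (pd (i + 1) f) - opL (i + 1) (pd (i + 2%:R) f)
                - pd i f + gamma%:C *: mul_coord i (mul_rinv f)).

Definition polyT (p : {poly C}) (f : fun_R3) : fun_R3 :=
  \sum_(k < size p) p`_k *: iter k opT f.
Definition gop (X : galg R) (f : fun_R3) : fun_R3 :=
  \sum_i (polyT (X.1 0 i) (opL i f) + polyT (X.2 0 i) (opR i f)).

End Operators.

Lemma extD c (f g : fun_R3) y : ext (c *: f + g) y = c * ext f y + ext g y.
Proof. by rewrite /ext; case: insubP => // _; rewrite mulr0 addr0. Qed.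

Lemma Re_mulD (c u v : C) : complex.Re (c * u + v) =
  complex.Re c * complex.Re u - complex.Im c * complex.Im u + complex.Re v.
Proof. by case: c u v => [? ?] [? ?] []. Qed.

Lemma Im_mulD (c u v : C) : complex.Im (c * u + v) =
  complex.Re c * complex.Im u + complex.Im c * complex.Re u + complex.Im v.
Proof. by case: c u v => [? ?] [? ?] []. Qed.

Lemma Re_extD c (f g : fun_R3) : Re_ext (c *: f + g) =
  complex.Re c \*: Re_ext f - complex.Im c \*: Im_ext f + Re_ext g.
Proof. by apply/funext => y; rewrite /Re_ext extD; exact: Re_mulD. Qed.

Lemma Im_extD c (f g : fun_R3) : Im_ext (c *: f + g) =
  complex.Re c \*: Im_ext f + complex.Im c \*: Re_ext f + Im_ext g.
Proof. by apply/funext => y; rewrite /Im_ext extD; exact: Im_mulD. Qed.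

Lemma pderivableD c f g x i : pderivable f x i -> pderivable g x i ->
  pderivable (c *: f + g) x i.
Proof.
move=> [rf imf] [rg img]; rewrite /pderivable Re_extD Im_extD.
have rZ k : derivable (k \*: Re_ext f) (val x) (delta_mx i 0).
  exact: derivableZ.
have iZ k : derivable (k \*: Im_ext f) (val x) (delta_mx i 0).
  exact: derivableZ.
have hR := derivableD (derivableB (rZ (complex.Re c)) (iZ (complex.Im c))) rg.
have hI := derivableD (derivableD (iZ (complex.Re c)) (rZ (complex.Im c))) img.
by split; [exact: hR | exact: hI].
Qed.

Lemma pdD i c f g x : pderivable f x i -> pderivable g x i ->
  pd i (c *: f + g) x = c * pd i f x + pd i g x.
Proof.
move=> [rf imf] [rg img]; rewrite /pd Re_extD Im_extD.
have rZ k : derivable (k \*: Re_ext f) (val x) (delta_mx i 0) by exact: derivableZ.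
have iZ k : derivable (k \*: Im_ext f) (val x) (delta_mx i 0) by exact: derivableZ.
rewrite (deriveD (derivableB (rZ _) (iZ _)) rg) (deriveB (rZ _) (iZ _)).
rewrite (deriveD (derivableD (iZ _) (rZ _)) img) (deriveD (iZ _) (rZ _)).
rewrite (deriveZ _ rf) (deriveZ _ imf) (deriveZ _ imf) (deriveZ _ rf).
by case: c.
Qed.

Lemma smoothD c (f g : fun_R3) : smooth f -> smooth g ->
  (forall s, foldr pd (c *: f + g) s = c *: foldr pd f s + foldr pd g s)
  /\ smooth (c *: f + g).
Proof.
move=> sf sg.
have E s : foldr pd (c *: f + g) s = c *: foldr pd f s + foldr pd g s.
  elim: s => //= i s ->; apply/funext => x.
  have [_ _ df] := sf s x; have [_ _ dg] := sg s x.
  by rewrite pdD.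
split; first exact: E.
move=> s x; cbv zeta; rewrite E.
have [rf imf df] := sf s x; have [rg img dg] := sg s x.
split; last by move=> i; apply: pderivableD; [exact: df | exact: dg].
  rewrite Re_extD.
  have hr k := @continuousZl_tmp _ _ _ _ k _ rf.
  have hi k := @continuousZl_tmp _ _ _ _ k _ imf.
  have h := continuousD (continuousB (hr (complex.Re c)) (hi (complex.Im c))) rg.
  exact: h.
rewrite Im_extD.
have hr k := @continuousZl_tmp _ _ _ _ k _ rf.
have hi k := @continuousZl_tmp _ _ _ _ k _ imf.
have h := continuousD (continuousD (hi (complex.Re c)) (hr (complex.Im c))) img.
exact: h.
Qed.

Lemma kfunD A c (f g : fun_R3) : kfun A (c *: f + g) = c *: kfun A f + kfun A g.
Proof. by apply/funext => x; rewrite /kfun extD. Qed.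

Lemma opTD gamma c (f g : fun_R3) : smooth f -> smooth g ->
  opT gamma (c *: f + g) = c *: opT gamma f + opT gamma g.
Proof.
move=> sf sg; have [E _] := smoothD c sf sg.
have Ei i : pd i (pd i (c *: f + g)) = c *: pd i (pd i f) + pd i (pd i g).
  exact: (E [:: i; i]).
have Es : \sum_i pd i (pd i (c *: f + g)) =
    c *: \sum_i pd i (pd i f) + \sum_i pd i (pd i g).
  by rewrite scaler_sumr -big_split; apply: eq_bigr => i _; exact: Ei.
have Er : mul_rinv (c *: f + g) = c *: mul_rinv f + mul_rinv g.
  by apply/funext => x; rewrite /mul_rinv [LHS]mulrDr mulrCA.
have H (V : lmodType C) (k : C) (a b u v : V) :
    - (c *: a + b) - k *: (c *: u + v) = c *: (- a - k *: u) + (- b - k *: v).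
  rewrite scalerBr scalerN opprD scalerDr !scalerA [c * k]mulrC -scalerA opprD.
  by rewrite addrACA !scalerA.
have -> : opT gamma (c *: f + g) = - (\sum_i pd i (pd i (c *: f + g)))
    - (2 * gamma)%:C *: mul_rinv (c *: f + g) by [].
rewrite {}Es.
rewrite {}Er.
exact: H.
Qed.

Section Sol.
Variables (gamma : R) (lam : C).

Definition sol_pred : {pred fun_R3} := fun f =>
  `[< [/\ smooth f, kfinite_fun f & opT gamma f = lam *: f] >].

Lemma Re_ext0 : Re_ext (0 : fun_R3) = cst 0.
Proof. by apply/funext => y; rewrite /Re_ext /ext; case: insubP. Qed.

Lemma Im_ext0 : Im_ext (0 : fun_R3) = cst 0.
Proof. by apply/funext => y; rewrite /Im_ext /ext; case: insubP. Qed.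

Lemma smooth0 : smooth (0 : fun_R3).
Proof.
have E s : foldr pd 0 s = 0.
  elim: s => //= i s ->; apply/funext => x.
  by rewrite /pd Re_ext0 Im_ext0 derive_cst.
move=> s x; cbv zeta; rewrite E /pderivable Re_ext0 Im_ext0.
split; [exact: cst_continuous | exact: cst_continuous|].
by move=> i; split; exact: derivable_cst.
Qed.

Lemma sol_submod : submod_closed sol_pred.
Proof.
split.
  apply/asboolP; split; first exact: smooth0.
    exists 0%N, (fun=> 0) => A _; exists (fun=> 0); rewrite big_ord0.
    by apply/funext => x; rewrite /kfun /ext; case: insubP.
  have := opTD gamma (- 1) smooth0 smooth0.
  by rewrite !scaler0 addr0 scaleN1r addNr.
move=> c f g /asboolP[sf [n [w fw]] Tf] /asboolP[sg [m [u gu]] Tg].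
apply/asboolP; split.
- by have [_] := smoothD c sf sg.
- exists (n + m)%N.
  exists (fun i : 'I_(n + m) =>
    match fintype.split i with inl j => c *: w j | inr j => u j end).
  move=> A oA; have [d dE] := fw A oA; have [e eE] := gu A oA.
  exists (fun i : 'I_(n + m) =>
    match fintype.split i with inl j => d j | inr j => e j end).
  rewrite kfunD dE eE big_split_ord scaler_sumr; congr (_ + _).
    by apply: eq_bigr => i _; rewrite (unsplitK (inl i)) !scalerA mulrC.
  by apply: eq_bigr => i _; rewrite (unsplitK (inr i)).
- by rewrite opTD // Tf Tg scalerDr !scalerA mulrC.
Qed.

HB.instance Definition _ :=
  GRing.isSubmodClosed.Build C fun_R3 sol_pred sol_submod.

Definition Sol := {f : fun_R3 | f \in sol_pred}.
HB.instance Definition _ := [isSub of Sol for @sval fun_R3 (fun f => f \in sol_pred)].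
HB.instance Definition _ := [Choice of Sol by <:].
HB.instance Definition _ := [SubChoice_isSubLmodule of Sol by <:].

End Sol.

Definition cderivable (f : R -> C) (t : R) : Prop :=
  derivable (fun s => complex.Re (f s)) t 1 /\
  derivable (fun s => complex.Im (f s)) t 1.
Definition cderive (f : R -> C) (t : R) : C :=
  derive1 (fun s => complex.Re (f s)) t +i* derive1 (fun s => complex.Im (f s)) t.

(* Infinite radius of convergence, as absolute convergence at all radii. *)
Definition entire_coef (a : nat -> C) : Prop :=
  forall t : R, 0 <= t -> cvgn (series (fun k => complex.Re `|a k| * t ^+ k)).
Definition power_series (a : nat -> C) (t : R) : C :=
  limn (series (fun k => complex.Re (a k * (t%:C) ^+ k))) +i*
  limn (series (fun k => complex.Im (a k * (t%:C) ^+ k))).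

(* Only the values of [f] on the positive half-line are relevant. *)
Definition radial_solution (gamma : R) (l : nat) (lam : C) (f : R -> C) : Prop :=
  forall t : R, 0 < t ->
    [/\ cderivable f t, cderivable (cderive f) t
      & (t ^+ 2)%:C * cderive (cderive f) t + (2 * t)%:C * cderive f t
        - (l * l.+1)%N%:R * f t + (2 * gamma * t)%:C * f t
        + lam * (t ^+ 2)%:C * f t = 0].

Definition regular_radial (gamma : R) (l : nat) (lam : C) (f : R -> C) : Prop :=
  radial_solution gamma l lam f /\
  exists a : nat -> C,
    [/\ entire_coef a, forall k, (k < l)%N -> a k = 0, a l = 1
      & forall t, 0 < t -> f t = power_series a t].

(* The meromorphic part [H] is [t ^- (l + 1)] times an entire function that
   takes the value [1] at [0]. *)
Definition singular_radial (gamma : R) (l : nat) (lam : C) (g : R -> C) : Prop :=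
  radial_solution gamma l lam g /\
  exists (b : nat -> C) (c : C) (f : R -> C),
    [/\ entire_coef b, b 0%N = 1, regular_radial gamma l lam f
      & forall t, 0 < t ->
          g t = (t ^- l.+1)%:C * power_series b t + c * (ln t)%:C * f t].

Definition harmonic_poly (l : nat) (Y : mpoly.mpoly 3 C) : Prop :=
  Y \is mpoly.ishomog1 l mpoly.mdeg /\
  \sum_(i < 3) mpoly.mderiv i (mpoly.mderiv i Y) = 0.

(* The function [f(r) Y(x / r)]; spherical harmonics of degree [l] are the
   restrictions to the unit sphere of the harmonic polynomials [Y] that are
   homogeneous of degree [l]. *)
Definition radial_angular (f : R -> C) (Y : mpoly.mpoly 3 C) : fun_R3 := fun x =>
  let r := enorm (val x) in
  f r * mpoly.meval (fun i => (val x i 0 / r)%:C) Y.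

Section Families.
Variable gamma : R.

Definition regsol_gen (lam : C) : set (Sol gamma lam) :=
  [set psi | exists l Y f, [/\ harmonic_poly l Y, regular_radial gamma l lam f
                             & val psi = radial_angular f Y]].
Definition RegSol (lam : C) : set (Sol gamma lam) := lspan (@regsol_gen lam).
(* The quotient of [Sol] by [RegSol]. *)
Definition SingSol (lam : C) := lquot (@regsol_gen lam).

Definition sing_class (lam : C) : Sol gamma lam -> SingSol lam :=
  @lproj _ _ (@regsol_gen lam).

Definition solsections := sections (fun lam => Sol gamma lam : lmodType C).
Definition singsections := sections (fun lam => SingSol lam : lmodType C).
HB.instance Definition _ := GRing.Lmodule.on solsections.
HB.instance Definition _ := GRing.Lmodule.on singsections.

(* The generators are stable under multiplication by polynomials, so that their
   span over the polynomial ring is their complex span. *)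
Definition regfam_gen : set solsections :=
  [set s | exists l Y (p : {poly C}) (F : C -> R -> C),
     [/\ harmonic_poly l Y, forall lam, regular_radial gamma l lam (F lam)
       & forall lam, val (s lam) = p.[lam] *: radial_angular (F lam) Y]].
Definition RegFam := lspan_type regfam_gen.
HB.instance Definition _ := GRing.Lmodule.on RegFam.

Definition singfam_gen : set singsections :=
  [set s | exists l Y (p : {poly C}) (G : C -> R -> C),
     [/\ harmonic_poly l Y, forall lam, singular_radial gamma l lam (G lam)
       & forall lam, exists psi : Sol gamma lam,
           val psi = p.[lam] *: radial_angular (G lam) Y /\ s lam = sing_class psi]].
Definition SingFam := lspan_type singfam_gen.
HB.instance Definition _ := GRing.Lmodule.on SingFam.

(* The group [O(3)] and the Lie algebra act on sections pointwise in [lam],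
   through their actions on functions; the action of [O(3,C)] is the algebraic
   extension of that of [O(3)]. *)
Definition reg_pointwise (a : hc_family RegFam) : Prop :=
  (forall A : 'M[R]_3, orthogonal_mx A -> forall (s : RegFam) lam,
     val (val (kact a (map_mx (real_complex R) A) s) lam) =
     kfun A (val (val s lam))) /\
  (forall X (s : RegFam) lam,
     val (val (gact a X s) lam) = gop gamma X (val (val s lam))).

Definition sing_pointwise (a : hc_family SingFam) : Prop :=
  (forall A : 'M[R]_3, orthogonal_mx A ->
   forall (s : SingFam) lam (psi : Sol gamma lam), val s lam = sing_class psi ->
     exists psi' : Sol gamma lam, val psi' = kfun A (val psi) /\
       val (kact a (map_mx (real_complex R) A) s) lam = sing_class psi') /\
  (forall X (s : SingFam) lam (psi : Sol gamma lam), val s lam = sing_class psi ->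
     exists psi' : Sol gamma lam, val psi' = gop gamma X (val psi) /\
       val (gact a X s) lam = sing_class psi').

(* The area element of the unit sphere is [sin theta dtheta dphi]. *)
Definition sphere_point (theta phi : R) : 'cV[R]_3 :=
  \col_i [:: sin theta * cos phi; sin theta * sin phi; cos theta]`_i.
Definition sphere_int_real (h : 'cV[R]_3 -> R) : R :=
  \int[lebesgue_measure]_(theta in `[0, pi])
    \int[lebesgue_measure]_(phi in `[0, 2 * pi])
      (h (sphere_point theta phi) * sin theta).
Definition sphere_int (h : 'cV[R]_3 -> C) : C :=
  sphere_int_real (fun w => complex.Re (h w)) +i*
  sphere_int_real (fun w => complex.Im (h w)).

(* The Wronskian computed on the sphere of radius [r]; [wronskian_pairing] uses
   all radii and all representatives. *)
Definition wronskian (r : R) (f g : fun_R3) : C :=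
  ((4 * pi)^-1)%:C * sphere_int (fun w =>
    (r ^+ 2)%:C * (cderive (fun t => ext f (t *: w)) r * ext g (r *: w)
                   - ext f (r *: w) * cderive (fun t => ext g (t *: w)) r)).

Definition wronskian_pairing (s : SingFam) (t : RegFam) (p : {poly C}) : Prop :=
  forall (lam : C) (psi : Sol gamma lam) (r : R), 0 < r ->
    val s lam = sing_class psi ->
    p.[lam] = wronskian r (val psi) (val (val t lam)).

End Families.
End Analysis.

(* Main.v *)
From HB Require Import structures.
Require Import Defs.
From mathcomp Require Import all_boot all_order all_algebra.
From mathcomp Require Import complex.
From mathcomp Require Import ring zify.
From mathcomp.multinomials Require mpoly.
From mathcomp Require Import boolp reals.

Set Implicit Arguments.
Unset Strict Implicit.
Unset Printing Implicit Defensive.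

Import Order.TTheory GRing.Theory Num.Theory.
Local Open Scope ring_scope.
Local Open Scope complex_scope.

(* Spherical harmonics are modelled by harmonic polynomials, so that both
   families live on the module [HO] of harmonic polynomials with coefficients in
   [C[T]]: [O(3)] acts by rotations, [L_i] by [x_j d_k - x_k d_j], and [R_i]
   sends a harmonic [Y] of degree [l] to
   [sqrt(-1) (al_l up_i Y + be_l d_i Y)], where
   [up_i Y = (2 l + 1) x_i Y - |x|^2 d_i Y].  The ladder operators
   [(l + 1) (f' - l f / r) + gamma f] and
   [(l + 1) (f' + (l + 2) f / r) - gamma f] exchange solutions of the radial
   equations of degrees [l] and [l + 1]; comparing leading terms at [r = 0]
   gives the coefficients [al], [be] of the regular solutions and of the
   singular ones modulo the regular ones.  The Wronskian of the regular and
   singular radial solutions of degree [l] is [-(2 l + 1)], and the integral of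
   [Y Z] over the sphere is a multiple, depending on [l] only, of the Fischer
   pairing [Y(d) Z], for which [x_i] is adjoint to [d_i] and rotations are
   orthogonal.  Hence the Wronskian form is a Fischer pairing with nonzero
   constants in each degree.  Finally, a [K]-finite functional on [HO] vanishes
   in high degrees, hence is represented by this pairing. *)

(** * Harmonic polynomials *)

(** The definition of a family quantifies over all frames and all irreducible representations of
    [O(3,C)], and matrices of regular functions are only known by their values on the group. Two
    facts deal with this. A regular function that vanishes on the group has zero differential in
    skew directions, because the Cayley transform is a rational curve in the group. The Casimir
    operator has an eigenvalue proportional to [l (l + 1)] in degree [l], so that an irreducible
    representation occurs in one degree only. As [K] acts by constant matrices, extracting
    coefficients in [T] or evaluating [T] at [lam] reduces statements over [C[T]] to complex
    polynomials; a basis of harmonics that does not depend on the coefficient ring leads back. The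
    Lie bracket only constrains the products of [al_l] and [be_(l + 1)]. Both families have the same
    products, distributed differently over raising and lowering. The Fischer pairing exchanges
    raising and lowering, which is why the regular family is dual to the singular one; rotations are
    skew for it and the ladder operators symmetric, whence the twist by [theta]. *)

Section Cyclic.

Lemma ord3_addE (i : 'I_3) :
  (i + 1 + 1 = i + 2%:R) * (i + 1 + 2%:R = i) * (i + 2%:R + 1 = i) *
  (i + 2%:R + 2%:R = i + 1).
Proof. by do !split; apply/val_inj; case: i => [[|[|[]]]]. Qed.

Lemma ord3_eqE (i : 'I_3) :
  (i == i + 1 = false) * (i + 1 == i = false) * (i == i + 2%:R = false) *
  (i + 2%:R == i = false) * (i + 1 == i + 2%:R = false) * (i + 2%:R == i + 1 = false).
Proof. by do !split; apply/negbTE; case: i => [[|[|[]]]]. Qed.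

Lemma ord3P (i j : 'I_3) : [\/ j = i, j = i + 1 | j = i + 2%:R].
Proof.
case: i => [[|[|[|]]]] //= hi; case: j => [[|[|[|]]]] //= hj;
  solve [ by constructor 1; apply/val_inj | by constructor 2; apply/val_inj
        | by constructor 3; apply/val_inj ].
Qed.

Lemma sum_ord3 (V : nmodType) (F : 'I_3 -> V) i :
  \sum_j F j = F i + F (i + 1) + F (i + 2%:R).
Proof.
rewrite (bigD1 i) //= (bigD1 (i + 1)) ?ord3_eqE //= (bigD1 (i + 2%:R)) ?ord3_eqE //=.
rewrite big1 ?addr0 => [|j]; first by rewrite [LHS]addrA.
by case: (ord3P i j) => ->; rewrite ?eqxx ?andbF.
Qed.

Lemma sum3 (V : nmodType) (F : 'I_3 -> V) : \sum_j F j = F 0 + F 1 + F 2%:R.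
Proof. by rewrite (sum_ord3 F 0) !add0r. Qed.

Lemma det_mx3 (K : comNzRingType) (B : 'M[K]_3) k :
  \det B = \sum_j B j k * (B (j + 1) (k + 1) * B (j + 2%:R) (k + 2%:R)
                           - B (j + 1) (k + 2%:R) * B (j + 2%:R) (k + 1)).
Proof.
(* Indexing the entries by natural numbers identifies ordinals of equal value, so that [ring] sees
   equal entries as the same atom. *)
have [b E] : exists b : nat -> nat -> K, forall i j m n, val i = m -> val j = n -> B i j = b m n.
  by exists (fun i j => B (inord i) (inord j)) => i j m n <- <-; rewrite !inord_val.
rewrite (expand_det_col B 0) [in RHS]sum3 !big_ord_recl big_ord0 /cofactor.
rewrite !(expand_det_col _ 0) !big_ord_recl !big_ord0 /cofactor !det_mx11 !mxE.
case: k => [[|[|[|]]]] // hk;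
  repeat match goal with |- context [fun_of_matrix B ?i ?j] =>
    let m := eval vm_compute in (nat_of_ord i) in
    let n := eval vm_compute in (nat_of_ord j) in
    rewrite (E i j m n erefl erefl) end; rewrite /= /bump /= ?addn0 ?expr0 ?expr1 ?expr2; ring.
Qed.

End Cyclic.

(** * Degree weights, ladder operators, rotations and the Fischer pairing on polynomials *)

Section WeightOperators.
Import mpoly.

Lemma mpoly_ring_ind (n : nat) (K : comNzRingType) (Q : {mpoly K[n]} -> Prop) :
    (forall c, Q c%:MP) -> (forall i, Q 'X_i) ->
    (forall p q, Q p -> Q q -> Q (p + q)) ->
    (forall p q, Q p -> Q q -> Q (p * q)) ->
  forall p, Q p.
Proof.
move=> hC hX hD hM; have hXm m : Q 'X_[m].
  rewrite mpolyXE_id; apply: big_ind => [|//|i _]; first exact: hC.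
  elim: (m i) => [|k ih]; first by rewrite expr0; exact: hC.
  by rewrite exprS; exact: hM.
elim/mpolyind => [|c m p _ _ hp]; first by rewrite -mpolyC0; exact: hC.
by apply: hD => //; rewrite -mul_mpolyC; apply: hM.
Qed.

Variable K : comNzRingType.
Local Notation P := {mpoly K[3]}.
Implicit Types (p q : P) (a b al be : nat -> K) (i j : 'I_3).

Lemma mpoly_lin_ind (Q : P -> Prop) :
    Q 0 -> (forall c p q, Q p -> Q q -> Q (c *: p + q)) -> (forall m, Q 'X_[m]) ->
  forall p, Q p.
Proof.
by move=> h0 hD hX; elim/mpolyind => [//|c m p _ _ hp]; exact: hD.
Qed.

Lemma mpoly_mulX_ind (Q : P -> Prop) :
    (forall c, Q c%:MP) -> (forall i p, Q p -> Q ('X_i * p)) ->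
    (forall p q, Q p -> Q q -> Q (p + q)) ->
  forall p, Q p.
Proof.
move=> hC hX hD; elim/mpolyind => [|c m p _ _ hp]; first by rewrite -mpolyC0; exact: hC.
apply: hD => //; have [n hn] := ubnP (mdeg m); elim: n => // n ih in m hn *.
have [->|nz] := eqVneq m 0%MM; first by rewrite mpolyX0 alg_mpolyC; exact: hC.
have [i mi] : exists i, m i != 0%N.
  apply/existsP; apply: contraNT nz; rewrite negb_exists => /forallP h.
  by apply/eqP/mnmP => i; apply/eqP; have := h i; rewrite negbK mnm0E.
have E : m = (U_(i) + (m - U_(i)))%MM by rewrite addmC submK // lep1mP.
rewrite E mpolyXD scalerAr; apply: hX; apply: ih.
by move: hn; rewrite {1}E mdegD mdeg1 add1n.
Qed.

(** A function of the Euler degree operator. The degree-dependent constants of the ladder operators,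
    and later the radial functions, all enter through such weights, so that polynomials need not be
    split into homogeneous parts. *)
Definition wgt a p : P := \sum_(m <- msupp p) (a (mdeg m) * p@_m) *: 'X_[m].

Lemma mcoeff_wgt a p m : (wgt a p)@_m = a (mdeg m) * p@_m.
Proof.
rewrite /wgt raddf_sum /=; under eq_bigr do rewrite mcoeffZ mcoeffX.
have [hm|/[dup] hm] := boolP (m \in msupp p).
  rewrite (bigD1_seq m) ?msupp_uniq //= eqxx mulr1 big1 ?addr0 // => k /negbTE->.
  by rewrite mulr0.
move/memN_msupp_eq0 => ->; rewrite mulr0 big1_seq // => k /andP[_ hk].
by case: eqP => [E|_]; [rewrite -E hk in hm | rewrite mulr0].
Qed.

Lemma wgt_is_linear a : linear (wgt a).
Proof.
move=> c p q; apply/mpolyP => m.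
by rewrite !(mcoeffD, mcoeffZ, mcoeff_wgt) mulrDr mulrCA.
Qed.

HB.instance Definition _ a := GRing.isLinear.Build K P P *:%R (wgt a) (wgt_is_linear a).

Lemma wgtX a m : wgt a 'X_[m] = a (mdeg m) *: 'X_[m].
Proof.
apply/mpolyP => k; rewrite mcoeff_wgt mcoeffZ mcoeffX.
by case: eqP => [->|]; rewrite ?mulr0.
Qed.

Lemma wgt_comp a b p : wgt a (wgt b p) = wgt (fun l => a l * b l) p.
Proof. by apply/mpolyP => m; rewrite !mcoeff_wgt mulrA. Qed.

Lemma wgtC a b p : wgt a (wgt b p) = wgt b (wgt a p).
Proof. by apply/mpolyP => m; rewrite !mcoeff_wgt mulrCA. Qed.

Lemma wgtD a b p : wgt (fun l => a l + b l) p = wgt a p + wgt b p.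
Proof. by apply/mpolyP => m; rewrite mcoeffD !mcoeff_wgt mulrDl. Qed.

Lemma wgtZ c a p : wgt (fun l => c * a l) p = c *: wgt a p.
Proof. by apply/mpolyP => m; rewrite mcoeffZ !mcoeff_wgt mulrA. Qed.

Lemma wgt_cst c p : wgt (fun=> c) p = c *: p.
Proof. by apply/mpolyP => m; rewrite mcoeffZ mcoeff_wgt. Qed.

Lemma eq_wgt a b p : a =1 b -> wgt a p = wgt b p.
Proof. by move=> E; apply/mpolyP => m; rewrite !mcoeff_wgt E. Qed.

Lemma wgt_homog a l p : p \is l.-homog -> wgt a p = a l *: p.
Proof.
move=> hp; apply/mpolyP => m; rewrite mcoeff_wgt mcoeffZ.
have [->//|nm] := eqVneq (mdeg m) l.
by rewrite (dhomog_nemf_coeff hp nm) !mulr0.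
Qed.

Definition hpart l := wgt (fun k => (k == l)%:R).

HB.instance Definition _ l := GRing.Linear.on (hpart l).

Lemma mcoeff_hpart l p m : (hpart l p)@_m = (mdeg m == l)%:R * p@_m.
Proof. exact: mcoeff_wgt. Qed.

Lemma hpart_homog l p : hpart l p \is l.-homog.
Proof.
apply/dhomogP => m; rewrite mcoeff_msupp mcoeff_hpart.
by case: (mdeg m =P l) => // _; rewrite mul0r eqxx.
Qed.

Lemma hpart_id l p : p \is l.-homog -> hpart l p = p.
Proof. by move=> hp; rewrite /hpart (wgt_homog _ hp) eqxx scale1r. Qed.

Lemma hpart_neq k l p : p \is l.-homog -> k != l -> hpart k p = 0.
Proof.
by move=> hp /negbTE nk; rewrite /hpart (wgt_homog _ hp) eq_sym nk scale0r.
Qed.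

Lemma sum_hpart N p : (msize p <= N)%N -> p = \sum_(l < N) hpart l p.
Proof.
move=> hN; apply/mpolyP => m; rewrite raddf_sum /=.
under eq_bigr do rewrite mcoeff_hpart.
have [hm|hm] := ltnP (mdeg m) N.
  rewrite (bigD1 (Ordinal hm)) //= eqxx mul1r big1 ?addr0 // => l.
  by rewrite -val_eqE /= eq_sym => /negbTE->; rewrite mul0r.
have -> : p@_m = 0.
  by apply: memN_msupp_eq0; apply: msize_mdeg_ge; apply: leq_trans hN _; exact: hm.
by rewrite big1 // => l _; rewrite mulr0.
Qed.

Lemma mulX_wgt a i p : wgt a ('X_i * p) = 'X_i * wgt (fun l => a l.+1) p.
Proof.
elim/mpoly_lin_ind: p => [|c p q hp hq|m]; first by rewrite mulr0 !raddf0 mulr0.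
  by rewrite mulrDr -scalerAr !linearP /= hp hq mulrDr -scalerAr.
by rewrite -mpolyXD !wgtX mdegD mdeg1 -scalerAr mpolyXD.
Qed.

Lemma deriv_wgt a i p : (wgt a p)^`M(i) = wgt (fun l => a l.+1) p^`M(i).
Proof.
apply/mpolyP => m; rewrite mcoeff_deriv !mcoeff_wgt mcoeff_deriv mdegD mdeg1 addn1.
by rewrite mulrnAr.
Qed.

Lemma deriv_homog l i p : p \is l.+1.-homog -> p^`M(i) \is l.-homog.
Proof.
move=> hp; apply/dhomogP => m; rewrite mcoeff_msupp mcoeff_deriv => nz.
have : p@_(m + U_(i)) != 0 by apply: contraNneq nz => ->; rewrite mul0rn.
rewrite -mcoeff_msupp => /(dhomog_mf hp); rewrite /= mdegD mdeg1 addn1.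
by case.
Qed.

Lemma deriv_homog0 i p : p \is 0.-homog -> p^`M(i) = 0.
Proof.
move=> hp; apply/mpolyP => m; rewrite mcoeff_deriv mcoeff0.
by rewrite (dhomog_nemf_coeff hp) ?mul0rn //= mdegD mdeg1 addn1.
Qed.

Lemma mderivX1 i j : ('X_j : P)^`M(i) = (j == i)%:R.
Proof.
rewrite mderivX mnm1E; case: eqP => [->|]; rewrite ?scale0r // scale1r.
rewrite -[1%:R]mpolyX0; congr 'X_[_]; apply/mnmP => k.
by rewrite mnmBE mnm0E subnn.
Qed.

Lemma euler p : \sum_i 'X_i * p^`M(i) = wgt (fun l => l%:R) p.
Proof.
elim/mpoly_lin_ind: p => [|c p q hp hq|m].
- by rewrite raddf0 big1 // => i _; rewrite raddf0 mulr0.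
- rewrite linearP /= -hp -hq scaler_sumr -big_split; apply: eq_bigr => i _ /=.
  by rewrite linearP /= mulrDr scalerAr.
rewrite wgtX mdegE natr_sum scaler_suml; apply: eq_bigr => i _.
rewrite mderivX -scalerAr -mpolyXD.
have [->|h] := eqVneq (m i) 0%N; first by rewrite !scale0r.
by congr (_ *: 'X_[_]); rewrite addmC submK // lep1mP.
Qed.

Lemma mderiv_nat i n : (n%:R : P)^`M(i) = 0.
Proof. by rewrite -mpolyC_nat mderivC. Qed.

Definition mderivs :=
  (@mderivM, @mderivD, @mderivB, @mderivN, @mderivZ, @mderivX1, @mderiv_nat, ord3_eqE).

Definition lap p : P := \sum_i p^`M(i)^`M(i).
Definition nn : P := \sum_i 'X_i ^+ 2.

Lemma lap_is_linear : linear lap.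
Proof.
move=> c p q; rewrite scaler_sumr -big_split; apply: eq_bigr => i _ /=.
by rewrite !linearP.
Qed.

HB.instance Definition _ := GRing.isLinear.Build K P P *:%R lap lap_is_linear.

Lemma lapZ c p : lap (c *: p) = c *: lap p.
Proof. exact: linearZ. Qed.

Lemma lapD p q : lap (p + q) = lap p + lap q.
Proof. exact: raddfD. Qed.

Lemma lap0 : lap 0 = 0.
Proof. exact: raddf0. Qed.

Lemma lap_sum (I : Type) (s : seq I) (Q : pred I) (F : I -> P) :
  lap (\sum_(i <- s | Q i) F i) = \sum_(i <- s | Q i) lap (F i).
Proof. exact: raddf_sum. Qed.

Lemma lap_wgt a p : lap (wgt a p) = wgt (fun l => a l.+2) (lap p).
Proof. by rewrite /lap raddf_sum; apply: eq_bigr => i _ /=; rewrite !deriv_wgt. Qed.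

Lemma lap_mulX i p : lap ('X_i * p) = 'X_i * lap p + 2%:R * p^`M(i).
Proof.
rewrite /lap !(sum_ord3 _ i) !mderivs !eqxx /=.
ring.
Qed.

Lemma lap_deriv i p : lap p^`M(i) = (lap p)^`M(i).
Proof.
rewrite /lap raddf_sum; apply: eq_bigr => j _ /=.
by rewrite (mderiv_comm i j p) (mderiv_comm i j p^`M(j)).
Qed.

Lemma deriv_nn i : nn^`M(i) = 2%:R * 'X_i.
Proof. rewrite /nn (sum_ord3 _ i) !expr2 !mderivs !eqxx /=; ring. Qed.

Lemma nn_wgt a p : wgt a (nn * p) = nn * wgt (fun l => a l.+2) p.
Proof.
rewrite !mulr_suml raddf_sum; apply: eq_bigr => i _ /=.
by rewrite expr2 -!mulrA !mulX_wgt.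
Qed.

(** The constant [6] is twice the dimension, and the cross terms [2 (2 x_i) d_i] add up to four
    times the Euler operator. *)
Lemma lap_nn p : lap (nn * p) = nn * lap p + 6%:R * p + 4%:R * wgt (fun l => l%:R) p.
Proof.
have E i : (nn * p)^`M(i)^`M(i) =
    nn * p^`M(i)^`M(i) + 2%:R * p + 4%:R * ('X_i * p^`M(i)).
  by rewrite !(mderivs, deriv_nn) eqxx /=; ring.
rewrite {1}/lap; under eq_bigr do rewrite E.
by rewrite !big_split /= -!mulr_sumr euler sumr_const card_ord -/(lap p); ring.
Qed.

Definition twol1 l : K := (2 * l + 1)%:R.

(** On harmonic polynomials of degree [l] this is [2 l + 1] times the harmonic component of degree
    [l + 1] of [x_i p]; clearing the denominator makes sense over every commutative ring. *)
Definition up i p : P := 'X_i * wgt twol1 p - nn * p^`M(i).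

Lemma up_is_linear i : linear (up i).
Proof.
move=> c p q; rewrite /up !linearP /= !mulrDr -!scalerAr scalerBr.
by rewrite opprD addrACA.
Qed.

HB.instance Definition _ i := GRing.isLinear.Build K P P *:%R (up i) (up_is_linear i).

(** In degree [l] the first term contributes [2 (2 l + 1)] times [d_i p] and the second
    [6 + 4 (l - 1)] times [d_i p]; these are equal. *)
Lemma lap_up i p : lap p = 0 -> lap (up i p) = 0.
Proof.
move=> hp; rewrite raddfB /= lap_mulX lap_nn lap_deriv lap_wgt hp !raddf0 !mulr0 !add0r.
have -> : (wgt twol1 p)^`M(i) = 2%:R * wgt (fun l => l%:R) p^`M(i) + 3%:R * p^`M(i).
  rewrite deriv_wgt -!mpolyC_nat !mul_mpolyC -wgtZ -wgt_cst -wgtD.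
  by apply: eq_wgt => l; rewrite /twol1 -natrM -natrD; congr _%:R; lia.
by ring.
Qed.

Lemma wgt_up a i p : wgt a (up i p) = up i (wgt (fun l => a l.+1) p).
Proof.
rewrite /up raddfB /= mulX_wgt nn_wgt deriv_wgt; congr ('X_i * _ - _).
exact: wgtC.
Qed.

Lemma nn_homog : nn \is 2.-homog.
Proof.
apply: rpred_sum => i _; rewrite expr2; apply: (@dhomogM _ _ mdeg 1 _ 1 _);
  by rewrite dhomogX /= mdeg1.
Qed.

Lemma up_homog l i p : p \is l.-homog -> up i p \is l.+1.-homog.
Proof.
move=> hp; rewrite /up (wgt_homog _ hp); apply: rpredB.
  by rewrite -scalerAr; apply: rpredZ; rewrite -[l.+1]/(1 + l)%N; apply: dhomogM => //; rewrite dhomogX /= mdeg1.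
case: l hp => [|l] hp; first by rewrite deriv_homog0 // mulr0 rpred0.
by rewrite -[l.+2]/(2 + l)%N; apply: dhomogM nn_homog (deriv_homog _ hp).
Qed.

Definition rot i j p : P := 'X_i * p^`M(j) - 'X_j * p^`M(i).

Lemma rot_is_linear i j : linear (rot i j).
Proof.
move=> c p q; rewrite /rot !linearP /= !mulrDr -!scalerAr scalerBr.
by rewrite opprD addrACA.
Qed.

HB.instance Definition _ i j :=
  GRing.isLinear.Build K P P *:%R (rot i j) (rot_is_linear i j).

Lemma rotM i j p q : rot i j (p * q) = rot i j p * q + p * rot i j q.
Proof. by rewrite /rot !mderivM; ring. Qed.

Lemma rot_wgt a i j p : rot i j (wgt a p) = wgt a (rot i j p).
Proof. by rewrite /rot raddfB /= !mulX_wgt !deriv_wgt. Qed.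

Lemma rotX i j k : rot i j 'X_k = (k == j)%:R * 'X_i - (k == i)%:R * 'X_j.
Proof. by rewrite /rot !mderivX1; ring. Qed.

Lemma lap_rot i j p : lap (rot i j p) = rot i j (lap p).
Proof.
by rewrite /rot raddfB /= !lap_mulX !lap_deriv (mderiv_comm i j); ring.
Qed.

Lemma rot_nn i j p : rot i j (nn * p) = nn * rot i j p.
Proof. by rewrite rotM {1}/rot !deriv_nn; ring. Qed.

Lemma rot_homog l i j p : p \is l.-homog -> rot i j p \is l.-homog.
Proof.
case: l => [|l] hp; first by rewrite /rot !deriv_homog0 // !mulr0 subrr rpred0.
by rewrite /rot -[l.+1]/(1 + l)%N; apply: rpredB; apply: dhomogM;
  rewrite ?dhomogX /= ?mdeg1 // deriv_homog.
Qed.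

Lemma rot_deriv i j k p :
  rot i j p^`M(k) - (rot i j p)^`M(k) = (k == j)%:R * p^`M(i) - (k == i)%:R * p^`M(j).
Proof.
rewrite /rot !mderivs (mderiv_comm k i) (mderiv_comm k j) (eq_sym i) (eq_sym j).
by ring.
Qed.

Lemma rot_rot i j k l p :
  rot i j (rot k l p) - rot k l (rot i j p) =
  (k == j)%:R * rot i l p - (k == i)%:R * rot j l p
  + (l == j)%:R * rot k i p - (l == i)%:R * rot k j p.
Proof.
have E : rot i j (rot k l p) = rot i j 'X_k * p^`M(l) - rot i j 'X_l * p^`M(k)
    + 'X_k * rot i j p^`M(l) - 'X_l * rot i j p^`M(k).
  by rewrite {2}/rot raddfB /= !rotM; ring.
have F m : rot i j p^`M(m) =
    (rot i j p)^`M(m) + ((m == j)%:R * p^`M(i) - (m == i)%:R * p^`M(j)).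
  by rewrite -rot_deriv; ring.
by rewrite {}E !F !rotX {8}/rot; move: (rot i j p) => q; rewrite /rot; ring.
Qed.

Lemma rot_up i j k p :
  rot i j (up k p) - up k (rot i j p) = (k == j)%:R * up i p - (k == i)%:R * up j p.
Proof.
have -> : rot i j (up k p) - up k (rot i j p) =
    rot i j 'X_k * wgt twol1 p - nn * (rot i j p^`M(k) - (rot i j p)^`M(k)).
  by rewrite /up raddfB /= rot_nn rotM rot_wgt; ring.
by rewrite rot_deriv rotX /up; ring.
Qed.

Definition rl al be i p : P := up i (wgt al p) + (wgt be p)^`M(i).

Lemma rl_is_linear al be i : linear (rl al be i).
Proof. by move=> c p q; rewrite /rl !linearP /= addrACA -scalerDr. Qed.

HB.instance Definition _ al be i :=
  GRing.isLinear.Build K P P *:%R (rl al be i) (rl_is_linear al be i).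

Lemma lap_rl al be i p : lap p = 0 -> lap (rl al be i p) = 0.
Proof.
move=> hp; have hw a : lap (wgt a p) = 0 by rewrite lap_wgt hp raddf0.
by rewrite /rl raddfD /= lap_up // lap_deriv hw mderiv0 addr0.
Qed.

Lemma rot_rl al be i j k p :
  rot i j (rl al be k p) - rl al be k (rot i j p) =
  (k == j)%:R * rl al be i p - (k == i)%:R * rl al be j p.
Proof.
have -> : rot i j (rl al be k p) - rl al be k (rot i j p) =
    (rot i j (up k (wgt al p)) - up k (rot i j (wgt al p))) +
    (rot i j (wgt be p)^`M(k) - (rot i j (wgt be p))^`M(k)).
  by rewrite /rl raddfD /= !rot_wgt opprD addrACA.
by rewrite rot_up rot_deriv /rl; ring.
Qed.

Lemma up_comm i j p : up i (up j p) = up j (up i p).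
Proof.
have E i' j' : up i' (up j' p) = 'X_i' * 'X_j' * wgt (fun l => twol1 l.+1 * twol1 l) p
    - nn * ('X_i' * (wgt twol1 p)^`M(j') + 'X_j' * (wgt twol1 p)^`M(i'))
    - nn * (j' == i')%:R * wgt twol1 p + nn * nn * p^`M(j')^`M(i').
  rewrite {1}/up wgt_up /up !wgt_comp !deriv_wgt !mderivs deriv_wgt deriv_nn.
  have -> : wgt (fun l => twol1 l.+2) p^`M(j') = wgt (fun l => twol1 l.+1) p^`M(j') + 2%:R * p^`M(j').
    rewrite -mpolyC_nat mul_mpolyC -wgt_cst -wgtD; apply: eq_wgt => l.
    by rewrite /twol1 -natrD; congr _%:R; lia.
  rewrite -(eq_wgt _ (fun l => mulrC (twol1 l) _)).
  by ring.
by rewrite !E mderiv_comm eq_sym; ring.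
Qed.

Lemma deriv_up i j p :
  (up j p)^`M(i) - (up i p)^`M(j) = - rot i j (wgt (fun l => (2 * l + 3)%:R) p).
Proof.
have -> : wgt (fun l => (2 * l + 3)%:R) p = wgt twol1 p + 2%:R * p.
  rewrite -mpolyC_nat mul_mpolyC -wgt_cst -wgtD; apply: eq_wgt => l.
  by rewrite /twol1 -natrD; congr _%:R; lia.
rewrite /up /rot !(mderivB, mderivM, mderivD, deriv_nn, mderivX1, mderiv_nat) (mderiv_comm i j) (eq_sym i).
by ring.
Qed.

(** Rotations kill constants, so the weight in degree [0] does not matter. This is why the
    recurrence in [rl_comm] starts in degree [1] and leaves the product [al 0 * be 1], through which
    [gamma] will enter, free. *)
Lemma rot_wgt_ext a b i j p : (forall l, a l.+1 = b l.+1) ->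
  rot i j (wgt a p) = rot i j (wgt b p).
Proof. by move=> E; rewrite /rot !deriv_wgt !(eq_wgt _ E). Qed.

(** The parts of the product that change the degree by two are symmetric in [i] and [j], by
    [up_comm] and by symmetry of second derivatives. Only the cross terms between raising and
    lowering remain, and antisymmetrized they are rotations with a scalar depending on the
    degree. *)
Lemma rl_comm al be (lam : K) i j p :
    (forall l, (2 * l + 5)%:R * (al l.+1 * be l.+2) =
       lam + (2 * l + 1)%:R * (al l * be l.+1)) ->
  rl al be i (rl al be j p) - rl al be j (rl al be i p) = - (lam *: rot i j p).
Proof.
move=> H.
pose q := wgt be p; pose r := wgt (fun l => be l.+1) (wgt al p).
(* The weight [twol1 * al] acts after a derivative; moved in front of it, it is shifted by one
   degree. Its value in degree [0] is arbitrary, since the derivative kills constants. *)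
pose c l := twol1 l.-1 * al l.-1.
have E i' j' : rl al be i' (rl al be j' p) =
    up i' (up j' (wgt (fun l => al l.+1 * al l) p)) +
    ('X_i' * (wgt c q)^`M(j') - nn * wgt (fun l => al l.+1) q^`M(j')^`M(i')) +
    (up j' r)^`M(i') + wgt (fun l => be l.+1) q^`M(j')^`M(i').
  have -> : rl al be i' (rl al be j' p) = up i' (wgt al (up j' (wgt al p))) +
      up i' (wgt al q^`M(j')) + ((wgt be (up j' (wgt al p)))^`M(i') +
      (wgt be q^`M(j'))^`M(i')).
    by rewrite [rl al be j' p]/rl /rl !(raddfD (wgt _)) /= (raddfD (up i')) mderivD.
  have -> : up i' (wgt al q^`M(j')) =
      'X_i' * (wgt c q)^`M(j') - nn * wgt (fun l => al l.+1) q^`M(j')^`M(i').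
    by rewrite /up !deriv_wgt wgt_comp.
  by rewrite !wgt_up wgt_comp (deriv_wgt be i' q^`M(j')) /r; ring.
have -> : rl al be i (rl al be j p) - rl al be j (rl al be i p) =
    rot i j (wgt c q) + ((up j r)^`M(i) - (up i r)^`M(j)).
  by rewrite !E (up_comm i j) (mderiv_comm i j) {1}/rot; ring.
rewrite deriv_up -raddfB /r /q !wgt_comp.
have D (a b : nat -> K) : wgt a p - wgt b p = wgt (fun l => a l - b l) p.
  by apply/mpolyP => m; rewrite mcoeffB !mcoeff_wgt mulrBl.
rewrite D /= (rot_wgt_ext (b := fun=> - lam)) => [|l].
  by rewrite wgt_cst -scaleNr linearZ.
rewrite /c /twol1 /= -[_ * _ * al _]mulrA [be _ * al _]mulrC (_ : 2 * l.+1 + 3 = 2 * l + 5)%N; last by lia.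
by rewrite H; ring.
Qed.

(** The value at [x] is [p (B^T x)]. For orthogonal [B] the transpose is the inverse, so this is the
    usual left action on functions, which explains the order of the indices. *)
Definition sub (B : 'M[K]_3) : P -> P :=
  comp_mpoly [tuple \sum_j B j i *: 'X_j | i < 3].

HB.instance Definition _ B := GRing.RMorphism.on (sub B).
HB.instance Definition _ B := GRing.Linear.on (sub B).

Lemma subC B c : sub B c%:MP = c%:MP.
Proof. exact: comp_mpolyC. Qed.

Lemma subX B i : sub B 'X_i = \sum_j B j i *: 'X_j.
Proof. by rewrite /sub comp_mpolyXU -tnth_nth tnth_mktuple. Qed.

Lemma sub1 p : sub 1%:M p = p.
Proof.
elim/mpoly_ring_ind: p => [c|i|p q hp hq|p q hp hq].
- exact: subC.
- rewrite subX (bigD1 i) //= big1 ?addr0 => [|j /negbTE ne].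
    by rewrite mxE eqxx scale1r.
  by rewrite mxE ne scale0r.
- by rewrite rmorphD /= hp hq.
- by rewrite rmorphM /= hp hq.
Qed.

Lemma subM A B p : sub (A *m B) p = sub A (sub B p).
Proof.
elim/mpoly_ring_ind: p => [c|i|p q hp hq|p q hp hq].
- by rewrite !subC.
- rewrite !subX linear_sum /=.
  under [RHS]eq_bigr do rewrite linearZ /= subX scaler_sumr.
  rewrite exchange_big /=; apply: eq_bigr => j _.
  rewrite mxE scaler_suml; apply: eq_bigr => k _.
  by rewrite scalerA mulrC.
- by rewrite !rmorphD /= hp hq.
- by rewrite !rmorphM /= hp hq.
Qed.

Lemma deriv_sub B i p : (sub B p)^`M(i) = \sum_k B i k *: sub B p^`M(k).
Proof.
elim/mpoly_ring_ind: p => [c|j|p q hp hq|p q hp hq].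
- by rewrite subC mderivC big1 // => k _; rewrite mderivC rmorph0 scaler0.
- rewrite subX raddf_sum /= (bigD1 i) //= big1 ?addr0 => [|k /negbTE ne]; last first.
    by rewrite mderivZ mderivX1 ne scaler0.
  rewrite (bigD1 j) //= big1 ?addr0 => [|k /negbTE ne]; last first.
    by rewrite mderivX1 eq_sym ne rmorph0 scaler0.
  by rewrite mderivZ !mderivX1 !eqxx rmorph_nat.
- rewrite rmorphD mderivD hp hq -big_split; apply: eq_bigr => k _ /=.
  by rewrite mderivD rmorphD scalerDr.
- rewrite rmorphM mderivM hp hq mulr_suml mulr_sumr -big_split; apply: eq_bigr => k _ /=.
  by rewrite mderivM rmorphD !rmorphM scalerDr scalerAl -scalerAr.
Qed.

Lemma sub_homog B l p : p \is l.-homog -> sub B p \is l.-homog.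
Proof.
move=> hp; rewrite [p]mpolyE raddf_sum /= big_seq_cond.
apply: rpred_sum => m /andP[hm _]; rewrite linearZ rpredZ //=.
have <- := dhomog_mf hp hm; rewrite /= mpolyXE_id rmorph_prod /= mdegE.
apply: (big_ind2 (fun (x : P) n => x \is n.-homog)) => [|x m1 y m2 hx hy|i _].
- exact: dhomog1.
- exact: dhomogM.
rewrite rmorphXn /=; elim: (m i) => [|k ih]; first by rewrite expr0 dhomog1.
rewrite exprS -[k.+1]/(1 + k)%N; apply: dhomogM ih.
by rewrite subX; apply: rpred_sum => j _; rewrite rpredZ // dhomogX /= mdeg1.
Qed.

Lemma homog_ind (Q : P -> Prop) :
    Q 0 -> (forall p q, Q p -> Q q -> Q (p + q)) ->
    (forall l p, p \is l.-homog -> Q p) ->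
  forall p, Q p.
Proof.
move=> h0 hD hh p; rewrite (sum_hpart (leqnn (msize p))).
by apply: (big_ind Q) => // l _; apply: (hh l); exact: hpart_homog.
Qed.

Lemma sub_wgt a B p : sub B (wgt a p) = wgt a (sub B p).
Proof.
elim/homog_ind: p => [|p q hp hq|l p hl]; first by rewrite !raddf0.
  by rewrite (raddfD (wgt a)) !(raddfD (sub B)) (raddfD (wgt a)) /= hp hq.
by rewrite (wgt_homog _ hl) linearZ /= (wgt_homog _ (sub_homog B hl)).
Qed.

Section Orthogonal.
Variable B : 'M[K]_3.
Hypothesis BtB : B^T *m B = 1%:M.

Lemma orth_col i j : \sum_k B k i * B k j = (i == j)%:R.
Proof.
have := congr1 (fun M : 'M_3 => M i j) BtB; rewrite !mxE => <-.
by apply: eq_bigr => k _; rewrite mxE.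
Qed.

Lemma orth_row i j : \sum_k B i k * B j k = (i == j)%:R.
Proof.
have := congr1 (fun M : 'M_3 => M i j) (mulmx1C BtB); rewrite !mxE => <-.
by apply: eq_bigr => k _; rewrite mxE.
Qed.

Lemma deriv_sub' i p : sub B p^`M(i) = \sum_j B j i *: (sub B p)^`M(j).
Proof.
under eq_bigr do rewrite deriv_sub scaler_sumr.
rewrite exchange_big /= (bigD1 i) //= [X in _ + X]big1 => [|k /negbTE ne].
  under eq_bigr do rewrite scalerA.
  by rewrite -scaler_suml orth_col eqxx scale1r addr0.
under eq_bigr do rewrite scalerA.
by rewrite -scaler_suml orth_col eq_sym ne scale0r.
Qed.

Lemma sub_nn : sub B nn = nn.
Proof.
rewrite /nn raddf_sum /=.
under eq_bigr do rewrite rmorphXn /= subX expr2 mulr_suml.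
under eq_bigr do under eq_bigr do rewrite mulr_sumr.
rewrite exchange_big; apply: eq_bigr => i _ /=; rewrite exchange_big (bigD1 i) //=.
rewrite [X in _ + X]big1 => [|j /negbTE ne];
  under eq_bigr do rewrite -scalerAl -scalerAr scalerA;
  by rewrite -scaler_suml orth_row ?eqxx ?scale1r ?addr0 ?expr2 // eq_sym ne scale0r.
Qed.

Lemma lap_sub p : lap (sub B p) = sub B (lap p).
Proof.
rewrite [lap p]/lap (raddf_sum (sub B)) /=.
under [RHS]eq_bigr do rewrite deriv_sub'.
rewrite exchange_big; apply: eq_bigr => j _ /=.
by rewrite deriv_sub raddf_sum; apply: eq_bigr => i _ /=; rewrite mderivZ.
Qed.

Lemma sub_up i p : sub B (up i p) = \sum_j B j i *: up j (sub B p).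
Proof.
rewrite /up rmorphB !rmorphM /= subX sub_nn sub_wgt deriv_sub' mulr_suml mulr_sumr -sumrB.
by apply: eq_bigr => j _; rewrite scalerBr scalerAl -scalerAr.
Qed.

Lemma sub_rl al be i p : sub B (rl al be i p) = \sum_j B j i *: rl al be j (sub B p).
Proof.
rewrite /rl rmorphD /= sub_up deriv_sub' !sub_wgt -big_split.
by apply: eq_bigr => j _ /=; rewrite -scalerDr.
Qed.

Lemma sub_rot i j p :
  sub B (rot i j p) = \sum_k \sum_l (B k i * B l j) *: rot k l (sub B p).
Proof.
have E i' j' : sub B ('X_i' * p^`M(j')) =
    \sum_k \sum_l (B k i' * B l j') *: ('X_k * (sub B p)^`M(l)).
  rewrite rmorphM /= subX deriv_sub' mulr_suml; apply: eq_bigr => k _.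
  rewrite mulr_sumr; apply: eq_bigr => l _.
  by rewrite -scalerAl -scalerAr scalerA.
rewrite {1}/rot rmorphB /= !E [X in _ - X]exchange_big /= -sumrB.
apply: eq_bigr => k _; rewrite -sumrB; apply: eq_bigr => l _.
by rewrite scalerBr [B l j * _]mulrC.
Qed.

(** A rotation is its own cofactor matrix: the cofactors along column [k] pair to [0] or [1] with
    the columns of [B], as determinants with two equal columns or as [\det B], and orthonormality of
    the rows inverts this relation. *)
Lemma orth_cofactor (j k : 'I_3) : \det B = 1 ->
  B (j + 1) (k + 1) * B (j + 2%:R) (k + 2%:R)
  - B (j + 1) (k + 2%:R) * B (j + 2%:R) (k + 1) = B j k.
Proof.
move=> detB; pose c j := B (j + 1) (k + 1) * B (j + 2%:R) (k + 2%:R)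
  - B (j + 1) (k + 2%:R) * B (j + 2%:R) (k + 1).
have Bc i : \sum_l B l i * c l = (i == k)%:R.
  case: (ord3P k i) => ->; rewrite ?eqxx ?ord3_eqE.
  - by rewrite -det_mx3.
  - by rewrite mulr0n (sum_ord3 _ k) /c !ord3_addE; ring.
  - by rewrite mulr0n (sum_ord3 _ k) /c !ord3_addE; ring.
have : \sum_i B j i * (\sum_l B l i * c l) = B j k.
  rewrite (bigD1 k) //= Bc eqxx mulr1 big1 ?addr0 // => i /negbTE ne.
  by rewrite Bc ne mulr0.
move=> <-; under [RHS]eq_bigr do rewrite mulr_sumr.
rewrite -/(c j) exchange_big /= (bigD1 j) //= [X in _ + X]big1 => [|l /negbTE ne];
  under eq_bigr do rewrite mulrA;
  by rewrite -mulr_suml orth_row 1?eq_sym ?ne ?eqxx ?mul0r ?mul1r ?addr0.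
Qed.

(** Rotation generators transform by the cofactors of an orthogonal matrix, and determinant one
    turns these into its entries. This is where it matters that [rho] takes values in the special
    orthogonal group. *)
Lemma sub_rot_cyc k p : \det B = 1 ->
  sub B (rot (k + 1) (k + 2%:R) p) =
  \sum_j B j k *: rot (j + 1) (j + 2%:R) (sub B p).
Proof.
move=> detB; rewrite sub_rot; set q := sub B p.
under [RHS]eq_bigr do rewrite -(orth_cofactor _ _ detB).
have r0 i : rot i i q = 0 by rewrite /rot subrr.
have rN i j : rot i j q = - rot j i q by rewrite /rot opprB.
rewrite !(sum_ord3 _ k) !ord3_addE !r0 !scaler0 !add0r !addr0.
rewrite (rN (k + 1) k) (rN (k + 2%:R) (k + 1)) (rN k (k + 2%:R)) !scalerN.
by rewrite -!mul_mpolyC !(mpolyCM, mpolyCB); ring.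
Qed.

End Orthogonal.

(** The angular part of the Laplacian; every unordered pair of indices is counted twice, whence the
    factor [2]. On harmonic polynomials of degree [l] the result is the scalar [- 2 l (l + 1)],
    which tells the degrees apart. *)
Lemma casimir p :
  \sum_i \sum_j rot i j (rot i j p) =
  2%:R * (nn * lap p - wgt (fun l => (l * l.+1)%:R) p).
Proof.
pose E := wgt (fun l => l%:R) p.
have EE : wgt (fun l => (l * l.+1)%:R) p =
    2%:R * E + \sum_i \sum_j 'X_i * 'X_j * p^`M(i)^`M(j).
  have -> : wgt (fun l => (l * l.+1)%:R) p = wgt (fun l => l%:R) E + E.
    by rewrite /E wgt_comp -wgtD; apply: eq_wgt => l; rewrite -natrM -natrD -mulnSr.
  rewrite -[wgt _ E]euler /E -{1 3}euler.
  have F i : (\sum_j 'X_j * p^`M(j))^`M(i) = p^`M(i) + \sum_j 'X_j * p^`M(i)^`M(j).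
    rewrite raddf_sum /= [RHS]addrC (bigD1 i) //= [X in _ = X + _](bigD1 i) //=.
    rewrite mderivM mderivX1 eqxx mul1r.
    under eq_bigr => j ne do rewrite mderivM mderivX1 (negbTE ne) mul0r add0r mderiv_comm.
    by ring.
  under eq_bigr do rewrite F mulrDr mulr_sumr.
  rewrite big_split /= euler.
  by under [in RHS]eq_bigr do under eq_bigr do rewrite -mulrA; ring.
rewrite EE.
have F i j : rot i j (rot i j p) =
    (i == j)%:R * ('X_i * p^`M(j)) + (i == j)%:R * ('X_j * p^`M(i))
    + 'X_i ^+ 2 * p^`M(j)^`M(j) + 'X_j ^+ 2 * p^`M(i)^`M(i)
    - 'X_i * p^`M(i) - 'X_j * p^`M(j)
    - 2%:R * ('X_i * 'X_j * p^`M(i)^`M(j)).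
  rewrite /rot !mderivs !eqxx (eq_sym j) (mderiv_comm j i) /=.
  by ring.
have D (G : 'I_3 -> P) i : \sum_j (i == j)%:R * G j = G i.
  rewrite (bigD1 i) //= eqxx mul1r big1 ?addr0 // => j /negbTE ne.
  by rewrite eq_sym ne mul0r.
under eq_bigr do under eq_bigr do rewrite F.
under eq_bigr do rewrite !(sumrB, big_split) /= !D -!mulr_sumr sumr_const card_ord -/(lap p) euler -/E.
rewrite !(sumrB, big_split) /= -!mulr_suml -!mulr_sumr -/nn euler -/E.
have -> : \sum_i \sum_j 'X_j ^+ 2 * p^`M(i)^`M(i) = nn * lap p.
  by under eq_bigr do rewrite -mulr_suml; rewrite -mulr_sumr.
have -> : \sum_i 'X_i * (p^`M(i) *+ 3) = 3%:R * E.
  by under eq_bigr do rewrite mulrnAr; rewrite sumrMnl euler -/E; ring.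
by rewrite sumr_const card_ord; ring.
Qed.

Definition mfact (m : 'X_{1..3}) : nat := \prod_i (m i)`!.

Definition fis p q : K := \sum_(m <- msupp p) (mfact m)%:R * p@_m * q@_m.

Lemma fisE s p q : uniq s -> {subset msupp p <= s} ->
  fis p q = \sum_(m <- s) (mfact m)%:R * p@_m * q@_m.
Proof.
move=> us hs; rewrite (bigID (mem (msupp p))) /= [X in _ + X]big1 ?addr0.
  rewrite -big_filter; apply: perm_big; apply: uniq_perm; rewrite ?filter_uniq ?msupp_uniq //.
  by move=> m; rewrite mem_filter; case: (boolP (m \in msupp p)) => // /hs ->.
by move=> m /memN_msupp_eq0 ->; rewrite mulr0 mul0r.
Qed.

Lemma fisC p q : fis p q = fis q p.
Proof.
have us := undup_uniq (msupp p ++ msupp q).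
rewrite (fisE q us) ?(fisE p us) => [|m|m];
  rewrite ?mem_undup ?mem_cat; try by move=> ->; rewrite ?orbT.
by apply: eq_bigr => m _; rewrite mulrAC.
Qed.

Lemma fis_linearr p : linear (fis p : P -> K^o).
Proof.
move=> c q r; rewrite /fis scaler_sumr -big_split; apply: eq_bigr => m _ /=.
by rewrite mcoeffD mcoeffZ mulrDr mulrCA.
Qed.

HB.instance Definition _ p :=
  GRing.isLinear.Build K P K^o *:%R (fis p) (fis_linearr p).

Lemma fisDl p q r : fis (p + q) r = fis p r + fis q r.
Proof. by rewrite !(fisC _ r) raddfD. Qed.

Lemma fisZl c p r : fis (c *: p) r = c * fis p r.
Proof. by rewrite !(fisC _ r) linearZ. Qed.

Lemma fis0l r : fis 0 r = 0.
Proof. by rewrite fisC raddf0. Qed.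

Lemma fisNl p r : fis (- p) r = - fis p r.
Proof. by rewrite !(fisC _ r) raddfN. Qed.

Lemma fisBl p q r : fis (p - q) r = fis p r - fis q r.
Proof. by rewrite fisDl fisNl. Qed.

Lemma fis_suml (I : Type) (s : seq I) (Q : pred I) (F : I -> P) r :
  fis (\sum_(i <- s | Q i) F i) r = \sum_(i <- s | Q i) fis (F i) r.
Proof. by rewrite fisC raddf_sum; apply: eq_bigr => i _ /=; rewrite fisC. Qed.

Lemma fisXl m q : fis 'X_[m] q = (mfact m)%:R * q@_m.
Proof. by rewrite /fis msuppX big_seq1 mcoeffX eqxx mulr1. Qed.

Lemma fis_mulX i p q : fis ('X_i * p) q = fis p q^`M(i).
Proof.
elim/mpoly_lin_ind: p => [|c p r hp hr|m]; first by rewrite mulr0 !fis0l.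
  by rewrite mulrDr -scalerAr !fisDl !fisZl hp hr.
rewrite -mpolyXD !fisXl mcoeff_deriv addmC mulrnAr -mulrnAl -mulrnA; congr (_%:R * _).
rewrite /mfact (bigD1 i) //= [in RHS](bigD1 i) //=.
rewrite mnmDE mnm1E eqxx addn1 factS -mulnA mulnC; congr (_ * _)%N; congr (_ * _)%N.
by apply: eq_bigr => j ne; rewrite mnmDE mnm1E eq_sym (negbTE ne) addn0.
Qed.

Lemma fis_deriv i p q : fis p^`M(i) q = fis p ('X_i * q).
Proof. by rewrite fisC -fis_mulX fisC. Qed.

Lemma fis_nn p q : fis (nn * p) q = fis p (lap q).
Proof.
rewrite mulr_suml fis_suml raddf_sum; apply: eq_bigr => i _ /=.
by rewrite expr2 -mulrA !fis_mulX.
Qed.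

Lemma fis_wgt a p q : fis (wgt a p) q = fis p (wgt a q).
Proof.
elim/mpoly_lin_ind: p => [|c p r hp hr|m]; first by rewrite raddf0 !fis0l.
  by rewrite linearP /= !fisDl !fisZl hp hr.
by rewrite wgtX fisZl !fisXl mcoeff_wgt mulrCA.
Qed.

Lemma fis_rot i j p q : fis (rot i j p) q = - fis p (rot i j q).
Proof.
rewrite /rot fisBl raddfB /= opprB; congr (_ - _);
  by rewrite fis_mulX fis_deriv.
Qed.

Lemma fis_up i p q : lap q = 0 -> fis (up i p) q = fis (wgt twol1 p) q^`M(i).
Proof. by move=> hq; rewrite /up fisBl fis_mulX fis_nn hq raddf0 subr0. Qed.

(** On harmonic polynomials the term with [|x|^2] in [up i] is invisible to the pairing, being
    adjoint to the Laplacian; hence [up i] is adjoint to [d_i] with the weight [2 l + 1]. The two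
    halves of [rl] are therefore exchanged, and the two hypotheses match their weights. *)
Lemma fis_rl ka al be al' be' i p q :
    (forall l, be l.+1 * ka l = ka l.+1 * (twol1 l * al' l)) ->
    (forall l, twol1 l * al l * ka l.+1 = ka l * be' l.+1) ->
    lap p = 0 -> lap q = 0 ->
  fis (wgt ka (rl al be i p)) q = fis (wgt ka p) (rl al' be' i q).
Proof.
move=> h1 h2 hp hq; have hk a r : lap r = 0 -> lap (wgt a r) = 0.
  by move=> hr; rewrite lap_wgt hr raddf0.
rewrite fis_wgt /rl fisDl raddfD /= fis_up; last exact: hk.
rewrite [fis _ (up i _)]fisC fis_up; last exact: hk.
rewrite addrC; congr (_ + _).
  rewrite [RHS]fisC wgt_comp !deriv_wgt !fis_wgt !wgt_comp.
  by congr fis; apply: eq_wgt => l; exact: h1.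
rewrite wgt_comp !deriv_wgt !fis_wgt !wgt_comp.
by congr fis; apply: eq_wgt => l; exact: h2.
Qed.

Lemma mcoeff0_sub B q : (sub B q)@_0%MM = q@_0%MM.
Proof.
have h0 i : ('X_i : P)@_0%MM = 0 by rewrite mcoeffX mnm1_eq0.
elim/mpoly_ring_ind: q => [c|i|p q hp hq|p q hp hq].
- by rewrite subC.
- by rewrite subX raddf_sum h0 big1 // => j _ /=; rewrite mcoeffZ h0 mulr0.
- by rewrite rmorphD !mcoeffD hp hq.
- rewrite rmorphM; have M (r s : P) : (r * s)@_0%MM = r@_0%MM * s@_0%MM.
    exact: (rmorphM (mcoeff 0%MM)).
  by rewrite !M hp hq.
Qed.

(** Induction on [p]: a variable moves to the other side as a derivative, and [deriv_sub'] matches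
    the rotated variables with the rotated derivatives. *)
Lemma fis_sub B p q : B^T *m B = 1%:M -> fis (sub B p) (sub B q) = fis p q.
Proof.
move=> BtB; elim/mpoly_mulX_ind: p q => [c|i p ih|p r hp hr] q.
- by rewrite subC -alg_mpolyC !fisZl -mpolyX0 !fisXl mcoeff0_sub.
- rewrite rmorphM /= subX mulr_suml fis_suml fis_mulX -ih.
  rewrite (deriv_sub' BtB) raddf_sum /=; apply: eq_bigr => j _.
  by rewrite -scalerAl fisZl fis_mulX linearZ.
- by rewrite (raddfD (sub B)) !fisDl hp hr.
Qed.

End WeightOperators.

(** * Change of coefficients in polynomials *)

Section BaseChange.
Import mpoly.
Variables (K K' : comNzRingType).

Section Additive.
Variable f : {additive K -> K'}.
Implicit Types p : {mpoly K[3]}.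

(** The lemmas of this section ask for additivity only: they are applied to coefficient extraction
    and to a differential at the identity, which are not multiplicative. Compatibility with the
    scalars involved is a hypothesis. *)
Lemma map_mpoly_scale c c' p : (forall d, f (c * d) = c' * f d) ->
  map_mpoly f (c *: p) = c' *: map_mpoly f p.
Proof. by move=> E; apply/mpolyP => m; rewrite mcoeffZ !mcoeff_map_mpoly mcoeffZ E. Qed.

Lemma map_mpoly_mulX i p : map_mpoly f ('X_i * p) = 'X_i * map_mpoly f p.
Proof.
have M c m : map_mpoly f (c *: 'X_[m]) = f c *: 'X_[m].
  apply/mpolyP => k; rewrite mcoeff_map_mpoly !mcoeffZ !mcoeffX !mulr_natr.
  exact: raddfMn.
elim/mpolyind: p => [|c m p _ _ hp]; first by rewrite mulr0 raddf0 mulr0.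
rewrite mulrDr !raddfD /= mulrDr hp; congr (_ + _).
by rewrite -scalerAr -mpolyXD !M -scalerAr mpolyXD.
Qed.

Lemma map_mpoly_deriv i p : map_mpoly f p^`M(i) = (map_mpoly f p)^`M(i).
Proof.
by apply/mpolyP => m; rewrite mcoeff_map_mpoly !mcoeff_deriv mcoeff_map_mpoly raddfMn.
Qed.

Lemma map_mpoly_wgt a a' p : (forall l d, f (a l * d) = a' l * f d) ->
  map_mpoly f (wgt a p) = wgt a' (map_mpoly f p).
Proof.
by move=> E; apply/mpolyP => m; rewrite mcoeff_map_mpoly !mcoeff_wgt mcoeff_map_mpoly E.
Qed.

Lemma map_mpoly_lap p : map_mpoly f (lap p) = lap (map_mpoly f p).
Proof. by rewrite /lap raddf_sum; apply: eq_bigr => i _ /=; rewrite !map_mpoly_deriv. Qed.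

Lemma map_mpoly_rot i j p : map_mpoly f (rot i j p) = rot i j (map_mpoly f p).
Proof. by rewrite /rot raddfB /= !map_mpoly_mulX !map_mpoly_deriv. Qed.

Lemma map_mpoly_sub (B : 'M[K]_3) (B' : 'M[K']_3) p : (forall i j d, f (B i j * d) = B' i j * f d) ->
  map_mpoly f (sub B p) = sub B' (map_mpoly f p).
Proof.
move=> E; elim/mpoly_mulX_ind: p => [c|i p ih|p q hp hq].
- by rewrite subC !map_mpolyC subC.
- rewrite rmorphM /= subX mulr_suml raddf_sum /= map_mpoly_mulX rmorphM /= subX mulr_suml.
  apply: eq_bigr => j _; rewrite -!scalerAl -ih -map_mpoly_mulX.
  exact: map_mpoly_scale.
- by rewrite (raddfD (sub B)) !(raddfD (map_mpoly f)) (raddfD (sub B')) /= hp hq.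
Qed.

End Additive.

Lemma map_mpoly_fis (f : {rmorphism K -> K'}) (p q : {mpoly K[3]}) :
  f (fis p q) = fis (map_mpoly f p) (map_mpoly f q).
Proof.
elim/mpoly_lin_ind: p => [|c p r hp hr|m].
- by rewrite rmorph0 !fis0l rmorph0.
- by rewrite rmorphD /= map_mpolyZ !fisDl !fisZl rmorphD rmorphM hp hr.
- by rewrite map_mpolyX !fisXl rmorphM rmorph_nat mcoeff_map_mpoly.
Qed.

End BaseChange.

(** * A basis of harmonic polynomials that does not depend on the coefficient ring *)

Section HarmonicBasis.
Import mpoly.

(** By the Cauchy problem for the Laplace equation, a harmonic polynomial is determined by its value
    and its normal derivative on the plane where the third variable vanishes; these two data are the
    coefficients at the monomials selected here. *)
Definition low (m : 'X_{1..3}) : bool := (m 2%:R <= 1)%N.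

Section Basis.
Variable K : comUnitRingType.
Hypothesis unitS : forall n, n.+1%:R \is a @GRing.unit K.
Implicit Types p q : {mpoly K[3]}.

(** The Laplace equation expresses a coefficient with exponent [e + 2] in the third variable by
    coefficients with exponent [e], up to the factor [(e + 1) (e + 2)], which is a unit. *)
Lemma harm_eq0 p : lap p = 0 -> (forall m, low m -> p@_m = 0) -> p = 0.
Proof.
move=> hp h0; apply/mpolyP => m; rewrite mcoeff0.
have [n hn] := ubnP (m 2%:R); elim: n => // n ih in m hn *.
have [lm|] := boolP (low m); first exact: h0.
rewrite -ltnNge => m2; pose m' := (m - (U_(2%:R) + U_(2%:R)))%MM.
have Em : m = (m' + U_(2%:R) + U_(2%:R))%MM.
  rewrite -addmA submK //; apply/mnm_lepP => i; rewrite mnmDE !mnm1E.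
  by case: eqP => // <-.
have m'2 : m 2%:R = (m' 2%:R).+2 by rewrite {1}Em !mnmDE mnm1E eqxx !addn1.
have /(congr1 (mcoeff m')) := hp.
rewrite mcoeff0 /lap raddf_sum (sum_ord3 _ 2%:R) /= !mcoeff_deriv.
have hz i : i != 2%:R -> p@_(m' + U_(i) + U_(i)) = 0.
  move=> ni; apply: ih; rewrite !mnmDE !mnm1E (negbTE ni) !addn0.
  by move: hn; rewrite m'2; lia.
rewrite (hz (2%:R + 1)) // (hz (2%:R + 2%:R)) // !mul0rn !addr0 -Em -mulrnA.
set u := (_.+1 * _.+1)%N; rewrite -[u]/u.-1.+1 -[p@_m *+ _]mulr_natr.
by move/(canRL (mulrK (unitS _))) => ->; rewrite mul0r.
Qed.

(** Integrate twice in the third variable. The error consists of the second derivatives in the other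
    two variables, which are monomials with two units of degree moved to the third variable, so that
    the degree in the first two variables decreases and induction applies. Every monomial used has
    exponent at least two in the third variable, hence none is low. *)
Lemma lap_solve m : exists r : {mpoly K[3]},
  [/\ r \is (mdeg m).+2.-homog, lap r = 'X_[m] & forall k, low k -> r@_k = 0].
Proof.
have [n hn] := ubnP (mdeg m - m 2%R)%N; elim: n => // n ih in m hn *.
pose s := (m + U_(2%:R) + U_(2%:R))%MM.
have DX k i : ('X_[k] : {mpoly K[3]})^`M(i)^`M(i) =
    (k i * (k i).-1)%:R *: 'X_[k - U_(i) - U_(i)].
  rewrite mderivX mderivZ mderivX scalerA -natrM mnmBE mnm1E eqxx /=.
  by case: (k i) => [|a]; rewrite ?mul0n // subSS subn0.
have solve i : i != 2%:R -> exists r : {mpoly K[3]}, [/\ r \is (mdeg m).+2.-homog,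
    lap r = ('X_[s])^`M(i)^`M(i) & forall k, low k -> r@_k = 0].
  move=> ni; rewrite DX.
  have [h|si] := boolP (s i * (s i).-1 == 0)%N.
    exists 0; rewrite (eqP h) scale0r raddf0; split; rewrite ?rpred0 // => k _.
    exact: mcoeff0.
  have s2 : (1 < s i)%N by case: (s i) si => [|[]].
  have si' : s i = m i by rewrite !mnmDE mnm1E eq_sym (negbTE ni) !addn0.
  have le : (U_(i) + U_(i) <= s)%MM.
    by apply/mnm_lepP => j; rewrite mnmDE !mnm1E; case: eqP => // <-.
  have := submK le; rewrite -submDA => /(congr1 (@mdeg 3)).
  rewrite !mdegD !mdeg1 => E.
  have [|r [hr lr r0]] := ih (s - U_(i) - U_(i))%MM.
    have n2 : (U_(i))%MM 2%R = 0%N by rewrite mnm1E (negbTE ni).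
    have : (m i + m 2%R <= mdeg m)%N.
      by rewrite mdegE (bigD1 i) //= (bigD1 2%R) 1?eq_sym //= addnA leq_addr.
    rewrite !mnmBE !mnmDE n2 mnm1E eqxx; move: hn s2 E; rewrite si'; lia.
  exists ((s i * (s i).-1)%:R *: r); split.
  - have -> : (mdeg m).+2 = (mdeg (s - U_(i) - U_(i))).+2 by lia.
    exact: rpredZ.
  - by rewrite linearZ /= lr.
  - by move=> k hk; rewrite mcoeffZ r0 ?mulr0.
have [r1 [h1 l1 z1]] := solve (2%:R + 1) isT; have [r2 [h2 l2 z2]] := solve (2%:R + 2%:R) isT.
pose c : K := (s 2%:R * (s 2%:R).-1)%:R.
have uc : c \is a GRing.unit.
  have E : s 2%:R = (m 2%:R).+2 by rewrite !mnmDE mnm1E eqxx !addn1.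
  by rewrite /c E natrM unitrM !unitS.
exists (c^-1 *: ('X_[s] - r1 - r2)); split.
- by rewrite rpredZ // !rpredB // dhomogX /= !mdegD !mdeg1 !addn1.
- have E (u v w : {mpoly K[3]}) : u + v + w - v - w = u by ring.
  rewrite linearZ !raddfB /= l1 l2 {1}/lap (sum_ord3 _ 2%:R).
  rewrite -!scalerBr E DX -/c scalerA mulVr // scale1r; congr 'X_[_]; rewrite /s.
  by rewrite !addmK.
- move=> k hk; rewrite mcoeffZ !mcoeffB z1 // z2 // !subr0 mcoeffX.
  case: eqP => [E|]; last by rewrite mulr0.
  by move: hk; rewrite -E /low !mnmDE mnm1E eqxx !addn1.
Qed.

Definition mons l : seq 'X_{1..3} :=
  [seq m <- [seq val m | m : 'X_{1..3 < l.+1}] | (mdeg m == l) && low m].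

Lemma mem_mons l m : (m \in mons l) = (mdeg m == l) && low m.
Proof.
rewrite mem_filter andb_idr // => /andP[/eqP hm _].
have hm' : (mdeg m < l.+1)%N by rewrite hm.
by apply/imageP; exists (BMultinom hm').
Qed.

Lemma mons_uniq l : uniq (mons l).
Proof. by rewrite filter_uniq // map_inj_uniq ?enum_uniq //; exact: val_inj. Qed.

Definition mon l (a : 'I_(size (mons l))) : 'X_{1..3} := tnth (in_tuple (mons l)) a.

Lemma mon_mem l a : @mon l a \in mons l.
Proof. exact: mem_tnth. Qed.

Lemma mon_inj l : injective (@mon l).
Proof. by apply/tuple_uniqP; exact: mons_uniq. Qed.

Lemma monP l m : mdeg m = l -> low m -> exists a, m = @mon l a.
Proof.
move=> hm lm; have /tnthP[a ->] : m \in in_tuple (mons l).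
  by rewrite mem_mons hm eqxx.
by exists a.
Qed.

Definition hb_pred l (a : 'I_(size (mons l))) (e : {mpoly K[3]}) : bool :=
  [&& e \is l.-homog, lap e == 0 &
    [forall b, e@_(@mon l b) == (a == b)%:R]].

(** Subtract from the low monomial a solution of the same Laplace equation without low monomials;
    the component of degree [l] of the difference is harmonic and has the prescribed
    coefficients. *)
Lemma hb_ex l a : exists e, @hb_pred l a e.
Proof.
have := mon_mem a; rewrite mem_mons => /andP[/eqP hd hl].
have [r lr r0] : exists2 r : {mpoly K[3]},
    lap r = lap 'X_[mon a] & forall k, low k -> r@_k = 0.
  elim/mpolyind: (lap 'X_[_]) => [|c m p _ _ [r h2 h3]].
    by exists 0 => [|k _]; rewrite ?raddf0 ?mcoeff0.
  have [s [_ s2 s3]] := lap_solve m; exists (c *: s + r) => [|k hk].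
    by rewrite linearP /= s2 h2.
  by rewrite mcoeffD mcoeffZ s3 // h3 // mulr0 addr0.
exists (hpart l ('X_[mon a] - r)); apply/and3P; split.
- exact: hpart_homog.
- by rewrite lap_wgt raddfB /= lr subrr raddf0.
- apply/forallP => b; have := mon_mem b; rewrite mem_mons => /andP[/eqP bd bl].
  rewrite mcoeff_hpart bd eqxx mul1r mcoeffB mcoeffX r0 // subr0.
  by rewrite (inj_eq (@mon_inj l)).
Qed.

Definition hb l a : {mpoly K[3]} := xchoose (@hb_ex l a).

Lemma hbP l a : hb_pred a (@hb l a).
Proof. exact: xchooseP. Qed.

Lemma hb_homog l a : @hb l a \is l.-homog.
Proof. by have /and3P[] := hbP a. Qed.

Lemma lap_hb l a : lap (@hb l a) = 0.
Proof. by have /and3P[_ /eqP] := hbP a. Qed.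

Lemma mcoeff_hb l a k b : (@hb l a)@_(@mon k b) = (mon a == mon b)%:R.
Proof.
have := mon_mem b; rewrite mem_mons => /andP[/eqP bd bl].
have := mon_mem a; rewrite mem_mons => /andP[/eqP ad al].
have [E|ne] := eqVneq l k.
  subst k; have /and3P[_ _ /forallP/(_ b)/eqP ->] := hbP a.
  by rewrite (inj_eq (@mon_inj l)).
rewrite (dhomog_nemf_coeff (hb_homog a)); last by rewrite /= bd eq_sym.
by case: eqP => // E; move: ne; rewrite -bd -E ad eqxx.
Qed.

Lemma harm_homogE l p : p \is l.-homog -> lap p = 0 ->
  p = \sum_a p@_(mon a) *: @hb l a.
Proof.
move=> hp lp; apply/eqP; rewrite -subr_eq0; apply/eqP; apply: harm_eq0.
  rewrite raddfB /= lp sub0r lap_sum big1 ?oppr0 // => a _.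
  by rewrite lapZ lap_hb scaler0.
move=> m lm; rewrite mcoeffB raddf_sum /=; under eq_bigr do rewrite mcoeffZ.
have [E|ne] := eqVneq (mdeg m) l; last first.
  rewrite (dhomog_nemf_coeff hp) // big1 ?subrr // => a _.
  by rewrite (dhomog_nemf_coeff (hb_homog a)) // mulr0.
have [b ->] := monP E lm; rewrite (bigD1 b) //= mcoeff_hb eqxx mulr1.
rewrite big1 ?addr0 ?subrr // => a nab.
by rewrite mcoeff_hb (inj_eq (@mon_inj l)) (negbTE nab) mulr0.
Qed.

Lemma lap_hpart l p : lap p = 0 -> lap (hpart l p) = 0.
Proof. by move=> hp; rewrite lap_wgt hp raddf0. Qed.

Lemma mcoeff_hpart_mon l p a : (hpart l p)@_(@mon l a) = p@_(mon a).
Proof.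
have := mon_mem a; rewrite mem_mons => /andP[/eqP ad _].
by rewrite mcoeff_hpart ad eqxx mul1r.
Qed.

Lemma harm_hpartE l p : lap p = 0 -> hpart l p = \sum_a p@_(mon a) *: @hb l a.
Proof.
move=> lp; rewrite {1}(harm_homogE (hpart_homog l p) (lap_hpart l lp)).
by apply: eq_bigr => a _; rewrite mcoeff_hpart_mon.
Qed.

End Basis.

(** The basis is characterized by harmonicity and by coefficients [0] and [1], both preserved by
    ring morphisms. The basis over [C[T]] thus consists of constant polynomials in [T], and
    evaluation at [lam] gives back the complex basis. *)
Lemma map_mpoly_hb (K K' : comUnitRingType) (f : {rmorphism K -> K'})
    (uK : forall n, n.+1%:R \is a @GRing.unit K)
    (uK' : forall n, n.+1%:R \is a @GRing.unit K') l a :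
  map_mpoly f (@hb _ uK l a) = hb uK' a.
Proof.
apply/eqP; rewrite -subr_eq0; apply/eqP; apply: (harm_eq0 uK').
  by rewrite raddfB /= lap_hb -map_mpoly_lap lap_hb raddf0 subr0.
move=> m lm; have [b ->] := monP erefl lm.
rewrite mcoeffB mcoeff_map_mpoly !mcoeff_hb.
by case: (_ == _); rewrite /= ?(rmorph1 f) ?(rmorph0 f) subrr.
Qed.

End HarmonicBasis.

(** * The Lie algebra relations between rotations and ladder operators *)

Section LieAlgebra.
Import mpoly.
Variable K : comNzRingType.
Local Notation P := {mpoly K[3]}.
Implicit Types (p q : P) (i j k : 'I_3) (u v w : 'rV[K]_3).

Definition crossp u v : 'rV[K]_3 :=
  \row_(k < 3) (u 0 (k + 1) * v 0 (k + 2%:R) - u 0 (k + 2%:R) * v 0 (k + 1)).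

Lemma cross_comb u v (T : 'I_3 -> 'I_3 -> P) (D : 'I_3 -> P) :
    (forall i, T i i = 0) -> (forall i, T i (i + 1) = D (i + 2%:R)) ->
    (forall i, T (i + 1) i = - D (i + 2%:R)) ->
  \sum_i \sum_j (u 0 i * v 0 j) *: T i j = \sum_k crossp u v 0 k *: D k.
Proof.
move=> T0 T1 T2; have [k _] : exists k : 'I_3, True by exists 0.
have T3 : T k (k + 2%:R) = - D (k + 1) by have := T2 (k + 2%:R); rewrite !ord3_addE.
have T4 : T (k + 2%:R) k = D (k + 1) by have := T1 (k + 2%:R); rewrite !ord3_addE.
have T5 : T (k + 1) (k + 2%:R) = D k by have := T1 (k + 1); rewrite !ord3_addE.
have T6 : T (k + 2%:R) (k + 1) = - D k by have := T2 (k + 1); rewrite !ord3_addE.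
rewrite !(sum_ord3 _ k) !T0 T1 T2 T3 T4 T5 T6 !mxE !ord3_addE -!mul_mpolyC !mpolyCB !mpolyCM.
move: (u 0 k)%:MP (u 0 (k + 1))%:MP (u 0 (k + 2%:R))%:MP => u0 u1 u2.
move: (v 0 k)%:MP (v 0 (k + 1))%:MP (v 0 (k + 2%:R))%:MP => v0 v1 v2.
move: (D k) (D (k + 1)) (D (k + 2%:R)) => d0 d1 d2.
by ring.
Qed.

Lemma comm_sums (F G : 'I_3 -> P -> P) u v p :
    (forall i w f, F i (\sum_j w 0 j *: f j) = \sum_j w 0 j *: F i (f j)) ->
    (forall i w f, G i (\sum_j w 0 j *: f j) = \sum_j w 0 j *: G i (f j)) ->
  (\sum_i u 0 i *: F i (\sum_j v 0 j *: G j p)) - (\sum_j v 0 j *: G j (\sum_i u 0 i *: F i p)) =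
  \sum_i \sum_j (u 0 i * v 0 j) *: (F i (G j p) - G j (F i p)).
Proof.
move=> linF linG.
have -> : \sum_j v 0 j *: G j (\sum_i u 0 i *: F i p) =
    \sum_i \sum_j (u 0 i * v 0 j) *: G j (F i p).
  rewrite exchange_big; apply: eq_bigr => j _ /=; rewrite linG scaler_sumr.
  by apply: eq_bigr => i _ /=; rewrite scalerA mulrC.
rewrite -sumrB; apply: eq_bigr => i _; rewrite linF scaler_sumr -sumrB.
by apply: eq_bigr => j _ /=; rewrite scalerBr scalerA.
Qed.

Definition gL k p : P := rot (k + 1) (k + 2%:R) p.

Lemma gL_linear k : linear (gL k).
Proof. exact: linearP. Qed.

Lemma gL_sum i w f : gL i (\sum_j w 0 j *: f j) = \sum_j w 0 j *: gL i (f j).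
Proof. by rewrite /gL raddf_sum; apply: eq_bigr => j _; exact: linearZ. Qed.

Variables (al be : nat -> K) (lam iota : K).
Local Notation rl := (rl al be).

Lemma rl_sum i w f : rl i (\sum_j w 0 j *: f j) = \sum_j w 0 j *: rl i (f j).
Proof. by rewrite (raddf_sum (rl i)); apply: eq_bigr => j _; exact: linearZ. Qed.

Definition Lsum u p : P := \sum_k u 0 k *: gL k p.
Definition Rsum u p : P := \sum_k u 0 k *: rl k p.

Definition gfun (X : 'rV[K]_3 * 'rV[K]_3) p : P := Lsum X.1 p + iota *: Rsum X.2 p.

Lemma Lsum_linear u : linear (Lsum u).
Proof.
move=> c p q; rewrite /Lsum scaler_sumr -big_split; apply: eq_bigr => k _ /=.
by rewrite gL_linear scalerDr !scalerA mulrC.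
Qed.

Lemma Rsum_linear u : linear (Rsum u).
Proof.
move=> c p q; rewrite /Rsum scaler_sumr -big_split; apply: eq_bigr => k _ /=.
by rewrite linearP /= scalerDr !scalerA mulrC.
Qed.

Lemma gfun_linear X : linear (gfun X).
Proof.
move=> c p q; rewrite /gfun Lsum_linear Rsum_linear !scalerDr !scalerA mulrC.
by rewrite -scalerA addrACA.
Qed.

Lemma gfun_linearl p : linear (gfun^~ p).
Proof.
move=> c [a b] [a' b']; rewrite /gfun /=.
have -> : Lsum (c *: a + a') p = c *: Lsum a p + Lsum a' p.
  rewrite /Lsum scaler_sumr -big_split; apply: eq_bigr => k _ /=.
  by rewrite !mxE scalerDl scalerA.
have -> : Rsum (c *: b + b') p = c *: Rsum b p + Rsum b' p.
  rewrite /Rsum scaler_sumr -big_split; apply: eq_bigr => k _ /=.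
  by rewrite !mxE scalerDl scalerA.
by rewrite !scalerDr !scalerA mulrC -scalerA addrACA.
Qed.

Lemma lap_gfun X p : lap p = 0 -> lap (gfun X p) = 0.
Proof.
move=> hp; have hL k : lap (gL k p) = 0 by rewrite lap_rot hp /rot !mderiv0 !mulr0 subrr.
rewrite /gfun lapD lapZ /Lsum /Rsum !lap_sum !big1 ?scaler0 ?addr0 // => k _.
  by rewrite lapZ lap_rl // scaler0.
by rewrite lapZ hL scaler0.
Qed.

Lemma cyc_rot_rot i j k p : i != j -> j != k -> k != i ->
  rot j k (rot k i p) - rot k i (rot j k p) = - rot i j p.
Proof.
move=> /negbTE ij /negbTE jk /negbTE ki; rewrite rot_rot eqxx (eq_sym k j) jk (eq_sym i k) ki ij.
by rewrite !mul0r mul1r !subr0 addr0 /rot opprB.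
Qed.

Lemma cyc_rot_rl i j k p : i != j -> j != k -> k != i ->
  (rot j k (rl i p) - rl i (rot j k p) = 0) *
  (rot j k (rl j p) - rl j (rot j k p) = - rl k p) *
  (rot k i (rl i p) - rl i (rot k i p) = rl k p).
Proof.
move=> /negbTE ij /negbTE jk /negbTE ki.
rewrite !rot_rl !eqxx (eq_sym i k) ki ij jk !mul0r !mul1r !subr0 sub0r.
by do !split.
Qed.

Let n01 i : i != i + 1. Proof. by rewrite ord3_eqE. Qed.
Let n12 i : i + 1 != i + 2%:R. Proof. by rewrite ord3_eqE. Qed.
Let n20 i : i + 2%:R != i. Proof. by rewrite ord3_eqE. Qed.

Lemma gLE i : (gL (i + 1) =1 rot (i + 2%:R) i) * (gL (i + 2%:R) =1 rot i (i + 1)).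
Proof. by rewrite /gL !ord3_addE; split. Qed.

Lemma gL_gL i p : gL i (gL (i + 1) p) - gL (i + 1) (gL i p) = - gL (i + 2%:R) p.
Proof. by rewrite !gLE /gL; exact: cyc_rot_rot. Qed.

Lemma Lsum_Lsum u v p : Lsum u (Lsum v p) - Lsum v (Lsum u p) = - Lsum (crossp u v) p.
Proof.
rewrite (comm_sums _ _ _ gL_sum gL_sum) (@cross_comb _ _ _ (fun k => - gL k p)).
- by rewrite /Lsum -sumrN; apply: eq_bigr => k _; rewrite scalerN.
- by move=> i; rewrite subrr.
- by move=> i; exact: gL_gL.
- by move=> i; rewrite -opprB gL_gL.
Qed.

Lemma Lsum_Rsum u v p : Lsum u (Rsum v p) - Rsum v (Lsum u p) = - Rsum (crossp u v) p.
Proof.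
rewrite (comm_sums _ _ _ gL_sum rl_sum) (@cross_comb _ _ _ (fun k => - rl k p)).
- by rewrite /Rsum -sumrN; apply: eq_bigr => k _; rewrite scalerN.
- by move=> i; have [[-> _] _] := cyc_rot_rl p (n01 i) (n12 i) (n20 i).
- by move=> i; have [[_ ->] _] := cyc_rot_rl p (n01 i) (n12 i) (n20 i).
- by move=> i; rewrite !gLE opprK; have [_ ->] := cyc_rot_rl p (n01 i) (n12 i) (n20 i).
Qed.

Hypothesis iota2 : iota * iota = - 1.
Hypothesis alpha_beta : forall l,
  (2 * l + 5)%:R * (al l.+1 * be l.+2) = lam + (2 * l + 1)%:R * (al l * be l.+1).

Lemma Rsum_Rsum u v p :
  Rsum u (Rsum v p) - Rsum v (Rsum u p) = - (lam *: Lsum (crossp u v) p).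
Proof.
rewrite (comm_sums _ _ _ rl_sum rl_sum) (@cross_comb _ _ _ (fun k => - (lam *: gL k p))).
- rewrite /Lsum scaler_sumr -sumrN; apply: eq_bigr => k _.
  by rewrite scalerN !scalerA mulrC.
- by move=> i; exact: subrr.
- by move=> i; rewrite (rl_comm _ _ _ alpha_beta) gLE.
- by move=> i; rewrite -opprB (rl_comm _ _ _ alpha_beta) gLE.
Qed.

Lemma gfun_bracket X Y p :
  gfun (- crossp X.1 Y.1 + lam *: crossp X.2 Y.2, - crossp X.1 Y.2 - crossp X.2 Y.1) p =
  gfun X (gfun Y p) - gfun Y (gfun X p).
Proof.
rewrite /gfun /=.
have LD u q r : Lsum u (q + iota *: r) = Lsum u q + iota *: Lsum u r.
  by rewrite addrC Lsum_linear addrC.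
have RD u q r : Rsum u (q + iota *: r) = Rsum u q + iota *: Rsum u r.
  by rewrite addrC Rsum_linear addrC.
rewrite !LD !RD.
have -> : Lsum (- crossp X.1 Y.1 + lam *: crossp X.2 Y.2) p =
    - Lsum (crossp X.1 Y.1) p + lam *: Lsum (crossp X.2 Y.2) p.
  have mxE' (a b : 'rV[K]_3) k : (- a + lam *: b) 0 k = - a 0 k + lam * b 0 k by rewrite !mxE.
  rewrite /Lsum scaler_sumr -sumrN -big_split; apply: eq_bigr => k _ /=.
  by rewrite mxE' scalerDl scaleNr scalerA.
have -> : Rsum (- crossp X.1 Y.2 - crossp X.2 Y.1) p =
    - Rsum (crossp X.1 Y.2) p - Rsum (crossp X.2 Y.1) p.
  have mxE' (a b : 'rV[K]_3) k : (- a - b) 0 k = - a 0 k - b 0 k by rewrite !mxE.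
  rewrite /Rsum -!sumrN -big_split; apply: eq_bigr => k _ /=.
  by rewrite mxE' scalerBl scaleNr.
have -> : - Rsum (crossp X.2 Y.1) p = Rsum (crossp Y.1 X.2) p.
  rewrite /Rsum -sumrN; apply: eq_bigr => k _; rewrite -scaleNr; congr (_ *: _).
  by rewrite !mxE; ring.
have E1 := Lsum_Lsum X.1 Y.1 p; have E2 := Lsum_Rsum X.1 Y.2 p.
have E3 := Lsum_Rsum Y.1 X.2 p; have E4 := Rsum_Rsum X.2 Y.2 p.
have -> : lam *: Lsum (crossp X.2 Y.2) p = - (Rsum X.2 (Rsum Y.2 p) - Rsum Y.2 (Rsum X.2 p)).
  by rewrite E4 opprK.
rewrite -[Rsum (crossp Y.1 X.2) p]opprK -E1 -E2 -E3 -!mul_mpolyC.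
have i2 : iota%:MP * iota%:MP = - 1 :> P by rewrite -mpolyCM iota2 mpolyCN mpolyC1.
move: (Lsum X.1 (Lsum Y.1 p)) (Lsum Y.1 (Lsum X.1 p)) => a1 a2.
move: (Lsum X.1 (Rsum Y.2 p)) (Rsum Y.2 (Lsum X.1 p)) => a3 a4.
move: (Lsum Y.1 (Rsum X.2 p)) (Rsum X.2 (Lsum Y.1 p)) => a5 a6.
move: (Rsum X.2 (Rsum Y.2 p)) (Rsum Y.2 (Rsum X.2 p)) => a7 a8.
(* The commutator of the ladder operators carries [- lam]; the square of [iota] turns this into the
   plus sign of [[R_i, R_j]]. *)
have -> : - (a7 - a8) = iota%:MP * iota%:MP * (a7 - a8) by rewrite i2 mulN1r.
by move: iota%:MP => z; ring.
Qed.

Lemma sub_gfun (B : 'M[K]_3) X p : B^T *m B = 1%:M -> \det B = 1 ->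
  sub B (gfun X p) = gfun (X.1 *m B^T, X.2 *m B^T) (sub B p).
Proof.
move=> oB dB; rewrite /gfun rmorphD /= linearZ /=.
have E (F : 'I_3 -> P -> P) u q : (forall k, sub B (F k p) = \sum_j B j k *: F j q) ->
    sub B (\sum_k u 0 k *: F k p) = \sum_k (u *m B^T) 0 k *: F k q.
  move=> h; rewrite (raddf_sum (sub B)) /=.
  have -> : \sum_i sub B (u 0 i *: F i p) = \sum_i \sum_j (u 0 i * B j i) *: F j q.
    apply: eq_bigr => i _; rewrite linearZ /= h scaler_sumr.
    by apply: eq_bigr => j _; rewrite scalerA.
  rewrite exchange_big; apply: eq_bigr => j _ /=; rewrite -scaler_suml; congr (_ *: _).
  by rewrite mxE; apply: eq_bigr => k _; rewrite mxE.
congr (_ + _ *: _); apply: E => k; first exact: sub_rot_cyc.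
exact: sub_rl.
Qed.

End LieAlgebra.

(** * Regular functions on the orthogonal group *)

Module RegularFunctions.

Section InfinitesimalRotations.
Import mpoly.
Variable K : comNzRingType.
Implicit Types (xi : 'M[K]_3) (p : {mpoly K[3]}).

Definition so3op xi p : {mpoly K[3]} :=
  \sum_i \sum_j xi i j *: ('X_i * p^`M(j)).

Lemma so3opE xi p : (forall i j, xi i j = - xi j i) -> (forall i, xi i i = 0) ->
  so3op xi p = \sum_k xi (k + 1) (k + 2%:R) *: rot (k + 1) (k + 2%:R) p.
Proof.
move=> skewE d; have [k _] : exists k : 'I_3, True by exists 0.
rewrite /so3op !(sum_ord3 _ k) !ord3_addE /rot !d !scale0r.
rewrite (skewE (k + 1) k) (skewE (k + 2%:R) (k + 1)) (skewE k (k + 2%:R)) -!mul_mpolyC !mpolyCN.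
move: ('X_k) ('X_(k + 1)) ('X_(k + 2%:R)) => u0 u1 u2.
move: (p^`M(k)) (p^`M(k + 1)) (p^`M(k + 2%:R)) => v0 v1 v2.
move: (_%:MP) (_%:MP) (_%:MP) => w0 w1 w2.
by ring.
Qed.

Variables (L : comNzRingType) (phi : {rmorphism K -> L}) (e : {rmorphism L -> K}).
Variable D : {additive L -> K}.
Hypothesis DM : forall f g, D (f * g) = D f * e g + e f * D g.
Hypothesis ephi : forall c, e (phi c) = c.
Hypothesis Dphi : forall c, D (phi c) = 0.

Lemma map_derivation_scale b (r : {mpoly L[3]}) :
  map_mpoly D (b *: r) = D b *: map_mpoly e r + e b *: map_mpoly D r.
Proof.
by apply/mpolyP => m; rewrite mcoeffD !mcoeffZ !mcoeff_map_mpoly mcoeffZ DM.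
Qed.

(** The infinitesimal form of the action: in the application [L] consists of the polynomial
    functions of a matrix, [e] evaluates them at the identity and [D] is a tangent vector there.
    Only the product rule is used, so the induction runs over multiplication by variables. *)
Lemma map_derivation_sub (B : 'M[L]_3) xi p :
    (forall i j, e (B i j) = (1%:M : 'M[K]_3) i j) -> (forall i j, D (B i j) = xi i j) ->
  map_mpoly D (sub B (map_mpoly phi p)) = so3op xi p.
Proof.
move=> eB DB; elim/mpoly_mulX_ind: p => [c|i p ih|p q hp hq].
- rewrite map_mpolyC subC; apply/mpolyP => m.
  rewrite mcoeff_map_mpoly mcoeffC mulr_natr raddfMn /= Dphi mul0rn.
  by rewrite /so3op big1 ?mcoeff0 // => i _; rewrite big1 // => j _; rewrite mderivC mulr0 scaler0.
- have E j (r : {mpoly L[3]}) : map_mpoly D (B j i *: ('X_j * r)) =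
      xi j i *: ('X_j * map_mpoly e r) + (j == i)%:R *: ('X_j * map_mpoly D r).
    by rewrite map_derivation_scale !map_mpoly_mulX eB DB mxE.
  have ev : map_mpoly e (sub B (map_mpoly phi p)) = p.
    rewrite (@map_mpoly_sub _ _ _ _ 1%:M) => [|k l f]; last by rewrite /= rmorphM eB.
    by rewrite sub1; apply/mpolyP => m; rewrite !mcoeff_map_mpoly; exact: ephi.
  have G : sub B (map_mpoly phi ('X_i * p)) =
      \sum_j B j i *: ('X_j * sub B (map_mpoly phi p)).
    rewrite map_mpoly_mulX rmorphM /= subX mulr_suml.
    by apply: eq_bigr => j _; rewrite scalerAl.
  rewrite G raddf_sum /=; under eq_bigr do rewrite E ih ev.
  rewrite big_split /= [X in _ + X](bigD1 i) //= eqxx scale1r.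
  rewrite [X in _ + (_ + X)]big1 ?addr0 => [|j /negbTE ->]; last by rewrite scale0r.
  have M j : ('X_i * p)^`M(j) = (i == j)%:R * p + 'X_i * p^`M(j).
    by rewrite mderivM mderivX1.
  rewrite /so3op mulr_sumr -big_split; apply: eq_bigr => j _ /=.
  under [RHS]eq_bigr do rewrite M mulrDr scalerDr.
  rewrite big_split /= [X in _ = X + _](bigD1 i) //= eqxx mul1r [X in _ = _ + X + _]big1 ?addr0 => [|k ne].
    rewrite mulr_sumr; congr (_ + _); apply: eq_bigr => k _.
    by rewrite -scalerAr; congr (_ *: _); ring.
  by rewrite eq_sym (negbTE ne) mul0r mulr0 scaler0.
- rewrite (raddfD (map_mpoly phi)) (raddfD (sub B)) raddfD /= hp hq.
  rewrite /so3op -big_split; apply: eq_bigr => i _ /=; rewrite -big_split; apply: eq_bigr => j _ /=.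
  by rewrite mderivD mulrDr scalerDr.
Qed.

End InfinitesimalRotations.

Section Orthogonal3.
Variable F : fieldType.
Implicit Types A B : 'M[F]_3.

Lemma det_orth A : orthogonal_mx A -> \det A * \det A = 1.
Proof. by move=> oA; rewrite -{1}det_tr -det_mulmx oA det1. Qed.

Lemma det_orth_neq0 A : orthogonal_mx A -> \det A != 0.
Proof.
by move=> oA; apply/eqP => h; have /eqP := det_orth oA; rewrite h mul0r eq_sym oner_eq0.
Qed.

Lemma invdet_orth A : orthogonal_mx A -> (\det A)^-1 = \det A.
Proof.
by move=> oA; apply: (mulIf (det_orth_neq0 oA)); rewrite mulVf ?det_orth // det_orth_neq0.
Qed.

Lemma orth1 : orthogonal_mx (1%:M : 'M[F]_3).
Proof. by rewrite /orthogonal_mx trmx1 mul1mx. Qed.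

Lemma orthM A B : orthogonal_mx A -> orthogonal_mx B -> orthogonal_mx (A *m B).
Proof.
by move=> oA oB; rewrite /orthogonal_mx trmx_mul mulmxA -(mulmxA B^T) oA mulmx1.
Qed.

Lemma orth_inv A : orthogonal_mx A -> invmx A = A^T.
Proof.
move=> oA; have uA := (mulmx1_unit oA).2.
by rewrite -[LHS]mul1mx -oA -mulmxA mulmxV // mulmx1.
Qed.

Lemma orthT A : orthogonal_mx A -> orthogonal_mx A^T.
Proof. by move=> oA; rewrite /orthogonal_mx trmxK; exact: mulmx1C. Qed.

Lemma orthV A : orthogonal_mx A -> orthogonal_mx (invmx A).
Proof. by move=> oA; rewrite orth_inv //; exact: orthT. Qed.

Lemma rho_orth A : orthogonal_mx A -> orthogonal_mx (rho A).
Proof.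
move=> oA; rewrite /orthogonal_mx /rho invdet_orth // [(_ *: A)^T]linearZ /= -scalemxAl -scalemxAr.
by rewrite scalerA det_orth // scale1r.
Qed.

Lemma det_rho A : orthogonal_mx A -> \det (rho A) = 1.
Proof.
by move=> oA; rewrite /rho invdet_orth // detZ !exprS expr0 mulr1 -!mulrA det_orth // mulr1 det_orth.
Qed.

Lemma rho1 : rho (1%:M : 'M[F]_3) = 1%:M.
Proof. by rewrite /rho det1 invr1 scale1r. Qed.

Lemma rhoM A B : rho (A *m B) = rho A *m rho B.
Proof. by rewrite /rho det_mulmx invfM -scalemxAl -scalemxAr scalerA. Qed.

End Orthogonal3.

Section RegularFunctions.
Import mpoly.
Variable R : realType.
Local Notation C := R[i].
Local Notation O := {poly C}.
Implicit Types (f g : regfun R) (A B : 'M[C]_3) (xi : 'M[C]_3).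

Lemma poly_eq0_val (F : numDomainType) (p : {poly F}) : (forall t, p.[t] = 0) -> p = 0.
Proof.
move=> h; apply/eqP; apply: contraT => nz.
have := @max_poly_roots _ p [seq n%:R | n <- iota 0 (size p)] nz.
rewrite size_map size_iota ltnn => -> //.
  by apply/allP => x _; rewrite /root h.
by rewrite map_inj_uniq ?iota_uniq // => m n /eqP; rewrite eqr_nat => /eqP.
Qed.

Lemma regevalD A f g : regeval A (f + g) = regeval A f + regeval A g.
Proof. exact: mevalD. Qed.

Lemma regevalM A f g : regeval A (f * g) = regeval A f * regeval A g.
Proof. exact: mevalM. Qed.

Lemma regevalC A c : regeval A c%:MP = c.
Proof. exact: mevalC. Qed.

Lemma regeval_sum A (I : Type) (s : seq I) (Q : pred I) (F : I -> regfun R) :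
  regeval A (\sum_(i <- s | Q i) F i) = \sum_(i <- s | Q i) regeval A (F i).
Proof. exact: (raddf_sum (meval _)). Qed.

Lemma regdiffC xi c : regdiff xi c%:MP = 0.
Proof. by rewrite /regdiff big1 // => k _; rewrite mderivC /regeval meval0 mulr0. Qed.

Lemma regdiffD xi f g : regdiff xi (f + g) = regdiff xi f + regdiff xi g.
Proof.
by rewrite /regdiff -big_split; apply: eq_bigr => k _; rewrite /= mderivD regevalD mulrDr.
Qed.

Lemma regdiffM xi f g : regdiff xi (f * g) =
  regdiff xi f * regeval 1%:M g + regeval 1%:M f * regdiff xi g.
Proof.
rewrite /regdiff mulr_suml mulr_sumr -big_split; apply: eq_bigr => k _ /=.
by rewrite mderivM regevalD !regevalM mulrDr mulrA mulrCA.
Qed.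

Lemma regdiffX xi k : regdiff xi 'X_k = mxvec xi 0 k.
Proof.
rewrite /regdiff (bigD1 k) //= big1 ?addr0 => [|j ne].
  rewrite mderivX mnm1E eqxx scale1r (_ : (U_(k) - U_(k))%MM = 0%MM).
    by rewrite mpolyX0 /regeval meval1 mulr1.
  by apply/mnmP => i; rewrite mnmBE subnn mnm0E.
by rewrite mderivX mnm1E eq_sym (negbTE ne) scale0r /regeval meval0 mulr0.
Qed.

Lemma regdiff_additive xi : additive (regdiff xi : regfun R -> C).
Proof.
move=> f g; apply/eqP; rewrite eq_sym subr_eq -regdiffD; apply/eqP.
by rewrite subrK.
Qed.

(** Along a rational curve a polynomial function becomes a polynomial [q] in [t] after clearing
    denominators. As [D] equals [1] to first order at [t = 0], the powers of [D] affect neither the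
    value nor the derivative of [q] there; the factor [2] is the speed of the curve used below. *)
Lemma regeval_curve (D : {poly C}) (num : 'M[{poly C}]_3) (curve : C -> 'M[C]_3) xi f :
    D.[0] = 1 -> D^`().[0] = 0 ->
    (forall t, D.[t] != 0 -> forall i j, curve t i j * D.[t] = (num i j).[t]) ->
    (forall i j, (num i j).[0] = (i == j)%:R) ->
    (forall i j, (num i j)^`().[0] = 2%:R * xi i j) ->
  exists N (q : {poly C}),
  [/\ forall t, D.[t] != 0 -> regeval (curve t) f * D.[t] ^+ N = q.[t],
      q.[0] = regeval 1%:M f & q^`().[0] = 2%:R * regdiff xi f].
Proof.
move=> D0 D'0 num1 num2 num3.
have DN N : (D ^+ N).[0] = 1 by rewrite horner_exp D0 expr1n.
have D'N N : (D ^+ N)^`().[0] = 0.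
  by rewrite deriv_exp hornerMn hornerM D'0 ?mul0r ?mulr0 mul0rn.
elim/mpoly_ring_ind: f => [c|k|f g [N [q [q1 q2 q3]]] [M [r [r1 r2 r3]]]
                            |f g [N [q [q1 q2 q3]]] [M [r [r1 r2 r3]]]].
- exists 0%N, c%:P; split=> [t _||].
  + by rewrite regevalC expr0 mulr1 hornerC.
  + by rewrite hornerC regevalC.
  + by rewrite derivC horner0 regdiffC mulr0.
- have ev A : regeval A 'X_k = mxvec A 0 k by rewrite /regeval mevalXU.
  case/mxvec_indexP: k ev => i j ev.
  exists 1%N, (num i j); split=> [t nz||].
  + by rewrite ev mxvecE expr1; exact: num1.
  + by rewrite ev mxvecE num2 mxE.
  + by rewrite regdiffX mxvecE num3.
- exists (N + M)%N, (q * D ^+ M + r * D ^+ N); split=> [t nz||].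
  + by rewrite regevalD [RHS]hornerD !hornerM !horner_exp -q1 // -r1 // exprD mulrDl mulrA [D.[t] ^+ N * _]mulrC mulrA.
  + by rewrite hornerD !hornerM !DN q2 r2 regevalD !mulr1.
  + have arith (u v x y : C) : u * 1 + x * 0 + (v * 1 + y * 0) = u + v.
      by rewrite !mulr0 !mulr1 !addr0.
    by rewrite derivD !derivM !hornerD !hornerM !DN !D'N q3 r3 regdiffD arith mulrDr.
- exists (N + M)%N, (q * r); split=> [t nz||].
  + by rewrite regevalM hornerM -q1 // -r1 // exprD mulrACA.
  + by rewrite hornerM q2 r2 regevalM.
  + by rewrite derivM hornerD !hornerM q2 q3 r2 r3 regdiffM mulrDr mulrA mulrCA.
Qed.

Section Curve.
Variable xi : 'M[C]_3.
Hypothesis skew : xi^T = - xi.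

Let skewE i j : xi i j = - xi j i.
Proof. by have := congr1 (fun M : 'M_3 => M j i) skew; rewrite !mxE. Qed.

(** With [D] and [num], this describes the Cayley transform [(1 + t xi) (1 - t xi)^-1]. A skew
    matrix of size three satisfies [xi^3 = - s xi], so the inverse is explicit and the transform
    equals [1 + 2 (t xi + t^2 xi^2) / (1 + s t^2)]: a rational curve in the orthogonal group through
    the identity with velocity [2 xi]. *)
Let s : C := xi 0 1 ^+ 2 + xi 1 2%:R ^+ 2 + xi 2%:R 0 ^+ 2.

Let D : {poly C} := 1 + s *: 'X ^+ 2.
Let num : 'M[{poly C}]_3 :=
  D%:M + (2%:R *: 'X) *: map_mx polyC xi + (2%:R *: 'X ^+ 2) *: map_mx polyC (xi *m xi).
Let curve (t : C) : 'M[C]_3 := (D.[t])^-1 *: map_mx (horner_eval t) num.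

Let numE t : map_mx (horner_eval t) num =
  (D.[t])%:M + (2%:R * t) *: xi + (2%:R * t ^+ 2) *: (xi *m xi).
Proof.
have cK (z : 'M[C]_3) : map_mx (horner_eval t) (map_mx polyC z) = z.
  by apply/matrixP => i j; rewrite !mxE /horner_eval hornerC.
by rewrite /num !map_mxD !map_mxZ map_scalar_mx !cK /= /horner_eval !hornerE.
Qed.

Let DE t : D.[t] = 1 + s * t * t.
Proof. by rewrite /D -polyC1 hornerD hornerC hornerZ hornerXn expr2 mulrA. Qed.

Let curve_orth t : D.[t] != 0 -> orthogonal_mx (curve t).
Proof.
have Dt : D.[t] = 1 + s * t ^+ 2 by rewrite /D !hornerE.
move=> nz; rewrite /orthogonal_mx /curve numE.
pose N i j : C := D.[t] *+ (i == j) + 2%:R * t * xi i j + 2%:R * t ^+ 2 * \sum_k xi i k * xi k j.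
have H i j : \sum_k N k i * N k j = D.[t] ^+ 2 *+ (i == j).
  have d i' : xi i' i' = 0.
    by have /eqP := skewE i' i'; rewrite -addr_eq0 -mulr2n mulrn_eq0 /= => /eqP.
  rewrite sum3 /N !sum3 Dt /s !d (skewE 1 0) (skewE 2%:R 1) (skewE 0 2%:R).
  have := ord3P 0 i; have := ord3P 0 j; rewrite !add0r.
  by move=> [] -> [] ->; rewrite !d ?(skewE 1 0) ?(skewE 2%:R 1) ?(skewE 0 2%:R)
    ?(mulr1n, mulr0n) /=; ring.
apply/matrixP => i j; rewrite !mxE.
under eq_bigr => k _.
  rewrite (_ : _ k j = D.[t]^-1 * N k j); last by rewrite !mxE /N.
  rewrite (_ : _ i k = D.[t]^-1 * N k i); last by rewrite !mxE /N.
  rewrite mulrACA; over.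
rewrite -mulr_sumr H; case: (i == j); rewrite ?mulr0n ?mulr0 //.
by rewrite !mulr1n expr2 mulrACA mulVf // mulr1.
Qed.

Lemma regdiff_eq0 f : (forall A, orthogonal_mx A -> regeval A f = 0) -> regdiff xi f = 0.
Proof.
move=> f0; have D0 : D.[0] = 1 by rewrite DE mulr0 addr0.
have D'0 : D^`().[0] = 0.
  by rewrite /D -polyC1 derivD derivC derivZ derivXn hornerD horner0 hornerZ hornerMn hornerX mul0rn mulr0 addr0.
have n1 t : D.[t] != 0 -> forall i j, curve t i j * D.[t] = (num i j).[t].
  by move=> nz i j; rewrite /curve mxE mulrAC mulVf // mul1r mxE.
have n2 i j : (num i j).[0] = (i == j)%:R.
  have num0 : map_mx (horner_eval 0) num = 1%:M.
    by rewrite numE D0 mulr0 expr0n /= mulr0 !scale0r !addr0.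
  have <- : (1%:M : 'M[C]_3) i j = (i == j)%:R by rewrite mxE.
  by rewrite -num0 [RHS]mxE.
have n3 i j : (num i j)^`().[0] = 2%:R * xi i j.
  have -> : num i j = D *+ (i == j) + (2%:R * xi i j) *: 'X
        + (2%:R * (xi *m xi) i j) *: 'X^2.
    by rewrite /num; set z := xi *m xi; rewrite 8!mxE -!mul_polyC !rmorphM /=; ring.
  rewrite !derivD derivMn !derivZ derivX derivXn !hornerD.
  rewrite hornerMn !hornerZ hornerMn hornerC hornerX D'0 !mul0rn mulr0 mulr1.
  by rewrite add0r addr0.
have [N [q [q1 _ q3]]] := regeval_curve f D0 D'0 n1 n2 n3.
(* Where [D] does not vanish the curve lies in the group and [q] is zero; elsewhere [D] is zero. A
   polynomial vanishing at every [t] is zero, so [q] and its derivative vanish. *)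
have /eqP : D * q = 0.
  apply: poly_eq0_val => t; rewrite hornerM.
  have [->|nz] := eqVneq D.[t] 0; first by rewrite mul0r.
  by rewrite -q1 // f0 ?mul0r ?mulr0 //; exact: curve_orth.
rewrite mulf_eq0 => /orP[/eqP E|/eqP q0].
  by move/eqP: D0; rewrite E horner0 eq_sym oner_eq0.
move: q3; rewrite q0 deriv0 horner0 => /esym/eqP.
by rewrite mulf_eq0 pnatr_eq0 /= => /eqP.
Qed.

End Curve.

Lemma skew_entry xi : xi^T = - xi -> forall i j, xi i j = - xi j i.
Proof. by move=> skew i j; have := congr1 (fun M : 'M_3 => M j i) skew; rewrite !mxE. Qed.

Lemma skew_diag xi : xi^T = - xi -> forall i, xi i i = 0.
Proof.
move=> /skew_entry skewE i; have /eqP := skewE i i.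
by rewrite -addr_eq0 -mulr2n mulrn_eq0 /= => /eqP.
Qed.

Lemma regdiff_linear_comb xi (f : regfun R) n (c : 'I_n -> C) (g : 'I_n -> regfun R) :
    xi^T = - xi ->
    (forall A, orthogonal_mx A -> regeval A f = \sum_i c i * regeval A (g i)) ->
  regdiff xi f = \sum_i c i * regdiff xi (g i).
Proof.
move=> skew E; pose h := f + \sum_i (- c i)%:MP * g i.
have h0 A : orthogonal_mx A -> regeval A h = 0.
  move=> oA; rewrite regevalD regeval_sum E // -big_split big1 // => i _ /=.
  by rewrite regevalM regevalC mulNr subrr.
have : regdiff xi h = regdiff xi f + \sum_i (- c i) * regdiff xi (g i).
  rewrite /h regdiffD; congr (_ + _).
  elim/big_ind2: _ => [|x x' y y' <- <-|i _]; first by rewrite -mpolyC0 regdiffC.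
    exact: regdiffD.
  by rewrite regdiffM regdiffC mul0r add0r regevalC.
rewrite (regdiff_eq0 skew h0) => /esym/eqP; rewrite addr_eq0 => /eqP ->.
by rewrite -sumrN; apply: eq_bigr => i _; rewrite mulNr opprK.
Qed.

Definition genmx : 'M[regfun R]_3 := vec_mx (\row_k 'X_k).
(** On the orthogonal group the determinant is its own inverse, so this matrix of polynomials
    represents [rho] there. *)
Definition genrho : 'M[regfun R]_3 := \det genmx *: genmx.

HB.instance Definition _ A :=
  GRing.RMorphism.copy (regeval A) (meval (fun k => mxvec A 0 k) : regfun R -> C).

Lemma regeval_genmx A : map_mx (regeval A) genmx = A.
Proof.
by apply/matrixP => i j; rewrite !mxE /regeval mevalXU mxvecE.
Qed.

Lemma regeval_genrho A : orthogonal_mx A -> map_mx (regeval A) genrho = rho A.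
Proof.
by move=> oA; rewrite map_mxZ /= -det_map_mx regeval_genmx /rho invdet_orth.
Qed.

(** On the group the square of the determinant is [1]; differentiating at the identity, where the
    determinant is [1], gives twice the claim. *)
Lemma regdiff_det xi : xi^T = - xi -> regdiff xi (\det genmx) = 0.
Proof.
move=> skew; have ev A : regeval A (\det genmx) = \det A.
  by rewrite -{2}(regeval_genmx A) det_map_mx.
have := @regdiff_eq0 xi skew (\det genmx * \det genmx + (- 1)%:MP).
rewrite regdiffD regdiffC regdiffM !ev det1 mulr1 mul1r addr0 => E.
suff /eqP : regdiff xi (\det genmx) + regdiff xi (\det genmx) = 0.
  by rewrite -mulr2n mulrn_eq0 /= => /eqP.
by apply: E => A oA; rewrite regevalD regevalM regevalC !ev det_orth // subrr.
Qed.

Lemma regdiff_genrho xi i j : xi^T = - xi -> regdiff xi (genrho i j) = xi i j.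
Proof.
move=> skew; have ev : regeval 1%:M (\det genmx) = 1.
  by rewrite -det_map_mx regeval_genmx det1.
rewrite mxE regdiffM regdiff_det // mul0r add0r ev mul1r mxE mxE.
by rewrite regdiffX mxvecE.
Qed.

(** The rotated polynomial for a generic group element: its coefficients are the matrix coefficients
    of the representation, as regular functions. *)
Definition gensub (p : {mpoly C[3]}) : {mpoly (regfun R)[3]} :=
  sub genrho (map_mpoly (@mpolyC (3 * 3) C) p).

Lemma regeval_gensub A p : orthogonal_mx A ->
  map_mpoly (regeval A) (gensub p) = sub (rho A) p.
Proof.
move=> oA; rewrite /gensub (@map_mpoly_sub _ _ _ _ (rho A)) => [|i j f].
  congr sub; apply/mpolyP => m; rewrite !mcoeff_map_mpoly; exact: regevalC.
by rewrite /= regevalM; congr (_ * _); rewrite -regeval_genrho // [RHS]mxE.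
Qed.

HB.instance Definition _ xi :=
  GRing.isZmodMorphism.Build (regfun R) C (regdiff xi) (regdiff_additive xi).

Lemma regdiff_gensub xi p : xi^T = - xi ->
  map_mpoly (regdiff xi) (gensub p) = so3op xi p.
Proof.
move=> skew; apply: (@map_derivation_sub _ _ (@mpolyC (3 * 3) C) (regeval 1%:M)).
- exact: regdiffM.
- exact: regevalC.
- exact: regdiffC.
- move=> i j; have := regeval_genrho (orth1 _); rewrite /rho det1 invr1 scale1r.
  by move/(congr1 (fun M : 'M_3 => M i j)) => E; rewrite -E [RHS]mxE.
- by move=> i j; exact: regdiff_genrho.
Qed.

End RegularFunctions.

End RegularFunctions.
Export RegularFunctions.

(** * The harmonic model of the families *)

Module HarmonicModel.

Section LinearSpan.
Variables (K : nzRingType) (V : lmodType K).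

Lemma mem_lspan (A : V -> Prop) v : A v -> lspan A v.
Proof.
by exists 1%N, (fun=> 1), (fun=> v); split=> //; rewrite big_ord1 scale1r.
Qed.

Lemma lspan_ind (A Q : V -> Prop) : Q 0 -> (forall c u v, Q u -> Q v -> Q (c *: u + v)) ->
  (forall v, A v -> Q v) -> forall v, lspan A v -> Q v.
Proof.
move=> Q0 QD QA _ [n [c [a [Aa ->]]]]; elim/big_ind: _ => [//|x y Qx Qy|i _].
  by rewrite -[x]scale1r; exact: QD.
by rewrite -[_ *: _]addr0; apply: QD => //; exact: QA.
Qed.

End LinearSpan.

Section HarmonicFamily.
Import mpoly.
Variable R : realType.
Local Notation C := R[i].
Local Notation O := {poly C}.
Local Notation PO := {mpoly O[3]}.

Lemma unitC n : n.+1%:R \is a @GRing.unit C.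
Proof. by rewrite unitfE pnatr_eq0. Qed.

Lemma unitO n : n.+1%:R \is a @GRing.unit O.
Proof. by have := rmorph_unit polyC (unitC n); rewrite rmorph_nat. Qed.

Definition harm_pred : {pred PO} := fun p => lap p == 0.

Lemma harm_submod : submod_closed harm_pred.
Proof.
split=> [|c p q /eqP hp /eqP hq]; rewrite /in_mem /= /harm_pred ?lap0 //.
by rewrite lapD lapZ hp hq scaler0 addr0.
Qed.

HB.instance Definition _ := GRing.isSubmodClosed.Build O PO harm_pred harm_submod.

Definition HO := {p : PO | p \in harm_pred}.
HB.instance Definition _ := [isSub of HO for @sval PO (fun p => p \in harm_pred)].
HB.instance Definition _ := [Choice of HO by <:].
HB.instance Definition _ := [SubChoice_isSubLmodule of HO by <:].

Lemma lap_val (v : HO) : lap (val v) = 0.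
Proof. exact/eqP/(valP v). Qed.

Definition mkHO (p : PO) (hp : lap p = 0) : HO := exist _ p (introT eqP hp).

Lemma valHOD (u v : HO) : val (u + v) = val u + val v.
Proof. by []. Qed.

Lemma valHOZ c (v : HO) : val (c *: v) = c *: val v.
Proof. by []. Qed.

Lemma valHO_sum (I : Type) (s : seq I) (Q : pred I) (F : I -> HO) :
  val (\sum_(i <- s | Q i) F i) = \sum_(i <- s | Q i) val (F i).
Proof. by elim/big_rec2: _ => [//|i x y _ <-]. Qed.

Definition hO l a : HO := mkHO (@lap_hb _ unitO l a).

Lemma HO_expand (v : HO) N : (msize (val v) <= N)%N ->
  v = \sum_(l < N) \sum_a (val v)@_(@mon l a) *: hO a.
Proof.
move=> hN; apply: val_inj; rewrite valHO_sum {1}(sum_hpart hN).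
apply: eq_bigr => l _; rewrite valHO_sum (harm_hpartE unitO) ?lap_val //.
Qed.

Definition hbasis (v : HO) : Prop := exists l a, v = @hO l a.

Lemma HO_free : free_module HO.
Proof.
exists hbasis; split=> [n b c inj hb0 sum0 i|v]; last first.
  suff: v \in lspan_pred hbasis by move/asboolP.
  rewrite (HO_expand (leqnn (msize (val v)))).
  apply: rpred_sum => l _; apply: rpred_sum => a _; apply: rpredZ.
  by apply/asboolP/mem_lspan; exists (val l), a.
have [l [a bi]] := hb0 i.
have /(congr1 (fun v : HO => (val v)@_(mon a))) := sum0.
rewrite valHO_sum raddf_sum mcoeff0 (bigD1 i) //= big1 ?addr0 => [|j ne].
  by rewrite mcoeffZ bi mcoeff_hb eqxx mulr1.
have [k [a' bj]] := hb0 j; rewrite mcoeffZ bj mcoeff_hb.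
case: eqP => [E|_]; last by rewrite mulr0.
case/eqP: ne; apply: inj; rewrite bi bj.
have lk : k = l.
  have := mon_mem a; have := mon_mem a'; rewrite !mem_mons E.
  by move=> /andP[/eqP e1 _] /andP[/eqP e2 _]; exact: etrans (esym e1) e2.
by move: E; subst k => /mon_inj ->.
Qed.

Local Notation BO A := (map_mx polyC (rho A)).

Lemma BO_orth A : orthogonal_mx A -> (BO A)^T *m BO A = 1%:M :> 'M[O]_3.
Proof. by move=> /rho_orth oA; rewrite map_trmx -map_mxM oA map_mx1. Qed.

Lemma det_BO A : orthogonal_mx A -> \det (BO A) = 1 :> O.
Proof. by move=> oA; rewrite det_map_mx det_rho. Qed.

(** The default value [v] is returned if the result is not harmonic, which does not happen for
    orthogonal [A]. *)
Definition kH (A : 'M[C]_3) (v : HO) : HO := insubd v (sub (BO A) (val v)).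

Lemma val_kH A v : orthogonal_mx A -> val (kH A v) = sub (BO A) (val v).
Proof.
move=> oA; rewrite insubdK //; apply/eqP.
by rewrite (lap_sub (BO_orth oA)) lap_val raddf0.
Qed.

Lemma kH_linear A : orthogonal_mx A -> linear (kH A).
Proof.
move=> oA c u v; apply: val_inj; rewrite valHOD valHOZ !val_kH // valHOD valHOZ.
exact: linearP.
Qed.

Lemma kHZ A c v : orthogonal_mx A -> kH A (c *: v) = c *: kH A v.
Proof.
move=> oA; apply: val_inj.
by rewrite val_kH // !valHOZ linearZ val_kH.
Qed.

Lemma kH_sum A (I : Type) (s : seq I) (Q : pred I) (F : I -> HO) : orthogonal_mx A ->
  kH A (\sum_(i <- s | Q i) F i) = \sum_(i <- s | Q i) kH A (F i).
Proof.
move=> oA; apply: val_inj; rewrite val_kH // !valHO_sum raddf_sum.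
by apply: eq_bigr => i _; rewrite val_kH.
Qed.

Lemma kH1 v : kH 1%:M v = v.
Proof. by apply: val_inj; rewrite val_kH ?rho1 ?map_mx1 ?sub1 //; exact: orth1. Qed.

Lemma kHM A B : orthogonal_mx A -> orthogonal_mx B ->
  forall v, kH (A *m B) v = kH A (kH B v).
Proof.
move=> oA oB v; apply: val_inj.
rewrite (val_kH _ (orthM oA oB)) (val_kH _ oA) (val_kH _ oB) rhoM.
have -> : map_mx polyC (rho A *m rho B) = BO A *m BO B by exact: map_mxM.
exact: subM.
Qed.

Definition iO : O := (0 +i* 1)%:P.

Lemma iO2 : iO * iO = - 1.
Proof.
rewrite /iO -polyCM -polyCN; congr _%:P.
by apply/eqP; rewrite eq_complex /= !mul0r !mulr0 mul1r !add0r oppr0 !eqxx.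
Qed.

Section LieAction.
Variables al be : nat -> O.

Definition gH (X : galg R) (v : HO) : HO :=
  mkHO (lap_gfun al be iO X (lap_val v)).

Lemma gH_linear X : linear (gH X).
Proof. by move=> c u v; apply: val_inj; exact: gfun_linear. Qed.

Lemma gH_linearl v : linear (gH^~ v).
Proof. by move=> c X Y; apply: val_inj; exact: gfun_linearl. Qed.

Lemma gH_bracket X Y v :
    (forall l, (2 * l + 5)%:R * (al l.+1 * be l.+2) =
       'X + (2 * l + 1)%:R * (al l * be l.+1)) ->
  gH (gbracket X Y) v = gH X (gH Y v) - gH Y (gH X v).
Proof. by move=> ab; apply: val_inj; exact: (gfun_bracket iO2 ab). Qed.

Lemma gH_equivariant A X v : orthogonal_mx A -> kH A (gH X v) = gH (gAd A X) (kH A v).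
Proof.
move=> oA; apply: val_inj; rewrite (val_kH _ oA) /=.
rewrite (sub_gfun _ _ _ _ _ (BO_orth oA) (det_BO oA)).
by rewrite -(val_kH _ oA).
Qed.

(** Since [K] and the rotations act with constant coefficients, extracting the coefficient of [T^n]
    commutes with them; statements about frames are thereby checked on complex polynomials. *)
Definition coefX n (p : PO) : {mpoly C[3]} := map_mpoly (coefp n) p.

Lemma mcoeff_coefX n p m : (coefX n p)@_m = (p@_m)`_n.
Proof. exact: mcoeff_map_mpoly. Qed.

Lemma coefX_inj p q : (forall n, coefX n p = coefX n q) -> p = q.
Proof.
by move=> E; apply/mpolyP => m; apply/polyP => n; rewrite -!mcoeff_coefX E.
Qed.

Lemma coefX_sub n A p : coefX n (sub (BO A) p) = sub (rho A) (coefX n p).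
Proof. by apply: map_mpoly_sub => i j d; rewrite mxE /= coefCM. Qed.

Lemma coefX_lap n p : lap (coefX n p) = coefX n (lap p).
Proof. by rewrite /coefX -map_mpoly_lap. Qed.

Lemma coefX_rot n i j p : coefX n (rot i j p) = rot i j (coefX n p).
Proof. exact: map_mpoly_rot. Qed.

Lemma coefXZ n c p : coefX n (c%:P *: p) = c *: coefX n p.
Proof. by apply: map_mpoly_scale => d; rewrite /= coefCM. Qed.

Lemma coefX_sum n (I : Type) (s : seq I) (Q : pred I) (F : I -> PO) :
  coefX n (\sum_(i <- s | Q i) F i) = \sum_(i <- s | Q i) coefX n (F i).
Proof. exact: raddf_sum. Qed.

Lemma val_gH_so3 xi v : val (gH (so3_to_galg xi) v) =
  \sum_k (xi (k + 1) (k + 2%:R))%:P *: rot (k + 1) (k + 2%:R) (val v).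
Proof.
rewrite /= /gfun /= /Rsum [X in _ + _ *: X]big1 ?scaler0 ?addr0 => [|k _].
  by apply: eq_bigr => k _; rewrite mxE.
by rewrite mxE scale0r.
Qed.

Lemma coefX_gH_so3 n xi v : xi^T = - xi ->
  coefX n (val (gH (so3_to_galg xi) v)) = so3op xi (coefX n (val v)).
Proof.
move=> skew; rewrite val_gH_so3 coefX_sum so3opE; [|exact: skew_entry|exact: skew_diag].
by apply: eq_bigr => k _; rewrite coefXZ coefX_rot.
Qed.

Lemma coefX_comb k n (c : 'I_n -> C) (w : 'I_n -> HO) :
  coefX k (val (\sum_i (c i)%:P *: w i)) = \sum_i c i *: coefX k (val (w i)).
Proof.
rewrite valHO_sum coefX_sum; apply: eq_bigr => i _.
by rewrite valHOZ coefXZ.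
Qed.

Lemma coefX_frame k n (w : 'I_n -> HO) (M : 'M[regfun R]_n) A j :
    regular_frame kH w M -> orthogonal_mx A ->
  sub (rho A) (coefX k (val (w j))) = \sum_i regeval A (M i j) *: coefX k (val (w i)).
Proof. by move=> hw oA; rewrite -coefX_comb -(hw A oA) (val_kH _ oA) coefX_sub. Qed.

(** The vectors [y i] may be linearly dependent, so the action does not determine [M]. Comparing the
    coefficients at each monomial turns the hypothesis into linear relations between values of
    regular functions on the group, and these can be differentiated in skew directions. *)
Lemma so3op_frame n (y : 'I_n -> {mpoly C[3]}) (M : 'M[regfun R]_n) xi j :
    (forall A, orthogonal_mx A -> sub (rho A) (y j) = \sum_i regeval A (M i j) *: y i) ->
    xi^T = - xi ->
  so3op xi (y j) = \sum_i regdiff xi (M i j) *: y i.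
Proof.
move=> hy skew; rewrite -(regdiff_gensub _ skew); apply/mpolyP => m.
rewrite mcoeff_map_mpoly.
transitivity (\sum_i (y i)@_m * regdiff xi (M i j)); last first.
  by rewrite raddf_sum; apply: eq_bigr => i _; rewrite /= mcoeffZ mulrC.
apply: (regdiff_linear_comb skew) => A oA.
have := congr1 (mcoeff m) (hy A oA); rewrite -(regeval_gensub _ oA) mcoeff_map_mpoly /= => ->.
by rewrite raddf_sum; apply: eq_bigr => i _; rewrite /= mcoeffZ mulrC.
Qed.

Lemma gH_infinitesimal n (w : 'I_n -> HO) (M : 'M[regfun R]_n) :
    regular_frame kH w M -> forall xi : 'M[C]_3, xi^T = - xi -> forall j,
  gH (so3_to_galg xi) (w j) = \sum_i (regdiff xi (M i j))%:P *: w i.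
Proof.
move=> hw xi skew j; apply: val_inj; apply: coefX_inj => k.
transitivity (so3op xi (coefX k (val (w j)))); first exact: coefX_gH_so3.
rewrite coefX_comb; apply: (so3op_frame (y := fun i => coefX k (val (w i)))) skew => A oA.
exact: coefX_frame.
Qed.

End LieAction.

End HarmonicFamily.

End HarmonicModel.
Export HarmonicModel.

(** * Algebraicity and isotypic components of the harmonic model *)

Section HarmonicFrames.
Import mpoly.
Variable R : realType.
Local Notation C := R[i].
Local Notation O := {poly C}.
Local Notation PO := {mpoly O[3]}.
Local Notation BO A := (map_mx polyC (rho A)).
Local Notation unitC := (@unitC R).
Local Notation unitO := (@unitO R).

Lemma polyC_coef (A : 'M[C]_3) i j (d : C) : (rho A i j * d)%:P = (BO A) i j * d%:P.
Proof. by rewrite polyCM; congr (_ * _); rewrite [RHS]mxE. Qed.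

Lemma mcoeff_sub_hb A l (a : 'I_(size (mons l))) m : orthogonal_mx A ->
  (sub (BO A) (hb unitO a))@_m = (regeval A (gensub (hb unitC a))@_m)%:P.
Proof.
move=> oA.
have E1 : hb unitO a = map_mpoly polyC (hb unitC a) by rewrite (map_mpoly_hb _ unitC unitO).
have E2 : map_mpoly polyC (sub (rho A) (hb unitC a)) = sub (BO A) (map_mpoly polyC (hb unitC a)).
  by apply: map_mpoly_sub => i j d; exact: polyC_coef.
rewrite E1.
rewrite -E2.
rewrite mcoeff_map_mpoly.
congr _%:P.
rewrite -(regeval_gensub _ oA).
by rewrite mcoeff_map_mpoly.
Qed.

Lemma frame_basis l : exists M : 'M[regfun R]_(size (mons l)),
  regular_frame (@kH R) (@hO R l) M.
Proof.
exists (\matrix_(b, a) (gensub (hb unitC a))@_(mon b)) => A oA a.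
apply: val_inj; rewrite (val_kH _ oA) valHO_sum.
have hh : sub (BO A) (hb unitO a) \is l.-homog by rewrite sub_homog // hb_homog.
have hl : lap (sub (BO A) (hb unitO a)) = 0 by rewrite (lap_sub (BO_orth oA)) lap_hb raddf0.
rewrite [LHS](harm_homogE unitO hh hl); apply: eq_bigr => b _.
by rewrite (mcoeff_sub_hb _ _ oA) [in RHS]mxE.
Qed.

Definition has_frame (v : HO R) : Prop := exists n (w : 'I_n -> HO R) (M : 'M[regfun R]_n),
  regular_frame (@kH R) w M /\ exists c : 'I_n -> C, v = \sum_i (c i)%:P *: w i.

Lemma has_frameD u v : has_frame u -> has_frame v -> has_frame (u + v).
Proof.
move=> [n [w [M [hw [c ->]]]]] [m [x [N [hx [d ->]]]]].
exists (n + m)%N, (fun i => match fintype.split i with inl j => w j | inr j => x j end).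
exists (block_mx M 0 0 N); split.
  move=> A oA j; case: (splitP j) => k jk; rewrite big_split_ord /=.
    rewrite [X in _ + X]big1 ?addr0 => [|i _]; last first.
      have -> : j = lshift m k by apply: val_inj.
      by rewrite block_mxEdl mxE /regeval meval0 scale0r.
    rewrite hw //; apply: eq_bigr => i _; rewrite (unsplitK (inl i)).
    have -> : j = lshift m k by apply: val_inj.
    by rewrite block_mxEul.
  rewrite [X in X + _]big1 ?add0r => [|i _]; last first.
    have -> : j = rshift n k by apply: val_inj.
    by rewrite block_mxEur mxE /regeval meval0 scale0r.
  rewrite hx //; apply: eq_bigr => i _; rewrite (unsplitK (inr i)).
  have -> : j = rshift n k by apply: val_inj.
  by rewrite block_mxEdr.
exists (fun i : 'I_(n + m) => match fintype.split i with inl j => c j | inr j => d j end).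
rewrite big_split_ord /=; congr (_ + _); apply: eq_bigr => i _.
  by rewrite (unsplitK (inl i)).
by rewrite (unsplitK (inr i)).
Qed.

Lemma has_frameZ p v : has_frame v -> has_frame (p *: v).
Proof.
move=> [n [w [M [hw [c ->]]]]]; exists n, (fun i => p *: w i), M; split.
  move=> A oA j; rewrite kHZ // hw // scaler_sumr; apply: eq_bigr => i _.
  by rewrite !scalerA mulrC.
by exists c; rewrite scaler_sumr; apply: eq_bigr => i _; rewrite !scalerA mulrC.
Qed.

Lemma HO_algebraic : locally_algebraic (@kH R).
Proof.
move=> v; rewrite -/(has_frame v) (HO_expand (leqnn (msize (val v)))).
have h0 : has_frame 0.
  exists 0%N, (fun=> 0), 0; split=> [A oA []//|].
  by exists (fun=> 0); rewrite big_ord0.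
apply: big_ind => [//||l _]; first exact: has_frameD.
apply: big_ind => [//||a _]; first exact: has_frameD.
apply: has_frameZ; have [M hM] := frame_basis l.
exists _, (@hO R l), M; split=> //; exists (fun b => (b == a)%:R).
rewrite (bigD1 a) //= eqxx scale1r big1 ?addr0 // => b /negbTE ->.
by rewrite scale0r.
Qed.

Lemma orth_rho_frame n (y : 'I_n -> {mpoly C[3]}) (M : 'M[regfun R]_n) A (c : 'rV[C]_n) :
    orthogonal_mx A ->
    (forall j, sub (rho A) (y j) = \sum_i regeval A (M i j) *: y i) ->
  sub (rho A) (\sum_j c 0 j *: y j) =
  \sum_i (c *m (map_mx (regeval A) M)^T) 0 i *: y i.
Proof.
move=> oA hy; rewrite raddf_sum /=.
transitivity (\sum_j \sum_i (c 0 j * regeval A (M i j)) *: y i).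
  apply: eq_bigr => j _; rewrite linearZ /= hy scaler_sumr.
  by apply: eq_bigr => i _; rewrite scalerA.
rewrite exchange_big; apply: eq_bigr => i _ /=; rewrite -scaler_suml; congr (_ *: _).
by rewrite mxE; apply: eq_bigr => j _; rewrite !mxE.
Qed.

Definition cframe n (y : 'I_n -> {mpoly C[3]}) (M : 'M[regfun R]_n) : Prop :=
  (forall j, lap (y j) = 0) /\ forall A, orthogonal_mx A -> forall j,
    sub (rho A) (y j) = \sum_i regeval A (M i j) *: y i.

Lemma cframe_coefX k n (w : 'I_n -> HO R) (M : 'M[regfun R]_n) :
  regular_frame (@kH R) w M -> cframe (fun j => coefX k (val (w j))) M.
Proof.
move=> hw; split=> [j|A oA j]; last exact: coefX_frame.
by rewrite coefX_lap lap_val /coefX raddf0.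
Qed.

Lemma cframe_hpart l n (y : 'I_n -> {mpoly C[3]}) (M : 'M[regfun R]_n) :
  cframe y M -> cframe (fun j => hpart l (y j)) M.
Proof.
move=> [hl hy]; split=> [j|A oA j]; first by rewrite lap_hpart.
rewrite /hpart sub_wgt hy // raddf_sum; apply: eq_bigr => i _.
exact: linearZ.
Qed.

Definition rotgen (i j : 'I_3) : 'M[C]_3 := delta_mx i j - delta_mx j i.

Lemma rotgen_skew i j : (rotgen i j)^T = - rotgen i j.
Proof. by rewrite /rotgen linearB /= !trmx_delta opprB. Qed.

Lemma so3op_rotgen i j (p : {mpoly C[3]}) : so3op (rotgen i j) p = rot i j p.
Proof.
have D (a b : 'I_3) : \sum_k \sum_l (delta_mx a b : 'M[C]_3) k l *: ('X_k * p^`M(l)) =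
    'X_a * p^`M(b).
  rewrite (bigD1 a) //= (bigD1 b) //= mxE !eqxx scale1r !big1 ?addr0 // => [k /negbTE ne|l /negbTE ne].
    by apply: big1 => l _; rewrite mxE ne scale0r.
  by rewrite mxE ne andbF scale0r.
rewrite /so3op /rot -!D -sumrB; apply: eq_bigr => k _; rewrite -sumrB.
apply: eq_bigr => l _; rewrite -scalerBl; congr (_ *: _).
by rewrite [LHS]mxE; congr (_ + _); rewrite [LHS]mxE.
Qed.

(** The Casimir operator is computed twice: as the scalar of harmonic polynomials of degree [l], and
    from the differentials of the matrix coefficients, which know nothing of [l]. *)
Lemma cframe_casimir n (y : 'I_n -> {mpoly C[3]}) (M : 'M[regfun R]_n) l j :
    cframe y M -> (forall j, y j \is l.-homog) ->
  (- 2%:R * (l * l.+1)%:R) *: y j =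
  \sum_i (\sum_a \sum_b \sum_k regdiff (rotgen a b) (M k j) * regdiff (rotgen a b) (M i k)) *: y i.
Proof.
move=> [hl hy] hh.
transitivity (\sum_a \sum_b rot a b (rot a b (y j))).
  rewrite casimir hl mulr0 sub0r (wgt_homog _ (hh j)) mulrN -scalerAr -mpolyC_nat.
  by rewrite mul_mpolyC scalerA mulNr scaleNr mulrC.
have E a b i : rot a b (y i) = \sum_k regdiff (rotgen a b) (M k i) *: y k.
  by rewrite -so3op_rotgen; apply: so3op_frame; [move=> A oA; exact: hy | exact: rotgen_skew].
transitivity (\sum_a \sum_b \sum_i (\sum_k regdiff (rotgen a b) (M k j) *
    regdiff (rotgen a b) (M i k)) *: y i).
  apply: eq_bigr => a _; apply: eq_bigr => b _; rewrite E raddf_sum /=.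
  transitivity (\sum_k \sum_i (regdiff (rotgen a b) (M k j) * regdiff (rotgen a b) (M i k)) *: y i).
    apply: eq_bigr => k _; rewrite linearZ /= E scaler_sumr.
    by apply: eq_bigr => i _; rewrite scalerA.
  by rewrite exchange_big; apply: eq_bigr => i _ /=; rewrite scaler_suml.
rewrite (eq_bigr (fun a => \sum_i \sum_b (\sum_k regdiff (rotgen a b) (M k j) *
    regdiff (rotgen a b) (M i k)) *: y i)) => [|a _]; last by rewrite exchange_big.
rewrite exchange_big; apply: eq_bigr => i _ /=; rewrite scaler_suml.
by apply: eq_bigr => a _; rewrite scaler_suml.
Qed.

Definition crow l (p : {mpoly C[3]}) : 'rV[C]_(size (mons l)) := \row_a p@_(mon a).

Lemma crow_inj l p q : p \is l.-homog -> q \is l.-homog -> lap p = 0 -> lap q = 0 ->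
  crow l p = crow l q -> p = q.
Proof.
move=> hp hq lp lq E; rewrite (harm_homogE unitC hp lp) (harm_homogE unitC hq lq).
by apply: eq_bigr => a _; have /rowP/(_ a) := E; rewrite !mxE => ->.
Qed.

Lemma crow_comb l n (c : 'rV[C]_n) (y : 'I_n -> {mpoly C[3]}) :
  crow l (\sum_j c 0 j *: y j) = c *m \matrix_j crow l (y j).
Proof.
apply/rowP => a; rewrite !mxE raddf_sum; apply: eq_bigr => j _ /=.
by rewrite mcoeffZ !mxE.
Qed.

(* Schur: the linear dependencies between the vectors of an equivariant image of
   an irreducible representation form an invariant subspace. *)
Lemma cframe_free n (y : 'I_n -> {mpoly C[3]}) (tau : 'M[regfun R]_n) l :
    irreducible_rep tau -> cframe y tau -> (forall j, y j \is l.-homog) ->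
    (exists j, y j != 0) ->
  row_free (\matrix_j crow l (y j)).
Proof.
move=> [n0 t1 tM irr] [hl hy] hh [j0 yj0]; set W := \matrix_j _.
have comb0 (c : 'rV[C]_n) : c *m W = 0 -> \sum_j c 0 j *: y j = 0.
  rewrite -crow_comb => E; apply: (@crow_inj l); rewrite ?rpred0 ?lap0 //.
  - by apply: rpred_sum => j _; apply: rpredZ; exact: hh.
  - by rewrite lap_sum big1 // => j _; rewrite lapZ hl scaler0.
  - by rewrite E; apply/rowP => a; rewrite !mxE mcoeff0.
have ker0 i : row i (kermx W) *m W = 0 by rewrite -row_mul mulmx_ker row0.
have [||/eqP] := irr (kermx W).
- move=> A oA; apply/sub_kermxP/row_matrixP => i; rewrite row0 row_mul row_mul.
  rewrite -crow_comb -(orth_rho_frame _ oA (hy A oA)).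
  rewrite comb0 // raddf0; by apply/rowP => a; rewrite !mxE mcoeff0.
- by move=> K0; rewrite -kermx_eq0 K0.
move=> full; exfalso; case/eqP: yj0.
have : (delta_mx 0 j0 : 'rV[C]_n) *m W = 0.
  by apply/sub_kermxP; apply: submx_full; rewrite /row_full full.
move/comb0; rewrite (bigD1 j0) //= mxE !eqxx scale1r big1 ?addr0 // => j /negbTE ne.
by rewrite mxE ne scale0r.
Qed.

(** A nonzero equivariant image of an irreducible representation is free, so the coefficients in
    [cframe_casimir] can be compared: the representation determines [l (l + 1)], hence [l]. *)
Lemma cframe_degree n (tau : 'M[regfun R]_n) (y z : 'I_n -> {mpoly C[3]}) k l :
    irreducible_rep tau -> cframe y tau -> cframe z tau ->
    (forall j, y j \is k.-homog) -> (forall j, z j \is l.-homog) ->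
    (exists j, y j != 0) -> (exists j, z j != 0) ->
  k = l.
Proof.
move=> irr; have [n0 _ _ _] := irr; pose a : 'I_n := Ordinal n0.
pose T i j : C := \sum_a \sum_b \sum_k regdiff (rotgen a b) (tau k j) * regdiff (rotgen a b) (tau i k).
have E (x : 'I_n -> {mpoly C[3]}) m : cframe x tau -> (forall j, x j \is m.-homog) ->
    (exists j, x j != 0) -> T a a = - 2%:R * (m * m.+1)%:R.
  move=> fx hx nx; have := cframe_casimir a fx hx; rewrite -/T => Ea.
  have /row_free_inj inj := cframe_free irr fx hx nx.
  pose u : 'rV[C]_n := \row_i T i a.
  pose v : 'rV[C]_n := (- 2%:R * (m * m.+1)%:R) *: delta_mx 0 a.
  have uv : u = v.
    apply: inj; rewrite -!crow_comb; congr crow.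
    transitivity (\sum_i T i a *: x i); first by apply: eq_bigr => i _; rewrite mxE.
    rewrite -Ea (bigD1 a) //= !mxE !eqxx mulr1 big1 ?addr0 // => j /negbTE ne.
    by rewrite !mxE ne mulr0 scale0r.
  by have /rowP/(_ a) := uv; rewrite !mxE !eqxx mulr1.
move=> fy fz hy hz ny nz; have := E _ _ fy hy ny; rewrite (E _ _ fz hz nz).
have n2 : - 2%:R != 0 :> C by rewrite oppr_eq0 pnatr_eq0.
move/(mulfI n2)/eqP; rewrite eqr_nat => /eqP; nia.
Qed.

Lemma coefX_mul (F : comNzRingType) m n (u : 'rV[{poly F}]_m) (Q : 'M[F]_(m, n)) k :
  map_mx (coefp k) (u *m map_mx polyC Q) = map_mx (coefp k) u *m Q.
Proof.
apply/rowP => i; rewrite mxE [(u *m _) 0 i]mxE raddf_sum [RHS]mxE; apply: eq_bigr => j _.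
by rewrite [map_mx polyC Q j i]mxE [X in _ = X * _]mxE /= coefMC.
Qed.

(** A basis of the span of [P] made of elements of [P], which need not be a subspace. The induction
    is on [d], a bound for the number of rows that can still be added. *)
Lemma max_row_free (F : fieldType) N (P : 'rV[F]_N -> Prop) : exists r (W : 'M[F]_(r, N)),
  [/\ row_free W, forall i, P (row i W) & forall v, P v -> (v <= W)%MS].
Proof.
suff H d r (W : 'M[F]_(r, N)) : row_free W -> (forall i, P (row i W)) -> (N - r <= d)%N ->
    exists r (W : 'M[F]_(r, N)),
  [/\ row_free W, forall i, P (row i W) & forall v, P v -> (v <= W)%MS].
  by apply: (H N 0%N 0); [rewrite /row_free mxrank0 | case | rewrite subn0].
elim: d r W => [|d IH] r W fW PW hd.
  exists r, W; split=> // v _; apply: submx_full.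
  by rewrite /row_full (eqP fW) eqn_leq -{1}(eqP fW) rank_leq_col -subn_eq0 -leqn0.
have [[v [Pv nv]]|no] := pselect (exists v, P v /\ ~~ (v <= W)%MS); last first.
  exists r, W; split=> // v Pv; apply: contrapT => /negP nv; apply: no.
  by exists v.
have fr : row_free (col_mx v W).
  rewrite -row_leq_rank -[leqLHS]/r.+1; have /eqP {1}<- := fW.
  by rewrite rank_ltmx // ltmxE col_mx_sub negb_and nv -addsmxE addsmxSr.
apply: (IH _ _ fr) => [i|]; last by rewrite add1n subnS -subn1 leq_subLR add1n.
by case: (split_ordP i) => j ->; rewrite ?rowKu ?rowKd ?row_id.
Qed.

Lemma map_polyC_inj_mul (F : fieldType) m n (W : 'M[F]_(m, n)) : row_free W ->
  injective (fun c : 'rV[{poly F}]_m => c *m map_mx polyC W).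
Proof.
move=> /row_freeP[V WV] c d /(congr1 (mulmx^~ (map_mx polyC V))) /=.
by rewrite -!mulmxA -map_mxM WV map_mx1 !mulmx1.
Qed.

(** The coefficients are found with a pseudo-inverse of the constant matrix [W], which commutes with
    taking coefficients of polynomials. *)
Lemma poly_rows_sub (F : fieldType) m n (W : 'M[F]_(m, n)) (u : 'rV[{poly F}]_n) :
  (forall k, (map_mx (coefp k) u <= W)%MS) -> exists c, u = c *m map_mx polyC W.
Proof.
move=> hu; exists (u *m map_mx polyC (pinvmx W)); rewrite -mulmxA -map_mxM.
apply/rowP => j; apply/polyP => k.
have /rowP/(_ j) := coefX_mul u (pinvmx W *m W) k.
by rewrite mulmxA (mulmxKpV (hu k)) mxE [RHS]mxE => /= <-.
Qed.

Definition harm_row l (u : 'rV[O]_(size (mons l))) : HO R := \sum_a u 0 a *: hO R a.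

Lemma harm_row_comb l n (W : 'M[C]_(n, size (mons l))) (c : 'rV[O]_n) :
  \sum_i c 0 i *: harm_row (map_mx polyC (row i W)) = harm_row (c *m map_mx polyC W).
Proof.
rewrite /harm_row.
transitivity (\sum_i \sum_a (c 0 i * (W i a)%:P) *: hO R a).
  apply: eq_bigr => i _; rewrite scaler_sumr; apply: eq_bigr => a _.
  by rewrite scalerA !mxE.
rewrite exchange_big; apply: eq_bigr => a _ /=; rewrite -scaler_suml; congr (_ *: _).
by rewrite mxE; apply: eq_bigr => i _; rewrite mxE.
Qed.

Lemma harm_row_inj l : injective (@harm_row l).
Proof.
suff E u b : (val (@harm_row l u))@_(mon b) = u 0 b.
  by move=> u v uv; apply/rowP => b; rewrite -!E uv.
rewrite /harm_row valHO_sum raddf_sum (bigD1 b) //= mcoeffZ mcoeff_hb eqxx mulr1.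
rewrite big1 ?addr0 // => a ne; rewrite mcoeffZ mcoeff_hb.
case: eqP => [/mon_inj E|]; last by rewrite mulr0.
by rewrite E eqxx in ne.
Qed.

Lemma harm_row_id l (v : HO R) : val v \is l.-homog ->
  v = harm_row (\row_a (val v)@_(@mon l a)).
Proof.
move=> hv; apply: val_inj; rewrite valHO_sum [LHS](harm_homogE unitO hv (lap_val v)).
by apply: eq_bigr => a _; rewrite mxE.
Qed.

Lemma coefX_homog l (p : PO) : (forall k, coefX k p \is l.-homog) -> p \is l.-homog.
Proof.
move=> hp; apply/dhomogP => m; rewrite mcoeff_msupp => pm.
have [k pk] : exists k, (p@_m)`_k != 0.
  apply: contrapT => no; case/eqP: pm; apply/polyP => k; rewrite coef0.
  by apply: contrapT => /eqP nk; apply: no; exists k.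
move: (hp k) => /dhomogP/(_ m); rewrite mcoeff_msupp mcoeff_coefX; exact.
Qed.

(** Equivariant maps into complex harmonic polynomials extend to constant sections, because the
    basis of harmonics is the same over both rings. *)
Lemma lift_frame l n (y : 'I_n -> {mpoly C[3]}) (M : 'M[regfun R]_n) :
    cframe y M -> (forall j, y j \is l.-homog) ->
  regular_frame (@kH R) (fun j => harm_row (map_mx polyC (crow l (y j)))) M.
Proof.
move=> [hl hy] hh.
have E j : val (harm_row (map_mx polyC (crow l (y j)))) = map_mpoly polyC (y j).
  rewrite {2}(harm_homogE unitC (hh j) (hl j)) valHO_sum raddf_sum.
  apply: eq_bigr => a _; rewrite valHOZ !mxE.
  rewrite /= -(map_mpoly_hb polyC unitC unitO); symmetry.
  by apply: map_mpoly_scale => d; rewrite /= polyCM.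
move=> A oA j; apply: val_inj; rewrite (val_kH _ oA) E.
have -> : sub (BO A) (map_mpoly polyC (y j)) = map_mpoly polyC (sub (rho A) (y j)).
  by symmetry; apply: map_mpoly_sub => a b d; exact: polyC_coef.
rewrite (hy A oA) valHO_sum raddf_sum; apply: eq_bigr => i _.
by rewrite valHOZ E; apply: map_mpoly_scale => d; rewrite /= polyCM.
Qed.

Lemma frame_single_degree n (tau : 'M[regfun R]_n) (y : 'I_n -> {mpoly C[3]}) l
    (w : 'I_n -> HO R) : irreducible_rep tau -> cframe y tau ->
    (forall j, y j \is l.-homog) -> (exists j, y j != 0) ->
  regular_frame (@kH R) w tau -> forall j k, coefX k (val (w j)) \is l.-homog.
Proof.
move=> irr fy hy ny fw j k.
have E d : d != l -> hpart d (coefX k (val (w j))) = 0.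
  move=> ne; apply: contrapT => /eqP nz; case/eqP: ne.
  have fz := cframe_hpart d (cframe_coefX k fw).
  by apply: (cframe_degree irr fz fy _ hy _ ny) => [i|]; [exact: hpart_homog | exists j].
rewrite (sum_hpart (leqnn (msize (coefX k (val (w j)))))); apply: rpred_sum => d _.
have [<-|ne] := eqVneq (val d) l; first exact: hpart_homog.
by rewrite E // rpred0.
Qed.

(** If the representation occurs at all, it occurs in a single degree [l]. The coefficients in [T]
    of every image vector then lie in the finite-dimensional complex span of the images in degree
    [l], and a complex basis of this span is a basis over [C[T]]. If it does not occur, the isotypic
    component is zero. *)
Lemma HO_isotypic n (tau : 'M[regfun R]_n) :
  irreducible_rep tau -> fin_free (isotypic (@kH R) tau).
Proof.
move=> irr.
have [[l [y [fy hy ny]]]|no] := pselect (exists l (y : 'I_n -> {mpoly C[3]}),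
    [/\ cframe y tau, forall j, y j \is l.-homog & exists j, y j != 0]); last first.
  have w0 (w : 'I_n -> HO R) j : regular_frame (@kH R) w tau -> w j = 0.
    move=> fw; apply: val_inj; apply: coefX_inj => k; rewrite [RHS]raddf0.
    apply: contrapT => nz; apply: no.
    have [l nl] : exists l, hpart l (coefX k (val (w j))) != 0.
      apply: contrapT => nl; apply: nz.
      rewrite (sum_hpart (leqnn (msize (coefX k (val (w j)))))) big1 // => d _.
      by apply: contrapT => /eqP nd; apply: nl; exists (val d).
    exists l, (fun i => hpart l (coefX k (val (w i)))); split; last by exists j.
      exact/cframe_hpart/cframe_coefX.
    by move=> i; exact: hpart_homog.
  exists 0%N, (fun=> 0); split=> [[]//|v hv]; exists 0; split=> [|c _]; last first.
    by apply/rowP => -[].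
  rewrite big_ord0; move: v hv; apply: lspan_ind => [//|c u v -> ->|v [w [fw [j ->]]]].
    by rewrite scaler0 addr0.
  exact: w0.
(* The coordinates of the vectors that lie in some complex copy of [tau] in degree [l]. They need
   not form a subspace, which is why [max_row_free] takes an arbitrary predicate. *)
pose P (u : 'rV[C]_(size (mons l))) := exists z j,
  [/\ cframe z tau, forall i, z i \is l.-homog & u = crow l (z j)].
have [r [W [fW PW WP]]] := max_row_free P.
exists r, (fun i => harm_row (map_mx polyC (row i W))); split=> [i|v hv].
  have [z [j [fz hz ->]]] := PW i.
  by apply: mem_lspan; exists (fun j => harm_row (map_mx polyC (crow l (z j)))); split;
    [exact: lift_frame | exists j].
suff [c vc] : exists c : 'rV[O]_r, v = \sum_i c 0 i *: harm_row (map_mx polyC (row i W)).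
  exists c; split=> // d; rewrite vc !harm_row_comb => /harm_row_inj.
  exact: map_polyC_inj_mul.
move: v hv; apply: lspan_ind => [|p u v [c ->] [d ->]|v [w [fw [j ->]]]].
- by exists 0; rewrite big1 // => i _; rewrite mxE scale0r.
- exists (p *: c + d); rewrite scaler_sumr -big_split; apply: eq_bigr => i _.
  by rewrite !mxE scalerDl scalerA.
have hw := frame_single_degree irr fy hy ny fw.
rewrite (harm_row_id (coefX_homog (hw j))).
have [|c ->] := @poly_rows_sub _ _ _ W (\row_a (val (w j))@_(mon a)).
  move=> k; apply: WP; exists (fun i => coefX k (val (w i))), j; split=> [||].
  - exact: cframe_coefX.
  - by move=> i; exact: hw.
  - by apply/rowP => a; rewrite !mxE mcoeff_coefX.
by exists c; rewrite harm_row_comb.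
Qed.

(** One construction serves both families: they differ only in the weights of the ladder operators,
    and the bracket sees nothing but the recurrence. *)
Definition hcH (al be : nat -> O)
    (ab : forall l, (2 * l + 5)%:R * (al l.+1 * be l.+2) =
       'X + (2 * l + 1)%:R * (al l * be l.+1)) : hc_family (HO R) :=
  @HCFamily R (HO R) (@kH R) (gH al be) (@HO_free R) (@kH_linear R) (@kH1 R) (@kHM R)
    HO_algebraic HO_isotypic (gH_linear al be) (gH_linearl al be)
    (fun X Y v => gH_bracket X Y v ab) (fun A oA X v => gH_equivariant al be X v oA)
    (@gH_infinitesimal R al be).

End HarmonicFrames.

(** * Transport and duality *)

Section Transport.
Variables (R : realType) (E F : lmodType {poly R[i]}) (aE : hc_family E).
Variables (Phi : E -> F) (Psi : F -> E).
Hypotheses (Phi_lin : linear Phi) (PhiK : cancel Phi Psi) (PsiK : cancel Psi Phi).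
Local Notation O := {poly R[i]}.

Fact Psi_lin : linear Psi.
Proof. by move=> c u v; apply: (can_inj PhiK); rewrite Phi_lin !PsiK. Qed.

Lemma Phi_sum n (c : 'I_n -> O) (w : 'I_n -> E) :
  Phi (\sum_i c i *: w i) = \sum_i c i *: Phi (w i).
Proof.
have Phi0 : Phi 0 = 0.
  by have := Phi_lin (- 1) 0 0; rewrite scaler0 addr0 scaleN1r addNr.
elim/big_rec2: _ => [//|i x y _ <-].
by rewrite Phi_lin.
Qed.

Lemma Psi_sum n (c : 'I_n -> O) (w : 'I_n -> F) :
  Psi (\sum_i c i *: w i) = \sum_i c i *: Psi (w i).
Proof.
apply: (can_inj PhiK); rewrite Phi_sum PsiK; apply: eq_bigr => i _.
by rewrite PsiK.
Qed.

Definition tr_kact A v := Phi (kact aE A (Psi v)).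
Definition tr_gact X v := Phi (gact aE X (Psi v)).

Lemma tr_frame n (w : 'I_n -> E) (M : 'M[regfun R]_n) :
  regular_frame (kact aE) w M -> regular_frame tr_kact (Phi \o w) M.
Proof. by move=> fw A oA j; rewrite /tr_kact /= PhiK fw // Phi_sum. Qed.

Lemma tr_frame' n (w : 'I_n -> F) (M : 'M[regfun R]_n) :
  regular_frame tr_kact w M -> regular_frame (kact aE) (Psi \o w) M.
Proof.
move=> fw A oA j; apply: (can_inj PhiK); rewrite -[LHS]/(tr_kact A (w j)) fw // Phi_sum.
by apply: eq_bigr => i _; rewrite /= PsiK.
Qed.

Lemma tr_free : free_module F.
Proof.
have [B [indB spanB]] := hc_free aE; exists (fun v => B (Psi v)); split=> [n b c inj hb b0|v].
  apply: (indB n (Psi \o b) c _ hb); first exact: (inj_comp (can_inj PsiK)).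
  have Psi0 : Psi 0 = 0.
    by have := Psi_lin (- 1) 0 0; rewrite scaler0 addr0 scaleN1r addNr.
  by rewrite -[RHS]Psi0 -b0 Psi_sum.
have [n [c [a [Ba va]]]] := spanB (Psi v).
exists n, c, (Phi \o a); split=> [i|]; first by rewrite /= PhiK.
by rewrite -[LHS]PsiK va Phi_sum.
Qed.

Lemma tr_linear A : orthogonal_mx A -> linear (tr_kact A).
Proof. by move=> oA c u v; rewrite /tr_kact Psi_lin (kact_linear aE oA) Phi_lin. Qed.

Lemma tr_algebraic : locally_algebraic tr_kact.
Proof.
move=> v; have [n [w [M [fw [c vc]]]]] := kact_algebraic aE (Psi v).
exists n, (Phi \o w), M; split; first exact: tr_frame.
by exists c; rewrite -[LHS]PsiK vc Phi_sum.
Qed.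

Lemma tr_isotypic n (tau : 'M[regfun R]_n) :
  irreducible_rep tau -> fin_free (isotypic tr_kact tau).
Proof.
move=> irr; have [r [b [Eb Ub]]] := kact_isotypic aE irr.
exists r, (Phi \o b); split=> [i|v [m [c [a [ha va]]]]].
  have [m [c [a [ha va]]]] := Eb i.
  exists m, c, (Phi \o a); split=> [k|]; last by rewrite /= va Phi_sum.
  have [w [fw [j aj]]] := ha k; exists (Phi \o w).
  by split; [exact: tr_frame | exists j; rewrite /= aj].
have [|d [vd ud]] := Ub (Psi v).
  exists m, c, (Psi \o a); split=> [k|]; last by rewrite va Psi_sum.
  have [w [fw [j aj]]] := ha k; exists (Psi \o w).
  by split; [exact: tr_frame' | exists j; rewrite /= aj].
exists d; split=> [|e ve]; first by rewrite -[LHS]PsiK vd Phi_sum.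
by apply: ud; apply: (can_inj PhiK); rewrite PsiK Phi_sum.
Qed.

Lemma tr_infinitesimal n (w : 'I_n -> F) (M : 'M[regfun R]_n) :
  regular_frame tr_kact w M -> forall xi : 'M[R[i]]_3, xi^T = - xi -> forall j,
  tr_gact (so3_to_galg xi) (w j) = \sum_i (regdiff xi (M i j))%:P *: w i.
Proof.
move=> /tr_frame' fw xi skew j; rewrite /tr_gact (gact_infinitesimal fw skew) Phi_sum.
by apply: eq_bigr => i _; rewrite /= PsiK.
Qed.

Definition transport : hc_family F.
Proof.
refine (@HCFamily R F tr_kact tr_gact tr_free tr_linear _ _ tr_algebraic tr_isotypic
  _ _ _ _ tr_infinitesimal).
- by move=> v; rewrite /tr_kact kact1 PsiK.
- by move=> A B oA oB v; rewrite /tr_kact (kactM aE oA oB) PhiK.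
- by move=> X c u v; rewrite /tr_gact Psi_lin gact_linear Phi_lin.
- by move=> v c X Y; rewrite /tr_gact gact_linearl Phi_lin.
- move=> X Y v; rewrite /tr_gact gact_bracket !PhiK -scaleN1r addrC Phi_lin.
  by rewrite scaleN1r addrC.
- by move=> A oA X v; rewrite /tr_kact /tr_gact !PhiK (gact_equivariant aE oA).
Defined.

Lemma transport_isomorphism : hc_isomorphism aE transport Phi.
Proof.
split=> // [|A oA v|X v]; first by exists Psi.
  by rewrite /= /tr_kact PhiK.
by rewrite /= /tr_gact PhiK.
Qed.

End Transport.

(** * Finite functionals and Fischer duality *)

Section KFiniteFunctionals.
Import mpoly.
Variable R : realType.
Local Notation C := R[i].
Local Notation O := {poly C}.
Local Notation PO := {mpoly O[3]}.
Local Notation BO A := (map_mx polyC (rho A)).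
Local Notation unitC := (@unitC R).
Local Notation unitO := (@unitO R).
Local Notation HO := (HO R).
Implicit Types (xi : HO -> O) (u v : HO).

Definition functional xi : Prop := forall p u v, xi (p *: u + v) = p * xi u + xi v.

Section Functional.
Variable xi : HO -> O.
Hypothesis xi_lin : functional xi.

Lemma functional0 : xi 0 = 0.
Proof. by have := xi_lin (- 1) 0 0; rewrite scaler0 addr0 mulN1r addNr. Qed.

Lemma functionalD u v : xi (u + v) = xi u + xi v.
Proof. by have := xi_lin 1 u v; rewrite scale1r mul1r. Qed.

Lemma functionalZ p u : xi (p *: u) = p * xi u.
Proof. by have := xi_lin p u 0; rewrite functional0 !addr0. Qed.

Lemma functional_sum (I : Type) (s : seq I) (Q : pred I) (F : I -> HO) :
  xi (\sum_(i <- s | Q i) F i) = \sum_(i <- s | Q i) xi (F i).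
Proof. by elim/big_rec2: _ => [|i x y _ <-]; rewrite ?functional0 ?functionalD. Qed.

(** Each coefficient of [xi] along the orbit of [u] is a regular function that vanishes on the
    group, hence its differential vanishes. The weights are set to [0] because elements of [so(3)]
    have no component along the [R_i]. *)
Lemma functional_so3 u s : (forall A, orthogonal_mx A -> xi (kH A u) = 0) ->
  s^T = - s -> xi (gH (fun=> 0) (fun=> 0) (so3_to_galg s) u) = 0.
Proof.
move=> h skew; have [n [w [M [fw [c uc]]]]] := @HO_algebraic R u.
have E : xi (gH (fun=> 0) (fun=> 0) (so3_to_galg s) u) =
    \sum_j \sum_i (c j * regdiff s (M i j))%:P * xi (w i).
  have gl := gH_linear (fun=> 0 : O) (fun=> 0) (so3_to_galg s).
  have g0 : gH (fun=> 0) (fun=> 0) (so3_to_galg s) 0 = 0 :> HO.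
    by have := gl (- 1) 0 0; rewrite scaler0 addr0 scaleN1r addNr.
  rewrite uc; transitivity (xi (\sum_j (c j)%:P *: gH (fun=> 0) (fun=> 0) (so3_to_galg s) (w j))).
    by congr xi; elim/big_rec2: _ => [//|j x y _ <-]; exact: gl.
  rewrite functional_sum; apply: eq_bigr => j _; rewrite functionalZ.
  rewrite (gH_infinitesimal _ _ fw skew) functional_sum mulr_sumr; apply: eq_bigr => i _.
  by rewrite functionalZ mulrA polyCM.
rewrite E; apply/polyP => k; rewrite coef0.
pose f : regfun R := \sum_j \sum_i (c j * (xi (w i))`_k)%:MP * M i j.
have rf : regdiff s f = \sum_j \sum_i (c j * (xi (w i))`_k) * regdiff s (M i j).
  rewrite /f; elim/big_rec2: _ => [|j x y _ <-]; first exact: (regdiffC s 0).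
  rewrite regdiffD; congr (_ + _).
  elim/big_rec2: _ => [|i x' y' _ <-]; first exact: (regdiffC s 0).
  by rewrite regdiffD regdiffM regdiffC mul0r add0r regevalC.
transitivity (regdiff s f).
  rewrite rf coef_sum; apply: eq_bigr => j _; rewrite coef_sum; apply: eq_bigr => i _.
  by rewrite coefCM mulrAC.
apply: regdiff_eq0 => // A oA.
transitivity (xi (kH A u))`_k; last by rewrite h // coef0.
rewrite uc kH_sum // functional_sum coef_sum /f regeval_sum; apply: eq_bigr => j _.
rewrite kHZ // fw // functionalZ functional_sum coefCM coef_sum regeval_sum mulr_sumr.
apply: eq_bigr => i _; rewrite regevalM regevalC functionalZ coefCM.
by rewrite mulrA mulrAC.
Qed.

Definition annul u : Prop := forall A, orthogonal_mx A -> xi (kH A u) = 0.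

End Functional.

Lemma functional_kH xi A : orthogonal_mx A -> functional xi -> functional (xi \o kH A).
Proof. by move=> oA xi_lin p u v; rewrite /= kH_linear. Qed.

Definition Hrot i j u : HO := gH (fun=> 0) (fun=> 0) (so3_to_galg (rotgen R i j)) u.

Lemma val_Hrot i j u : val (Hrot i j u) = rot i j (val u).
Proof.
apply: coefX_inj => n; rewrite (coefX_gH_so3 _ _ _ _ (rotgen_skew R i j)).
by rewrite so3op_rotgen coefX_rot.
Qed.

Definition Hwgt (a : nat -> O) u : HO := insubd u (wgt a (val u)).

Lemma val_Hwgt a u : val (Hwgt a u) = wgt a (val u).
Proof. by rewrite insubdK //; apply/eqP; rewrite lap_wgt lap_val raddf0. Qed.

Definition Hpart l u : HO := Hwgt (fun k => (k == l)%:R) u.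

Lemma val_Hpart l u : val (Hpart l u) = hpart l (val u).
Proof. exact: val_Hwgt. Qed.

Section Annihilated.
Variable xi : HO -> O.
Hypothesis xi_lin : functional xi.

Lemma annulD p u v : annul xi u -> annul xi v -> annul xi (p *: u + v).
Proof. by move=> hu hv A oA; rewrite kH_linear // xi_lin hu // hv // mulr0 addr0. Qed.

Lemma annulZ p u : p != 0 -> annul xi (p *: u) -> annul xi u.
Proof.
move=> p0 hu A oA; have /eqP := hu A oA; rewrite kHZ // functionalZ // mulf_eq0.
by rewrite (negbTE p0) => /eqP.
Qed.

Lemma annul0 : annul xi 0.
Proof.
move=> A oA; have -> : kH A 0 = 0 :> HO by rewrite -[X in kH A X](scale0r 0) kHZ // scale0r.
exact: functional0.
Qed.

Lemma annul_sum (I : Type) (s : seq I) (Q : pred I) (F : I -> HO) :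
  (forall i, Q i -> annul xi (F i)) -> annul xi (\sum_(i <- s | Q i) F i).
Proof.
move=> hF; apply: big_ind => [|x y hx hy|//]; first exact: annul0.
by rewrite -[x]scale1r; exact: annulD.
Qed.

Lemma annul_rot i j u : annul xi u -> annul xi (Hrot i j u).
Proof.
move=> hu B oB; apply: (functional_so3 (functional_kH oB xi_lin)); last exact: rotgen_skew.
by move=> A oA; rewrite /= -kHM // hu //; exact: orthM.
Qed.

(** The annihilated vectors are stable under rotations, hence under the Casimir operator shifted by
    any constant; the factor [- 2] of [casimir] is cancelled since [C[T]] is a domain. *)
Lemma annul_casimir (d : O) u : annul xi u -> annul xi (Hwgt (fun l => (l * l.+1)%:R - d) u).
Proof.
move=> hu; have hs : annul xi (\sum_i \sum_j Hrot i j (Hrot i j u)).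
  by apply: annul_sum => i _; apply: annul_sum => j _; do 2!apply: annul_rot.
have n2 : - 2%:R != 0 :> O.
  by rewrite oppr_eq0 -(rmorph_nat polyC) polyC_eq0 pnatr_eq0.
apply: (annulZ n2).
have -> : - 2%:R *: Hwgt (fun l => (l * l.+1)%:R - d) u =
    (2%:R * d) *: u + \sum_i \sum_j Hrot i j (Hrot i j u).
  apply: val_inj; rewrite valHOD !valHOZ val_Hwgt valHO_sum.
  have -> : \sum_i val (\sum_j Hrot i j (Hrot i j u)) =
      \sum_i \sum_j rot i j (rot i j (val u)).
    apply: eq_bigr => i _; rewrite valHO_sum; apply: eq_bigr => j _.
    by rewrite !val_Hrot.
  rewrite casimir lap_val mulr0 sub0r; apply/mpolyP => m.
  rewrite mcoeffD !mcoeffZ mcoeff_wgt -mpolyC_nat mul_mpolyC mcoeffZ mcoeffN mcoeff_wgt.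
  by move: (_%:R : O) (_@_m) => a b; ring.
exact: annulD.
Qed.

(** The projection to degree [l] is, up to a nonzero scalar, a polynomial in the Casimir operator,
    since distinct degrees have distinct eigenvalues. *)
Lemma annul_hpart l u : annul xi u -> annul xi (Hpart l u).
Proof.
move=> hu; pose c k : O := (k * k.+1)%:R.
have H (s : seq nat) : annul xi (Hwgt (fun k => \prod_(j <- s) (c k - c j)) u).
  elim: s => [|j s IH].
    suff -> : Hwgt (fun k => \prod_(j <- [::]) (c k - c j)) u = u by [].
    apply: val_inj; rewrite val_Hwgt; apply/mpolyP => m.
    by rewrite mcoeff_wgt big_nil mul1r.
  have := annul_casimir (c j) IH; congr annul; apply: val_inj; rewrite !val_Hwgt wgt_comp.
  by apply: eq_wgt => k; rewrite big_cons.
(* The interpolation nodes: all the other degrees that can occur in [u]. *)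
pose N := msize (val u); pose s := [seq j <- iota 0 N | j != l].
apply: (@annulZ (\prod_(j <- s) (c l - c j))).
  rewrite prodf_seq_neq0; apply/allP => j; rewrite mem_filter => /andP[jl _].
  apply/implyP => _; rewrite subr_eq0 /c -!(rmorph_nat polyC) (inj_eq (@polyC_inj _)).
  by rewrite eqr_nat; move: jl; apply: contraNneq; nia.
have := H s; congr annul; apply: val_inj; rewrite val_Hwgt valHOZ val_Hpart.
apply/mpolyP => m; rewrite mcoeff_wgt mcoeffZ mcoeff_hpart.
have [<-|ne] := eqVneq (mdeg m) l; first by rewrite mul1r.
rewrite mul0r mulr0.
have [hm|hm] := ltnP (mdeg m) N; last first.
  suff -> : (val u)@_m = 0 by rewrite mulr0.
  by apply: memN_msupp_eq0; apply: contraL hm => /msize_mdeg_lt; rewrite -ltnNge.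
by rewrite (big_rem (mdeg m)) /= ?subrr ?mul0r // mem_filter ne mem_iota.
Qed.

End Annihilated.

(** Padding the [n] columns with a zero column makes the matrix square and singular, and the kernel
    vector is found over the domain itself. *)
Lemma overdetermined_kernel (D : idomainType) n (M : 'I_n.+1 -> 'I_n -> D) :
  exists2 p : 'rV[D]_n.+1, p != 0 & forall a, \sum_i p 0 i * M i a = 0.
Proof.
pose N : 'M[D]_n.+1 := \matrix_(i, j) if unlift ord0 j is Some a then M i a else 0.
have N0 : \det N = 0.
  rewrite (expand_det_col _ ord0) big1 // => i _.
  by rewrite mxE unlift_none mul0r.
have /det0P[p p0 pN] : \det N == 0 by apply/eqP.
exists p => // a; have /rowP/(_ (lift ord0 a)) := pN; rewrite mxE [RHS]mxE => E.
by rewrite -[RHS]E; apply: eq_bigr => i _; rewrite [N _ _]mxE liftK.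
Qed.

(* If [xi] were nonzero in [n + 1] degrees, where [n] is the dimension of a
   [K]-stable space containing [xi], then some combination of vectors from these
   degrees would be annihilated by the whole [K]-orbit of [xi], hence so would
   its homogeneous components. *)
Lemma kfinite_bounded xi : functional xi -> kfinite_functional (@kH R) xi ->
  exists N, forall l u, (N <= l)%N -> val u \is l.-homog -> xi u = 0.
Proof.
move=> xi_lin [n [w hw]]; apply: contrapT => no.
have {no} ex N : exists lu : nat * HO, [/\ (N <= lu.1)%N, val lu.2 \is lu.1.-homog & xi lu.2 != 0].
  apply: contrapT => noN; apply: no; exists N => l u Nl hu.
  by apply: contrapT => /eqP nz; apply: noN; exists (l, u).
have [g hg] := choice ex.
(* Each new vector is chosen beyond the degree of the preceding one, so the chosen degrees increase
   strictly and are distinct. *)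
pose b := fix b i := if i is j.+1 then (g (b j)).1.+1 else 0%N.
pose deg i := (g (b i)).1; pose e i := (g (b i)).2.
have deg_lt i j : (i < j)%N -> (deg i < deg j)%N.
  elim: j => // j IH; rewrite ltnS leq_eqVlt => lij.
  have [+ _ _] := hg (b j.+1); rewrite -/(deg _) /= -/(deg j) => dj.
  by case/orP: lij => [/eqP->//|/IH h]; exact: ltn_trans dj.
have deg_inj i j : deg i = deg j -> i = j.
  by move=> E; have := deg_lt i j; have := deg_lt j i; rewrite E ltnn; case: ltngtP => // _ h1 h2; exfalso; auto.
have [p p0 hp] := overdetermined_kernel (fun (i : 'I_n.+1) a => w a (e i)).
pose u := \sum_i p 0 i *: e i.
have nu : annul xi u.
  move=> A oA; rewrite kH_sum // functional_sum //.
  have oA' : orthogonal_mx (invmx A) by exact: orthV.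
  have [c hc] := hw _ oA'.
  transitivity (\sum_i \sum_a (c a)%:P * (p 0 i * w a (e i))).
    apply: eq_bigr => i _; rewrite kHZ // functionalZ // -{1}(invmxK A) hc mulr_sumr.
    by apply: eq_bigr => a _; rewrite mulrCA.
  rewrite exchange_big big1 // => a _ /=.
  by rewrite -mulr_sumr hp mulr0.
case/eqP: p0; apply/rowP => i; rewrite mxE.
have := annul_hpart xi_lin (deg i) nu (orth1 _).
have -> : Hpart (deg i) u = p 0 i *: e i.
  apply: val_inj; rewrite val_Hpart valHO_sum /hpart raddf_sum (bigD1 i) //= big1 ?addr0 => [|j ne].
    by rewrite linearZ; congr (_ *: _); apply: hpart_id; have [] := hg (b i).
  rewrite linearZ /=; have [_ he _] := hg (b j).
  rewrite [X in _ *: X](_ : _ = 0) ?scaler0 //; apply: (hpart_neq he).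
  by apply: contraNneq ne => /deg_inj E; apply/eqP/val_inj.
rewrite kH1 functionalZ // => /eqP; rewrite mulf_eq0 => /orP[/eqP//|/eqP z].
by have [_ _ /eqP[]] := hg (b i).
Qed.

(** The pairing is bilinear. Pairing [p] with its complex conjugate, again harmonic, gives a sum of
    squared moduli with positive weights. *)
Lemma fis_eq0 (p : {mpoly C[3]}) : lap p = 0 ->
  (forall q, lap q = 0 -> fis p q = 0) -> p = 0.
Proof.
move=> hp h; pose q := map_mpoly (@conjc R) p.
have : fis p q = 0 by apply: h; rewrite /q -map_mpoly_lap hp raddf0.
rewrite (fisE q (msupp_uniq p)) // => /eqP; rewrite psumr_eq0 => [/allP h0|m _]; last first.
  by rewrite mcoeff_map_mpoly -mulrA mulr_ge0 ?ler0n // mul_conjC_ge0.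
apply/mpolyP => m; rewrite mcoeff0; have [/h0|/memN_msupp_eq0//] := boolP (m \in msupp p).
rewrite mcoeff_map_mpoly -mulrA mulf_eq0 pnatr_eq0 mul_conjC_eq0 => /orP[|/eqP//].
by rewrite eqn0Ngt prodn_gt0 // => i; exact: fact_gt0.
Qed.

(** The harmonic basis has constant coefficients, so the pairing over [C[T]] has this complex
    matrix. Being invertible over [C], it makes the pairing perfect over [C[T]] in each degree, not
    merely nondegenerate. *)
Definition gram l : 'M[C]_(size (mons l)) := \matrix_(a, b) fis (hb unitC a) (hb unitC b).

Lemma gram_unit l : gram l \in unitmx.
Proof.
rewrite -row_free_unit; apply: inj_row_free => c cG.
pose p := \sum_a c 0 a *: hb unitC a : {mpoly C[3]}.
have hp : p \is l.-homog by apply: rpred_sum => a _; apply: rpredZ; exact: hb_homog.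
have lp : lap p = 0 by rewrite lap_sum big1 // => a _; rewrite lapZ lap_hb scaler0.
have ortho (a : 'I_(size (mons l))) : fis p (hb unitC a) = 0.
  have /rowP/(_ a) := cG; rewrite mxE [RHS]mxE => E; rewrite -[RHS]E /p fis_suml.
  by apply: eq_bigr => b _; rewrite fisZl mxE.
have p0 : p = 0.
  apply: fis_eq0 => // q hq.
  rewrite -(hpart_id hp) /hpart fis_wgt -/(hpart l q) (harm_hpartE unitC l hq) raddf_sum big1 // => a _.
  by rewrite /= fisC fisZl fisC ortho mulr0.
apply/rowP => b; rewrite mxE; have /(congr1 (mcoeff (mon b))) := p0.
rewrite mcoeff0 raddf_sum (bigD1 b) //= mcoeffZ mcoeff_hb eqxx mulr1 big1 ?addr0 // => a ne.
rewrite mcoeffZ mcoeff_hb; case: eqP => [/mon_inj E|]; last by rewrite mulr0.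
by rewrite E eqxx in ne.
Qed.

Lemma fis_hO l (a b : 'I_(size (mons l))) :
  fis (val (hO R a)) (val (hO R b)) = (gram l a b)%:P.
Proof.
rewrite mxE (map_mpoly_fis polyC) !(map_mpoly_hb polyC unitC unitO).
by [].
Qed.

Variable ka : nat -> C.
Hypothesis ka_neq0 : forall l, ka l != 0.

Definition fisH u v : O := fis (wgt (fun l => (ka l)%:P) (val u)) (val v).

Lemma fisH_functional u : functional (fisH u).
Proof. by move=> p v w; rewrite /fisH valHOD valHOZ !(fisC (wgt _ _)) fisDl fisZl. Qed.

Lemma fisH_linearl v : functional (fisH^~ v).
Proof. by move=> p u w; rewrite /fisH valHOD valHOZ linearP fisDl fisZl. Qed.

Lemma fisH_kH A u v : orthogonal_mx A -> fisH u (kH (invmx A) v) = fisH (kH A u) v.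
Proof.
move=> oA; rewrite /fisH (val_kH _ oA) (val_kH _ (orthV oA)) -sub_wgt.
rewrite -[in LHS](@fis_sub _ (BO A)) ?BO_orth //; congr fis.
rewrite -subM -map_mxM -rhoM (_ : A *m invmx A = 1%:M) ?rho1 ?map_mx1 ?sub1 //.
by apply: mulmxV; have /mulmx1_unit[] := oA.
Qed.

Lemma fisH_kfinite u : kfinite_functional (@kH R) (fisH u).
Proof.
have [n [w [M [fw [c uc]]]]] := @HO_algebraic R u.
exists n, (fun i => fisH (w i)) => A oA.
exists (fun i => \sum_j c j * regeval A (M i j)) => v.
rewrite fisH_kH // uc kH_sum //; set f := fisH^~ v.
have f_lin : functional f by exact: fisH_linearl.
rewrite -[LHS]/(f _) (functional_sum f_lin).
transitivity (\sum_j \sum_i (c j * regeval A (M i j))%:P * f (w i)).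
  apply: eq_bigr => j _; rewrite kHZ // (functionalZ f_lin) fw // (functional_sum f_lin) mulr_sumr.
  by apply: eq_bigr => i _; rewrite (functionalZ f_lin) mulrA polyCM.
rewrite exchange_big; apply: eq_bigr => i _ /=.
by rewrite rmorph_sum mulr_suml.
Qed.

Lemma fisH_hO l u a : fisH u (@hO R l a) = (ka l)%:P * fis (val (Hpart l u)) (val (hO R a)).
Proof.
have ha : val (hO R a) \is l.-homog by exact: hb_homog.
rewrite /fisH val_Hpart -{1}(hpart_id ha) {1}/hpart -fis_wgt wgt_comp.
rewrite -fisZl; congr fis; apply/mpolyP => m; rewrite mcoeffZ !mcoeff_wgt.
by case: eqP => [->|_]; rewrite ?mul0r ?mul1r ?mulr0.
Qed.

Lemma fisH_inj u : (forall v, fisH u v = 0) -> u = 0.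
Proof.
move=> h; rewrite (HO_expand (leqnn (msize (val u)))) big1 // => l _.
apply: big1 => a _.
pose c : 'rV[O]_(size (mons l)) := \row_b (val u)@_(mon b).
have c0 : c *m map_mx polyC (gram l) = 0.
  apply/rowP => b; have /eqP := h (hO R b); rewrite fisH_hO mulf_eq0 polyC_eq0 (negbTE (ka_neq0 l)).
  move/eqP => E; rewrite [RHS]mxE -[RHS]E mxE val_Hpart (harm_hpartE unitO l (lap_val u)) fis_suml.
  by apply: eq_bigr => i _; rewrite fisZl /c mxE [map_mx _ _ _ _]mxE -fis_hO.
have : c = 0.
  have g1 : map_mx polyC (gram l) *m map_mx polyC (invmx (gram l)) = 1%:M.
    by rewrite -map_mxM mulmxV ?gram_unit // map_mx1.
  by rewrite -[LHS]mulmx1 -g1 mulmxA c0 mul0mx.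
by move/rowP/(_ a); rewrite !mxE => ->; rewrite scale0r.
Qed.

Lemma functional_ext xi zeta : functional xi -> functional zeta ->
  (forall l a, xi (@hO R l a) = zeta (hO R a)) -> xi =1 zeta.
Proof.
move=> lx lz E v; rewrite (HO_expand (leqnn (msize (val v)))).
rewrite (functional_sum lx) (functional_sum lz); apply: eq_bigr => l _.
rewrite (functional_sum lx) (functional_sum lz); apply: eq_bigr => a _.
by rewrite (functionalZ lx) (functionalZ lz) E.
Qed.

(** Finiteness bounds the degrees in which [xi] is nonzero; in each of the remaining degrees the
    representing vector is obtained with the inverse of [gram l] and the inverse of the nonzero
    constant [ka l]. *)
Theorem kfinite_represented xi : functional xi -> kfinite_functional (@kH R) xi ->
  exists u, forall v, xi v = fisH u v.
Proof.
move=> xi_lin kf; have [N hN] := kfinite_bounded xi_lin kf.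
pose c l : 'rV[O]_(size (mons l)) :=
  (ka l)^-1%:P *: (\row_b xi (hO R b)) *m map_mx polyC (invmx (gram l)).
pose u := \sum_(l < N) harm_row (c l).
exists u; apply: functional_ext => // [|l a]; first exact: fisH_functional.
have hh k (r : 'rV[O]_(size (mons k))) : val (harm_row r) \is k.-homog.
  rewrite valHO_sum; apply: rpred_sum => b _; rewrite valHOZ; apply: rpredZ; exact: hb_homog.
have HP k : val (Hpart l (harm_row (c k))) = if k == l then val (harm_row (c k)) else 0.
  rewrite val_Hpart; have [<-|ne] := eqVneq k l; first by rewrite hpart_id.
  by rewrite (hpart_neq (hh _ _)) // eq_sym.
have uE : val (Hpart l u) = if (l < N)%N then val (harm_row (c l)) else 0.
  rewrite val_Hpart valHO_sum /hpart raddf_sum /=.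
  transitivity (\sum_(k < N | (k : nat) == l) val (harm_row (c k))).
    rewrite [RHS]big_mkcond; apply: eq_bigr => k _; rewrite -HP val_Hpart //.
  case: ltnP => hl; first by rewrite (big_pred1 (Ordinal hl)).
  by rewrite big1 // => k /eqP E; have := ltn_ord k; rewrite E ltnNge hl.
rewrite fisH_hO uE; case: ltnP => hl; last first.
  by rewrite fis0l mulr0; apply: hN hl _; exact: hb_homog.
rewrite valHO_sum fis_suml.
transitivity ((ka l)%:P * (c l *m map_mx polyC (gram l)) 0 a); last first.
  congr (_ * _); rewrite mxE; apply: eq_bigr => b _.
  by rewrite valHOZ fisZl fis_hO [map_mx _ _ _ _]mxE.
rewrite /c -mulmxA -map_mxM mulVmx ?gram_unit // map_mx1 mulmx1 !mxE mulrA -polyCM.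
by rewrite mulfV // mul1r.
Qed.

(** Rotations are skew for the Fischer pairing, whereas the ladder operators are symmetric with
    raising and lowering exchanged. The sign of [gtheta] on the [R_i] makes both cases obey the same
    rule: the origin of the twist. *)
Lemma fisH_gH (al be al2 be2 : nat -> O) X u v :
    (forall l, be l.+1 * (ka l)%:P = (ka l.+1)%:P * ((2 * l + 1)%:R * al2 l)) ->
    (forall l, (2 * l + 1)%:R * al l * (ka l.+1)%:P = (ka l)%:P * be2 l.+1) ->
  fisH (gH al be X u) v = - fisH u (gH al2 be2 (gtheta X) v).
Proof.
move=> h1 h2; rewrite /fisH /= /gfun /=; set w := wgt _.
have wZ c p : w (c *: p) = c *: w p by exact: linearZ.
have wD p q : w (p + q) = w p + w q by exact: raddfD.
have wS (F : 'I_3 -> PO) : w (\sum_i F i) = \sum_i w (F i) by exact: raddf_sum.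
have rS p (F : 'I_3 -> PO) : fis p (\sum_i F i) = \sum_i fis p (F i) by exact: raddf_sum.
have rZ c p q : fis p (c *: q) = c * fis p q by rewrite fisC fisZl fisC.
rewrite wD wZ fisDl fisZl raddfD /= rZ opprD; congr (_ + _).
  rewrite /Lsum wS fis_suml rS -sumrN; apply: eq_bigr => k _.
  by rewrite wZ fisZl rZ -mulrN; congr (_ * _); rewrite /gL /w -rot_wgt fis_rot.
rewrite -mulrN; congr (_ * _).
rewrite /Rsum wS fis_suml rS -sumrN; apply: eq_bigr => k _.
rewrite wZ fisZl rZ mxE mulNr opprK; congr (_ * _).
exact: (fis_rl _ h1 h2 (lap_val u) (lap_val v)).
Qed.

End KFiniteFunctionals.

(** * Polynomial identities behind the Runge-Lenz operators *)

Section RungeLenzPolynomials.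
Import mpoly.
Variable K : comNzRingType.
Implicit Types p : {mpoly K[3]}.

Lemma euler_homog l p : p \is l.-homog -> \sum_i 'X_i * p^`M(i) = l%:R * p.
Proof. by move=> hp; rewrite euler (wgt_homog _ hp) scaler_nat mulr_natl. Qed.

(** This identity and the next compute a Runge-Lenz operator on [h(r) p]: here the inner derivative
    falls on [h] and leaves a factor [x_j], there it falls on [p]. *)
Lemma rot_mulX_sum l i p : p \is l.-homog ->
  rot i (i + 1) ('X_(i + 1) * p) - rot (i + 2%:R) i ('X_(i + 2%:R) * p) - 'X_i * p =
  l.+1%:R * ('X_i * p) - nn K * p^`M(i).
Proof.
move=> hp; have := euler_homog hp; move=> {hp}; rewrite (sum_ord3 _ i) /nn (sum_ord3 _ i) /rot.
rewrite !mderivM !mderivX1 !eqxx !ord3_eqE !mul1r !mul0r !add0r -[l.+1%:R]natr1.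
move: (i + 1) (i + 2%:R) => j k.
move: (p^`M(i)) (p^`M(j)) (p^`M(k)) ('X_i) ('X_j) ('X_k) (l%:R) => a b c x y z n E.
have -> : (n + 1) * (x * p) = x * (n * p) + x * p by ring.
by rewrite -E; ring.
Qed.

Lemma rot_deriv_sum l i p : p \is l.-homog -> lap p = 0 ->
  rot i (i + 1) p^`M(i + 1) - rot (i + 2%:R) i p^`M(i + 2%:R) - p^`M(i) = - (l%:R * p^`M(i)).
Proof.
case: l => [|l] hp hl; first by rewrite /rot !(deriv_homog0 _ hp) !mderiv0 !(mulr0, subr0, oppr0).
have := euler_homog (deriv_homog i hp); move: hl.
rewrite /lap !(sum_ord3 _ i) /rot.
have c1 := mderiv_comm i (i + 1) p; have c2 := mderiv_comm i (i + 2%:R) p.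
rewrite -c1 -c2 -[l.+1%:R]natr1.
move: (i + 1) (i + 2%:R) => j k.
move: (p^`M(i)^`M(i)) (p^`M(j)^`M(j)) (p^`M(k)^`M(k)) (p^`M(i)^`M(j)) (p^`M(i)^`M(k)) => a b c d e.
move: (p^`M(i)) ('X_i) ('X_j) ('X_k) (l%:R) => q x y z n L E.
have -> : - ((n + 1) * q) = - (n * q) - q by ring.
rewrite -E; have -> : a = - b - c by apply/eqP; rewrite -subr_eq0 !opprD !opprK addrA L.
by ring.
Qed.

Lemma deriv_mulX_sum l p : p \is l.-homog ->
  \sum_(i < 3) ('X_i * p)^`M(i) = (l + 3)%:R * p.
Proof.
move=> hp; transitivity (\sum_(i < 3) (p + 'X_i * p^`M(i))).
  by apply: eq_bigr => i _; rewrite mderivM mderivX1 eqxx mul1r.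
by rewrite big_split /= (euler_homog hp) sumr_const card_ord natrD mulrDl [RHS]addrC -[p *+ 3]mulr_natl.
Qed.

Lemma meval_homog (v : 'I_3 -> K) c l p : p \is l.-homog ->
  meval (fun i => c * v i) p = c ^+ l * meval v p.
Proof.
move=> hp; rewrite /meval /mmap mulr_sumr !big_seq; apply: eq_bigr => m hm.
rewrite mulrCA; congr (_ * _); rewrite -(dhomog_mf hp hm) /= mdegE expr_sum /mmap1 -big_split.
by apply: eq_bigr => i _; rewrite exprMn.
Qed.

Lemma meval_sub (B : 'M[K]_3) (v : 'I_3 -> K) p :
  meval v (sub B p) = meval (fun i => \sum_j B j i * v j) p.
Proof.
elim/mpoly_ring_ind: p => [c|i|p q hp hq|p q hp hq].
- by rewrite subC !mevalC.
- rewrite subX mevalXU (raddf_sum (meval v)); apply: eq_bigr => j _.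
  by rewrite /= mevalZ mevalXU.
- by rewrite rmorphD !mevalD hp hq.
- by rewrite rmorphM !mevalM hp hq.
Qed.

End RungeLenzPolynomials.

(** * Rotation-invariant integration from the moments of monomials *)

Section InvariantFunctional.
Import mpoly.
Variables (K : numFieldType) (M : 'X_{1..3} -> K).
Local Notation P := {mpoly K[3]}.
Implicit Types p q Y Z : P.

Hypothesis M_rot : forall (i j : 'I_3) (m : 'X_{1..3}), i != j ->
  (m j)%:R * M (U_(i) + (m - U_(j)))%MM = (m i)%:R * M (U_(j) + (m - U_(i)))%MM.
Hypothesis M_nn : forall m : 'X_{1..3}, \sum_i M (U_(i) + U_(i) + m)%MM = M m.

(** The functional with moments [M]. The two hypotheses on [M] say that it kills infinitesimal
    rotations and ignores a factor [|x|^2], as integration over the unit sphere does; up to the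
    factor [M 0%MM] they determine all integrals of products of harmonics. *)
Definition Iint p : K := \sum_(m <- msupp p) p@_m * M m.

Lemma IintE s p : uniq s -> {subset msupp p <= s} -> Iint p = \sum_(m <- s) p@_m * M m.
Proof.
move=> us hs; rewrite /Iint [RHS](bigID (mem (msupp p))) /= [X in _ = _ + X]big1 ?addr0.
  rewrite -[RHS]big_filter; apply: perm_big; apply: uniq_perm; rewrite ?filter_uniq //.
  by move=> m; rewrite mem_filter andb_idr // => /hs.
by move=> m /memN_msupp_eq0 ->; rewrite mul0r.
Qed.

Lemma Iint_linear c p q : Iint (c *: p + q) = c * Iint p + Iint q.
Proof.
have us := undup_uniq (msupp p ++ msupp q ++ msupp (c *: p + q)).
rewrite !(IintE us); try by move=> m hm; rewrite mem_undup !mem_cat hm ?orbT.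
rewrite mulr_sumr -big_split.
by apply: eq_bigr => m _ /=; rewrite mcoeffD mcoeffZ mulrDl mulrA.
Qed.

Lemma Iint0 : Iint 0 = 0.
Proof. by rewrite /Iint msupp0 big_nil. Qed.

Lemma IintD p q : Iint (p + q) = Iint p + Iint q.
Proof. by have := Iint_linear 1 p q; rewrite scale1r mul1r. Qed.

Lemma IintZ c p : Iint (c *: p) = c * Iint p.
Proof. by have := Iint_linear c p 0; rewrite Iint0 !addr0. Qed.

Lemma IintN p : Iint (- p) = - Iint p.
Proof. by rewrite -scaleN1r IintZ mulN1r. Qed.

Lemma Iint_sum (F : 'I_3 -> P) : Iint (\sum_i F i) = \sum_i Iint (F i).
Proof. by elim/big_rec2: _ => [|i x y _ <-]; rewrite ?Iint0 ?IintD. Qed.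

Lemma IintX m : Iint 'X_[m] = M m.
Proof. by rewrite /Iint msuppX big_seq1 mcoeffX eqxx mul1r. Qed.

Lemma Iint_rot i j p : Iint (rot i j p) = 0.
Proof.
have [<-|ne] := eqVneq i j; first by rewrite /rot subrr Iint0.
elim/mpoly_lin_ind: p => [|c p q hp hq|m]; first by rewrite raddf0 Iint0.
  by rewrite linearP /= Iint_linear hp hq mulr0 addr0.
rewrite /rot IintD IintN !mderivX -!scalerAr !IintZ -!mpolyXD !IintX M_rot // subrr //.
Qed.

Lemma Iint_nn p : Iint (nn K * p) = Iint p.
Proof.
elim/mpoly_lin_ind: p => [|c p q hp hq|m]; first by rewrite mulr0.
  by rewrite mulrDr -scalerAr !Iint_linear hp hq.
rewrite /nn mulr_suml Iint_sum IintX -[RHS]M_nn; apply: eq_bigr => i _.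
by rewrite expr2 -!mpolyXD IintX.
Qed.

(** Apply the functional to [casimir]: the rotations integrate to zero and the factor [|x|^2]
    disappears. *)
Lemma Iint_lap l p : p \is l.-homog -> Iint (lap p) = (l * l.+1)%:R * Iint p.
Proof.
move=> hp; have /(congr1 Iint) := casimir p; rewrite (wgt_homog _ hp) -mpolyC_nat mul_mpolyC IintZ.
rewrite IintD IintN IintZ Iint_nn => E.
have : 2%:R * (Iint (lap p) - (l * l.+1)%:R * Iint p) = 0.
  by rewrite -E Iint_sum big1 // => i _; rewrite Iint_sum big1 // => j _; exact: Iint_rot.
by move/eqP; rewrite mulf_eq0 pnatr_eq0 subr_eq0 => /eqP.
Qed.

(** The inverse of the double factorial [1 * 3 * ... * (2 l + 1)], the ratio between the normalized
    integral over the sphere and the Fischer pairing in degree [l]. *)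
Fixpoint cc l : K := if l is k.+1 then cc k / (2 * k + 3)%:R else 1.

Lemma homog0_cst p : p \is 0.-homog -> p = p@_0%MM *: 1.
Proof.
move=> hp; apply/mpolyP => m; rewrite mcoeffZ mcoeff1.
have [->|ne] := eqVneq m 0%MM; first by rewrite mulr1.
by rewrite mulr0 (dhomog_nemf_coeff hp) //= mdeg_eq0.
Qed.

Lemma lapM p q : lap (p * q) = lap p * q + 2%:R * (\sum_i p^`M(i) * q^`M(i)) + p * lap q.
Proof.
rewrite /lap mulr_suml mulr_sumr mulr_sumr -!big_split; apply: eq_bigr => i _ /=.
by rewrite !(mderivM, mderivD); ring.
Qed.

Lemma Iint_harm l p : p \is l.+1.-homog -> lap p = 0 -> Iint p = 0.
Proof.
move=> hp lp; have := Iint_lap hp; rewrite lp Iint0 => /esym/eqP.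
by rewrite mulf_eq0 pnatr_eq0 => /eqP.
Qed.

(** For harmonic [Y] and [Z] the Laplacian of [Y Z] is twice the sum of the products of their
    derivatives, and [Iint_lap] recovers the integral of [Y Z] from it. This lowers both degrees by
    one, and [euler] gives the matching relation for the Fischer pairing. *)
Lemma Iint_harmonic l m Y Z : Y \is l.-homog -> Z \is m.-homog -> lap Y = 0 -> lap Z = 0 ->
  Iint (Y * Z) = (l == m)%:R * cc l * fis Y Z * M 0%MM.
Proof.
elim: l m Y Z => [|l IH] [|m] Y Z hY hZ lY lZ.
- rewrite (homog0_cst hY) (homog0_cst hZ) -scalerAl -scalerAr !IintZ mulr1 -mpolyX0 IintX.
  by rewrite fisZl fisC fisZl fisXl mcoeffX /mfact big1 ?eqxx; [rewrite !mul1r mulr1 mulrA | move=> i _; rewrite mnm0E].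
- by rewrite (homog0_cst hY) -scalerAl mul1r IintZ (Iint_harm hZ lZ) mulr0 !mul0r.
- by rewrite (homog0_cst hZ) -scalerAr mulr1 IintZ (Iint_harm hY lY) mulr0 !mul0r.
have hYZ : Y * Z \is (l + m).+2.-homog by rewrite -addnS -addSn; exact: dhomogM.
have := Iint_lap hYZ; rewrite lapM lY lZ mul0r mulr0 add0r addr0 -mpolyC_nat mul_mpolyC IintZ Iint_sum.
have E i : Iint (Y^`M(i) * Z^`M(i)) = (l == m)%:R * cc l * fis Y^`M(i) Z^`M(i) * M 0%MM.
  by apply: IH; rewrite ?deriv_homog // lap_deriv ?lY ?lZ mderiv0.
rewrite (eq_bigr _ (fun i _ => E i)) -mulr_suml -mulr_sumr.
have -> : \sum_i fis Y^`M(i) Z^`M(i) = l.+1%:R * fis Y Z.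
  transitivity (\sum_i fis ('X_i * Y^`M(i)) Z).
    by apply: eq_bigr => i _; rewrite fis_mulX.
  by rewrite -fis_suml euler (wgt_homog _ hY) fisZl.
rewrite eqSS => H.
have n0 : ((l + m).+2 * (l + m).+3)%:R != 0 :> K by rewrite pnatr_eq0.
apply: (mulfI n0); rewrite -H; have [<-|ne] := eqVneq l m; last by rewrite !mul0r !mulr0.
have n3 : (2 * l + 3)%:R != 0 :> K by rewrite addn3 pnatr_eq0.
have -> : ((l + l).+2 * (l + l).+3)%:R = 2%:R * l.+1%:R * (2 * l + 3)%:R :> K.
  by rewrite -!natrM; congr _%:R; lia.
rewrite /=; move: (cc l) (fis Y Z) (M _) (l.+1%:R) ((2 * l + 3)%:R) n3 => b c d e a a0.
by field.
Qed.

End InvariantFunctional.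

Section MomentSymmetry.
Import mpoly.
Variables (K : numFieldType) (N : nat -> nat -> nat -> K).
Hypothesis N12 : forall a b c, b%:R * N a.+1 b.-1 c = a%:R * N a.-1 b.+1 c.
Hypothesis N13 : forall a b c, c%:R * N a.+1 b c.-1 = a%:R * N a.-1 b c.+1.
Hypothesis N23 : forall a b c, c%:R * N a b.+1 c.-1 = b%:R * N a b.-1 c.+1.
Hypothesis Nnn : forall a b c, N a.+2 b c + N a b.+2 c + N a b c.+2 = N a b c.

Definition momfun (m : 'X_{1..3}) : K := N (m 0) (m 1) (m 2%:R).

Let U (i j : 'I_3) : U_(i)%MM j = (i == j) :> nat. Proof. exact: mnm1E. Qed.

Lemma momfun_nn m : \sum_i momfun (U_(i) + U_(i) + m)%MM = momfun m.
Proof. by rewrite sum3 /momfun !mnmDE !U /= !add0n !add1n; exact: Nnn. Qed.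

Lemma momfun_rot (i j : 'I_3) (m : 'X_{1..3}) : i != j ->
  (m j)%:R * momfun (U_(i) + (m - U_(j)))%MM = (m i)%:R * momfun (U_(j) + (m - U_(i)))%MM.
Proof.
rewrite /momfun !mnmDE !mnmBE !U.
by case: (ord3P 0 i) => ->; case: (ord3P 0 j) => ->; rewrite ?add0r ?eqxx //= => _;
  rewrite !(add0n, add1n, subn0, subn1); [exact: N12 | exact: N13 | exact/esym/N12
   | exact: N23 | exact/esym/N13 | exact/esym/N23].
Qed.

End MomentSymmetry.

Section FischerRight.
Import mpoly.
Variable K : comNzRingType.
Implicit Types p q r : {mpoly K[3]}.

Lemma fis0r p : fis p 0 = 0.
Proof. by rewrite fisC fis0l. Qed.

Lemma fis_homog_neq l m p q : p \is l.-homog -> q \is m.-homog -> l != m -> fis p q = 0.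
Proof.
move=> hp hq lm; transitivity (fis p (hpart l q)); last by rewrite (hpart_neq hq lm) fis0r.
by rewrite -{1}(hpart_id hp); exact: fis_wgt.
Qed.

Lemma harm_ind (Q : {mpoly K[3]} -> Prop) : Q 0 -> (forall p q, Q p -> Q q -> Q (p + q)) ->
    (forall l p, p \is l.-homog -> lap p = 0 -> Q p) ->
  forall p, lap p = 0 -> Q p.
Proof.
move=> Q0 QD Qh p hp; rewrite (sum_hpart (leqnn (msize p))); apply: big_ind => // l _.
by apply: (Qh l); [exact: hpart_homog | by rewrite lap_wgt hp raddf0].
Qed.

End FischerRight.

(** * The Wronskian form as a weighted Fischer pairing *)

Section WronskianForm.
Import mpoly.
Variable K : numFieldType.

(** Distinct degrees are orthogonal, so only products of equal degrees survive, and there the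
    weights combine into the radial Wronskian [w]. *)
Lemma Iint_wgt (M : 'X_{1..3} -> K) (z : K) (w a a' b b' : nat -> K) (p q : {mpoly K[3]}) :
    (forall l m Y Z, Y \is l.-homog -> Z \is m.-homog -> lap Y = 0 -> lap Z = 0 ->
       Iint M (Y * Z) = z * ((l == m)%:R * cc K l * fis Y Z)) ->
    (forall l, a' l * b l - a l * b' l = w l) ->
    lap p = 0 -> lap q = 0 ->
  Iint M (wgt a' p * wgt b q - wgt a p * wgt b' q) =
  z * fis (wgt (fun l => w l * cc K l) p) q.
Proof.
move=> hM hw hp hq; move: p hp; apply: harm_ind => [|p1 p2 h1 h2|l p pl hp].
- by rewrite !raddf0 !mul0r subr0 fis0l Iint0 mulr0.
- rewrite !raddfD /= !mulrDl opprD addrACA IintD h1 h2 -mulrDr.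
  by congr (z * _); apply: esym; exact: fisDl.
move: q hq; apply: harm_ind => [|q1 q2 h1 h2|m q qm hq].
- by rewrite !raddf0 !mulr0 subr0 Iint0.
- by rewrite !raddfD /= !mulrDr opprD addrACA IintD h1 h2.
rewrite !(wgt_homog _ pl) !(wgt_homog _ qm) -!scalerAl -!scalerAr !scalerA -scalerBl IintZ.
rewrite (hM _ _ _ _ pl qm hp hq) fisZl.
have [->|lm] := eqVneq l m; last first.
  rewrite !mul0r !mulr0 (fis_homog_neq pl qm lm) ?mulr0 //.
rewrite hw mul1r; move: (w m) (cc K m) (fis p q) => x y t; ring.
Qed.

End WronskianForm.

(** * Evaluation at a value of the spectral parameter *)

Section Specialization.
Import mpoly.
Variable R : realType.
Local Notation C := R[i].
Local Notation O := {poly C}.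
Local Notation PO := {mpoly O[3]}.
Local Notation PC := {mpoly C[3]}.

Lemma fis_nondeg (ka : nat -> C) (p : PC) : (forall l, ka l != 0) -> lap p = 0 ->
  (forall q, lap q = 0 -> fis (wgt ka p) q = 0) -> p = 0.
Proof.
move=> ka0 hp H; suff E : wgt ka p = 0.
  rewrite -[p]scale1r -(wgt_cst 1); transitivity (wgt (fun l => (ka l)^-1 * ka l) p).
    by apply: eq_wgt => l; rewrite mulVf.
  by rewrite -wgt_comp E raddf0.
by apply: fis_eq0; [rewrite lap_wgt hp raddf0 | exact: H].
Qed.

Lemma wgt_anti (a : nat -> C) (p q : PC) : fis (wgt a p) q = fis (wgt a q) p.
Proof. by rewrite fis_wgt fisC. Qed.

Lemma poly_eq0_horner (p : O) : (forall x, p.[x] = 0) -> p = 0.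
Proof.
move=> H; apply/eqP/negPn/negP => p0.
pose rs : seq C := [seq n%:R | n <- iota 0 (size p)].
have A : all (root p) rs by apply/allP => x _; rewrite /root H.
have U : uniq rs.
  by rewrite map_inj_uniq ?iota_uniq // => m n /eqP; rewrite eqr_nat => /eqP.
by have := max_poly_roots p0 A U; rewrite size_map size_iota ltnn.
Qed.

Section At.
Variable lam : C.

Definition spec (p : PO) : PC := map_mpoly (horner_eval lam) p.

Lemma specD p q : spec (p + q) = spec p + spec q.
Proof. exact: raddfD. Qed.

Lemma specN p : spec (- p) = - spec p.
Proof. exact: raddfN. Qed.

Lemma specZ (c : O) p : spec (c *: p) = c.[lam] *: spec p.
Proof. by apply: map_mpoly_scale => d; exact: hornerM. Qed.

Lemma spec_sum (I : Type) (s : seq I) (Q : pred I) (F : I -> PO) :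
  spec (\sum_(i <- s | Q i) F i) = \sum_(i <- s | Q i) spec (F i).
Proof. exact: raddf_sum. Qed.

Lemma lap_spec p : lap p = 0 -> lap (spec p) = 0.
Proof. by move=> hp; rewrite /spec -map_mpoly_lap hp raddf0. Qed.

Lemma spec_rot i j p : spec (rot i j p) = rot i j (spec p).
Proof. exact: map_mpoly_rot. Qed.

Lemma spec_sub A p : spec (sub (map_mx polyC (rho A)) p) = sub (rho A) (spec p).
Proof. by apply: map_mpoly_sub => i j d; rewrite mxE; apply: etrans (hornerM _ _ _) _; rewrite hornerC. Qed.

Lemma spec_wgt a p : spec (wgt a p) = wgt (fun l => (a l).[lam]) (spec p).
Proof. by apply: map_mpoly_wgt => l d; exact: hornerM. Qed.

Lemma spec_deriv i p : spec p^`M(i) = (spec p)^`M(i).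
Proof. exact: map_mpoly_deriv. Qed.

Lemma spec_mulX i p : spec ('X_i * p) = 'X_i * spec p.
Proof. exact: map_mpoly_mulX. Qed.

Lemma spec_nn p : spec (nn O * p) = nn C * spec p.
Proof.
rewrite /nn !mulr_suml spec_sum; apply: eq_bigr => i _.
by rewrite -!mulrA !spec_mulX.
Qed.

Lemma spec_up i p : spec (up i p) = up i (spec p).
Proof.
have E : spec (wgt (@twol1 O) p) = wgt (@twol1 C) (spec p).
  apply: etrans (spec_wgt _ _) _; apply: eq_wgt => l.
  exact: (rmorph_nat (horner_eval lam)).
apply: etrans (specD _ _) _; congr (_ + _).
  by apply: etrans (spec_mulX _ _) _; rewrite E.
apply: etrans (specN _) _; congr (- _); apply: etrans (spec_nn _) _.
by rewrite spec_deriv.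
Qed.

Lemma spec_rl al be i p : spec (rl al be i p) =
  rl (fun l => (al l).[lam]) (fun l => (be l).[lam]) i (spec p).
Proof. by rewrite /rl specD spec_up spec_deriv !spec_wgt. Qed.

Lemma spec_gfun al be X p : spec (gfun al be (iO R) X p) =
  \sum_i ((X.1 0 i).[lam] *: rot (i + 1) (i + 2%:R) (spec p) +
    ((X.2 0 i).[lam] * (0 +i* 1)) *:
      rl (fun l => (al l).[lam]) (fun l => (be l).[lam]) i (spec p)).
Proof.
rewrite /gfun specD specZ /Lsum /Rsum !spec_sum big_split /=; congr (_ + _).
  by apply: eq_bigr => i _; rewrite specZ /gL spec_rot.
rewrite /iO hornerC scaler_sumr; apply: eq_bigr => i _.
by rewrite specZ spec_rl scalerA mulrC.
Qed.

Lemma horner_fis p q : (fis p q).[lam] = fis (spec p) (spec q).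
Proof. exact: (map_mpoly_fis (horner_eval lam)). Qed.

Lemma spec_lift (P : PC) : spec (map_mpoly polyC P) = P.
Proof. by apply/mpolyP => m; rewrite !mcoeff_map_mpoly; exact: hornerC. Qed.

Lemma spec_hO l a : spec (val (hO R a)) = @hb _ (unitC R) l a.
Proof. exact: map_mpoly_hb. Qed.

End At.

Lemma spec_inj p : (forall lam, spec lam p = 0) -> p = 0.
Proof.
move=> H; apply/mpolyP => m; rewrite mcoeff0; apply: poly_eq0_horner => x.
by have /mpolyP/(_ m) := H x; rewrite mcoeff_map_mpoly mcoeff0.
Qed.

Lemma lap_lift (P : PC) : lap P = 0 -> lap (map_mpoly polyC P) = 0 :> PO.
Proof. by move=> hP; rewrite -map_mpoly_lap hP raddf0. Qed.

Definition liftH (P : PC) (hP : lap P = 0) : HO R := mkHO (lap_lift hP).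

Lemma cc_neq0 l : cc C l != 0.
Proof.
elim: l => [|l IH]; first exact: oner_neq0.
by rewrite /= mulf_neq0 // invr_eq0 pnatr_eq0 addn3.
Qed.

End Specialization.

From mathcomp Require Import all_classical all_reals all_analysis.
Import numFieldNormedType.Exports.
Import (canonicals, coercions, hints) mpoly.
Local Open Scope classical_set_scope.
Local Open Scope ring_scope.
Local Open Scope complex_scope.

(** * Power series and radial functions *)

Section ComplexDerivative.
Variable R : realType.
Local Notation C := R[i].
Local Notation Re := (@complex.Re R).
Local Notation Im := (@complex.Im R).
Implicit Types (f g : R -> C) (t : R) (z : C).

Lemma eq_ReIm z w : Re z = Re w -> Im z = Im w -> z = w.
Proof. by move=> hr hi; apply/eqP; rewrite eq_complex hr hi !eqxx. Qed.

Lemma Re_Im z : Re z +i* Im z = z.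
Proof. by case: z. Qed.

Lemma Re_mul z w : Re (z * w) = Re z * Re w - Im z * Im w.
Proof. by case: z w => [? ?] []. Qed.

Lemma Im_mul z w : Im (z * w) = Re z * Im w + Im z * Re w.
Proof. by case: z w => [? ?] []. Qed.

Lemma Re_add z w : Re (z + w) = Re z + Re w.
Proof. by case: z w => [? ?] []. Qed.

Lemma Im_add z w : Im (z + w) = Im z + Im w.
Proof. by case: z w => [? ?] []. Qed.

(** Existence and value of the derivative in one relation, so that the rules of calculus compose
    without separate differentiability conditions. *)
Definition cder f t (d : C) : Prop :=
  is_derive t (1 : R) (fun s => Re (f s)) (Re d) /\
  is_derive t (1 : R) (fun s => Im (f s)) (Im d).

Lemma cder_eq f t d e : cder f t d -> d = e -> cder f t e.
Proof. by move=> + <-. Qed.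

Lemma cder_unique f t d e : cder f t d -> cder f t e -> d = e.
Proof.
by move=> [[_ h1] [_ h2]] [[_ h3] [_ h4]]; apply: eq_ReIm; [rewrite -h1 -h3 | rewrite -h2 -h4].
Qed.

Lemma cder_near f g t d : {near t, f =1 g} -> cder f t d -> cder g t d.
Proof.
move=> fg [hr hi]; split; [apply: near_eq_is_derive hr | apply: near_eq_is_derive hi];
  by apply: filterS fg => s /= ->.
Qed.

Lemma cder_pos f g t d : 0 < t -> (forall s, 0 < s -> f s = g s) -> cder f t d -> cder g t d.
Proof.
move=> t0 fg; apply: cder_near; near=> s; apply: fg; near: s.
exact: lt_nbhsr.
Unshelve. all: by end_near. Qed.

Lemma cder_derivable f t d : cder f t d -> cderivable f t.
Proof. by move=> [[h1 _] [h2 _]]; exact: conj h1 h2. Qed.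

Lemma cder_val f t d : cder f t d -> cderive f t = d.
Proof.
by move=> [[_ h1] [_ h2]]; apply: eq_ReIm; rewrite /cderive /= derive1E ?h1 ?h2.
Qed.

Lemma cderivable_cder f t : cderivable f t -> cder f t (cderive f t).
Proof.
by move=> [h1 h2]; split; rewrite /cderive /= derive1E; exact: derivableP.
Qed.

Lemma cder_cst z t : cder (fun=> z) t 0.
Proof. by split; exact: is_derive_cst. Qed.

Lemma cderD f g t d e : cder f t d -> cder g t e -> cder (fun s => f s + g s) t (d + e).
Proof.
move=> [fr fi] [gr gi]; split.
  have -> : (fun s => Re (f s + g s)) = (fun s => Re (f s)) + (fun s => Re (g s)).
    by apply/funext => s; rewrite Re_add.
  by rewrite Re_add; exact: is_deriveD.
have -> : (fun s => Im (f s + g s)) = (fun s => Im (f s)) + (fun s => Im (g s)).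
  by apply/funext => s; rewrite Im_add.
by rewrite Im_add; exact: is_deriveD.
Qed.

Lemma cderM f g t d e : cder f t d -> cder g t e ->
  cder (fun s => f s * g s) t (d * g t + f t * e).
Proof.
move=> [fr fi] [gr gi]; split.
  have -> : (fun s => Re (f s * g s)) = (fun s => Re (f s)) * (fun s => Re (g s)) -
      (fun s => Im (f s)) * (fun s => Im (g s)).
    by apply/funext => s; rewrite Re_mul.
  apply: is_derive_eq; rewrite Re_add !Re_mul /GRing.scale /=.
  by move: (Re (f t)) (Im (f t)) (Re (g t)) (Im (g t)) (Re d) (Im d) (Re e) (Im e) => *; ring.
have -> : (fun s => Im (f s * g s)) = (fun s => Re (f s)) * (fun s => Im (g s)) +
    (fun s => Im (f s)) * (fun s => Re (g s)).
  by apply/funext => s; rewrite Im_mul.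
have E : Im (d * g t + f t * e) = Re d * Im (g t) + Im d * Re (g t) +
    (Re (f t) * Im e + Im (f t) * Re e) by rewrite Im_add !Im_mul.
rewrite E; apply: is_derive_eq; rewrite /GRing.scale /=; clear E.
by move: (Re (f t)) (Im (f t)) (Re (g t)) (Im (g t)) (Re d) (Im d) (Re e) (Im e) => *; ring.
Qed.

Lemma cderZ z f t d : cder f t d -> cder (fun s => z * f s) t (z * d).
Proof. by move=> fd; apply: cder_eq (cderM (cder_cst z t) fd) _; rewrite mul0r add0r. Qed.

Lemma cderN f t d : cder f t d -> cder (fun s => - f s) t (- d).
Proof.
move=> fd; rewrite (_ : (fun s => - f s) = (fun s => -1 * f s)).
  by rewrite -[- d]mulN1r; exact: cderZ.
by apply/funext => s; rewrite mulN1r.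
Qed.

Lemma cderB f g t d e : cder f t d -> cder g t e -> cder (fun s => f s - g s) t (d - e).
Proof. by move=> fd /cderN; exact: cderD. Qed.

Lemma cder_real (u : R -> R) t d : is_derive t (1 : R) u d -> cder (fun s => (u s)%:C) t d%:C.
Proof. by move=> ud; split => //; exact: is_derive_cst. Qed.

Lemma cder_id t : cder (fun s => s%:C) t 1.
Proof. exact: cder_real. Qed.

Lemma cder_comp f (u : R -> R) t d e : cder f (u t) d -> is_derive t (1 : R) u e ->
  cder (fun s => f (u s)) t (d * e%:C).
Proof.
move=> [fr fi] ue; split; rewrite ?Re_mul ?Im_mul /= mulr0 ?subr0 ?add0r.
  exact: (@is_derive1_comp _ (fun s => Re (f s)) u).
exact: (@is_derive1_comp _ (fun s => Im (f s)) u).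
Qed.

Lemma cder_pow n t : cder (fun s => s%:C ^+ n) t (n%:R * t%:C ^+ n.-1).
Proof.
rewrite (_ : (fun s => _) = fun s => (s ^+ n)%:C); last first.
  by apply/funext => s; rewrite rmorphXn.
apply: cder_eq (cder_real (d := n%:R * t ^+ n.-1) _) _.
  rewrite (_ : (fun s => _) = (id : R -> R) ^+ n); last by rewrite exprfctE.
  by apply: is_derive_eq; rewrite /GRing.scale /= mulr1 ?mulr_natl.
by rewrite rmorphM rmorphXn rmorph_nat.
Qed.

Lemma cder_inv t : 0 < t -> cder (fun s => (s%:C)^-1) t (- (t%:C ^- 2)).
Proof.
move=> t0; rewrite (_ : (fun s => _) = fun s => (s^-1)%:C); last first.
  by apply/funext => s; rewrite fmorphV.
apply: cder_eq (cder_real (d := - t ^- 2) _) _.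
  by apply: is_derive_eq; [exact: is_deriveV (lt0r_neq0 t0) (is_derive_id _ _) |
    rewrite /GRing.scale /= mulr1].
by rewrite rmorphN fmorphV rmorphXn.
Qed.

Lemma cder_invX n t : 0 < t -> cder (fun s => (s%:C) ^- n) t (- (n%:R * t%:C ^- n.+1)).
Proof.
move=> t0; have tC : t%:C != 0 :> C by rewrite fmorph_eq0 lt0r_neq0.
elim: n => [|n IH].
  rewrite mul0r oppr0 (_ : (fun s => _) = fun=> 1); first exact: cder_cst.
  by apply/funext => s; rewrite expr0 invr1.
rewrite (_ : (fun s => _) = fun s => (s%:C) ^- n * (s%:C)^-1); last first.
  by apply/funext => s; rewrite -invfM -exprSr.
apply: cder_eq (cderM IH (cder_inv t0)) _.
rewrite !exprS expr0 mulr1 -[n.+1%:R]natr1 !invfM.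
by ring.
Qed.

Lemma cder_continuous f t d : cder f t d ->
  {for t, continuous (fun s => Re (f s))} /\ {for t, continuous (fun s => Im (f s))}.
Proof.
by move=> [[h1 _] [h2 _]]; split; apply: differentiable_continuous; exact/derivable1_diffP.
Qed.

(** The exponential reparametrizes the positive half-line by the whole line. *)
Lemma cder0_cst f : (forall t, 0 < t -> cder f t 0) -> forall s t, 0 < s -> 0 < t -> f s = f t.
Proof.
move=> h; have E x y : f (expR x) = f (expR y).
  have H x' : cder (fun s => f (expR s)) x' 0.
    have := cder_comp (h _ (expR_gt0 x')) (is_derive_expR x').
    by rewrite mul0r.
  apply: eq_ReIm.
    by apply: (@is_derive_0_is_cst _ (fun x => Re (f (expR x))) x y) => z; have [] := H z.
  by apply: (@is_derive_0_is_cst _ (fun x => Im (f (expR x))) x y) => z; have [] := H z.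
by move=> s t s0 t0; rewrite -(lnK s0) -(lnK t0).
Qed.

(** Used for Wronskians: they are constant for positive [t], and once written by an expression that
    is differentiable at [0] their value can be read off there. *)
Lemma cder_limit f d z : cder f 0 d -> (forall t, 0 < t -> f t = z) -> f 0 = z.
Proof.
move=> /cder_continuous[cr ci] h.
have L (u : R -> R) : {for 0, continuous u} -> forall a, (forall t, 0 < t -> u t = a) -> u 0 = a.
  move=> cu a ua; have c1 : u @ 0^'+ --> u 0 by exact: cvg_at_right_filter.
  have c2 : u @ 0^'+ --> a.
    apply: cvg_near_cst; near=> t; apply: ua.
    by near: t; exact: nbhs_right_gt.
  exact: (cvg_unique _ c1 c2).
by apply: eq_ReIm; [apply: (L _ cr) | apply: (L _ ci)] => t t0; rewrite h.
Unshelve. all: by end_near. Qed.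

End ComplexDerivative.

Section PowerSeries.
Variable R : realType.
Local Notation C := R[i].
Local Notation Re := (@complex.Re R).
Local Notation Im := (@complex.Im R).

Definition cmod (z : C) : R := Re `|z|.

Lemma cmodE z : (cmod z)%:C = `|z|.
Proof. by rewrite /cmod normc_def. Qed.

Lemma cmod_ge0 z : 0 <= cmod z.
Proof. by rewrite -lecR cmodE normr_ge0. Qed.

Lemma cmodM z w : cmod (z * w) = cmod z * cmod w.
Proof. by apply: (@complexI R); rewrite rmorphM /= !cmodE normrM. Qed.

Lemma cmodD z w : cmod (z + w) <= cmod z + cmod w.
Proof. by rewrite -lecR rmorphD /= !cmodE ler_normD. Qed.

Lemma cmodN z : cmod (- z) = cmod z.
Proof. by rewrite /cmod normrN. Qed.

Lemma cmod_nat n : cmod n%:R = n%:R.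
Proof. by apply: (@complexI R); rewrite cmodE rmorph_nat normr_nat. Qed.

Lemma cmod0 : cmod 0 = 0.
Proof. by rewrite /cmod normr0. Qed.

Lemma Re_cmod z : `|Re z| <= cmod z.
Proof.
rewrite /cmod normc_def /= -(sqrtr_sqr (Re z)) ler_sqrt ?addr_ge0 ?sqr_ge0 //.
by rewrite lerDl sqr_ge0.
Qed.

Lemma Im_cmod z : `|Im z| <= cmod z.
Proof.
rewrite /cmod normc_def /= -(sqrtr_sqr (Im z)) ler_sqrt ?addr_ge0 ?sqr_ge0 //.
by rewrite lerDr sqr_ge0.
Qed.

(** Infinite radius of convergence, stated as boundedness of the terms at every radius: a form that
    passes easily through shifts, derivatives and recurrences. *)
Definition fast (c : nat -> R) : Prop :=
  forall T, 0 < T -> exists M, forall k, `|c k| * T ^+ k <= M.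

Lemma fast_cvg c x : fast c -> cvgn (series (fun k => `|c k * x ^+ k|)).
Proof.
(* The bound at twice the radius compares the series with a geometric one of ratio [1/2]. *)
move=> fc; have T0 : 0 < 2 * (`|x| + 1) by rewrite mulr_gt0 // ltr_wpDl.
have [M hM] := fc _ T0.
have M0 : 0 <= M by apply: le_trans (hM 0%N); rewrite mulr_ge0 // exprn_ge0 // ltW.
apply: (@series_le_cvg _ _ (geometric M (2^-1))) => [//|n||].
- by rewrite /geometric /= mulr_ge0 // exprn_ge0 // invr_ge0.
- move=> n; rewrite /geometric /= exprVn ler_pdivlMr ?exprn_gt0 // normrM normrX -mulrA.
  apply: le_trans (hM n); rewrite ler_wpM2l // exprMn mulrC ler_wpM2l ?exprn_ge0 //.
  by rewrite lerXn2r ?nnegrE ?addr_ge0 // lerDl.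
- by apply: is_cvg_geometric_series; rewrite ger0_norm ?invr_ge0 // invf_lt1 // ltr1n.
Qed.

Lemma fast_pseries c x : fast c -> cvgn (pseries c x).
Proof. by move=> /fast_cvg h; apply: normed_cvg; exact: h. Qed.

Lemma fast_diffs c : fast c -> fast (pseries_diffs c).
Proof.
(* The radius is doubled so that a power of [2] absorbs the factor [k + 1] produced by
   differentiation. *)
move=> fc T T0; have T1 : 0 < 2 * (T + 1) by rewrite mulr_gt0 // addr_gt0.
have [M hM] := fc _ T1; exists M => k; apply: le_trans (hM k.+1).
rewrite /pseries_diffs normrM normr_nat [_ * `|_|]mulrC -mulrA ler_wpM2l //.
rewrite exprMn; apply: ler_pM => //; first by rewrite exprn_ge0 // ltW.
  by rewrite -natrX ler_nat ltnW // ltn_expl.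
apply: (@le_trans _ _ ((T + 1) ^+ k)).
  by rewrite lerXn2r ?nnegrE ?addr_ge0 ?(ltW T0) // lerDl.
by rewrite exprS ler_peMl ?exprn_ge0 ?addr_ge0 ?(ltW T0) // lerDr ltW.
Qed.

Lemma pseries_derive c x : fast c ->
  is_derive x (1 : R) (fun x => limn (pseries c x)) (limn (pseries (pseries_diffs c) x)).
Proof.
move=> fc; apply: (@pseries_snd_diffs _ c (`|x| + 1)); try exact: fast_pseries.
- by apply: fast_pseries; exact: fast_diffs.
- by apply: fast_pseries; do 2!apply: fast_diffs.
by rewrite [X in _ < X]ger0_norm ?addr_ge0 // ltrDl.
Qed.

Lemma pseries_rec c x : fast c ->
  limn (pseries c x) = c 0%N + x * limn (pseries (fun k => c k.+1) x).
Proof.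
move=> fc; have fc1 : fast (fun k => c k.+1).
  move=> T T0; have [M hM] := fc _ T0; exists (M / T) => k.
  by rewrite ler_pdivlMr // -mulrA -exprSr.
apply/cvg_lim => //; rewrite -(cvg_shiftS (pseries c x)).
have -> : [sequence (pseries c x) n.+1]_n = cst (c 0%N) + x \*o pseries (fun k => c k.+1) x.
  apply/funext => n; rewrite /pseries /series /= big_nat_recl //= expr0 mulr1; congr (_ + _).
  transitivity (x * \sum_(0 <= k < n) c k.+1 * x ^+ k); last by [].
  by rewrite mulr_sumr; apply: eq_bigr => k _; rewrite exprS mulrCA.
apply: cvgD; first exact: cvg_cst.
by apply: cvgMl_tmp; exact: fast_pseries.
Qed.

Lemma pseries_linear k c d x : fast c -> fast d ->
  limn (pseries (fun n => k * c n + d n) x) = k * limn (pseries c x) + limn (pseries d x).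
Proof.
move=> fc fd; have -> : pseries (fun n => k * c n + d n) x = k *: pseries c x + pseries d x.
  rewrite /pseries -seriesZ -seriesD; congr series; apply/funext => n.
  rewrite -[RHS]/(k * (c n * x ^+ n) + d n * x ^+ n) /=.
  by rewrite mulrA -mulrDl.
rewrite limD ?limZl_tmp //; try exact: fast_pseries.
by apply: cvgZl_tmp; exact: fast_pseries.
Qed.

Definition cfast (a : nat -> C) : Prop := fast (cmod \o a).

Lemma cfast_Re a : cfast a -> fast (Re \o a).
Proof.
move=> fa T T0; have [M hM] := fa T T0; exists M => k; apply: le_trans (hM k).
by rewrite ler_wpM2r ?exprn_ge0 ?(ltW T0) //= [X in _ <= X]ger0_norm ?cmod_ge0 // Re_cmod.
Qed.

Lemma cfast_Im a : cfast a -> fast (Im \o a).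
Proof.
move=> fa T T0; have [M hM] := fa T T0; exists M => k; apply: le_trans (hM k).
by rewrite ler_wpM2r ?exprn_ge0 ?(ltW T0) //= [X in _ <= X]ger0_norm ?cmod_ge0 // Im_cmod.
Qed.

Lemma cfast_entire a : cfast a -> entire_coef a.
Proof.
move=> fa t t0; rewrite (_ : (fun k => _) = fun k => `|cmod (a k) * t ^+ k|).
  exact: fast_cvg.
by apply/funext => k; rewrite [RHS]ger0_norm // mulr_ge0 ?exprn_ge0 // cmod_ge0.
Qed.

Lemma entire_cfast a : entire_coef a -> cfast a.
Proof.
move=> ea T T0; have /cvg_series_cvg_0/cvgP/cvg_seq_bounded := ea T (ltW T0).
move=> [B [_ /(_ (B + 1))]]; rewrite ltrDl => /(_ ltr01) h; exists (B + 1) => k.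
have := h k I; rewrite /= ger0_norm // ?mulr_ge0 ?exprn_ge0 ?(ltW T0) ?cmod_ge0 //.
by rewrite ger0_norm ?cmod_ge0.
Qed.

Lemma power_seriesE a t : power_series a t =
  limn (pseries (Re \o a) t) +i* limn (pseries (Im \o a) t).
Proof.
rewrite /power_series /pseries; congr (limn (series _) +i* limn (series _));
  apply/funext => k; rewrite -rmorphXn ?Re_mul ?Im_mul /= mulr0 ?subr0 ?add0r //.
Qed.

Definition cdiffs (a : nat -> C) k := k.+1%:R * a k.+1.

Lemma cfast_diffs a : cfast a -> cfast (cdiffs a).
Proof.
move=> /fast_diffs; congr fast; apply/funext => k.
by rewrite /pseries_diffs /cdiffs /= cmodM cmod_nat.
Qed.

Lemma cfast_shift a : cfast a -> cfast (fun k => a k.+1).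
Proof.
move=> fa T T0; have [M hM] := fa _ T0; exists (M / T) => k.
by rewrite ler_pdivlMr // -mulrA -exprSr; exact: hM.
Qed.

Lemma cfast_lin z a b : cfast a -> cfast b -> cfast (fun k => z * a k + b k).
Proof.
move=> fa fb T T0; have [M hM] := fa _ T0; have [N hN] := fb _ T0.
exists (cmod z * M + N) => k; apply: le_trans (_ : cmod z * (`|(cmod \o a) k| * T ^+ k) +
    `|(cmod \o b) k| * T ^+ k <= _); last by rewrite lerD // ler_wpM2l // cmod_ge0.
rewrite mulrA -mulrDl ler_wpM2r ?exprn_ge0 ?(ltW T0) //= !ger0_norm ?cmod_ge0 //.
by rewrite -cmodM cmodD.
Qed.

Lemma power_series_der a t : cfast a -> cder (power_series a) t (power_series (cdiffs a) t).
Proof.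
move=> fa; rewrite (_ : power_series a = fun t =>
    limn (pseries (Re \o a) t) +i* limn (pseries (Im \o a) t)); last first.
  by apply/funext => s; rewrite power_seriesE.
split; rewrite power_seriesE /=.
  rewrite (_ : Re \o cdiffs a = pseries_diffs (Re \o a)); last first.
    apply/funext => k; rewrite /pseries_diffs /cdiffs /= Re_mul -(rmorph_nat (real_complex R)) /=.
    by rewrite mul0r subr0.
  exact/pseries_derive/cfast_Re.
rewrite (_ : Im \o cdiffs a = pseries_diffs (Im \o a)); last first.
  apply/funext => k; rewrite /pseries_diffs /cdiffs /= Im_mul -(rmorph_nat (real_complex R)) /=.
  by rewrite mul0r addr0.
exact/pseries_derive/cfast_Im.
Qed.

Lemma power_series_rec a t : cfast a ->
  power_series a t = a 0%N + t%:C * power_series (fun k => a k.+1) t.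
Proof.
move=> fa; rewrite !power_seriesE; apply: eq_ReIm; rewrite ?Re_add ?Im_add ?Re_mul ?Im_mul /=.
  by rewrite mul0r subr0 (pseries_rec _ (cfast_Re fa)).
by rewrite mul0r addr0 (pseries_rec _ (cfast_Im fa)).
Qed.

Lemma power_series0 a : cfast a -> power_series a 0 = a 0%N.
Proof. by move=> fa; rewrite power_series_rec // mul0r addr0. Qed.

Lemma fastZ k c : fast c -> fast (fun n => k * c n).
Proof.
move=> fc T T0; have [M hM] := fc T T0; exists (`|k| * M) => n.
by rewrite normrM -mulrA ler_wpM2l.
Qed.

Lemma fastD c d : fast c -> fast d -> fast (fun n => c n + d n).
Proof.
move=> fc fd T T0; have [M hM] := fc T T0; have [N hN] := fd T T0; exists (M + N) => n.
apply: le_trans (lerD (hM n) (hN n)); rewrite -mulrDl ler_wpM2r ?ler_normD //.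
by rewrite exprn_ge0 // ltW.
Qed.

Lemma power_series_lin z a b t : cfast a -> cfast b ->
  power_series (fun k => z * a k + b k) t = z * power_series a t + power_series b t.
Proof.
move=> fa fb; have [ra ia] := (cfast_Re fa, cfast_Im fa).
have [rb ib] := (cfast_Re fb, cfast_Im fb); rewrite !power_seriesE.
apply: eq_ReIm; rewrite ?Re_add ?Im_add ?Re_mul ?Im_mul /=.
  rewrite (_ : Re \o _ = fun n => Re z * (Re \o a) n + (- Im z * (Im \o a) n + (Re \o b) n)).
    rewrite !pseries_linear //; [by ring|].
    by apply: fastD => //; exact: fastZ.
  by apply/funext => n; rewrite /= Re_add Re_mul; ring.
rewrite (_ : Im \o _ = fun n => Re z * (Im \o a) n + (Im z * (Re \o a) n + (Im \o b) n)).
  rewrite !pseries_linear //; [by ring|].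
  by apply: fastD => //; exact: fastZ.
by apply/funext => n; rewrite /= Im_add Im_mul; ring.
Qed.

End PowerSeries.

(** * Regular and singular radial solutions *)

Section Shift.
Variable R : realType.
Local Notation C := R[i].
Implicit Types (a b w : nat -> C).

(** Multiplication by the variable, on the sequence of coefficients. *)
Definition sh a k : C := if k is j.+1 then a j else 0.

Lemma cfast_sh a : cfast a -> cfast (sh a).
Proof.
move=> fa T T0; have [M hM] := fa T T0; exists (M * T) => -[|k] /=.
  rewrite cmod0 normr0 mul0r mulr_ge0 ?(ltW T0) //; apply: le_trans (hM 0%N).
  by rewrite mulr_ge0 // exprn_ge0 // ltW.
by rewrite exprSr mulrA ler_wpM2r ?(ltW T0) //; exact: hM.
Qed.

Lemma cfast_iter_sh n a : cfast a -> cfast (iter n sh a).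
Proof. by move=> fa; elim: n => //= n; exact: cfast_sh. Qed.

Lemma ps_sh a t : cfast a -> power_series (sh a) t = t%:C * power_series a t.
Proof. by move=> fa; rewrite power_series_rec ?add0r //; exact: cfast_sh. Qed.

Lemma ps_iter_sh n a t : cfast a ->
  power_series (iter n sh a) t = t%:C ^+ n * power_series a t.
Proof.
move=> fa; elim: n => [|n IH] /=; first by rewrite mul1r.
by rewrite ps_sh ?IH ?mulrA ?exprS //; exact: cfast_iter_sh.
Qed.

Lemma iter_sh_lt n a k : (k < n)%N -> iter n sh a k = 0.
Proof. by elim: n k => // n IH [|k] //= /IH. Qed.

Lemma iter_sh_add n a k : iter n sh a (n + k)%N = a k.
Proof. by elim: n => //= n ->. Qed.

Lemma iter_shS n a : sh (iter n sh a) = iter n sh (sh a).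
Proof. by elim: n => //= n ->. Qed.

Lemma sh_cdiffs a k : sh (cdiffs a) k = k%:R * a k.
Proof. by case: k => [|k] //=; rewrite mul0r. Qed.

(** Once [k] exceeds a constant depending on the radius [T], the growth of [q] beats the other
    coefficients of the recurrence, so that a bound on the weighted terms before [k] passes to the
    term [k]. *)
Lemma rec_fast (q b w : nat -> C) (al be : C) K :
    (forall k, (K <= k)%N -> k%:R <= cmod (q k)) -> cfast w ->
    (forall k, q k * b k + al * sh b k + be * sh (sh b) k + w k = 0) ->
  cfast b.
Proof.
move=> hq fw hb T T0; have [Mw hw] := fw T T0.
have Tk k : 0 <= T ^+ k by rewrite exprn_ge0 // ltW.
(* With [M] bounding the earlier weighted terms and the forcing, the recurrence gives
   [k B_k <= x M]; hence [B_k <= M] as soon as [k] is at least [x]. *)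
pose x := cmod al * T + cmod be * T ^+ 2 + 1.
have x0 : 0 <= x by rewrite !addr_ge0 ?mulr_ge0 ?cmod_ge0 // ltW.
pose N := maxn K (Num.bound x).
pose B k := cmod (b k) * T ^+ k.
have B0 k : 0 <= B k by rewrite mulr_ge0 ?cmod_ge0.
pose M := \sum_(i < N.+2) B i + Mw.
have Mw0 : 0 <= Mw by apply: le_trans (hw 0%N); rewrite mulr_ge0.
have MwM : Mw <= M by rewrite lerDr sumr_ge0.
have small k : (k < N.+2)%N -> B k <= M.
  move=> hk; rewrite /M (bigD1 (Ordinal hk)) //= -addrA lerDl addr_ge0 // sumr_ge0 //.
exists M => k; rewrite /= ger0_norm ?cmod_ge0 // -/(B k).
have [n] := ubnP k; elim: n k => // n IH k; rewrite ltnS => kn.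
have [/small//|hk] := ltnP k N.+2.
case: k hk kn => [|[|k]] // hk kn.
have k0 : 0 < (k.+2%:R : R) by rewrite ltr0n.
rewrite -(ler_pM2l k0).
have Nk : (N <= k.+2)%N by apply: leq_trans hk; rewrite -addn2 leq_addr.
have KN : (K <= k.+2)%N by apply: leq_trans Nk; exact: leq_maxl.
apply: (@le_trans _ _ (cmod (q k.+2) * B k.+2)); first by rewrite ler_wpM2r // hq.
have -> : cmod (q k.+2) * B k.+2 = cmod (al * b k.+1 + be * b k + w k.+2) * T ^+ k.+2.
  rewrite /B mulrA -cmodM -cmodN; congr (cmod _ * _).
  by have := hb k.+2; rewrite /= -!addrA => /eqP; rewrite addr_eq0 => /eqP ->; rewrite opprK !addrA.
apply: (@le_trans _ _ ((cmod al * T) * B k.+1 + (cmod be * T ^+ 2) * B k + Mw)).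
  apply: (@le_trans _ _ ((cmod al * cmod (b k.+1) + cmod be * cmod (b k) + cmod (w k.+2)) * T ^+ k.+2)).
    rewrite ler_wpM2r // -!cmodM; apply: le_trans (cmodD _ _) _; rewrite lerD2r.
    exact: cmodD.
  rewrite !mulrDl; apply: lerD.
    by rewrite /B !exprS le_eqVlt; apply/orP; left; apply/eqP; ring.
  by have := hw k.+2; rewrite /= ger0_norm ?cmod_ge0.
have M0 : 0 <= M by exact: le_trans MwM.
apply: (@le_trans _ _ (x * M)).
  rewrite /x !mulrDl mul1r; apply: lerD => //; apply: lerD; rewrite ler_wpM2l ?mulr_ge0 ?cmod_ge0 ?(ltW T0) //;
    by apply: IH; apply: leq_trans kn.
rewrite ler_wpM2r //; apply: (@le_trans _ _ (Num.bound x)%:R).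
  by apply: ltW; apply: le_lt_trans (archi_boundP x0); rewrite lexx.
by rewrite ler_nat; apply: leq_trans Nk; exact: leq_maxr.
Qed.

(** The two-step recurrence run on pairs of consecutive values, starting from [1] preceded by [0].
    The value at a zero of [q] is [0], by the convention for division. *)
Fixpoint rec_pair (q w : nat -> C) (al be : C) k : C * C :=
  if k is j.+1 then
    let p := rec_pair q w al be j in (- (al * p.1 + be * p.2 + w j.+1) / q j.+1, p.1)
  else (1, 0).

Definition rec_seq q w al be k := (rec_pair q w al be k).1.

Lemma rec_pair2 q w al be k : (rec_pair q w al be k).2 = sh (rec_seq q w al be) k.
Proof. by case: k. Qed.

Lemma rec_seqS q w al be k : rec_seq q w al be k.+1 =
  - (al * rec_seq q w al be k + be * sh (rec_seq q w al be) k + w k.+1) / q k.+1.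
Proof. by rewrite /rec_seq /= rec_pair2. Qed.

Lemma rec_seqE q w al be k : q k.+1 != 0 ->
  let b := rec_seq q w al be in
  q k.+1 * b k.+1 + al * sh b k.+1 + be * sh (sh b) k.+1 + w k.+1 = 0.
Proof.
move=> qk b; rewrite /b /= rec_seqS mulrC divfK // -/b.
by move: (be * _) (al * _) (w _) => x y z; ring.
Qed.

Lemma rec_seq_agree q w w' al be n : (forall k, (k <= n)%N -> w k = w' k) ->
  forall k, (k <= n)%N -> rec_seq q w al be k = rec_seq q w' al be k.
Proof.
move=> ww k; rewrite /rec_seq => kn.
suff -> : rec_pair q w al be k = rec_pair q w' al be k by [].
by elim: k kn => //= k IH kn; rewrite IH ?ww // ltnW.
Qed.

End Shift.

Section Radial.
Variables (R : realType) (gamma : R).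
Local Notation C := R[i].
Implicit Types (f g : R -> C) (l : nat) (lam : C).

Lemma tC_neq0 t : 0 < t -> t%:C != 0 :> C.
Proof. by move=> t0; rewrite fmorph_eq0 lt0r_neq0. Qed.

(** The radial equation solved for the second derivative reads [f'' = pot f - (2 / t) f']. *)
Definition pot l lam t : C := (l * l.+1)%:R / t%:C ^+ 2 - (2 * gamma)%:C / t%:C - lam.

Lemma rsolP l lam f : radial_solution gamma l lam f <->
  forall t, 0 < t -> cder f t (cderive f t) /\
    cder (cderive f) t (pot l lam t * f t - 2%:R / t%:C * cderive f t).
Proof.
have E t x y z : 0 < t -> (t ^+ 2)%:C * z + (2 * t)%:C * y - (l * l.+1)%:R * x
    + (2 * gamma * t)%:C * x + lam * (t ^+ 2)%:C * x =
    t%:C ^+ 2 * (z - (pot l lam t * x - 2%:R / t%:C * y)).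
  move=> t0; have := tC_neq0 t0.
  have -> : (t ^+ 2)%:C = t%:C ^+ 2 :> C by rewrite rmorphXn.
  have -> : (2 * t)%:C = 2 * t%:C :> C by rewrite rmorphM rmorph_nat.
  have -> : (2 * gamma * t)%:C = 2 * gamma%:C * t%:C :> C by rewrite !rmorphM rmorph_nat.
  have g2 : (2 * gamma)%:C = 2 * gamma%:C :> C by rewrite rmorphM rmorph_nat.
  rewrite /pot g2; move: (t%:C) (gamma%:C) ((l * l.+1)%:R) => u v w u0; field.
  exact: u0.
split=> h t t0; have := h t t0.
  move=> [d1 d2]; rewrite E // => /eqP; rewrite mulf_eq0 expf_eq0 (negbTE (tC_neq0 t0)) /=.
  rewrite subr_eq0 => /eqP <-; split; exact: cderivable_cder.
move=> [d1 d2]; split; [exact: cder_derivable d1 | exact: cder_derivable d2 |].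
by rewrite E // (cder_val d2) subrr mulr0.
Qed.

Lemma rsolI l lam f f1 : (forall t, 0 < t -> cder f t (f1 t)) ->
    (forall t, 0 < t -> cder f1 t (pot l lam t * f t - 2%:R / t%:C * f1 t)) ->
  radial_solution gamma l lam f.
Proof.
move=> h1 h2; apply/rsolP => t t0; have E s : 0 < s -> f1 s = cderive f s.
  by move=> s0; rewrite (cder_val (h1 s s0)).
by split; rewrite -E //; [exact: h1 | exact: cder_pos t0 E (h2 t t0)].
Qed.

Lemma rsol_ext l lam f g : (forall t, 0 < t -> f t = g t) ->
  radial_solution gamma l lam f -> radial_solution gamma l lam g.
Proof.
move=> fg /rsolP h; apply: (rsolI (f1 := cderive f)) => t t0; have [h1 h2] := h t t0.
  exact: cder_pos t0 fg h1.
by rewrite -fg.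
Qed.

Lemma rsol_lin l lam z f g : radial_solution gamma l lam f -> radial_solution gamma l lam g ->
  radial_solution gamma l lam (fun t => z * f t + g t).
Proof.
move=> /rsolP hf /rsolP hg; apply: (rsolI (f1 := fun t => z * cderive f t + cderive g t)) => t t0;
  have [f1 f2] := hf t t0; have [g1 g2] := hg t t0.
  exact: cderD (cderZ z f1) g1.
apply: cder_eq (cderD (cderZ z f2) g2) _.
by move: (pot _ _ _) (_ / _) (cderive f t) (cderive g t) (f t) (g t) => *; ring.
Qed.

Definition wr f g t : C := t%:C ^+ 2 * (cderive f t * g t - f t * cderive g t).

(** The factor [t^2] in [wr] cancels the first-order term of the radial equation. *)
Lemma wr_cst l lam f g : radial_solution gamma l lam f -> radial_solution gamma l lam g ->
  forall s t, 0 < s -> 0 < t -> wr f g s = wr f g t.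
Proof.
move=> /rsolP hf /rsolP hg; apply: cder0_cst => t t0; have [f1 f2] := hf t t0.
have [g1 g2] := hg t t0.
apply: cder_eq (cderM (cder_pow 2 t) (cderB (cderM f2 g1) (cderM f1 g2))) _.
have := tC_neq0 t0; rewrite expr1.
move: (pot _ _ _) (t%:C) (cderive f t) (cderive g t) (f t) (g t) => p u a b c d u0.
by field.
Qed.

Lemma wr_anti f g t : wr g f t = - wr f g t.
Proof. by rewrite /wr; ring. Qed.

(** The Pluecker relation in a space of dimension two. As Wronskians of solutions are constants, it
    writes every solution as a combination of two solutions with nonzero Wronskian. *)
Lemma wr_plucker f g h t : f t * wr g h t = g t * wr f h t - h t * wr f g t.
Proof. by rewrite /wr; ring. Qed.

Lemma cder_ext_val f g t : 0 < t -> (forall s, 0 < s -> f s = g s) ->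
  (exists d, cder g t d) -> cderive f t = cderive g t.
Proof.
move=> t0 fg [d gd]; rewrite (cder_val gd); apply: cder_val; apply: cder_pos gd => //.
by move=> s s0; rewrite fg.
Qed.

Definition frobh l b t : C := t%:C ^- l.+1 * power_series b t.
Definition frobD l b t : C :=
  - (l.+1%:R * t%:C ^- l.+2) * power_series b t + t%:C ^- l.+1 * power_series (cdiffs b) t.

Section Frobenius.
Variables (l : nat) (lam : C) (b : nat -> C).
Hypothesis fb : cfast b.
Local Notation P := (power_series b).
Local Notation P1 := (power_series (cdiffs b)).
Local Notation P2 := (power_series (cdiffs (cdiffs b))).

(** The coefficients of the defect left when the Frobenius series [frobh] is put into the radial
    equation. The indicial factor vanishes at [k = 0] and [k = 2 l + 1], that is, at the exponents
    [- (l + 1)] and [l]. *)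
Definition residue k : C :=
  k%:R * (k%:R - (2 * l + 1)%:R) * b k + (2 * gamma)%:C * sh b k + lam * sh (sh b) k.

Lemma residueE t : power_series residue t = t%:C ^+ 2 * P2 t - (2 * l)%:R * (t%:C * P1 t)
  + (2 * gamma)%:C * (t%:C * P t) + lam * (t%:C ^+ 2 * P t).
Proof.
have f1 := cfast_diffs fb; have f2 := cfast_diffs f1.
have s1 := cfast_sh fb; have s2 := cfast_sh s1.
have sd := cfast_sh f1; have sdd := cfast_sh (cfast_sh f2).
have z0 : cfast (fun=> 0 : C).
  by move=> T T0; exists 0 => k; rewrite /= cmod0 normr0 mul0r.
have a3 := cfast_lin lam s2 z0.
have a2 := cfast_lin (2 * gamma)%:C s1 a3.
have a1 := cfast_lin (- (2 * l)%:R) sd a2.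
rewrite (_ : residue = fun k => 1 * sh (sh (cdiffs (cdiffs b))) k + (- (2 * l)%:R * sh (cdiffs b) k +
    ((2 * gamma)%:C * sh b k + (lam * sh (sh b) k + 0)))); last first.
  apply/funext => -[|k]; rewrite /residue.
    by rewrite /= !(mulr0, mul0r, addr0, add0r).
  rewrite [sh (sh (cdiffs _)) _]/= !sh_cdiffs /cdiffs natrM natrD natrM -[k.+1%:R]natr1.
  by move: (sh b _) (sh (sh b) _) (b _) (k%:R) (l%:R) (_%:C) => *; ring.
rewrite !power_series_lin // !ps_sh //; try exact: cfast_sh.
have -> : power_series (fun=> 0 : C) t = 0.
  by rewrite power_series_rec // add0r; have := power_series_rec t z0; rewrite add0r => {1}<-;
    rewrite /power_series; congr (_ +i* _); apply/cvg_lim => //; apply: cvg_near_cst; near=> n;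
    rewrite /series /= big1 // => k _; rewrite mul0r.
rewrite !mul1r expr2 -!mulrA addr0.
by move: (P t) (P1 t) (P2 t) => *; ring.
Unshelve. all: by end_near. Qed.

Lemma frob_der1 t : 0 < t -> cder (frobh l b) t (frobD l b t).
Proof.
move=> t0; exact: cderM (cder_invX l.+1 t0) (power_series_der t fb).
Qed.

Lemma frob_der2 t : 0 < t ->
  cder (frobD l b) t (pot l lam t * frobh l b t - 2%:R / t%:C * frobD l b t
    + t%:C ^- l.+3 * power_series residue t).
Proof.
move=> t0; have d1 := power_series_der t fb.
have d2 := power_series_der t (cfast_diffs fb).
have i1 := cder_invX l.+1 t0; have i2 := cder_invX l.+2 t0.
apply: cder_eq (cderD (cderM (cderN (cderZ l.+1%:R i2)) d1) (cderM i1 d2)) _.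
rewrite residueE /frobh /frobD /pot !exprS !natrM -[l.+2%:R]natr1 -[l.+1%:R]natr1 rmorphM rmorph_nat expr0 !mulr1.
have := tC_neq0 t0; have : t%:C ^+ l != 0 :> C by rewrite expf_neq0 // tC_neq0.
move: (P t) (P1 t) (P2 t) (t%:C ^+ l) (t%:C) (gamma%:C) (l%:R) => *.
by field; apply/andP.
Qed.

End Frobenius.

Definition regat l (c : C) f : Prop := exists b, [/\ cfast b, b 0%N = c
  & forall t, 0 < t -> f t = t%:C ^+ l * power_series b t].

Lemma regat_der l b f t : cfast b -> (forall t, 0 < t -> f t = t%:C ^+ l * power_series b t) ->
  0 < t -> cderive f t =
    l%:R * t%:C ^+ l.-1 * power_series b t + t%:C ^+ l * power_series (cdiffs b) t.
Proof.
move=> fb fE t0; apply: cder_val; apply: cder_pos (cderM (cder_pow l t) (power_series_der t fb)) => //.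
by move=> s s0; rewrite fE.
Qed.

Lemma expr_predK l (x : C) : l%:R * x ^+ l.-1 * x = l%:R * x ^+ l.
Proof. by case: l => [|l]; rewrite ?mul0r // exprSr mulrA. Qed.

(** The Wronskian of two functions of order [l] carries the factor [t^(2 l + 2)]: the terms of order
    [2 l + 1] cancel. Being constant, it is its value [0] at [t = 0]. *)
Lemma wr_regat l lam c d f g : radial_solution gamma l lam f -> radial_solution gamma l lam g ->
  regat l c f -> regat l d g -> forall t, 0 < t -> wr f g t = 0.
Proof.
move=> sf sg [a [fa _ fE]] [b [fb _ gE]] t t0.
pose P := power_series a; pose P1 := power_series (cdiffs a).
pose Q := power_series b; pose Q1 := power_series (cdiffs b).
pose w s := s%:C ^+ (2 * l + 2) * (P1 s * Q s - P s * Q1 s).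
have wE s : 0 < s -> wr f g s = w s.
  move=> s0; rewrite /wr /w (regat_der fa fE) // (regat_der fb gE) // fE // gE //.
  rewrite -/(P s) -/(P1 s) -/(Q s) -/(Q1 s) exprD mul2n -addnn exprD.
  by move: (P s) (P1 s) (Q s) (Q1 s) (_ ^+ l) (_ ^+ l.-1) (_ ^+ 2) (l%:R) => *; ring.
have fa1 := cfast_diffs fa; have fb1 := cfast_diffs fb.
have wd := cderM (cder_pow (2 * l + 2) 0) (cderB
  (cderM (power_series_der 0 fa1) (power_series_der 0 fb))
  (cderM (power_series_der 0 fa) (power_series_der 0 fb1))).
have W0 : w 0 = wr f g t.
  by apply: (cder_limit wd) => s s0; rewrite -[LHS]/(w s) -wE //; exact: (wr_cst sf sg).
by rewrite -W0 /w addn2 expr0n mul0r.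
Qed.

Lemma wr_singat_alg (K : fieldType) (x v p p1 q q1 u z c k L : K) : x != 0 -> v != 0 ->
  x * x * ((- ((L + 1) * (x * (x * v))^-1) * p + (x * v)^-1 * p1 +
      c * (x^-1 * (v * u) + k * z)) * (v * q) -
    ((x * v)^-1 * p + c * (k * (v * u))) * (L * (v / x) * q + v * q1)) =
  - (2 * L + 1) * (p * q) + x * (p1 * q - p * q1) + c * (v * v * x * (u * q)) +
  c * k * (x * x * (z * (v * q) - v * u * (L * (v / x) * q + v * q1))).
Proof. by move=> x0 v0; field; apply/andP. Qed.

(** The leading terms [t^-(l + 1)] and [d t^l] contribute the constant. The logarithm is multiplied
    by the Wronskian of two regular solutions, which is zero, and the derivative of the logarithm
    only contributes a term that vanishes at [0]. *)
Lemma wr_singat l lam d g f : singular_radial gamma l lam g ->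
    radial_solution gamma l lam f -> regat l d f ->
    (forall h, regular_radial gamma l lam h -> regat l 1 h) ->
  forall t, 0 < t -> wr g f t = - (2 * l + 1)%:R * d.
Proof.
move=> [sg [b [c [h [/entire_cfast fb b0 rh gE]]]]] sf rf hreg t t0.
have [a [fa a0 fE]] := rf; have [e [fe e0 hE]] := hreg _ rh.
have sh0 := rh.1; have /rsolP hd := sh0.
pose P := power_series b; pose P1 := power_series (cdiffs b).
pose Q := power_series a; pose Q1 := power_series (cdiffs a).
pose S := power_series e.
pose w s := - (2 * l + 1)%:R * (P s * Q s) + s%:C * (P1 s * Q s - P s * Q1 s)
  + c * (s%:C ^+ (2 * l + 1) * (S s * Q s)).
have gE' s : 0 < s -> s%:C ^- l.+1 * P s + c * ((ln s)%:C * h s) = g s.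
  by move=> s0; rewrite gE // fmorphV rmorphXn mulrA.
have gder s : 0 < s -> cderive g s =
    - (l.+1%:R * s%:C ^- l.+2) * P s + s%:C ^- l.+1 * P1 s +
    c * ((s^-1)%:C * h s + (ln s)%:C * cderive h s).
  move=> s0; apply: cder_val; have [h1 _] := hd s s0; apply: cder_pos gE' _ => //.
  apply: cderD (cderM (cder_invX l.+1 s0) (power_series_der s fb)) _.
  by apply: cderZ; apply: cderM h1; apply: cder_real; exact: is_derive1_ln.
have wE s : 0 < s -> wr g f s = w s.
  move=> s0; have Z := wr_regat sh0 sf (hreg _ rh) rf s0.
  move: Z; rewrite /wr (regat_der fa fE) // gder // -gE' // fE // hE // => Z.
  have x0 := tC_neq0 s0; have v0 : s%:C ^+ l != 0 :> C by rewrite expf_neq0.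
  have e1 : s%:C ^- l.+2 = (s%:C * (s%:C * s%:C ^+ l))^-1 :> C by rewrite !exprS.
  have e2 : s%:C ^- l.+1 = (s%:C * s%:C ^+ l)^-1 :> C by rewrite exprS.
  have e3 : l%:R * s%:C ^+ l.-1 = l%:R * (s%:C ^+ l / s%:C) :> C.
    by apply: (mulIf x0); rewrite expr_predK mulrA divfK.
  have e4 : s%:C ^+ (2 * l + 1) = s%:C ^+ l * s%:C ^+ l * s%:C :> C.
    by rewrite addn1 exprSr mul2n -addnn exprD.
  have e5 : (s^-1)%:C = (s%:C)^-1 :> C by rewrite fmorphV.
  rewrite /w e4; move: Z; rewrite e1 e2 e3 e5 expr2 -[l.+1%:R]natr1 natrD natrM => Z.
  rewrite (wr_singat_alg _ _ _ _ _ _ _ _ _ x0 v0) Z.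
  by rewrite mulr0 addr0.
have fa1 := cfast_diffs fa; have fb1 := cfast_diffs fb.
have wd := cderD (cderD (cderZ (- (2 * l + 1)%:R) (cderM (power_series_der 0 fb) (power_series_der 0 fa)))
  (cderM (@cder_id R 0) (cderB
  (cderM (power_series_der 0 fb1) (power_series_der 0 fa))
  (cderM (power_series_der 0 fb) (power_series_der 0 fa1)))))
  (cderZ c (cderM (cder_pow (2 * l + 1) 0) (cderM (power_series_der 0 fe) (power_series_der 0 fa)))).
have W0 : w 0 = wr g f t.
  by apply: (cder_limit wd) => s s0; rewrite -[LHS]/(w s) -wE //; exact: (wr_cst sg sf).
by rewrite -W0 /w /P /Q !power_series0 // b0 a0 addn1 expr0n !mul0r mulr0 !addr0 mul1r.
Qed.

Lemma regularP l lam f : regular_radial gamma l lam f <->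
  radial_solution gamma l lam f /\ regat l 1 f.
Proof.
split=> [[sf [a [/entire_cfast fa a0 al fE]]]|[sf [b [fb b0 fE]]]]; split=> //.
  have fs n : cfast (fun k => a (n + k)%N).
    elim: n => // n IH; have := cfast_shift IH; congr cfast; apply/funext => k.
    by congr (a _); lia.
  exists (fun k => a (l + k)%N); split=> //; first by rewrite addn0.
  move=> t t0; rewrite fE // -ps_iter_sh //; congr power_series; apply/funext => k.
  have [kl|lk] := ltnP k l; first by rewrite a0 // iter_sh_lt.
  by rewrite -(subnKC lk) iter_sh_add.
exists (iter l (@sh R) b); split=> [|k|| t t0].
- exact/cfast_entire/cfast_iter_sh.
- exact: iter_sh_lt.
- by have := iter_sh_add l b 0; rewrite addn0 => ->.
- by rewrite ps_iter_sh // fE.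
Qed.

(** The coefficients come from [wr_plucker], divided by the Wronskian [- (2 l + 1)] of [G] and [F].
    The second conclusion lets later proofs find the coefficient of [G] from a Wronskian with
    [F]. *)
Lemma sol_decomp l lam f F G : radial_solution gamma l lam f ->
    regular_radial gamma l lam F -> singular_radial gamma l lam G ->
  exists al be, (forall t, 0 < t -> f t = al * G t + be * F t) /\
    (forall t, 0 < t -> wr f F t = - (2 * l + 1)%:R * al).
Proof.
move=> sf /[dup] rF /regularP[sF aF] sG; have [sG0 _] := sG.
have hr h : regular_radial gamma l lam h -> regat l 1 h by move=> /regularP[].
have n0 : (2 * l + 1)%:R != 0 :> C by rewrite addn1 pnatr_eq0.
exists (- (wr f F 1 / (2 * l + 1)%:R)), (wr f G 1 / (2 * l + 1)%:R).
split=> t t0; last by rewrite mulrNN mulrC divfK // (wr_cst sf sF t0 ltr01).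
have := wr_plucker f G F t.
rewrite (wr_singat sG sF aF hr t0) (wr_cst sf sF t0 ltr01) (wr_cst sf sG0 t0 ltr01).
move: (wr f F 1) (wr f G 1) (f t) (G t) (F t) _%:R n0 => a b x y z n n0 E.
apply: (mulIf (x := - n)); first by rewrite oppr_eq0.
by rewrite -[- n]mulr1 E; field.
Qed.

Lemma regat_eq l lam c f F G : radial_solution gamma l lam f -> regat l c f ->
    regular_radial gamma l lam F -> singular_radial gamma l lam G ->
  forall t, 0 < t -> f t = c * F t.
Proof.
move=> sf af /[dup] rF /regularP[sF aF] sG t t0; have [sG0 _] := sG.
have hr h : regular_radial gamma l lam h -> regat l 1 h by move=> /regularP[].
have n0 : (2 * l + 1)%:R != 0 :> C by rewrite addn1 pnatr_eq0.
have := wr_plucker f G F t.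
rewrite (wr_singat sG sF aF hr t0) (wr_regat sf sF af aF t0) wr_anti (wr_singat sG sf af hr t0).
move: (f t) (G t) (F t) _%:R n0 => x y z n n0 E.
apply: (mulIf (x := - n)); first by rewrite oppr_eq0.
by rewrite -[- n]mulr1 E; ring.
Qed.

Lemma cfast0 : cfast (fun=> 0 : C).
Proof. by move=> T T0; exists 0 => k; rewrite /= cmod0 normr0 mul0r. Qed.

Lemma ps_ext (a b : nat -> C) t : (forall k, a k = b k) -> power_series a t = power_series b t.
Proof. by move=> /funext ->. Qed.

Lemma ps0 t : power_series (fun=> 0 : C) t = 0.
Proof.
have E : power_series (fun=> 0 : C) t = power_series (fun=> 0 : C) t + power_series (fun=> 0 : C) t.
  rewrite -{2}[power_series _ t]mul1r -(power_series_lin _ _ cfast0 cfast0).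
  by apply: ps_ext => k; rewrite mulr0 addr0.
by move/eqP: E; rewrite -subr_eq0 opprD addrA subrr add0r oppr_eq0 => /eqP.
Qed.

(** The growth bound that [rec_fast] asks for starts beyond the zero [2 l + 1] of the indicial
    factor. *)
Lemma q_unit l k : (2 * l + 2 <= k)%N ->
  k%:R <= cmod (k%:R * (k%:R - (2 * l + 1)%:R) : C).
Proof.
move=> lk; rewrite -natrB; last by lia.
rewrite -natrM cmod_nat ler_nat leq_pmulr //; lia.
Qed.

Definition fseq l lam := rec_seq (fun k => k%:R * (k%:R + (2 * l + 1)%:R)) (fun=> 0)
  (2 * gamma)%:C lam.

Lemma fseq_rec l lam k : k%:R * (k%:R + (2 * l + 1)%:R) * fseq l lam k
  + (2 * gamma)%:C * sh (fseq l lam) k + lam * sh (sh (fseq l lam)) k + 0 = 0.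
Proof.
case: k => [|k]; first by rewrite /= !(mul0r, mulr0, addr0).
apply: (@rec_seqE R (fun k => k%:R * (k%:R + (2 * l + 1)%:R)) (fun=> 0)).
by rewrite -natrD mulf_neq0 // pnatr_eq0 // addn1 addnS.
Qed.

Lemma fseq_fast l lam : cfast (fseq l lam).
Proof.
apply: (rec_fast (K := 0%N) _ cfast0 (fseq_rec l lam)) => k _.
by rewrite -natrD -natrM cmod_nat ler_nat leq_pmulr // addn1 addnS.
Qed.

Definition Freg l lam : R -> C := fun t => t%:C ^+ l * power_series (fseq l lam) t.

Lemma Freg_regat l lam : regat l 1 (Freg l lam).
Proof. by exists (fseq l lam); split=> //; exact: fseq_fast. Qed.

(** The regular solution is the Frobenius series for the exponent [- (l + 1)] that starts at the
    second indicial root, so one residue computation serves both solutions. *)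
Lemma residue_shift l lam k :
  residue l lam (iter (2 * l + 1) (@sh R) (fseq l lam)) k = 0.
Proof.
rewrite /residue !iter_shS.
have [kl|lk] := ltnP k (2 * l + 1); first by rewrite !iter_sh_lt // !mulr0 !addr0.
have [j ->] : exists j, k = (2 * l + 1 + j)%N by exists (k - (2 * l + 1))%N; rewrite subnKC.
rewrite !iter_sh_add -[RHS](fseq_rec l lam j) [(_ + j)%:R]natrD addr0.
by move: (sh (sh _) _) (sh _ _) (fseq _ _ _) ((2 * l + 1)%:R) => *; ring.
Qed.

Lemma Freg_sol l lam : radial_solution gamma l lam (Freg l lam).
Proof.
pose b := iter (2 * l + 1) (@sh R) (fseq l lam).
have fb : cfast b by apply: cfast_iter_sh; exact: fseq_fast.
apply: (rsol_ext (f := fun t => t%:C ^- l.+1 * power_series b t)) => [t t0|].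
  rewrite /Freg ps_iter_sh; last exact: fseq_fast.
  rewrite mulrA; congr (_ * _); rewrite (_ : (2 * l + 1 = l.+1 + l)%N); last by lia.
  by rewrite exprD mulKf // expf_neq0 // tC_neq0.
apply: (rsolI (f := frobh l b) (f1 := frobD l b)) => t t0; first exact: frob_der1.
apply: cder_eq (frob_der2 l lam fb t0) _.
by rewrite (ps_ext (b := fun=> 0)) ?ps0 ?mulr0 ?addr0 // => k; exact: residue_shift.
Qed.

Lemma Freg_regular l lam : regular_radial gamma l lam (Freg l lam).
Proof. by apply/regularP; split; [exact: Freg_sol | exact: Freg_regat]. Qed.

(* The coefficient at [k = 2l + 1] of the Frobenius recurrence, where the
   indicial factor vanishes, forces the constant in front of the logarithm. *)
Definition gforce l lam (c : C) k : C :=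
  c * ((2%:R * k%:R - (2 * l + 1)%:R) * iter (2 * l + 1) (@sh R) (fseq l lam) k).

Definition gseq l lam c := rec_seq (fun k => k%:R * (k%:R - (2 * l + 1)%:R))
  (gforce l lam c) (2 * gamma)%:C lam.

Definition glog l lam : C := - ((2 * gamma)%:C * gseq l lam 0 (2 * l)
  + lam * sh (gseq l lam 0) (2 * l)) / (2 * l + 1)%:R.

Lemma gseq_rec l lam k : residue l lam (gseq l lam (glog l lam)) k + gforce l lam (glog l lam) k = 0.
Proof.
set c := glog l lam; set w := gforce l lam c; case: k => [|k].
  by rewrite /residue /w /gforce iter_sh_lt ?addn1 //= !(mul0r, mulr0, addr0).
(* At index [2 l + 1] the coefficient itself is set to [0], a choice modulo the regular solution.
   The equation there is met by the choice of [glog]: the forcing vanishes at lower indices, so the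
   earlier coefficients do not depend on the constant and may be computed with the constant [0]. *)
have [k2|ne] := eqVneq k (2 * l)%N; last first.
  apply: (@rec_seqE R (fun k => k%:R * (k%:R - (2 * l + 1)%:R)) w).
  by rewrite mulf_neq0 ?pnatr_eq0 // subr_eq0 eqr_nat; apply: contraNneq ne; lia.
have e : iter (2 * l + 1) (@sh R) (fseq l lam) (2 * l).+1 = 1.
  by rewrite -[(2 * l).+1]addn1 -[X in iter _ _ _ X]addn0 iter_sh_add.
rewrite /residue k2 /w /gforce e -[(2 * l).+1]addn1 subrr mulr0 mul0r add0r addn1 mulr1 /=.
have agree j : (j <= 2 * l)%N -> gseq l lam c j = gseq l lam 0 j.
  move=> jl; apply: (@rec_seq_agree R _ _ _ _ _ (2 * l)%N) => // i il.
  by rewrite /gforce iter_sh_lt ?mulr0 // addn1.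
have -> : sh (gseq l lam c) (2 * l) = sh (gseq l lam 0) (2 * l).
  by case E : (2 * l)%N => [|j] //=; apply: agree; rewrite E.
rewrite agree // /c /glog -addn1.
have n0 : (2 * l).+1%:R != 0 :> C by rewrite pnatr_eq0.
rewrite ?addn1; move: n0 (gseq _ _ _ _) (sh _ _) (_%:C) => + x y z.
by move: ((2 * l).+1%:R) => n n0; field.
Qed.

(** The contribution of the logarithmic term to the equation: differentiating [ln t F] twice leaves,
    besides the logarithm times the equation for [F], the expression [(2 t F' + F) / t^2]. *)
Lemma gforce_ps l lam c : cfast (gforce l lam c) /\ forall t, 0 < t ->
  power_series (gforce l lam c) t =
    c * (t%:C ^+ l.+1 * (2%:R * (t%:C * cderive (Freg l lam) t) + Freg l lam t)).
Proof.
have ff := fseq_fast l lam; have fi := cfast_iter_sh (2 * l + 1) ff.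
have fd := cfast_sh (cfast_diffs fi).
set s := iter _ _ _ in fi fd.
have E : gforce l lam c = fun k => c * (2%:R * sh (cdiffs s) k + (- (2 * l + 1)%:R * s k + 0)) + 0.
  apply/funext => k; rewrite /gforce sh_cdiffs -/s !addr0; congr (c * _).
  by move: (s k) => x; ring.
have f1 := cfast_lin (- (2 * l + 1)%:R) fi cfast0.
have f2 := cfast_lin 2%:R fd f1; have f3 := cfast_lin c f2 cfast0.
split; rewrite E // => t t0.
rewrite !power_series_lin //; try exact: cfast0.
rewrite ps0 !addr0 ps_sh; last exact: cfast_diffs.
have EF u : 0 < u -> power_series s u = u%:C ^+ l.+1 * Freg l lam u.
  move=> u0; rewrite /s ps_iter_sh // /Freg mulrA -exprD; congr (_ ^+ _ * _); lia.
have d1 := power_series_der t fi.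
have sF : radial_solution gamma l lam (Freg l lam) by exact: Freg_sol.
have [dF _] := (rsolP _ _ _).1 sF t t0.
have d2 := cder_pos t0 (fun u u0 => esym (EF u u0)) (cderM (cder_pow l.+1 t) dF).
rewrite (cder_unique d1 d2) EF // natrD natrM exprS -[l.+1%:R]natr1 [l.+1.-1]/=.
by move: (Freg l lam t) (cderive _ _) (_ ^+ l) (l%:R) => *; ring.
Qed.

Definition Gsing l lam : R -> C := fun t => frobh l (gseq l lam (glog l lam)) t
  + glog l lam * ((ln t)%:C * Freg l lam t).

Lemma gseq_fast l lam : cfast (gseq l lam (glog l lam)).
Proof.
have [fw _] := gforce_ps l lam (glog l lam).
exact: (rec_fast (K := (2 * l + 2)%N) (@q_unit l) fw (gseq_rec l lam)).
Qed.

Lemma Gsing_alg (K : fieldType) (x v h h1 F F1 p k c y : K) : x != 0 -> v != 0 ->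
  p * h - 2 / x * h1 + (v * x * x)^-1 * (- (c * (v * (2%:R * (x * F1) + F)))) +
    c * ((- (x ^+ 2)^-1) * F + x^-1 * F1 + (x^-1 * F1 + k * (p * F - 2 / x * F1))) =
  p * (h + c * (k * F)) - 2 / x * (h1 + c * (x^-1 * F + k * F1)).
Proof. by move=> x0 v0; field; apply/andP. Qed.

Lemma Gsing_sol l lam : radial_solution gamma l lam (Gsing l lam).
Proof.
have fb := gseq_fast l lam; set c := glog l lam; set b := gseq l lam c.
have /rsolP sF := Freg_sol l lam; set F := Freg l lam in sF.
have dln (t : R) : 0 < t -> cder (fun s => (ln s)%:C) t (t%:C)^-1.
  move=> t0; apply: cder_eq (cder_real (is_derive1_ln t0)) _.
  by rewrite fmorphV.
apply: (rsolI (f1 := fun t => frobD l b t + c * ((t%:C)^-1 * F t + (ln t)%:C * cderive F t))) => t t0;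
  have [F1 F2] := sF t t0.
  exact: cderD (frob_der1 l fb t0) (cderZ c (cderM (dln t t0) F1)).
apply: cder_eq (cderD (frob_der2 l lam fb t0) (cderZ c (cderD (cderM (cder_inv t0) F1) (cderM (dln t t0) F2)))) _.
have [fw wE] := gforce_ps l lam c.
have -> : power_series (residue l lam b) t = - (c * (t%:C ^+ l.+1 * (2%:R * (t%:C * cderive F t) + F t))).
  rewrite -wE // -mulN1r -[RHS]addr0 -(ps0 t) -power_series_lin //; last exact: cfast0.
  by apply: ps_ext => k; rewrite addr0 mulN1r; apply/eqP; rewrite -addr_eq0; apply/eqP; exact: gseq_rec.
rewrite (_ : t%:C ^- l.+3 = (t%:C ^+ l.+1 * t%:C * t%:C)^-1); last by rewrite -!exprSr.
by apply: Gsing_alg; rewrite ?expf_neq0 ?tC_neq0.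
Qed.

Lemma Gsing_singular l lam : singular_radial gamma l lam (Gsing l lam).
Proof.
split; first exact: Gsing_sol.
exists (gseq l lam (glog l lam)), (glog l lam), (Freg l lam); split=> //.
- exact/cfast_entire/gseq_fast.
- exact: Freg_regular.
by move=> t t0; rewrite /Gsing fmorphV rmorphXn mulrA.
Qed.

(** * Ladder operators between the radial equations of consecutive degrees *)

Section Ladder.
Variables (l : nat) (lam : C).

Definition dplus f t : C :=
  l.+1%:R * (cderive f t - l%:R * f t / t%:C) + gamma%:C * f t.
Definition dminus f t : C :=
  l.+1%:R * (cderive f t + l.+2%:R * f t / t%:C) - gamma%:C * f t.

Let dplus1 f t : C := l.+1%:R * (pot l lam t * f t - l.+2%:R / t%:C * cderive f t
  + l%:R / t%:C ^+ 2 * f t) + gamma%:C * cderive f t.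
Let dminus1 f t : C := l.+1%:R * (pot l.+1 lam t * f t + l%:R / t%:C * cderive f t
  - l.+2%:R / t%:C ^+ 2 * f t) - gamma%:C * cderive f t.

Lemma potE k t : pot k lam t =
  k%:R * (k%:R + 1) * ((t%:C)^-1) ^+ 2 - 2%:R * gamma%:C * (t%:C)^-1 - lam.
Proof. by rewrite /pot natrM -[k.+1%:R]natr1 rmorphM rmorph_nat exprVn. Qed.

Lemma dplus_der f : radial_solution gamma l lam f -> forall t, 0 < t -> cder (dplus f) t (dplus1 f t).
Proof.
move=> /rsolP sf t t0; have [f1 f2] := sf t t0.
have dq := cderM (cderZ l%:R f1) (cder_inv t0).
apply: cder_eq (cderD (cderZ l.+1%:R (cderB f2 dq)) (cderZ gamma%:C f1)) _.
rewrite /dplus1 -[l.+2%:R]natr1 -[l.+1%:R]natr1 -!exprVn; move: (pot _ _ _) ((t%:C)^-1).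
by move: (f t) (cderive f t) (l%:R) (gamma%:C) => *; ring.
Qed.

Lemma dminus_der f : radial_solution gamma l.+1 lam f ->
  forall t, 0 < t -> cder (dminus f) t (dminus1 f t).
Proof.
move=> /rsolP sf t t0; have [f1 f2] := sf t t0.
have dq := cderM (cderZ l.+2%:R f1) (cder_inv t0).
apply: cder_eq (cderB (cderZ l.+1%:R (cderD f2 dq)) (cderZ gamma%:C f1)) _.
rewrite /dminus1 -[l.+2%:R]natr1 -[l.+1%:R]natr1 -!exprVn; move: (pot _ _ _) ((t%:C)^-1).
by move: (f t) (cderive f t) (l%:R) (gamma%:C) => *; ring.
Qed.

Lemma pot_der k t : 0 < t -> cder (pot k lam) t
  (- 2%:R * (k%:R * (k%:R + 1)) * ((t%:C)^-1) ^+ 3 + 2%:R * gamma%:C * ((t%:C)^-1) ^+ 2).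
Proof.
move=> t0; have i2 := cderZ (k * k.+1)%:R (cder_invX 2 t0).
have i1 := cderZ (2 * gamma)%:C (cder_inv t0).
apply: cder_eq (cderB (cderB i2 i1) (cder_cst lam t)) _.
have g2 : (2 * gamma)%:C = 2 * gamma%:C :> C by rewrite rmorphM rmorph_nat.
rewrite natrM -[k.+1%:R]natr1 g2 -!exprVn; move: ((t%:C)^-1) (k%:R) (gamma%:C) => *.
by ring.
Qed.

Lemma dplus_sol f : radial_solution gamma l lam f -> radial_solution gamma l.+1 lam (dplus f).
Proof.
move=> /[dup] sf0 /rsolP sf; apply: (rsolI (f1 := dplus1 f)) => t t0; first exact: dplus_der.
have [f1 f2] := sf t t0; have dp := pot_der l t0.
have d1 := cderM (cderZ l.+2%:R (cder_inv t0)) f2.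
have d2 := cderM (cderZ l%:R (cder_invX 2 t0)) f1.
apply: cder_eq (cderD (cderZ l.+1%:R (cderD (cderB (cderM dp f1) d1) d2)) (cderZ gamma%:C f2)) _.
rewrite /dplus1 /dplus !potE -[l.+2%:R]natr1 -[l.+1%:R]natr1 -!exprVn; move: ((t%:C)^-1).
by move: (f t) (cderive f t) (l%:R) (gamma%:C) => *; ring.
Qed.

Lemma dminus_sol f : radial_solution gamma l.+1 lam f -> radial_solution gamma l lam (dminus f).
Proof.
move=> /[dup] sf0 /rsolP sf; apply: (rsolI (f1 := dminus1 f)) => t t0; first exact: dminus_der.
have [f1 f2] := sf t t0; have dp := pot_der l.+1 t0.
have d1 := cderM (cderZ l%:R (cder_inv t0)) f2.
have d2 := cderM (cderZ l.+2%:R (cder_invX 2 t0)) f1.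
apply: cder_eq (cderB (cderZ l.+1%:R (cderB (cderD (cderM dp f1) d1) d2)) (cderZ gamma%:C f2)) _.
rewrite /dminus1 /dminus !potE -[l.+2%:R]natr1 -[l.+1%:R]natr1 -!exprVn; move: ((t%:C)^-1).
by move: (f t) (cderive f t) (l%:R) (gamma%:C) => *; ring.
Qed.

(** The two ladder operators are adjoint up to sign for the Wronskian. This transfers what is known
    about regular solutions to singular ones, whose expansions need not be differentiated. *)
Lemma wr_ladder f g t : radial_solution gamma l lam f -> radial_solution gamma l.+1 lam g ->
  0 < t -> wr (dplus f) g t = - wr f (dminus g) t.
Proof.
move=> sf sg t0; rewrite /wr (cder_val (dplus_der sf t0)) (cder_val (dminus_der sg t0)).
rewrite /dplus1 /dminus1 /dplus /dminus !potE -[l.+2%:R]natr1 -[l.+1%:R]natr1 -!exprVn.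
rewrite -[RHS]mulrN; congr (_ * _); move: ((t%:C)^-1).
by move: (f t) (cderive f t) (g t) (cderive g t) (l%:R) (gamma%:C) => *; ring.
Qed.

(** The factorization of the radial operator. The constant vanishes at
    [lam = - gamma^2 / (l + 1)^2], the hydrogen bound-state energies, where the ladder of regular
    solutions breaks. *)
Lemma dminus_dplus f t : radial_solution gamma l lam f -> 0 < t ->
  dminus (dplus f) t = - (gamma%:C ^+ 2 + lam * l.+1%:R ^+ 2) * f t.
Proof.
move=> sf t0; rewrite /dminus (cder_val (dplus_der sf t0)).
rewrite /dplus1 /dplus !potE -[l.+2%:R]natr1 -[l.+1%:R]natr1 -!exprVn; move: ((t%:C)^-1).
by move: (f t) (cderive f t) (l%:R) (gamma%:C) => *; ring.
Qed.

Lemma dminus_regat f c : regat l.+1 c f -> regat l (l.+1%:R * (2 * l + 3)%:R * c) (dminus f).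
Proof.
move=> [b [fb b0 fE]]; have fd := cfast_diffs fb.
pose e k := (l.+1%:R * (2 * l + 3)%:R) * b k + (l.+1%:R * sh (cdiffs b) k +
  ((- gamma%:C) * sh b k + 0)).
have f3 := cfast_lin (- gamma%:C) (cfast_sh fb) cfast0.
have f2 := cfast_lin l.+1%:R (cfast_sh fd) f3.
exists e; split=> [||t t0]; first exact: cfast_lin.
  by rewrite /e /= !mulr0 !addr0 b0.
rewrite /dminus (regat_der fb fE t0) fE // /e !power_series_lin //; try exact: cfast_sh; try exact: cfast0.
rewrite ps0 !ps_sh // [l.+1.-1]/= natrD natrM exprS -[l.+2%:R]natr1 -[l.+1%:R]natr1.
move: (tC_neq0 t0).
move: (power_series b t) (power_series _ t) (t%:C) (gamma%:C) (l%:R) (t%:C ^+ l).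
by move=> *; field.
Qed.

Variables (F G F' G' : R -> C).
Hypotheses (rF : regular_radial gamma l lam F) (sG : singular_radial gamma l lam G).
Hypotheses (rF' : regular_radial gamma l.+1 lam F') (sG' : singular_radial gamma l.+1 lam G').

Let nz n : n.+1%:R != 0 :> C. Proof. by rewrite pnatr_eq0. Qed.
Let solF : radial_solution gamma l lam F. Proof. by case: rF. Qed.
Let solF' : radial_solution gamma l.+1 lam F'. Proof. by case: rF'. Qed.
Let solG : radial_solution gamma l lam G. Proof. by case: sG. Qed.
Let solG' : radial_solution gamma l.+1 lam G'. Proof. by case: sG'. Qed.
Let atF : regat l 1 F. Proof. by have /regularP[] := rF. Qed.
Let atF' : regat l.+1 1 F'. Proof. by have /regularP[] := rF'. Qed.
Let hreg k h : regular_radial gamma k lam h -> regat k 1 h. Proof. by move=> /regularP[]. Qed.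

Lemma dminus_reg t : 0 < t -> dminus F' t = l.+1%:R * (2 * l + 3)%:R * F t.
Proof.
move=> t0; have := dminus_regat atF'; rewrite mulr1 => h.
exact: (regat_eq (dminus_sol solF') h rF sG t0).
Qed.

Let solP k f t : radial_solution gamma k lam f -> 0 < t -> cderivable f t.
Proof. by move=> /rsolP h t0; have [/cder_derivable] := h t t0. Qed.

Lemma wr_zl z f g t : cderivable f t -> wr (fun s => z * f s) g t = z * wr f g t.
Proof.
move=> /cderivable_cder df; rewrite /wr (cder_val (cderZ z df)).
by move: (cderive f t) (cderive g t) (f t) (g t) => *; ring.
Qed.

Lemma wr_ext f h g t : 0 < t -> (forall s, 0 < s -> f s = h s) -> cderivable h t ->
  wr f g t = wr h g t.
Proof.
move=> t0 fh /cderivable_cder dh; rewrite /wr fh //.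
by rewrite (cder_ext_val t0 fh) //; exists (cderive h t).
Qed.

(** By [wr_ladder] and [dminus_reg] the Wronskian of [dplus F] with [F'] is a multiple of that of
    [F] with itself, hence zero, so [dplus F] is a multiple of [F']. The multiple follows by
    applying [dminus] and comparing with the factorization. *)
Lemma dplus_reg t : 0 < t ->
  dplus F t = - ((gamma%:C ^+ 2 + lam * l.+1%:R ^+ 2) / (l.+1%:R * (2 * l + 3)%:R)) * F' t.
Proof.
have [al [be [E W]]] := sol_decomp (dplus_sol solF) rF' sG'.
have al0 : al = 0.
  have := W 1 ltr01; rewrite wr_ladder // wr_anti.
  have E1 s : 0 < s -> dminus F' s = l.+1%:R * (2 * l + 3)%:R * F s by exact: dminus_reg.
  rewrite (wr_ext _ ltr01 E1); last first.
    by apply: cder_derivable; apply: cderZ; apply: cderivable_cder; apply: solP solF ltr01.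
  rewrite wr_zl; last exact: solP solF ltr01.
  rewrite (wr_regat solF solF atF atF ltr01) mulr0 !oppr0 => /esym/eqP.
  by rewrite mulNr oppr_eq0 mulf_eq0 addn1 (negbTE (nz _)) => /eqP.
have E' s : 0 < s -> dplus F s = be * F' s by move=> s0; rewrite E // al0 mul0r add0r.
move=> t0; rewrite E' //; suff -> : be = - ((gamma%:C ^+ 2 + lam * l.+1%:R ^+ 2) / (l.+1%:R * (2 * l + 3)%:R)) by [].
have c0 : (l.+1%:R * (2 * l + 3)%:R : C) != 0 by rewrite mulf_neq0 ?addn3 ?nz.
have H s : 0 < s -> be * (l.+1%:R * (2 * l + 3)%:R) * F s =
    - (gamma%:C ^+ 2 + lam * l.+1%:R ^+ 2) * F s.
  move=> s0; rewrite -dminus_dplus // -mulrA -dminus_reg // /dminus E' //.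
  rewrite (cder_ext_val s0 E'); last first.
    by exists (be * cderive F' s); apply: cderZ; apply: cderivable_cder; apply: solP solF' s0.
  rewrite (cder_val (cderZ be (cderivable_cder (solP solF' s0)))).
  by move: (cderive _ _) (F' s) (l.+1%:R) (l.+2%:R) (gamma%:C) ((s%:C)^-1) => *; ring.
apply: (mulIf c0); rewrite mulNr divfK //.
apply/eqP; rewrite -subr_eq0; apply/eqP.
have hr h : regular_radial gamma l lam h -> regat l 1 h by exact: hreg.
have := wr_singat sG solF atF hr ltr01; rewrite /wr.
(* The difference of the two constants kills [F] and its derivative at [1], hence also the Wronskian
   of [G] and [F] there, which is nonzero; so the difference is zero. *)
have [F0 F10] : F 1 * (be * (l.+1%:R * (2 * l + 3)%:R) - - (gamma%:C ^+ 2 + lam * l.+1%:R ^+ 2)) = 0 /\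
   cderive F 1 * (be * (l.+1%:R * (2 * l + 3)%:R) - - (gamma%:C ^+ 2 + lam * l.+1%:R ^+ 2)) = 0.
  have Z s : 0 < s -> (be * (l.+1%:R * (2 * l + 3)%:R) - - (gamma%:C ^+ 2 + lam * l.+1%:R ^+ 2)) * F s = 0.
    by move=> s0; rewrite mulrBl H // subrr.
  split; first by rewrite mulrC Z.
  have d1 := cderZ (be * (l.+1%:R * (2 * l + 3)%:R) - - (gamma%:C ^+ 2 + lam * l.+1%:R ^+ 2))
    (cderivable_cder (solP solF ltr01)).
  have d2 := cder_pos ltr01 (fun s s0 => esym (Z s s0)) (cder_cst 0 1).
  by rewrite mulrC (cder_unique d1 d2).
move: F0 F10; move: (_ - _) => x F0 F10 w.
have : - (2 * l + 1)%:R * 1 * x = 0.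
  rewrite -w -mulrA mulrBl -!mulrA F0 [cderive F 1 * x]F10 !mulr0 subrr !mulr0 //.
by rewrite mulr1 mulNr => /eqP; rewrite oppr_eq0 mulf_eq0 addn1 (negbTE (nz _)) => /eqP.
Qed.

(** The coefficient of [G'] is found by taking the Wronskian with [F'] and moving the ladder
    operator to [F']. The regular part is left unspecified, as only classes modulo regular solutions
    count. *)
Lemma dplus_sing : exists be, forall t, 0 < t ->
  dplus G t = - (l.+1%:R * (2 * l + 1)%:R) * G' t + be * F' t.
Proof.
have [al [be [E W]]] := sol_decomp (dplus_sol solG) rF' sG'.
exists be => t t0; rewrite E //; congr (_ * _ + _).
have := W 1 ltr01; rewrite wr_ladder // wr_anti opprK.
have E1 s : 0 < s -> dminus F' s = l.+1%:R * (2 * l + 3)%:R * F s by exact: dminus_reg.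
rewrite (wr_ext _ ltr01 E1); last first.
  by apply: cder_derivable; apply: cderZ; apply: cderivable_cder; apply: solP solF ltr01.
rewrite wr_zl; last exact: solP solF ltr01.
rewrite wr_anti (wr_singat sG solF atF (@hreg _) ltr01).
have -> : (2 * l.+1 + 1 = 2 * l + 3)%N by lia.
have c0 : (2 * l + 3)%:R != 0 :> C by rewrite addn3 nz.
move: c0; move: ((2 * l + 3)%:R) ((2 * l + 1)%:R) (l.+1%:R) => a b c a0 H.
apply: (mulIf (x := - a)); first by rewrite oppr_eq0.
by rewrite [al * _]mulrC -H; ring.
Qed.

Lemma dminus_sing : exists be, forall t, 0 < t ->
  dminus G' t = (gamma%:C ^+ 2 + lam * l.+1%:R ^+ 2) / (l.+1%:R * (2 * l + 1)%:R) * G t + be * F t.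
Proof.
have [al [be [E W]]] := sol_decomp (dminus_sol solG') rF sG.
exists be => t t0; rewrite E //; congr (_ * _ + _).
have := W 1 ltr01; rewrite wr_anti -wr_ladder //.
rewrite (wr_ext _ ltr01 dplus_reg); last first.
  by apply: cder_derivable; apply: cderZ; apply: cderivable_cder; apply: solP solF' ltr01.
rewrite wr_zl; last exact: solP solF' ltr01.
rewrite wr_anti (wr_singat sG' solF' atF' (@hreg _) ltr01).
have -> : (2 * l.+1 + 1 = 2 * l + 3)%N by lia.
have c0 : (2 * l + 3)%:R != 0 :> C by rewrite addn3 nz.
have d0 : (2 * l + 1)%:R != 0 :> C by rewrite addn1 nz.
have e0 := nz l.
move: c0 d0 e0; move: ((2 * l + 3)%:R) ((2 * l + 1)%:R) (l.+1%:R) => a b c a0 b0 c0 H.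
apply: (mulIf (x := - b)); first by rewrite oppr_eq0.
rewrite [al * _]mulrC -H; move: (gamma%:C) => g; field.
by apply/and3P.
Qed.

End Ladder.

End Radial.

(** * Separated functions on the punctured space *)

Section RadialTimesPolynomial.
Variable R : realType.
Local Notation C := R[i].
Local Notation Re := (@complex.Re R).
Local Notation Im := (@complex.Im R).
Local Notation PC := (mpoly.mpoly 3 C).
Local Notation mX i := (mpoly.mpolyX C (mpoly.mnm1 i) : PC).
Local Notation e_ i := (delta_mx i 0 : 'cV[R]_3).
Implicit Types (h : R -> C) (P Y : PC) (x y : 'cV[R]_3) (i : 'I_3).

Definition ev x P : C := mpoly.meval (fun i => (x i 0)%:C) P.

Lemma evD x P Y : ev x (P + Y) = ev x P + ev x Y. Proof. exact: mpoly.mevalD. Qed.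
Lemma evB x P Y : ev x (P - Y) = ev x P - ev x Y. Proof. exact: mpoly.mevalB. Qed.
Lemma evN x P : ev x (- P) = - ev x P. Proof. exact: mpoly.mevalN. Qed.
Lemma evM x P Y : ev x (P * Y) = ev x P * ev x Y. Proof. exact: mpoly.mevalM. Qed.
Lemma evZ x c P : ev x (c *: P) = c * ev x P. Proof. exact: mpoly.mevalZ. Qed.
Lemma evX x i : ev x (mX i) = (x i 0)%:C. Proof. exact: mpoly.mevalXU. Qed.
Lemma evC x c : ev x (mpoly.mpolyC 3 c) = c. Proof. exact: mpoly.mevalC. Qed.
Lemma ev_sum x (I : Type) (s : seq I) (Q : pred I) (F : I -> PC) :
  ev x (\sum_(i <- s | Q i) F i) = \sum_(i <- s | Q i) ev x (F i).
Proof. exact: (raddf_sum (mpoly.meval _)). Qed.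

Lemma ev_nat x n : ev x n%:R = n%:R.
Proof. exact: (rmorph_nat (mpoly.meval _)). Qed.

Lemma ev0 x : ev x 0 = 0. Proof. exact: mpoly.meval0. Qed.

Lemma ev_nn x : ev x (nn C) = (enorm x ^+ 2)%:C.
Proof.
rewrite /nn ev_sum /enorm sqr_sqrtr ?sumr_ge0 // => [|i _]; last exact: sqr_ge0.
by rewrite rmorph_sum; apply: eq_bigr => i _; rewrite expr2 evM evX -rmorphM.
Qed.

Lemma enorm_gt0 x : (0 < enorm x) = (x != 0).
Proof.
rewrite /enorm sqrtr_gt0; apply/idP/idP => [|x0].
  by apply: contraTneq => ->; rewrite big1 ?ltxx // => i _; rewrite mxE expr0n.
rewrite lt0r sumr_ge0 ?andbT => [|i _]; last exact: sqr_ge0.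
apply: contraNneq x0 => /eqP; rewrite psumr_eq0 => [/allP h|i _]; last exact: sqr_ge0.
apply/eqP/colP => i; rewrite mxE; apply/eqP; rewrite -sqrf_eq0.
by apply: h; rewrite mem_index_enum.
Qed.

Lemma punctured_gt0 (x : punctured R) : 0 < enorm (val x).
Proof. by rewrite enorm_gt0; exact: (valP x). Qed.

Lemma delta_line i j x (s : R) : (s *: e_ i + x) j 0 = s * (j == i)%:R + x j 0.
Proof. by rewrite !mxE eqxx andbT. Qed.

Lemma ev_line_der i x P s :
  cder (fun s => ev (s *: e_ i + x) P) s (ev (s *: e_ i + x) (mpoly.mderiv i P)).
Proof.
elim/mpoly_ring_ind: P => [c|j|p q hp hq|p q hp hq].
- rewrite mpoly.mderivC ev0 (_ : (fun s => _) = fun=> c); first exact: cder_cst.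
  by apply/funext => u; rewrite evC.
- rewrite mderivX1 ev_nat (_ : (fun s => _) = fun s => s%:C * (j == i)%:R + (x j 0)%:C).
    apply: cder_eq (cderD (cderM (cder_id s) (cder_cst (j == i)%:R s)) (cder_cst (x j 0)%:C s)) _.
    by rewrite mul1r mulr0 !addr0.
  by apply/funext => u; rewrite evX delta_line rmorphD rmorphM rmorph_nat.
- rewrite mpoly.mderivD evD (_ : (fun s => _) = fun s => ev (s *: e_ i + x) p + ev (s *: e_ i + x) q).
    exact: cderD.
  by apply/funext => u; rewrite evD.
- rewrite mpoly.mderivM evD !evM (_ : (fun s => _) = fun s => ev (s *: e_ i + x) p * ev (s *: e_ i + x) q).
    exact: cderM.
  by apply/funext => u; rewrite evM.
Qed.

Lemma sqnorm_line_der i x : is_derive (0 : R) (1 : R)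
  (fun s => \sum_j (s *: e_ i + x) j 0 ^+ 2) (2 * x i 0).
Proof.
rewrite (_ : (fun s => _) = fun s => s ^+ 2 + (2 * x i 0) * s + \sum_j x j 0 ^+ 2).
  apply: is_derive_eq; rewrite /GRing.scale /= !mul0r ?mulr0 ?addr0 ?add0r ?mulr1; ring.
apply/funext => s; rewrite (bigD1 i) //= [in RHS](bigD1 i) //= delta_line eqxx mulr1.
rewrite addrA; congr (_ + _); first by ring.
by apply: eq_bigr => j /negbTE ne; rewrite delta_line ne mulr0 add0r.
Qed.

Lemma enorm_line_der i x : x != 0 ->
  is_derive (0 : R) (1 : R) (fun s => enorm (s *: e_ i + x)) (x i 0 / enorm x).
Proof.
move=> x0; have n0 : 0 < \sum_j x j 0 ^+ 2 by rewrite -sqrtr_gt0 -/(enorm x) enorm_gt0.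
pose q s := \sum_j (s *: e_ i + x) j 0 ^+ 2.
have q0 : q 0 = \sum_j x j 0 ^+ 2 by rewrite /q scale0r add0r.
have dq : is_derive (0 : R) (1 : R) q (2 * x i 0) by exact: sqnorm_line_der.
have ds : is_derive (q 0) (1 : R) Num.sqrt (2 * Num.sqrt (q 0))^-1.
  by apply: is_derive1_sqrt; rewrite q0.
have := @is_derive1_comp _ Num.sqrt q 0 _ _ ds dq.
rewrite q0 -/(enorm x) (_ : _ * _ = x i 0 / enorm x) //.
have e0 : enorm x != 0 by rewrite gt_eqF ?enorm_gt0.
by field.
Qed.

Lemma near_line_neq0 i x : x != 0 -> \forall s \near (0 : R), s *: e_ i + x != 0.
Proof.
move=> x0; have [d _] := enorm_line_der i x0.
have cn : {for 0, continuous (fun s : R => enorm (s *: e_ i + x))}.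
  by apply: differentiable_continuous; exact/derivable1_diffP.
have e0 : 0 < enorm (0 *: e_ i + x) by rewrite scale0r add0r enorm_gt0.
have : \forall s \near (0 : R), 0 < enorm (s *: e_ i + x) by exact: cvgr_gt cn _ e0.
by apply: filterS => s; rewrite enorm_gt0.
Qed.

Lemma line_is_derive (u : 'cV[R]_3 -> R) x v d :
  is_derive (0 : R) (1 : R) (fun s => u (s *: v + x)) d -> is_derive x v u d.
Proof.
have E : (fun s : R => s^-1 *: (((fun s => u (s *: v + x)) \o shift 0) (s *: 1) -
      (fun s => u (s *: v + x)) 0)) =
    (fun s : R => s^-1 *: ((u \o shift x) (s *: v) - u x)).
  apply/funext => s /=; rewrite addr0 scale0r add0r.
  by congr (_ *: (u (_ *: _ + _) - _)); rewrite /GRing.scale /= mulr1.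
move=> [h1 h2]; split; first by move: h1; rewrite /derivable E.
by move: h2; rewrite /derive E.
Qed.

Definition rp h P : fun_R3 R := fun x : punctured R => h (enorm (val x)) * ev (val x) P.

Lemma ext_rp h P y : y != 0 -> ext (rp h P) y = h (enorm y) * ev y P.
Proof. by move=> y0; rewrite /ext; case: insubP => [z _ <-|/negP]. Qed.

Lemma rp_line_der h d P i x : x != 0 -> cder h (enorm x) d ->
  cder (fun s : R => ext (rp h P) (s *: e_ i + x)) 0
    (d / (enorm x)%:C * ev x (mX i * P) + h (enorm x) * ev x (mpoly.mderiv i P)).
Proof.
move=> x0 hd; have E0 : 0 *: e_ i + x = x by rewrite scale0r add0r.
have hd' : cder h (enorm (0 *: e_ i + x)) d by rewrite E0.
have := cderM (@cder_comp R h (fun s => enorm (s *: e_ i + x)) 0 d _ hd' (enorm_line_der i x0)) (ev_line_der i x P 0).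
rewrite E0 => H; apply: cder_near (cder_eq H _).
  by have := near_line_neq0 i x0; apply: filterS => s s0; rewrite ext_rp.
have -> : (x i 0 / enorm x)%:C = (x i 0)%:C / (enorm x)%:C by rewrite rmorphM fmorphV.
rewrite evM evX; congr (_ + _).
by move: (ev x P) ((_)^-1) ((x i 0)%:C) => *; ring.
Qed.

Lemma rp_derivable h d P i (x : punctured R) : cder h (enorm (val x)) d ->
  pderivable (rp h P) x i.
Proof.
move=> hd; have [r1 r2] := rp_line_der P i (valP x) hd; split.
  by have [] := @line_is_derive (Re_ext (rp h P)) _ _ _ r1.
by have [] := @line_is_derive (Im_ext (rp h P)) _ _ _ r2.
Qed.

Lemma pd_rp h h1 P i : (forall t, 0 < t -> cder h t (h1 t)) ->
  pd i (rp h P) = rp (fun t => h1 t / t%:C) (mX i * P) + rp h (mpoly.mderiv i P).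
Proof.
move=> hd; apply/funext => x; have hx := hd _ (punctured_gt0 x).
have [r1 r2] := rp_line_der P i (valP x) hx; rewrite /pd.
have [_ ->] := @line_is_derive (Re_ext (rp h P)) _ _ _ r1.
have [_ ->] := @line_is_derive (Im_ext (rp h P)) _ _ _ r2.
exact: Re_Im.
Qed.

Lemma near_neq0 x : x != 0 -> \forall y \near x, y != 0.
Proof.
move=> x0; have [i xi] : exists i, x i 0 != 0.
  apply: contrapT => no; case/eqP: x0; apply/colP => i; rewrite mxE.
  by apply: contrapT => /eqP xi; apply: no; exists i.
have c : (fun y : 'cV[R]_3 => y i 0) @ x --> x i 0 by exact: coord_continuous.
have : \forall z \near x i 0, z != 0.
  by apply: open_nbhs_nbhs; split => //; exact: open_neq.
move=> H; have h : nbhs x [set y : 'cV[R]_3 | y i 0 != 0] by exact: (c _ H).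
by apply: filterS h => y; apply: contraNneq => ->; rewrite mxE.
Qed.

Definition ccont (f : 'cV[R]_3 -> C) x :=
  {for x, continuous (fun y => Re (f y))} /\ {for x, continuous (fun y => Im (f y))}.

Lemma ccont_near f g x : {near x, f =1 g} -> ccont f x -> ccont g x.
Proof.
move=> fg [hr hi]; have fgx : f x = g x by exact: (nbhs_singleton fg).
have er : \forall y \near x, Re (f y) = Re (g y) by apply: filterS fg => y ->.
have ei : \forall y \near x, Im (f y) = Im (g y) by apply: filterS fg => y ->.
split; rewrite /prop_for /continuous_at -fgx.
  apply: cvg_trans hr; exact: (@near_eq_cvg _ _ _ _ (fun y => Re (f y)) (fun y => Re (g y)) er).
apply: cvg_trans hi; exact: (@near_eq_cvg _ _ _ _ (fun y => Im (f y)) (fun y => Im (g y)) ei).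
Qed.

Lemma ccontD f g x : ccont f x -> ccont g x -> ccont (fun y => f y + g y) x.
Proof.
move=> [fr fi] [gr gi]; split.
  rewrite (_ : (fun y => _) = (fun y => Re (f y)) + (fun y => Re (g y))).
    exact: continuousD.
  by apply/funext => y; rewrite Re_add.
rewrite (_ : (fun y => _) = (fun y => Im (f y)) + (fun y => Im (g y))).
  exact: continuousD.
by apply/funext => y; rewrite Im_add.
Qed.

Lemma ccontM f g x : ccont f x -> ccont g x -> ccont (fun y => f y * g y) x.
Proof.
move=> [fr fi] [gr gi]; split.
  rewrite (_ : (fun y => _) = (fun y => Re (f y)) * (fun y => Re (g y)) -
      (fun y => Im (f y)) * (fun y => Im (g y))).
    by apply: continuousB; exact: continuousM.
  by apply/funext => y; rewrite Re_mul.
rewrite (_ : (fun y => _) = (fun y => Re (f y)) * (fun y => Im (g y)) +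
    (fun y => Im (f y)) * (fun y => Re (g y))).
  by apply: continuousD; exact: continuousM.
by apply/funext => y; rewrite Im_mul.
Qed.

Lemma ccont_cst c x : ccont (fun=> c) x.
Proof. by split; exact: cst_continuous. Qed.

Lemma ccont_ev P x : ccont (ev ^~ P) x.
Proof.
elim/mpoly_ring_ind: P => [c|j|p q hp hq|p q hp hq].
- rewrite (_ : ev^~ _ = fun=> c); first exact: ccont_cst.
  by apply/funext => u; rewrite evC.
- rewrite (_ : ev^~ _ = fun y => (y j 0)%:C); last by apply/funext => u; rewrite evX.
  by split; [exact: coord_continuous | exact: cst_continuous].
- rewrite (_ : ev^~ _ = fun y => ev y p + ev y q); first exact: ccontD.
  by apply/funext => u; rewrite evD.
- rewrite (_ : ev^~ _ = fun y => ev y p * ev y q); first exact: ccontM.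
  by apply/funext => u; rewrite evM.
Qed.

Lemma enorm_continuous x : {for x, continuous (@enorm R)}.
Proof.
apply: continuous_comp; last exact: sqrt_continuous.
rewrite (_ : (fun y => _) = fun y => Re (ev y (nn C))); first by have [] := ccont_ev (nn C) x.
apply/funext => y; rewrite ev_nn /enorm sqr_sqrtr // sumr_ge0 // => i _; exact: sqr_ge0.
Qed.

Lemma rp_continuous h d P (x : punctured R) : cder h (enorm (val x)) d ->
  ccont (ext (rp h P)) (val x).
Proof.
move=> /cder_continuous[hr hi].
apply: (@ccont_near (fun y => h (enorm y) * ev y P)).
  by apply: filterS (near_neq0 (valP x)) => y y0; rewrite ext_rp.
apply: ccontM (ccont_ev P _); split.
  exact: (continuous_comp (@enorm_continuous (val x)) hr).
exact: (continuous_comp (@enorm_continuous (val x)) hi).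
Qed.

Lemma rpD h P Y : rp h (P + Y) = rp h P + rp h Y.
Proof. by apply/funext => x; rewrite /rp evD mulrDr. Qed.

Lemma rpZ h c P : rp h (c *: P) = c *: rp h P.
Proof. by apply/funext => x; rewrite /rp evZ mulrCA. Qed.

Lemma rp_ext h k P : (forall t, 0 < t -> h t = k t) -> rp h P = rp k P.
Proof. by move=> hk; apply/funext => x; rewrite /rp hk // punctured_gt0. Qed.

(** Since [d_i (h(r) P)] equals [(h'(r) / r) x_i P + h(r) d_i P], stability of the profiles under
    this operation keeps all iterated partial derivatives in the span [rpspan], which gives
    smoothness. *)
Definition radially_closed (S : (R -> C) -> Prop) : Prop := forall h, S h ->
  exists2 h1, forall t, 0 < t -> cder h t (h1 t) & S (fun t => h1 t / t%:C).

Inductive rpspan (S : (R -> C) -> Prop) : fun_R3 R -> Prop :=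
  | RpSpan0 : rpspan S 0
  | RpSpanD h P F : S h -> rpspan S F -> rpspan S (rp h P + F).

Lemma rpspan_pd S F : radially_closed S -> rpspan S F ->
  [/\ forall (x : punctured R) i, pderivable F x i, forall x : punctured R, ccont (ext F) (val x)
    & forall i, rpspan S (pd i F)].
Proof.
move=> cS; elim=> [|h P {}F Sh SF [dF cF pF]].
  split=> [x i|x|i].
  - by have [_ _] := @smooth0 R [::] x.
  - by have [] := @smooth0 R [::] x.
  - rewrite (_ : pd i 0 = 0); first exact: RpSpan0.
    by apply/funext => x; rewrite /pd Re_ext0 Im_ext0 derive_cst.
have [h1 hd Sh1] := cS h Sh.
have dh (x : punctured R) i : pderivable (rp h P) x i by apply: rp_derivable; exact: hd _ (punctured_gt0 x).
split=> [x i|x|i].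
- by rewrite -[rp h P]scale1r; exact: pderivableD.
- apply: (@ccont_near (fun y => ext (rp h P) y + ext F y)).
    by apply: filterE => y; rewrite -[rp h P + F]/(rp h P + F) -[rp h P in RHS]scale1r extD mul1r.
  by apply: ccontD => //; apply: rp_continuous; exact: hd _ (punctured_gt0 x).
- rewrite (_ : pd i (rp h P + F) = rp (fun t => h1 t / t%:C) (mX i * P) +
    (rp h (mpoly.mderiv i P) + pd i F)); first by do 2!apply: RpSpanD => //.
  rewrite addrA -(pd_rp P i hd); apply/funext => x.
  by rewrite -[rp h P in LHS]scale1r pdD // mul1r.
Qed.

Lemma rpspan_smooth S F : radially_closed S -> rpspan S F -> smooth F.
Proof.
move=> cS hF s x; have : rpspan S (foldr (@pd R) F s).
  by elim: s => //= i s IH; have [_ _] := rpspan_pd cS IH.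
move=> /(rpspan_pd cS)[d c _] /=.
by have [c1 c2] := c x; split=> // i; exact: d.
Qed.

Lemma rp_smooth S h P : radially_closed S -> S h -> smooth (rp h P).
Proof.
move=> cS Sh; apply: (rpspan_smooth cS); rewrite -[rp h P]addr0.
by apply: RpSpanD => //; exact: RpSpan0.
Qed.

Lemma pdDD i (F G : fun_R3 R) : (forall x : punctured R, pderivable F x i) ->
  (forall x : punctured R, pderivable G x i) ->
  pd i (F + G) = pd i F + pd i G.
Proof.
by move=> dF dG; apply/funext => x; rewrite -[F in LHS]scale1r pdD // mul1r.
Qed.

Lemma mul_coord_rp i h P : mul_coord i (rp h P) = rp h (mX i * P).
Proof. by apply/funext => x; rewrite /mul_coord /rp evM evX mulrCA. Qed.

Lemma mul_coordD i (F G : fun_R3 R) : mul_coord i (F + G) = mul_coord i F + mul_coord i G.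
Proof. by apply/funext => x; rewrite /mul_coord [LHS]mulrDr. Qed.

Lemma rpB h P Y : rp h (P - Y) = rp h P - rp h Y.
Proof. by rewrite rpD -scaleN1r rpZ scaleN1r. Qed.

Definition rotD j k (F : fun_R3 R) : fun_R3 R :=
  mul_coord j (pd k F) - mul_coord k (pd j F).

Lemma rotD_rp j k h h1 P : (forall t, 0 < t -> cder h t (h1 t)) ->
  rotD j k (rp h P) = rp h (rot j k P).
Proof.
move=> hd; rewrite /rotD !(pd_rp _ _ hd) !mul_coordD !mul_coord_rp /rot rpB.
by rewrite [mX k * (mX j * P)]mulrCA opprD addrACA subrr add0r.
Qed.

Lemma rotDD j k (F G : fun_R3 R) : (forall (x : punctured R) j, pderivable F x j) ->
  (forall (x : punctured R) j, pderivable G x j) -> rotD j k (F + G) = rotD j k F + rotD j k G.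
Proof.
by move=> dF dG; rewrite /rotD !pdDD // !mul_coordD opprD addrACA.
Qed.

Lemma mul_rinv_rp h P : mul_rinv (rp h P) = rp (fun t => h t / t%:C) P.
Proof.
apply/funext => x; rewrite /mul_rinv /rp fmorphV.
by rewrite mulrA [_^-1 * _]mulrC.
Qed.

Lemma rp_nn h P : rp h (nn C * P) = rp (fun t => t%:C ^+ 2 * h t) P.
Proof. by apply/funext => x; rewrite /rp evM ev_nn rmorphXn mulrA [h _ * _]mulrC. Qed.

Lemma rpZl c h P : c *: rp h P = rp (fun t => c * h t) P.
Proof. by apply/funext => x; rewrite /rp -mulrA. Qed.

Lemma rpDl h k P : rp h P + rp k P = rp (fun t => h t + k t) P.
Proof. by apply/funext => x; rewrite /rp mulrDl. Qed.

Lemma rp0 h : rp h 0 = 0.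
Proof. by apply/funext => x; rewrite /rp ev0 mulr0. Qed.

Lemma rp_sum h (P : 'I_3 -> PC) : \sum_i rp h (P i) = rp h (\sum_i P i).
Proof. by elim/big_rec2: _ => [|i x y _ ->]; rewrite ?rp0 ?rpD. Qed.

(** The factor [2 l + 3] is [l + 3] from the divergence of [x P] plus [l] from Euler's identity. *)
Lemma laplacian_rp h h1 k1 l P : P \is mpoly.ishomog1 l mpoly.mdeg -> lap P = 0 ->
    (forall t, 0 < t -> cder h t (h1 t)) ->
    (forall t, 0 < t -> cder (fun t => h1 t / t%:C) t (k1 t)) ->
  \sum_i pd i (pd i (rp h P)) = rp (fun t => t%:C * k1 t + (2 * l + 3)%:R * (h1 t / t%:C)) P.
Proof.
move=> hP lP hd kd; pose k t := h1 t / t%:C.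
have E i : pd i (pd i (rp h P)) = rp (fun t => k1 t / t%:C) (mX i ^+ 2 * P) +
    rp k (mpoly.mderiv i (mX i * P)) + (rp k (mX i * mpoly.mderiv i P) + rp h (mpoly.mderiv i (mpoly.mderiv i P))).
  rewrite (pd_rp _ _ hd) pdDD => [|x|x].
  - by rewrite (pd_rp _ _ kd) (pd_rp _ _ hd) mulrA -expr2.
  - by apply: rp_derivable; exact: kd _ (punctured_gt0 x).
  - by apply: rp_derivable; exact: hd _ (punctured_gt0 x).
transitivity (rp (fun t => k1 t / t%:C) (nn C * P) + rp k ((l + 3)%:R * P) + rp k (l%:R * P)).
  rewrite (eq_bigr _ (fun i _ => E i)) !big_split /= !rp_sum -mulr_suml -/(nn C).
  by rewrite (deriv_mulX_sum hP) (euler_homog hP) -/(lap P) lP rp0 addr0.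
apply/funext => x; rewrite rp_nn /k /rp.
transitivity ((enorm (val x))%:C ^+ 2 * (k1 (enorm (val x)) / (enorm (val x))%:C) * ev (val x) P +
  h1 (enorm (val x)) / (enorm (val x))%:C * ev (val x) ((l + 3)%:R * P) +
  h1 (enorm (val x)) / (enorm (val x))%:C * ev (val x) (l%:R * P)) => //.
have x0 := tC_neq0 (punctured_gt0 x).
rewrite !evM !ev_nat (_ : (2 * l + 3)%:R = (l + 3)%:R + l%:R :> C); last by rewrite -natrD; congr _%:R; lia.
move: x0 (k1 _) (h1 _) (ev _ _) ((l + 3)%:R) (l%:R); move: ((enorm _)%:C) => u u0 a b c d e.
by field.
Qed.

End RadialTimesPolynomial.

(** * Separated solutions and the action of the operators on them *)

Section SeparatedSolutions.
Variables (R : realType) (gamma : R).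
Local Notation C := R[i].
Local Notation PC := (mpoly.mpoly 3 C).
Local Notation mX i := (mpoly.mpolyX C (mpoly.mnm1 i) : PC).
Local Notation homog l P := (P \is mpoly.ishomog1 l mpoly.mdeg).
Implicit Types (f : R -> C) (l : nat) (lam : C) (Y : PC).

Definition RA l f Y : fun_R3 R := rp (fun t => t%:C ^- l * f t) Y.

Lemma radial_angularE l f Y : homog l Y -> radial_angular f Y = RA l f Y.
Proof.
move=> hY; apply/funext => x; rewrite /RA /rp /radial_angular; set r := enorm (val x).
have E : mpoly.meval (fun i => (val x i 0 / r)%:C) Y = (r^-1)%:C ^+ l * ev (val x) Y.
  apply: etrans _ (meval_homog (fun i => (val x i 0)%:C) (r^-1)%:C hY).
  by congr mpoly.meval; apply/funext => i; rewrite rmorphM mulrC.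
by rewrite E fmorphV exprVn mulrCA mulrA.
Qed.

Lemma horner_der (p : {poly C}) t : cder (fun s : R => p.[s%:C]) t p^`().[t%:C].
Proof.
elim/poly_ind: p => [|p c IH].
  rewrite deriv0 horner0 (_ : (fun s => _) = fun=> 0); first exact: cder_cst.
  by apply/funext => s; rewrite horner0.
rewrite derivMXaddC !hornerE (_ : (fun s => _) = fun s => p.[s%:C] * s%:C + c).
  apply: cder_eq (cderD (cderM IH (cder_id t)) (cder_cst c t)) _.
  by rewrite mulr1 addr0 addrC.
by apply/funext => s; rewrite !hornerE.
Qed.

(** The radial equation eliminates the second derivative of [f], so these profiles form a radially
    closed class containing [t^-l f]; the negative powers of [t] absorb the poles at the origin. *)
Definition sol_radial f (h : R -> C) : Prop := exists n (p q : {poly C}), forall t, 0 < t ->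
  h t = t%:C ^- n * (p.[t%:C] * f t + q.[t%:C] * cderive f t).

Lemma sol_radial_alg (K : fieldType) (u v a b c d e g k m L j : K) : u != 0 -> v != 0 ->
  - (j * (u * v)^-1) * (a * e + c * g) +
    v^-1 * (b * e + a * g + (d * g + c * ((k / u ^+ 2 - m / u - L) * e - 2%:R / u * g))) =
  (u * (u * v))^-1 * ((- j * u * a + u ^+ 2 * b + c * (k - m * u - L * u ^+ 2)) * e +
    (- j * u * c + u ^+ 2 * a + u ^+ 2 * d - 2%:R * u * c) * g).
Proof. by move=> u0 v0; field; apply/andP. Qed.

Lemma sol_radial_closed l lam f : radial_solution gamma l lam f -> radially_closed (sol_radial f).
Proof.
move=> /rsolP sf h [n [p [q hE]]].
(* This polynomial is [t^2] times the coefficient [pot]. *)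
pose V : {poly C} := (l * l.+1)%:R%:P - (2 * gamma)%:C%:P * 'X - lam%:P * 'X ^+ 2.
pose p2 := - n%:R%:P * 'X * p + 'X ^+ 2 * p^`() + q * V.
pose q2 := - n%:R%:P * 'X * q + 'X ^+ 2 * p + 'X ^+ 2 * q^`() - 2%:R%:P * 'X * q.
exists (fun t => t%:C ^- n.+2 * (p2.[t%:C] * f t + q2.[t%:C] * cderive f t)); last first.
  exists n.+3, p2, q2 => t t0.
  by rewrite mulrAC -invfM -exprSr.
move=> t t0; have [f1 f2] := sf t t0.
apply: cder_pos (fun s s0 => esym (hE s s0)) _ => //.
apply: cder_eq (cderM (cder_invX n t0) (cderD (cderM (horner_der p t) f1) (cderM (horner_der q t) f2))) _.
rewrite /p2 /q2 /V !(hornerD, hornerN, hornerM, hornerC, hornerX, hornerXn) /pot.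
have e1 : t%:C ^+ n.+1 = t%:C * t%:C ^+ n :> C by rewrite exprS.
have e2 : t%:C ^+ n.+2 = t%:C * (t%:C * t%:C ^+ n) :> C by rewrite !exprS.
by rewrite e1 e2; apply: sol_radial_alg; rewrite ?expf_neq0 // tC_neq0.
Qed.

Lemma RA_smooth l lam f Y : radial_solution gamma l lam f -> smooth (RA l f Y).
Proof.
move=> sf; apply: (rp_smooth Y (sol_radial_closed sf)); exists l, 1, 0 => t t0.
by rewrite !hornerE.
Qed.

Definition hl1 l f t : C := - (l%:R * t%:C ^- l.+1) * f t + t%:C ^- l * cderive f t.

Lemma hl_der l lam f : radial_solution gamma l lam f -> forall t, 0 < t ->
  cder (fun t => t%:C ^- l * f t) t (hl1 l f t).
Proof. by move=> /rsolP sf t t0; have [f1 _] := sf t t0; exact: cderM (cder_invX l t0) f1. Qed.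

Lemma laplacian_alg (K : fieldType) (u v f f1 V L : K) : u != 0 -> v != 0 ->
  let z := v^-1 in let h1 := - (L * (u * v)^-1) * f + z * f1 in
  let h2 := - (L * - ((L + 1) * (u * (u * v))^-1)) * f + (- (L * (u * v)^-1)) * f1 +
     ((- (L * (u * v)^-1)) * f1 + z * (V * f - 2%:R / u * f1)) in
  u * (h2 * u^-1 + h1 * - u ^- 2) + (2%:R * L + 3%:R) * (h1 / u) =
  z * (V - L * (L + 1) / u ^+ 2) * f.
Proof. by move=> u0 v0 /=; field; apply/andP. Qed.

Lemma RA_T l lam f Y : radial_solution gamma l lam f -> homog l Y -> lap Y = 0 ->
  opT gamma (RA l f Y) = lam *: RA l f Y.
Proof.
move=> sf hY lY; have dh := hl_der sf; have /rsolP sf' := sf.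
pose h2 t : C := - (l%:R * - (l.+1%:R * t%:C ^- l.+2)) * f t + (- (l%:R * t%:C ^- l.+1)) * cderive f t +
  ((- (l%:R * t%:C ^- l.+1)) * cderive f t + t%:C ^- l * (pot gamma l lam t * f t - 2%:R / t%:C * cderive f t)).
have d2 t : 0 < t -> cder (hl1 l f) t (h2 t).
  move=> t0; have [f1 f2] := sf' t t0.
  exact: cderD (cderM (cderN (cderZ l%:R (cder_invX l.+1 t0))) f1) (cderM (cder_invX l t0) f2).
have dk t : 0 < t -> cder (fun t => hl1 l f t / t%:C) t (h2 t * (t%:C)^-1 + hl1 l f t * - (t%:C ^- 2)).
  by move=> t0; exact: cderM (d2 t t0) (cder_inv t0).
rewrite /opT (laplacian_rp hY lY dh dk) mul_rinv_rp rpZl -scaleN1r rpZl -[- rp _ _]scaleN1r rpZl rpDl.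
rewrite /RA rpZl; apply: rp_ext => t t0; have u0 := tC_neq0 t0.
have v0 : t%:C ^+ l != 0 :> C by rewrite expf_neq0.
have := laplacian_alg (f t) (cderive f t) (pot gamma l lam t) l%:R u0 v0.
rewrite /hl1 /h2 natrD natrM !exprS -[l.+1%:R]natr1 /= => ->.
rewrite /pot natrM -[l.+1%:R]natr1.
by move: u0 v0 (f t) (l%:R) ((2 * gamma)%:C); move: (t%:C) (_ ^+ l) => u v u0 v0 a b c; field; apply/andP.
Qed.

Lemma kfun_rp (A : 'M[R]_3) h P : orthogonal_mx A ->
  kfun A (rp h P) = rp h (sub (rho (map_mx (real_complex R) A)) P).
Proof.
move=> oA; apply/funext => x; have oR := rho_orth oA.
have iR : invmx (rho A) = (rho A)^T.
  have u : rho A \in unitmx by have [_] := mulmx1_unit oR.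
  by rewrite -[LHS]mul1mx -oR mulmxK.
have oT : rho A *m (rho A)^T = 1%:M by exact: mulmx1C.
pose y := (rho A)^T *m val x.
have ny : enorm y = enorm (val x).
  have E (z : 'cV[R]_3) : \sum_i z i 0 ^+ 2 = (z^T *m z) 0 0.
    by rewrite mxE; apply: eq_bigr => i _; rewrite mxE expr2.
  by rewrite /enorm !E /y trmx_mul trmxK mulmxA -[_ *m rho A *m _]mulmxA oT mulmx1.
have y0 : y != 0 by rewrite -enorm_gt0 ny punctured_gt0.
rewrite /kfun iR; apply: etrans (ext_rp h P y0) _; rewrite ny /rp; congr (_ * _).
rewrite /ev meval_sub; congr (mpoly.meval _ _); apply/funext => i.
rewrite /y mxE rmorph_sum; apply: eq_bigr => j _; rewrite rmorphM mxE; congr (_ * _).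
rewrite /rho det_map_mx mxE [in RHS]mxE [in RHS]mxE rmorphM.
by rewrite fmorphV.
Qed.

Lemma RA_kfun (A : 'M[R]_3) l f Y : orthogonal_mx A ->
  kfun A (RA l f Y) = RA l f (sub (rho (map_mx (real_complex R) A)) Y).
Proof. exact: kfun_rp. Qed.

Lemma orth_mapR (A : 'M[R]_3) : orthogonal_mx A -> orthogonal_mx (map_mx (real_complex R) A).
Proof. by rewrite /orthogonal_mx => oA; rewrite map_trmx -map_mxM oA map_mx1. Qed.

Lemma RA_sumZ l f (I : finType) (c : I -> C) (Y : I -> PC) :
  RA l f (\sum_i c i *: Y i) = \sum_i c i *: RA l f (Y i).
Proof.
rewrite /RA; elim/big_rec2: _ => [|i x y _ <-]; first exact: rp0.
by rewrite rpD rpZ.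
Qed.

Lemma RA_kfinite l f Y : homog l Y -> lap Y = 0 -> kfinite_fun (RA l f Y).
Proof.
move=> hY lY; exists (size (mons l)), (fun a => RA l f (hb (@unitC R) a)) => A oA.
pose Y' := sub (rho (map_mx (real_complex R) A)) Y.
have hY' : homog l Y' by exact: sub_homog.
have lY' : lap Y' = 0 by rewrite /Y' (lap_sub (rho_orth (orth_mapR oA))) lY raddf0.
exists (fun a => mpoly.mcoeff (mon a) Y').
by rewrite RA_kfun // -/Y' {1}(harm_homogE (@unitC R) hY' lY') RA_sumZ.
Qed.

Lemma RA_sol l lam f Y : radial_solution gamma l lam f -> homog l Y -> lap Y = 0 ->
  RA l f Y \in sol_pred gamma lam.
Proof.
move=> sf hY lY; apply/asboolP; split; [exact: RA_smooth sf|exact: RA_kfinite|exact: RA_T].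
Qed.

Lemma opL_RA l lam f Y i : radial_solution gamma l lam f ->
  opL i (RA l f Y) = RA l f (rot (i + 1) (i + 2%:R) Y).
Proof. by move=> sf; exact: (rotD_rp (i + 1) (i + 2%:R) Y (hl_der sf)). Qed.

Lemma opR_alg (K : fieldType) (u v f f1 g x y d L : K) : u != 0 -> v != 0 ->
    2%:R * L + 3%:R != 0 ->
  (- ((L + 1) * (u * (u * v))^-1) * f + (u * v)^-1 * f1) / u * ((L + 2%:R) * (x * y) - u ^+ 2 * d) +
   (u * v)^-1 * f * - ((L + 1) * d) + g * ((u * v)^-1 * f / u * (x * y)) =
  (2%:R * L + 3%:R)^-1 * ((u * (u * v))^-1 * ((L + 2%:R) * (f1 - (L + 1) * f / u) + g * f) *
     (x * (y * (2%:R * L + 3%:R)) - u ^+ 2 * d) -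
   v^-1 * ((L + 1) * (f1 + (L + 2%:R) * f / u) - g * f) * d).
Proof. by move=> u0 v0 L0; field; apply/and3P. Qed.

Lemma sum_rearrange (V : zmodType) (a1 a2 a3 b1 b2 b3 c : V) :
  a1 + b1 - (a2 + b2) - (a3 + b3) + c = a1 - a2 - a3 + (b1 - b2 - b3) + c.
Proof. by rewrite (addrACA (a1 - a2)) (addrACA a1) !opprD. Qed.

Lemma opR_rp i h h1 k1 l P : homog l P -> lap P = 0 ->
    (forall t, 0 < t -> cder h t (h1 t)) ->
    (forall t, 0 < t -> cder (fun t => h1 t / t%:C) t (k1 t)) ->
  opR gamma i (rp h P) = (0 +i* 1) *:
    (rp (fun t => h1 t / t%:C) (l.+1%:R * (mX i * P) - nn C * mpoly.mderiv i P) +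
     rp h (- (l%:R * mpoly.mderiv i P)) + gamma%:C *: rp (fun t => h t / t%:C) (mX i * P)).
Proof.
move=> hP lP hd kd.
have dk (Q : PC) (x : punctured R) j : pderivable (rp (fun t => h1 t / t%:C) Q) x j.
  by apply: rp_derivable; exact: kd _ (punctured_gt0 x).
have dh (Q : PC) (x : punctured R) j : pderivable (rp h Q) x j.
  by apply: rp_derivable; exact: hd _ (punctured_gt0 x).
have -> : opR gamma i (rp h P) = (0 +i* 1) *: (rotD i (i + 1) (pd (i + 1) (rp h P))
    - rotD (i + 2%:R) i (pd (i + 2%:R) (rp h P)) - pd i (rp h P)
    + gamma%:C *: mul_coord i (mul_rinv (rp h P))).
  by move: (rp h P) => F; rewrite /opR /opL !ord3_addE.
rewrite -(rot_mulX_sum i hP) -(rot_deriv_sum i hP lP); move: (i + 1) (i + 2%:R) => j k.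
rewrite !(pd_rp _ _ hd) !(rotDD _ _ (dk _) (dh _)) !(rotD_rp _ _ _ hd) !(rotD_rp _ _ _ kd).
rewrite mul_rinv_rp mul_coord_rp; congr (_ *: _).
have sub3 g (A B D : PC) : rp g (A - B - D) = rp g A - rp g B - rp g D by rewrite rpB rpB.
rewrite (sub3 _ _ _ (mX i * P)) (sub3 h _ _ (mpoly.mderiv i P)).
exact: sum_rearrange.
Qed.

(** Writing [(2 l + 1) x_i Y] as [up i Y] plus [|x|^2 d_i Y] splits the result into its two harmonic
    components, and the radial factors that collect in front of them are the ladder operators. *)
Lemma opR_RA l lam f Y i : radial_solution gamma l lam f -> homog l Y -> lap Y = 0 ->
  opR gamma i (RA l f Y) = ((0 +i* 1) / (2 * l + 1)%:R) *:
    (RA l.+1 (dplus gamma l f) (up i Y) - RA l.-1 (dminus gamma l.-1 f) (mpoly.mderiv i Y)).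
Proof.
move=> sf hY lY; have dh := hl_der sf; have /rsolP sf' := sf.
have dk t : 0 < t -> cder (fun t => hl1 l f t / t%:C) t (((- (l%:R * - (l.+1%:R * t%:C ^- l.+2)) * f t + (- (l%:R * t%:C ^- l.+1)) * cderive f t +
  ((- (l%:R * t%:C ^- l.+1)) * cderive f t + t%:C ^- l * (pot gamma l lam t * f t - 2%:R / t%:C * cderive f t)))) * (t%:C)^-1 + hl1 l f t * - (t%:C ^- 2)).
  move=> t0; have [f1 f2] := sf' t t0.
  exact: cderM (cderD (cderM (cderN (cderZ l%:R (cder_invX l.+1 t0))) f1) (cderM (cder_invX l t0) f2)) (cder_inv t0).
rewrite (opR_rp i hY lY dh dk) -scalerA; congr (_ *: _); apply/funext => x.
have u0 := tC_neq0 (punctured_gt0 x); set t := enorm (val x) in u0.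
pose y := ev (val x) Y; pose d := ev (val x) (mpoly.mderiv i Y); pose xi : C := (val x i 0)%:C.
transitivity (hl1 l f t / t%:C * ev (val x) (l.+1%:R * (mX i * Y) - nn C * mpoly.mderiv i Y) +
   t%:C ^- l * f t * ev (val x) (- (l%:R * mpoly.mderiv i Y)) +
   gamma%:C * (t%:C ^- l * f t / t%:C * ev (val x) (mX i * Y))); first by [].
have tt : (t ^+ 2)%:C = t%:C ^+ 2 :> C by rewrite rmorphXn.
rewrite evB evN !evM !ev_nat !evX ev_nn -/t -/y -/d -/xi tt.
transitivity ((2 * l + 1)%:R^-1 * (t%:C ^- l.+1 * dplus gamma l f t * ev (val x) (up i Y)
   - t%:C ^- l.-1 * dminus gamma l.-1 f t * d)); last by [].
rewrite /up (wgt_homog _ hY) /twol1 evB !evM evZ ev_nn evX -/t -/y -/d -/xi tt [(_%:R) * y]mulrC.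
  (* In degree [0] the lowering term is multiplied by a derivative of a constant, so the predecessor
     of [0] there does no harm. *)
  case: l hY {sf sf' dh dk lY} => [|l] hY.
    have d0 : d = 0 by rewrite /d (deriv_homog0 _ hY) ev0.
    rewrite d0 /hl1 /dplus /= expr0 expr1 !(mulr0, mul0r, oppr0, subr0, addr0, add0r, invr1, mul1r, mulr1).
    by move: u0 (f t) (cderive f t) xi y; move: (t%:C) => u u0 a b x' y'; field.
  have v0 : t%:C ^+ l != 0 :> C by rewrite expf_neq0.
  have L0 : 2%:R * l%:R + 3%:R != 0 :> C by rewrite -natrM -natrD addn3 pnatr_eq0.
  have := opR_alg (f t) (cderive f t) gamma%:C xi y d u0 v0 L0.
  rewrite /hl1 /dplus /dminus (_ : (2 * l.+1 + 1)%:R = 2%:R * l%:R + 3%:R :> C); last first.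
    by rewrite -natrM -natrD; congr _%:R; lia.
  rewrite !exprS expr0 !mulr1 /= (_ : l.+2%:R = l%:R + 2%:R :> C); last by rewrite -natrD addn2.
  by rewrite -[l.+1%:R]natr1.
Qed.

End SeparatedSolutions.

(** * Integration over the unit sphere *)

Section TrigonometricIntegrals.
Variable R : realType.
Local Notation mu := (@lebesgue_measure R).

Lemma cont_integrable (a b : R) (f : R -> R) : continuous f -> mu.-integrable `[a, b] (EFin \o f).
Proof.
move=> cf; apply: continuous_compact_integrable; first exact: segment_compact.
exact: continuous_subspaceT.
Qed.

Lemma continuous_lin (k : R) (f g : R -> R) : continuous f -> continuous g ->
  continuous (fun x => k * f x + g x).
Proof.
move=> cf cg; rewrite (_ : (fun x => _) = (k \*: f) + g) // => x.
by apply: continuousD; [exact: continuousZl_tmp (cf x) | exact: cg].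
Qed.

Definition Rint a b (f : R -> R) : R := \int[mu]_(x in `[a, b]) f x.

Lemma Rint_lin (a b k : R) (f g : R -> R) : continuous f -> continuous g ->
  Rint a b (fun x => k * f x + g x) = k * Rint a b f + Rint a b g.
Proof.
move=> cf cg; rewrite /Rint; have If := cont_integrable a b cf; have Ig := cont_integrable a b cg.
have ckf : continuous (fun x => k * f x) by move=> x; apply: continuousM; [exact: cst_continuous | exact: cf].
rewrite RintegralD //; last exact: (cont_integrable a b ckf).
by rewrite RintegralZl.
Qed.

Lemma Rint_ftc (a b : R) (f F : R -> R) : a < b -> continuous f -> (forall x, is_derive x (1 : R) F (f x)) ->
  Rint a b f = F b - F a.
Proof.
move=> ab cf dF; rewrite /Rint /Rintegral.
have cF : continuous F.
  by move=> x; apply: differentiable_continuous; apply/derivable1_diffP; have [] := dF x.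
rewrite (@continuous_FTC2 _ f F a b ab); last first.
- by move=> x _; rewrite derive1E; have [] := dF x.
- split.
  + by move=> x _; have [] := dF x.
  + by apply: cvg_at_right_filter; exact: cF.
  + by apply: cvg_at_left_filter; exact: cF.
- exact: continuous_subspaceT.
by [].
Qed.

Lemma Rint0 a b : Rint a b (fun=> 0) = 0.
Proof.
have c0 : continuous (fun _ : R => 0 : R) by exact: cst_continuous.
rewrite [LHS](_ : _ = Rint a b (fun x => -1 * 0 + 0)); last first.
  by congr Rint; apply/funext => x; rewrite mulr0 addr0.
by have -> := Rint_lin a b (-1) c0 c0; rewrite [X in X + _]mulN1r addNr.
Qed.

Definition tp m n (x : R) : R := sin x ^+ m * cos x ^+ n.

Lemma tp_der m n x : is_derive x (1 : R) (tp m n)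
  (m%:R * tp m.-1 n.+1 x - n%:R * tp m.+1 n.-1 x).
Proof.
rewrite (_ : tp m n = ((@sin R) ^+ m) * ((@cos R) ^+ n)); last first.
  by apply/funext => y; rewrite /tp -[RHS]/(((@sin R) ^+ m) y * ((@cos R) ^+ n) y) !exprfctE.
have ds : is_derive x (1 : R) ((@sin R) ^+ m) (m%:R * sin x ^+ m.-1 * cos x).
  by apply: is_derive_eq; rewrite /GRing.scale /= ?mulr_natl.
have dc : is_derive x (1 : R) ((@cos R) ^+ n) (n%:R * cos x ^+ n.-1 * - sin x).
  by apply: is_derive_eq; rewrite /GRing.scale /= ?mulr_natl.
apply: is_derive_eq (is_deriveM ds dc) _; rewrite /tp /GRing.scale /= !exprfctE !exprS.
by move: (sin x ^+ m) (cos x ^+ n) (sin x ^+ m.-1) (cos x ^+ n.-1) (sin x) (cos x) => *; ring.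
Qed.

Lemma tp_continuous m n : continuous (tp m n).
Proof.
move=> x; apply: differentiable_continuous; apply/derivable1_diffP.
by have [] := tp_der m n x.
Qed.

Definition Jint b m n : R := Rint 0 b (tp m n).

(** The integral of the derivative of [sin^m cos^n], whose boundary terms cancel by hypothesis. *)
Lemma Jint_rec b m n : 0 < b -> tp m n b = tp m n 0 ->
  m%:R * Jint b m.-1 n.+1 = n%:R * Jint b m.+1 n.-1.
Proof.
move=> b0 E; apply/eqP; rewrite -subr_eq0; apply/eqP.
have c1 := @tp_continuous m.-1 n.+1; have c2 := @tp_continuous m.+1 n.-1.
have c0 : continuous (fun _ : R => 0 : R) by exact: cst_continuous.
pose f x := m%:R * tp m.-1 n.+1 x + ((- n%:R) * tp m.+1 n.-1 x + 0).
have cz := @continuous_lin (- n%:R) _ _ c2 c0.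
have cf : continuous f := @continuous_lin m%:R _ _ c1 cz.
have r0 := Rint0 0 b.
have dF x : is_derive x (1 : R) (tp m n) (f x).
  by have := tp_der m n x; rewrite /f addr0 mulNr.
have := Rint_ftc b0 cf dF; rewrite E subrr /f !Rint_lin // r0 addr0 mulNr => <-.
by [].
Qed.

Lemma Jint_pyth b m n : Jint b m.+2 n + Jint b m n.+2 = Jint b m n.
Proof.
have c1 := @tp_continuous m.+2 n; have c2 := @tp_continuous m n.+2.
rewrite -[Jint b m.+2 n]mul1r -Rint_lin //; congr Rint; apply/funext => x.
rewrite mul1r /tp -[RHS]mul1r -(cos2Dsin2 x) !exprS.
by move: (sin x ^+ m) (cos x ^+ n) (sin x) (cos x) => *; ring.
Qed.

Definition Aint := Jint pi.
Definition Bint := Jint (2 * pi).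

Lemma Aint_rec m n : m.+1%:R * Aint m n.+1 = n%:R * Aint m.+2 n.-1.
Proof. by apply: (@Jint_rec pi m.+1 n (pi_gt0 R)); rewrite /tp sinpi sin0 !expr0n !mul0r. Qed.

Lemma Bint_rec m n : m%:R * Bint m.-1 n.+1 = n%:R * Bint m.+1 n.-1.
Proof.
apply: Jint_rec; first by rewrite mulr_gt0 // pi_gt0.
by rewrite /tp mulr2n mulrDl mul1r -mulr2n sin2pi cos2pi sin0 cos0.
Qed.

(** The integral of the monomial with exponents [a], [b], [c] over the unit sphere in polar
    coordinates; the additional power of the sine is the area element. *)
Definition moment a b c := Aint (a + b).+1 c * Bint b a.

(** Integration by parts combined with the Pythagorean identity lowers a single exponent by two. *)
Lemma Bint_x b a : (a + b).+1%:R * Bint b a.+1 = a%:R * Bint b a.-1.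
Proof.
have := Bint_rec b.+1 a; rewrite /= => E.
case: a E => [|a] /= E; first by rewrite mul0r add0n in E *; rewrite E mul0r.
have := Jint_pyth (2 * pi) b a; rewrite -/Bint => P.
rewrite -P mulrDr -E -mulrDl -natrD; congr (_%:R * _); lia.
Qed.

Lemma Bint_y b a : (a + b).+1%:R * Bint b.+1 a = b%:R * Bint b.-1 a.
Proof.
have := Bint_rec b a.+1; rewrite /= => E.
case: b E => [|b] /= E; first by rewrite mul0r addn0 in E *; rewrite -E mul0r.
have := Jint_pyth (2 * pi) b a; rewrite -/Bint => P.
rewrite -P mulrDr E -mulrDl -natrD; congr (_%:R * _); lia.
Qed.

(** The three identities of this kind express invariance under rotations in the coordinate planes.
    In this plane only the longitude integral changes; in the other two both factors have to be
    reduced. *)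
Lemma moment12 a b c : b%:R * moment a.+1 b.-1 c = a%:R * moment a.-1 b.+1 c.
Proof.
case: b => [|b]; case: a => [|a]; rewrite ?mul0r //=.
- by have := Bint_rec 0 a.+1; rewrite mul0r /moment mulrCA => <-; rewrite mulr0.
- by have := Bint_rec b.+1 0; rewrite mul0r /moment mulrCA => ->; rewrite mulr0.
rewrite /moment !(mulrCA _ (Aint _ _)) (_ : (a.+2 + b).+1 = (a + b.+2).+1); last by lia.
by congr (_ * _); exact: (Bint_rec b.+1 a.+1).
Qed.

Lemma moment13 a b c : c%:R * moment a.+1 b c.-1 = a%:R * moment a.-1 b c.+1.
Proof.
have hA := Aint_rec (a + b) c; have hB := Bint_x b a.
rewrite /moment addSn mulrA -hA mulrAC hB mulrAC.
by case: a {hA hB} => [|a] /=; rewrite ?mul0r // -mulrA mulrCA mulrA -!mulrA [Aint _ _ * _]mulrC.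
Qed.

Lemma moment23 a b c : c%:R * moment a b.+1 c.-1 = b%:R * moment a b.-1 c.+1.
Proof.
have hA := Aint_rec (a + b) c; have hB := Bint_y b a.
rewrite /moment addnS mulrA -hA mulrAC hB mulrAC.
by case: b {hA hB} => [|b] /=; rewrite ?mul0r // addnS -mulrA mulrCA mulrA -!mulrA [Aint _ _ * _]mulrC.
Qed.

Lemma moment_nn a b c : moment a.+2 b c + moment a b.+2 c + moment a b c.+2 = moment a b c.
Proof.
rewrite /moment !addnS !addSn -mulrDr [Bint b a.+2 + _]addrC Jint_pyth -mulrDl.
by rewrite Jint_pyth.
Qed.

Lemma Rint_sum a b (I : Type) (s : seq I) (c : I -> R) (g : I -> R -> R) :
  (forall i, continuous (g i)) ->
  continuous (fun x => \sum_(i <- s) c i * g i x) /\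
  Rint a b (fun x => \sum_(i <- s) c i * g i x) = \sum_(i <- s) c i * Rint a b (g i).
Proof.
move=> cg; elim: s => [|i s [cs IH]].
  rewrite big_nil (_ : (fun x => _) = fun=> 0); last by apply/funext => x; rewrite big_nil.
  by split; [exact: cst_continuous | exact: Rint0].
rewrite big_cons (_ : (fun x => _) = fun x => c i * g i x + \sum_(i <- s) c i * g i x); last first.
  by apply/funext => x; rewrite big_cons.
by split; [exact: continuous_lin | rewrite Rint_lin // IH].
Qed.

Lemma moment000 : moment 0 0 0 = 4 * pi.
Proof.
have A1 : Aint 1 0 = 2.
  rewrite /Aint /Jint (_ : tp 1 0 = sin); last by apply/funext => x; rewrite /tp expr0 expr1 mulr1.
  have dc (x : R) : is_derive x (1 : R) (- (@cos R)) (sin x).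
    by rewrite -[sin x]opprK; exact: (is_deriveN (is_derive_cos x)).
  have cs : continuous (@sin R) by exact: continuous_sin.
  have -> := Rint_ftc (pi_gt0 R) cs dc.
  by rewrite -[(- (@cos R)) pi]/(- cos pi) -[(- (@cos R)) 0]/(- cos 0) cospi cos0 !opprK -mulr2n.
have B0 : Bint 0 0 = 2 * pi.
  rewrite /Bint /Jint (_ : tp 0 0 = fun=> 1); last by apply/funext => x; rewrite /tp !expr0 mulr1.
  have p0 : 0 < 2 * pi :> R by rewrite mulr_gt0 // pi_gt0.
  have c1 : continuous (fun _ : R => 1 : R) by exact: cst_continuous.
  have d1 (x : R) : is_derive x (1 : R) id (1 : R) by exact: is_derive_id.
  by have -> := Rint_ftc p0 c1 d1; rewrite subr0.
rewrite /moment addn0 A1 B0 mulrA; congr (_ * _).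
by rewrite -natrM.
Qed.

Local Notation C := R[i].
Local Notation Re := (@complex.Re R).
Local Notation Im := (@complex.Im R).
Local Notation mons3 := (mpoly.multinom 3).

Definition mono (m : mons3) (w : 'cV[R]_3) : R := \prod_i w i 0 ^+ m i.

Lemma prod3 (F : 'I_3 -> R) : \prod_i F i = F 0 * F 1 * F 2%:R.
Proof.
rewrite big_ord_recl big_ord_recl big_ord1 mulrA.
by congr (F _ * F _ * F _); apply: val_inj.
Qed.

Lemma mono_sphere (m : mons3) theta phi : mono m (sphere_point theta phi) =
  (sin theta * cos phi) ^+ m 0 * (sin theta * sin phi) ^+ m 1 * cos theta ^+ m 2%:R.
Proof. by rewrite /mono prod3 !mxE. Qed.

Lemma sphere_int_real_sum (s : seq mons3) (c : mons3 -> R) :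
  sphere_int_real (fun w => \sum_(m <- s) c m * mono m w) =
  \sum_(m <- s) c m * moment (m 0) (m 1) (m 2%:R).
Proof.
have E theta phi : (\sum_(m <- s) c m * mono m (sphere_point theta phi)) * sin theta =
    \sum_(m <- s) (c m * tp (m 0%R + m 1%R).+1 (m 2%:R) theta) * tp (m 1) (m 0) phi.
  rewrite mulr_suml; apply: eq_bigr => m _; rewrite -!mulrA; congr (_ * _).
  rewrite mono_sphere /tp; move: (m 0) (m 1) (m 2%:R) (sin theta) (cos theta) (sin phi) (cos phi).
  move=> a b d st ct sp cp; rewrite !exprMn exprS exprD.
  by move: (st ^+ a) (st ^+ b) (ct ^+ d) (sp ^+ b) (cp ^+ a) => *; ring.
rewrite /sphere_int_real.
transitivity (Rint 0 pi (fun theta => \sum_(m <- s) (c m * Bint (m 1) (m 0)) * tp (m 0%R + m 1%R).+1 (m 2%:R) theta)).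
  congr (Rint 0 pi _); apply/funext => theta.
  transitivity (Rint 0 (2 * pi) (fun phi => \sum_(m <- s) (c m * tp (m 0%R + m 1%R).+1 (m 2%:R) theta) * tp (m 1) (m 0) phi)).
    by congr (Rint 0 (2 * pi) _); apply/funext => phi; exact: E.
  have -> := (Rint_sum 0 (2 * pi) s (fun m => c m * tp (m 0%R + m 1%R).+1 (m 2%:R) theta) (fun m : mons3 => @tp_continuous (m 1) (m 0))).2.
  by apply: eq_bigr => m _; rewrite mulrAC.
have -> := (Rint_sum 0 pi s (fun m => c m * Bint (m 1) (m 0)) (fun m : mons3 => @tp_continuous (m 0%R + m 1%R).+1 (m 2%:R))).2.
by apply: eq_bigr => m _; rewrite /moment -mulrA [Bint _ _ * _]mulrC.
Qed.

Definition cmoment a b c : C := (moment a b c)%:C.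

Lemma sphere_int_ev P : sphere_int (fun w => ev w P) = Iint (momfun cmoment) P.
Proof.
have E w : ev w P = \sum_(m <- mpoly.msupp P) mpoly.mcoeff m P * (mono m w)%:C.
  rewrite /ev /mpoly.meval /mpoly.mmap; apply: eq_bigr => m _; congr (_ * _).
  rewrite /mpoly.mmap1 /mono rmorph_prod; apply: eq_bigr => i _.
  by rewrite rmorphXn.
have ReS (s : seq mons3) (F : mons3 -> C) : Re (\sum_(m <- s) F m) = \sum_(m <- s) Re (F m).
  by elim/big_rec2: _ => // m x y _ <-; rewrite Re_add.
have ImS (s : seq mons3) (F : mons3 -> C) : Im (\sum_(m <- s) F m) = \sum_(m <- s) Im (F m).
  by elim/big_rec2: _ => // m x y _ <-; rewrite Im_add.
rewrite /sphere_int /Iint.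
rewrite (_ : (fun w => Re _) = fun w => \sum_(m <- mpoly.msupp P) Re (mpoly.mcoeff m P) * mono m w); last first.
  by apply/funext => w; rewrite E ReS; apply: eq_bigr => m _; rewrite Re_mul /= mulr0 subr0.
rewrite (_ : (fun w => Im _) = fun w => \sum_(m <- mpoly.msupp P) Im (mpoly.mcoeff m P) * mono m w); last first.
  by apply/funext => w; rewrite E ImS; apply: eq_bigr => m _; rewrite Im_mul /= mulr0 add0r.
rewrite !sphere_int_real_sum; apply/eqP; rewrite eq_complex; apply/andP; split; apply/eqP; rewrite /= ?ReS ?ImS; apply: eq_bigr => m _.
  by rewrite Re_mul /= mulr0 subr0.
by rewrite Im_mul /= mulr0 add0r.
Qed.

Lemma sphere_int_ext (h k : 'cV[R]_3 -> C) :
  (forall w, enorm w = 1 -> h w = k w) -> sphere_int h = sphere_int k.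
Proof.
move=> hk; have sp theta phi : h (sphere_point theta phi) = k (sphere_point theta phi).
  apply: hk; apply/eqP; rewrite -(@eqrXn2 _ 2) ?sqrtr_ge0 // expr1n /enorm sqr_sqrtr ?sumr_ge0 // => [|i _]; last exact: sqr_ge0.
  by rewrite sum3 !mxE /= !exprMn -mulrDr cos2Dsin2 mulr1 addrC cos2Dsin2.
have E (F G : 'cV[R]_3 -> R) : (forall theta phi, F (sphere_point theta phi) = G (sphere_point theta phi)) ->
    sphere_int_real F = sphere_int_real G.
  by move=> FG; apply: eq_Rintegral => theta _; apply: eq_Rintegral => phi _; rewrite FG.
rewrite /sphere_int; congr (_ +i* _); apply: E => theta phi; by rewrite sp.
Qed.

Lemma sphere_harmonic l m (Y Z : mpoly.mpoly 3 C) : Y \is mpoly.ishomog1 l mpoly.mdeg ->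
    Z \is mpoly.ishomog1 m mpoly.mdeg -> lap Y = 0 -> lap Z = 0 ->
  sphere_int (fun w => ev w (Y * Z)) = (4 * pi)%:C * ((l == m)%:R * cc C l * fis Y Z).
Proof.
move=> hY hZ lY lZ; rewrite sphere_int_ev.
have K (n p : nat) (x y : R) : n%:R * x = p%:R * y -> (n%:R : C) * x%:C = p%:R * y%:C.
  by move=> E; rewrite -!(rmorph_nat (real_complex R)) -!rmorphM E.
have k12 a b c : b%:R * cmoment a.+1 b.-1 c = a%:R * cmoment a.-1 b.+1 c.
  by apply: K; exact: moment12.
have k13 a b c : c%:R * cmoment a.+1 b c.-1 = a%:R * cmoment a.-1 b c.+1.
  by apply: K; exact: moment13.
have k23 a b c : c%:R * cmoment a b.+1 c.-1 = b%:R * cmoment a b.-1 c.+1.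
  by apply: K; exact: moment23.
have knn a b c : cmoment a.+2 b c + cmoment a b.+2 c + cmoment a b c.+2 = cmoment a b c.
  by rewrite /cmoment -!rmorphD moment_nn.
rewrite (Iint_harmonic (momfun_rot k12 k13 k23) (momfun_nn knn) hY hZ lY lZ).
by rewrite /momfun !mpoly.mnm0E /cmoment moment000 mulrC.
Qed.

End TrigonometricIntegrals.

(** * Superpositions of separated solutions *)

Section AdditiveMaps.
Variable K : comNzRingType.
Local Notation P := (mpoly.mpoly 3 K).
Implicit Types p q : P.

Lemma sub0E B : sub B (0 : P) = 0. Proof. exact: raddf0. Qed.
Lemma subDE B p q : sub B (p + q) = sub B p + sub B q. Proof. exact: raddfD. Qed.
Lemma rot0E i j : rot i j (0 : P) = 0. Proof. exact: raddf0. Qed.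
Lemma rotDE i j p q : rot i j (p + q) = rot i j p + rot i j q. Proof. exact: raddfD. Qed.
Lemma rl0E al be i : rl al be i (0 : P) = 0. Proof. exact: raddf0. Qed.
Lemma rlDE al be i p q : rl al be i (p + q) = rl al be i p + rl al be i q.
Proof. exact: raddfD. Qed.
Lemma wgt0E a : wgt a (0 : P) = 0. Proof. exact: raddf0. Qed.
Lemma wgtDE a p q : wgt a (p + q) = wgt a p + wgt a q. Proof. exact: raddfD. Qed.
Lemma wgtPE a c p q : wgt a (c *: p + q) = c *: wgt a p + wgt a q. Proof. exact: linearP. Qed.

Lemma rl_homogE al be l i p : p \is mpoly.ishomog1 l mpoly.mdeg ->
  rl al be i p = al l *: up i p + be l *: mpoly.mderiv i p.
Proof.
by move=> hp; rewrite /rl !(wgt_homog _ hp) !linearZ.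
Qed.

Lemma lap_rotE i j p : lap p = 0 -> lap (rot i j p) = 0.
Proof. by move=> hp; rewrite lap_rot hp rot0E. Qed.

Lemma lapDE p q : lap p = 0 -> lap q = 0 -> lap (p + q) = 0.
Proof.
move=> hp hq; have -> : lap (p + q) = lap p + lap q by exact: raddfD.
by rewrite hp hq addr0.
Qed.

Lemma lapZE c p : lap p = 0 -> lap (c *: p) = 0.
Proof.
move=> hp; have -> : lap (c *: p) = c *: lap p by exact: linearZ.
by rewrite hp scaler0.
Qed.

Lemma lap0E : lap (0 : P) = 0.
Proof. exact: raddf0. Qed.

End AdditiveMaps.

(** * Linearity of the operators on smooth functions *)

Section SmoothOperators.
Variables (R : realType) (gamma : R).
Local Notation C := R[i].
Implicit Types f g : fun_R3 R.

Lemma smooth_pd j f : smooth f -> smooth (pd j f).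
Proof. by move=> sf s x; have := sf (rcons s j) x; rewrite foldr_rcons. Qed.

Lemma pd_lin j c f g : smooth f -> smooth g -> pd j (c *: f + g) = c *: pd j f + pd j g.
Proof. by move=> sf sg; exact: (smoothD c sf sg).1 [:: j]. Qed.

Lemma mul_coord_lin i c f g : mul_coord i (c *: f + g) = c *: mul_coord i f + mul_coord i g.
Proof. by apply/funext => x; rewrite /mul_coord [LHS]mulrDr mulrCA. Qed.

Lemma mul_rinv_lin c f g : mul_rinv (c *: f + g) = c *: mul_rinv f + mul_rinv g.
Proof. by apply/funext => x; rewrite /mul_rinv [LHS]mulrDr mulrCA. Qed.

Lemma subr_lin (V : lmodType C) c (a b a' b' : V) :
  c *: a + b - (c *: a' + b') = c *: (a - a') + (b - b').
Proof. by rewrite scalerBr opprD addrACA. Qed.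

Lemma addr_lin (V : lmodType C) c (a b a' b' : V) :
  c *: a + b + (c *: a' + b') = c *: (a + a') + (b + b').
Proof. by rewrite scalerDr addrACA. Qed.

Lemma scaler_lin (V : lmodType C) k c (a b : V) : k *: (c *: a + b) = c *: (k *: a) + k *: b.
Proof. by rewrite scalerDr !scalerA mulrC. Qed.

Lemma opL_lin i c f g : smooth f -> smooth g -> opL i (c *: f + g) = c *: opL i f + opL i g.
Proof.
move=> sf sg; rewrite /opL; move: (i + 1) (i + 2%:R) => j k.
by rewrite !pd_lin // !mul_coord_lin subr_lin.
Qed.

Lemma opR_lin i c f g : smooth f -> smooth g ->
  opR gamma i (c *: f + g) = c *: opR gamma i f + opR gamma i g.
Proof.
move=> sf sg; rewrite /opR; move: (i + 1) (i + 2%:R) => j k.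
rewrite !pd_lin // mul_rinv_lin mul_coord_lin.
rewrite !opL_lin; try exact: smooth_pd.
by rewrite scaler_lin !subr_lin addr_lin scaler_lin.
Qed.

Lemma smooth_add f g : smooth f -> smooth g -> smooth (f + g).
Proof. by move=> sf sg; have := (smoothD 1 sf sg).2; rewrite scale1r. Qed.

Lemma opL_add i f g : smooth f -> smooth g -> opL i (f + g) = opL i f + opL i g.
Proof. by move=> sf sg; have := opL_lin i 1 sf sg; rewrite !scale1r. Qed.

Lemma opR_add i f g : smooth f -> smooth g -> opR gamma i (f + g) = opR gamma i f + opR gamma i g.
Proof. by move=> sf sg; have := opR_lin i 1 sf sg; rewrite !scale1r. Qed.

Lemma kfun_add A f g : kfun A (f + g) = kfun A f + kfun A g.
Proof. by have := kfunD A 1 f g; rewrite !scale1r. Qed.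

Lemma morph_add0 (op : fun_R3 R -> fun_R3 R) :
  (forall f g, smooth f -> smooth g -> op (f + g) = op f + op g) -> op 0 = 0.
Proof.
move=> h; have := h _ _ (@smooth0 R) (@smooth0 R).
by rewrite addr0 => /(congr1 (fun z => z - op 0)); rewrite subrr addrK.
Qed.

Lemma polyT_sol lam (p : {poly C}) f : f \in sol_pred gamma lam -> polyT gamma p f = p.[lam] *: f.
Proof.
move=> hf; have E k : iter k (opT gamma) f = lam ^+ k *: f.
  elim: k => [|k IH]; first by rewrite expr0 scale1r.
  have hk : lam ^+ k *: f \in sol_pred gamma lam by exact: rpredZ.
  by move/asboolP: hk => [_ _ E]; rewrite iterS IH E scalerA -exprS.
rewrite /polyT horner_coef scaler_suml; apply: eq_bigr => k _.
by rewrite E scalerA.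
Qed.

End SmoothOperators.

Section HarmonicSuperposition.
Variables (R : realType) (gamma : R).
Local Notation C := R[i].
Local Notation PC := (mpoly.mpoly 3 C).
Local Notation homog l P := (P \is mpoly.ishomog1 l mpoly.mdeg).
Implicit Types (f g F : nat -> R -> C) (P Q : PC) (lam : C).

(** The sum over all degrees [l] of [f_l (r)] times the degree [l] part of [P] at [x / r], written
    with a single weight. Every solution needed below has this form, so [P] serves as its
    coordinate. *)
Definition SO : (nat -> R -> C) -> PC -> fun_R3 R := locked (fun f P (x : punctured R) =>
  ev (val x) (wgt (fun l => (enorm (val x))%:C ^- l * f l (enorm (val x))) P)).

Lemma SOE f P (x : punctured R) : SO f P x =
  ev (val x) (wgt (fun l => (enorm (val x))%:C ^- l * f l (enorm (val x))) P).
Proof. by rewrite /SO -lock. Qed.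

Lemma SO_homog f l P : homog l P -> SO f P = RA l (f l) P.
Proof. by move=> hP; apply/funext => x; rewrite SOE (wgt_homog _ hP) evZ. Qed.

Lemma SO_lin f c P Q : SO f (c *: P + Q) = c *: SO f P + SO f Q.
Proof. by apply/funext => x; rewrite -[RHS]/(c * SO f P x + SO f Q x) !SOE wgtPE evD evZ. Qed.

Lemma SO0 f : SO f 0 = 0.
Proof. by apply/funext => x; rewrite SOE wgt0E ev0. Qed.

Lemma SOD f P Q : SO f (P + Q) = SO f P + SO f Q.
Proof. by have := SO_lin f 1 P Q; rewrite !scale1r. Qed.

Lemma SOZ f c P : SO f (c *: P) = c *: SO f P.
Proof. by have := SO_lin f c P 0; rewrite SO0 !addr0. Qed.

Lemma SO_sum f (I : Type) (s : seq I) (Fs : I -> PC) :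
  SO f (\sum_(i <- s) Fs i) = \sum_(i <- s) SO f (Fs i).
Proof. by elim/big_rec2: _ => [|i x y _ <-]; rewrite ?SO0 ?SOD. Qed.

Lemma SO_zero P : SO (fun _ _ => 0) P = 0.
Proof.
apply/funext => x; rewrite SOE (@eq_wgt _ _ (fun=> 0)) => [|l]; last by rewrite mulr0.
by rewrite wgt_cst scale0r ev0.
Qed.

Lemma sol_add lam (phi psi : fun_R3 R) : phi \in sol_pred gamma lam ->
  psi \in sol_pred gamma lam -> phi + psi \in sol_pred gamma lam.
Proof. by move=> h k; have := (sol_submod gamma lam).2 1 _ _ h k; rewrite scale1r. Qed.

Lemma sol_smooth lam (phi : fun_R3 R) : phi \in sol_pred gamma lam -> smooth phi.
Proof. by move/asboolP => []. Qed.

Section Solutions.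
Variables (lam : C) (f : nat -> R -> C).
Hypothesis sf : forall l, radial_solution gamma l lam (f l).

Lemma SO_sol P : lap P = 0 -> SO f P \in sol_pred gamma lam.
Proof.
move: P; apply: harm_ind => [|P Q hP hQ|l P hP lP].
- by have -> := SO0 f; exact: (sol_submod gamma lam).1.
- by have -> := SOD f P Q; exact: sol_add.
- by have -> := SO_homog f hP; exact: RA_sol.
Qed.

Lemma SO_smooth P : lap P = 0 -> smooth (SO f P).
Proof. by move=> hP; exact: sol_smooth (SO_sol hP). Qed.

Variable F : nat -> R -> C.
Hypothesis sF : forall l, radial_solution gamma l lam (F l).

(** The error term in [F] allows computing modulo regular solutions: [F] is the regular family when
    [f] is the singular one, and zero when [f] is itself regular. *)
Lemma SO_intertwine (op : fun_R3 R -> fun_R3 R) (m : PC -> PC) :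
    (forall phi psi, smooth phi -> smooth psi -> op (phi + psi) = op phi + op psi) ->
    m 0 = 0 -> {morph m : P Q / P + Q} ->
    (forall l P, homog l P -> lap P = 0 -> exists Q, lap Q = 0 /\
       op (RA l (f l) P) = SO f (m P) + SO F Q) ->
  forall P, lap P = 0 -> exists Q, lap Q = 0 /\ op (SO f P) = SO f (m P) + SO F Q.
Proof.
move=> opD m0 mD hop P hP0; suff [] : smooth (SO f P) /\ exists Q, lap Q = 0 /\
  op (SO f P) = SO f (m P) + SO F Q by [].
move: P hP0; apply: harm_ind => [|P Q [sP [P1 [lP1 hP]]] [sQ [Q1 [lQ1 hQ]]]|l P hP lP].
- rewrite m0 !SO0; split; first exact: smooth0.
  by exists 0; split; [exact: lap0E | rewrite SO0 addr0 (morph_add0 opD)].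
- have -> := SOD f P Q; split; first exact: smooth_add.
  exists (P1 + Q1); split; first exact: lapDE.
  by rewrite opD // hP hQ mD !SOD addrACA.
have -> := SO_homog f hP; split; first exact: RA_smooth (sf l).
exact: hop.
Qed.

Variables al be : nat -> C.
Hypothesis hplus : forall l, exists b, forall t, 0 < t ->
  dplus gamma l (f l) t = (2 * l + 1)%:R * al l * f l.+1 t + b * F l.+1 t.
Hypothesis hminus : forall l, exists b, forall t, 0 < t ->
  dminus gamma l (f l.+1) t = - ((2 * l + 3)%:R * be l.+1) * f l t + b * F l t.

Lemma RA_comb l (h u v : R -> C) a b P : homog l P ->
  (forall t, 0 < t -> h t = a * u t + b * v t) ->
  RA l h P = a *: RA l u P + b *: RA l v P.
Proof.
move=> hP E; apply/funext => x; rewrite /RA /rp.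
rewrite -[RHS]/(a * ((enorm (val x))%:C ^- l * u (enorm (val x)) * ev (val x) P) +
  b * ((enorm (val x))%:C ^- l * v (enorm (val x)) * ev (val x) P)).
rewrite (E _ (punctured_gt0 x)).
move: ((enorm (val x))%:C ^- l) (u _) (v _) (ev _ _) => c y z e; ring.
Qed.

Lemma ladder_comb (V : lmodType C) (k a a' b b' c c' : C) (u v w z : V) :
  k * a = c -> k * a' = - c' ->
  k *: (a *: u + b *: v - (a' *: w + b' *: z)) =
  (c *: u + c' *: w) + ((k * b) *: v + (- (k * b')) *: z).
Proof.
move=> <- E; rewrite opprD addrACA scalerDr scalerBr !scalerA E scaleNr opprK.
by rewrite scalerBr !scalerA scaleNr.
Qed.

Lemma natC_neq0 n : n.+1%:R != 0 :> C.
Proof. by rewrite pnatr_eq0. Qed.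

Lemma ladder_step l u d : homog l.+1 u -> lap u = 0 -> lap d = 0 ->
    (if l is m.+1 then homog m d else d = 0) ->
  exists Q, lap Q = 0 /\
    ((0 +i* 1) / (2 * l + 1)%:R) *:
      (RA l.+1 (dplus gamma l (f l)) u - RA l.-1 (dminus gamma l.-1 (f l)) d) =
    SO f ((0 +i* 1) *: (al l *: u + be l *: d)) + SO F Q.
Proof.
move=> uP lu ld dP; have [b hb] := hplus l.
have -> := RA_comb uP hb.
have n0 : (2 * l + 1)%:R != 0 :> C by rewrite addn1 natC_neq0.
case: l uP hb dP n0 => [|l] uP hb dP n0.
  exists (((0 +i* 1) / (2 * 0 + 1)%:R * b) *: u); split; first exact: lapZE.
  rewrite dP scaler0 addr0 !SOZ.
  have -> := SO_homog f uP; have -> := SO_homog F uP.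
  have -> : RA 0.-1 (dminus gamma 0.-1 (f 0%N)) 0 = 0.
    by apply/funext => x; rewrite /RA /rp ev0 mulr0.
  by rewrite subr0 scalerDr !scalerA mulrA divfK.
have [b' hb'] := hminus l.
have -> := RA_comb dP hb'.
exists (((0 +i* 1) / (2 * l.+1 + 1)%:R * b) *: u +
  (- ((0 +i* 1) / (2 * l.+1 + 1)%:R * b')) *: d); split; first by apply: lapDE; apply: lapZE.
rewrite SOD !SOZ SOD !SOZ.
have -> := SO_homog f uP; have -> := SO_homog F uP.
have -> := SO_homog f dP; have -> := SO_homog F dP.
rewrite [X in _ = X + _]scalerDr !scalerA; apply: ladder_comb.
  by rewrite mulrA divfK.
rewrite (_ : (2 * l + 3)%N = (2 * l.+1 + 1)%N); last by lia.
by rewrite mulrN mulrA divfK.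
Qed.

Lemma opR_SO i P : lap P = 0 -> exists Q, lap Q = 0 /\
  opR gamma i (SO f P) = SO f ((0 +i* 1) *: rl al be i P) + SO F Q.
Proof.
move: P; apply: (SO_intertwine (m := fun P => (0 +i* 1) *: rl al be i P)) => [||P Q|l P hP lP].
- exact: opR_add.
- by rewrite rl0E scaler0.
- by rewrite rlDE scalerDr.
rewrite (opR_RA i (sf l) hP lP) (rl_homogE al be i hP); apply: ladder_step.
- exact: up_homog.
- exact: lap_up.
- by rewrite lap_deriv lP mpoly.mderiv0.
- by case: l hP => [|l] hP; [exact: deriv_homog0 | exact: deriv_homog].
Qed.

End Solutions.

Section Invariance.
Variables (lam : C) (f : nat -> R -> C).
Hypothesis sf : forall l, radial_solution gamma l lam (f l).

Lemma zero_sol l : radial_solution gamma l lam (fun=> 0).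
Proof.
have h := rsol_lin (-1) (sf l) (sf l).
by apply: rsol_ext h => t _; rewrite mulN1r addNr.
Qed.

Lemma SO_intertwine_exact (op : fun_R3 R -> fun_R3 R) (m : PC -> PC) :
    (forall phi psi, smooth phi -> smooth psi -> op (phi + psi) = op phi + op psi) ->
    m 0 = 0 -> {morph m : P Q / P + Q} ->
    (forall l P, homog l P -> lap P = 0 -> op (RA l (f l) P) = SO f (m P)) ->
  forall P, lap P = 0 -> op (SO f P) = SO f (m P).
Proof.
move=> opD m0 mD hop P lP.
have [|Q [_ ->]] := SO_intertwine sf (F := fun _ _ => 0) opD m0 mD _ lP.
  move=> l S hS lS; exists 0; split; first exact: lap0E.
  by rewrite SO0 addr0 hop.
by rewrite (SO_zero Q) addr0.
Qed.

Lemma SO_kfun (A : 'M[R]_3) P : orthogonal_mx A -> lap P = 0 ->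
  kfun A (SO f P) = SO f (sub (rho (map_mx (real_complex R) A)) P).
Proof.
move=> oA; move: P; apply: SO_intertwine_exact => [phi psi _ _|||l P hP lP].
- exact: kfun_add.
- exact: sub0E.
- exact: subDE.
apply: etrans (RA_kfun l (f l) P oA) _; apply: esym; exact: SO_homog (sub_homog _ hP).
Qed.

Lemma opL_SO i P : lap P = 0 -> opL i (SO f P) = SO f (rot (i + 1) (i + 2%:R) P).
Proof.
move: P; apply: SO_intertwine_exact => [phi psi|||l P hP lP].
- exact: opL_add.
- exact: rot0E.
- exact: rotDE.
apply: etrans (opL_RA P i (sf l)) _; apply: esym; exact: SO_homog (rot_homog _ _ hP).
Qed.

End Invariance.

Section LieOperators.
Variables (lam : C) (f F : nat -> R -> C) (al be alF beF : nat -> C).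
Hypothesis sf : forall l, radial_solution gamma l lam (f l).
Hypothesis sF : forall l, radial_solution gamma l lam (F l).
Hypothesis hplus : forall l, exists b, forall t, 0 < t ->
  dplus gamma l (f l) t = (2 * l + 1)%:R * al l * f l.+1 t + b * F l.+1 t.
Hypothesis hminus : forall l, exists b, forall t, 0 < t ->
  dminus gamma l (f l.+1) t = - ((2 * l + 3)%:R * be l.+1) * f l t + b * F l t.
Hypothesis hplusF : forall l, exists b, forall t, 0 < t ->
  dplus gamma l (F l) t = (2 * l + 1)%:R * alF l * F l.+1 t + b * 0.
Hypothesis hminusF : forall l, exists b, forall t, 0 < t ->
  dminus gamma l (F l.+1) t = - ((2 * l + 3)%:R * beF l.+1) * F l t + b * 0.

Definition gspec (X : galg R) P : PC := \sum_i ((X.1 0 i).[lam] *: rot (i + 1) (i + 2%:R) P +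
    ((X.2 0 i).[lam] * (0 +i* 1)) *: rl al be i P).

Lemma opR_SOF i Q : lap Q = 0 -> opR gamma i (SO F Q) = SO F ((0 +i* 1) *: rl alF beF i Q).
Proof.
move=> lQ; have [Q0 [_ ->]] := opR_SO sF (F := fun _ _ => 0) hplusF hminusF i lQ.
by rewrite (SO_zero Q0) addr0.
Qed.

Lemma gop_term (p q : {poly C}) (k : C) a b c d : lap a = 0 -> lap b = 0 -> lap c = 0 -> lap d = 0 ->
  polyT gamma p (SO f a + SO F b) + polyT gamma q (SO f (k *: c) + SO F d) =
  SO f (p.[lam] *: a + (q.[lam] * k) *: c) + SO F (p.[lam] *: b + q.[lam] *: d).
Proof.
move=> la lb lc ld.
have cL : SO f a + SO F b \in sol_pred gamma lam by exact: sol_add (SO_sol sf la) (SO_sol sF lb).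
have cR : SO f (k *: c) + SO F d \in sol_pred gamma lam.
  exact: sol_add (SO_sol sf (lapZE k lc)) (SO_sol sF ld).
rewrite (polyT_sol _ cL) (polyT_sol _ cR) !scalerDr addrACA !SOD !SOZ scalerA.
by [].
Qed.

(** A representative of a singular class is a singular superposition plus a regular one. The
    operators act on the first by the ladder formulas and keep the second, together with all errors,
    within the regular superpositions. *)
Lemma gop_pair X P Q : lap P = 0 -> lap Q = 0 -> exists Q', lap Q' = 0 /\
  gop gamma X (SO f P + SO F Q) = SO f (gspec X P) + SO F Q'.
Proof.
move=> lP lQ; have sP := SO_smooth sf lP; have sQ := SO_smooth sF lQ.
have /choice [S hS] := fun i => opR_SO sf hplus hminus i lP.
pose U i := (X.1 0 i).[lam] *: rot (i + 1) (i + 2%:R) P +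
    ((X.2 0 i).[lam] * (0 +i* 1)) *: rl al be i P.
pose V i := (X.1 0 i).[lam] *: rot (i + 1) (i + 2%:R) Q +
   (X.2 0 i).[lam] *: (S i + (0 +i* 1) *: rl alF beF i Q).
have lS i : lap (S i + (0 +i* 1) *: rl alF beF i Q) = 0.
  by apply: lapDE; [exact: (hS i).1 | apply: lapZE; exact: lap_rl].
exists (\sum_i V i); split.
  apply: (big_ind (fun p : PC => lap p = 0)); [exact: lap0E | exact: lapDE | move=> i _].
  by apply: lapDE; apply: lapZE; [exact: lap_rotE | exact: lS].
have -> : SO f (gspec X P) = \sum_i SO f (U i) := SO_sum f _ U.
have -> : SO F (\sum_i V i) = \sum_i SO F (V i) := SO_sum F _ V.
rewrite /gop -big_split; apply: eq_bigr => i _.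
have eL : opL i (SO f P + SO F Q) = SO f (rot (i + 1) (i + 2%:R) P) + SO F (rot (i + 1) (i + 2%:R) Q).
  apply: etrans (opL_add i sP sQ) _; congr (_ + _); [exact: opL_SO sf i _ lP | exact: opL_SO sF i _ lQ].
have eR : opR gamma i (SO f P + SO F Q) =
    SO f ((0 +i* 1) *: rl al be i P) + SO F (S i + (0 +i* 1) *: rl alF beF i Q).
  apply: etrans (opR_add gamma i sP sQ) _; rewrite (hS i).2 (opR_SOF i lQ) -addrA.
  by congr (_ + _); apply: esym; exact: SOD.
rewrite eL eR; apply: gop_term; [exact: lap_rotE|exact: lap_rotE|exact: lap_rl|exact: lS].
Qed.

End LieOperators.

Lemma ev_scale (t : R) w P : ev (t *: w) P = ev w (wgt (fun l => t%:C ^+ l) P).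
Proof.
move: P; apply: homog_ind => [|P Q hP hQ|l P hP].
- by rewrite wgt0E !ev0.
- by rewrite wgtDE !evD hP hQ.
rewrite (wgt_homog _ hP) evZ /ev -(meval_homog _ _ hP); congr mpoly.meval.
by apply/funext => i; rewrite mxE rmorphM.
Qed.

Lemma SO_sphere f P t w : 0 < t -> enorm w = 1 ->
  ext (SO f P) (t *: w) = ev w (wgt (fun l => f l t) P).
Proof.
move=> t0 w1.
have nt : enorm (t *: w) = t.
  rewrite /enorm (eq_bigr (fun i => t ^+ 2 * w i 0 ^+ 2)) => [|i _]; last by rewrite mxE exprMn.
  by rewrite -mulr_sumr sqrtrM ?sqr_ge0 // sqrtr_sqr gtr0_norm // -/(enorm w) w1 mulr1.
have tw0 : t *: w != 0 by rewrite -enorm_gt0 nt.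
rewrite /ext; case: insubP => [x _ ex|]; last by rewrite tw0.
rewrite SOE ex nt ev_scale wgt_comp; congr (ev w _); apply: eq_wgt => l.
by rewrite mulrA divff ?mul1r // expf_neq0 // tC_neq0.
Qed.

Lemma ev_wgt_cder f (f1 : nat -> C) w P t : (forall l, cder (f l) t (f1 l)) ->
  cder (fun s => ev w (wgt (fun l => f l s) P)) t (ev w (wgt f1 P)).
Proof.
move=> hf; move: P; apply: homog_ind => [|P Q hP hQ|l P hP].
- rewrite (_ : (fun s => _) = fun=> 0); last by apply/funext => s; rewrite wgt0E ev0.
  by rewrite wgt0E ev0; exact: cder_cst.
- rewrite (_ : (fun s => _) = fun s => ev w (wgt (fun l => f l s) P) + ev w (wgt (fun l => f l s) Q)).
    by rewrite wgtDE evD; exact: cderD.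
  by apply/funext => s; rewrite wgtDE evD.
- rewrite (_ : (fun s => _) = fun s => ev w P * f l s); last first.
    by apply/funext => s; rewrite (wgt_homog _ hP) evZ mulrC.
  by rewrite (wgt_homog _ hP) evZ mulrC; exact: cderZ.
Qed.

Lemma ext_add (phi psi : fun_R3 R) y : ext (phi + psi) y = ext phi y + ext psi y.
Proof. by have := extD 1 phi psi y; rewrite scale1r mul1r. Qed.

Lemma wronskian_alg (K : comNzRingType) (k a b c a' b' d : K) :
  k * ((a + a') * c - (b + b') * d) = k * a * c - k * b * d + (k * a' * c - k * b' * d).
Proof. by ring. Qed.

Lemma wronskian_pair lam f F g P Q S r (w w' : nat -> C) : 0 < r ->
    (forall l, radial_solution gamma l lam (f l)) ->
    (forall l, radial_solution gamma l lam (F l)) ->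
    (forall l, radial_solution gamma l lam (g l)) ->
    (forall l, wr (f l) (g l) r = w l) -> (forall l, wr (F l) (g l) r = w' l) ->
    lap P = 0 -> lap Q = 0 -> lap S = 0 ->
  wronskian r (SO f P + SO F Q) (SO g S) =
  fis (wgt (fun l => w l * cc C l) P) S + fis (wgt (fun l => w' l * cc C l) Q) S.
Proof.
move=> r0 sf sF sg hw hw' lP lQ lS.
have cd (h : nat -> R -> C) (sh : forall l, radial_solution gamma l lam (h l)) S1 x : enorm x = 1 ->
    cder (fun t => ext (SO h S1) (t *: x)) r (ev x (wgt (fun l => cderive (h l) r) S1)).
  move=> x1; apply: (@cder_pos _ (fun s => ev x (wgt (fun l => h l s) S1))) => //.
    by move=> s s0; rewrite SO_sphere.
  by apply: ev_wgt_cder => l; have /rsolP := sh l => /(_ r r0) [].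
pose Z (h : nat -> R -> C) (T : PC) := wgt (fun l => r%:C ^+ 2 * cderive (h l) r) T * wgt (fun l => g l r) S -
    wgt (fun l => r%:C ^+ 2 * h l r) T * wgt (fun l => cderive (g l) r) S.
have E1 : sphere_int (fun x => (r ^+ 2)%:C *
    (cderive (fun t => ext (SO f P + SO F Q) (t *: x)) r * ext (SO g S) (r *: x) -
     ext (SO f P + SO F Q) (r *: x) * cderive (fun t => ext (SO g S) (t *: x)) r)) =
    sphere_int (fun x => ev x (Z f P + Z F Q)).
  apply: sphere_int_ext => x x1.
  have -> : cderive (fun t => ext (SO f P + SO F Q) (t *: x)) r =
      ev x (wgt (fun l => cderive (f l) r) P) + ev x (wgt (fun l => cderive (F l) r) Q).
    apply: cder_val; rewrite (_ : (fun t => _) = fun t => ext (SO f P) (t *: x) + ext (SO F Q) (t *: x)).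
      by apply: cderD; [exact: cd sf _ _ x1 | exact: cd sF _ _ x1].
    by apply/funext => t; rewrite ext_add.
  have -> := cder_val (cd g sg S x x1).
  have eZ h T : ev x (Z h T) =
      r%:C ^+ 2 * ev x (wgt (fun l => cderive (h l) r) T) * ev x (wgt (fun l => g l r) S) -
      r%:C ^+ 2 * ev x (wgt (fun l => h l r) T) * ev x (wgt (fun l => cderive (g l) r) S).
    have eM a T1 T2 : ev x (wgt (fun l => r%:C ^+ 2 * a l) T1 * T2) =
        r%:C ^+ 2 * ev x (wgt a T1) * ev x T2.
      apply: etrans (evM _ _ _) _; congr (_ * _); apply: etrans (congr1 (ev x) (wgtZ _ _ _)) _.
      exact: evZ.
    by apply: etrans (evB _ _ _) _; congr (_ - _); exact: eM.
  have -> := ext_add (SO f P) (SO F Q) (r *: x).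
  have -> := SO_sphere f P r0 x1; have -> := SO_sphere F Q r0 x1; have -> := SO_sphere g S r0 x1.
  have -> : (r ^+ 2)%:C = r%:C ^+ 2 :> C by rewrite rmorphXn.
  apply: etrans (wronskian_alg _ _ _ _ _ _ _) _; apply: esym; apply: etrans (evD _ _ _) _.
  exact: f_equal2 (eZ f P) (eZ F Q).
have E2 := sphere_int_ev (Z f P + Z F Q).
have E3 (h : nat -> R -> C) (T : PC) v : (forall l, wr (h l) (g l) r = v l) -> lap T = 0 ->
    Iint (momfun (@cmoment R)) (Z h T) = (4 * pi)%:C * fis (wgt (fun l => v l * cc C l) T) S.
  move=> hv lT; apply: Iint_wgt lT lS => [l m Y1 Z1 hY hZ lY lZ|l].
    exact: etrans (esym (sphere_int_ev (Y1 * Z1))) (sphere_harmonic hY hZ lY lZ).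
  by rewrite -hv /wr mulrBr !mulrA.
have E4 : Iint (momfun (@cmoment R)) (Z f P + Z F Q) = (4 * pi)%:C *
    (fis (wgt (fun l => w l * cc C l) P) S + fis (wgt (fun l => w' l * cc C l) Q) S).
  apply: etrans (IintD _ _ _) _; apply: etrans _ (esym (mulrDr _ _ _)).
  exact: f_equal2 (E3 f P w hw lP) (E3 F Q w' hw' lQ).
have p0 : 4 * pi != 0 :> R by rewrite mulf_neq0 ?gt_eqF ?pi_gt0.
have pK : ((4 * pi)^-1)%:C * (4 * pi)%:C = 1 :> C by rewrite -rmorphM mulVf.
rewrite /wronskian E1 E2 E4; apply: etrans (mulrA _ _ _) _.
exact: etrans (congr1 ( *%R^~ _) pK) (mul1r _).
Qed.

End HarmonicSuperposition.

(** * Parametrization of the families of solutions *)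

Section LadderCoefficients.
Variables (R : realType) (gamma : R).
Local Notation C := R[i].
Local Notation O := {poly C}.

Lemma poly_ext (p q : O) : (forall x, p.[x] = q.[x]) -> p = q.
Proof.
move=> H; apply/eqP; rewrite -subr_eq0; apply/eqP; apply: poly_eq0_horner => x.
by rewrite hornerD hornerN H subrr.
Qed.

Lemma horner_natr n x : (n%:R : O).[x] = n%:R.
Proof. exact: (rmorph_nat (horner_eval x)). Qed.

(** The constant of [dplus_reg] up to sign, divided by the factor [2 l + 1] from [opR_RA]. As a
    polynomial in [lam] it vanishes exactly at a bound-state energy. *)
Definition c1 l : O := (((l.+1%:R * (2 * l + 1)%:R * (2 * l + 3)%:R)^-1 : C))%:P *
  ((gamma%:C ^+ 2)%:P + 'X * (l.+1%:R ^+ 2)%:P).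

Lemma horner_c1 l x : (c1 l).[x] =
  (gamma%:C ^+ 2 + x * l.+1%:R ^+ 2) / (l.+1%:R * (2 * l + 1)%:R * (2 * l + 3)%:R).
Proof. by rewrite /c1 hornerM hornerD hornerM !hornerC hornerX mulrC. Qed.

(** The four sequences are read off from the ladder formulas: regular solutions carry [c1] when
    raised, singular ones when lowered. The values of the lowering weights at [0] are irrelevant, as
    derivatives kill constants. *)
Definition alR l : O := - c1 l.
Definition beR l : O := - l%:R.
Definition alS l : O := - l.+1%:R.
Definition beS l : O := - c1 l.-1.

(** The radial Wronskian in degree [l] times the ratio between the normalized sphere integral and
    the Fischer pairing. *)
Definition ka l : C := - (2 * l + 1)%:R * cc C l.

Lemma ka_neq0 l : ka l != 0.
Proof. by rewrite /ka mulf_neq0 ?cc_neq0 // oppr_eq0 pnatr_eq0 addn1. Qed.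

Lemma kaS l : ka l.+1 = - cc C l.
Proof.
have n0 : (2 * l + 3)%:R != 0 :> C by rewrite pnatr_eq0 addn3.
rewrite /ka /= (_ : (2 * l.+1 + 1)%N = (2 * l + 3)%N); last by lia.
by rewrite mulNr mulrC divfK.
Qed.

Lemma c1_rec_alg (K : fieldType) (l x g : K) : 2%:R * l + 5%:R != 0 -> 2%:R * l + 3%:R != 0 ->
    l + 1 != 0 -> l + 2%:R != 0 -> 2%:R * l + 1 != 0 ->
  (2%:R * l + 5%:R) * ((g ^+ 2 + x * (l + 2%:R) ^+ 2) / ((l + 2%:R) * (2%:R * l + 3%:R) * (2%:R * l + 5%:R)) * (l + 2%:R)) =
  x + (2%:R * l + 1) * ((g ^+ 2 + x * (l + 1) ^+ 2) / ((l + 1) * (2%:R * l + 1) * (2%:R * l + 3%:R)) * (l + 1)).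
Proof. by move=> *; field; do ! (apply/andP; split). Qed.

(** After cancellation both fractions have the denominator [2 l + 3]; [gamma^2] drops out and the
    difference of the squares of [l + 2] and [l + 1] is [2 l + 3]. Both families have the product
    [c1 l * (l + 1)], so this is the bracket relation for both. *)
Lemma c1_rec l : (2 * l + 5)%:R * (c1 l.+1 * l.+2%:R) = 'X + (2 * l + 1)%:R * (c1 l * l.+1%:R) :> O.
Proof.
apply: poly_ext => x; have e k m : (c1 k * m%:R).[x] = (c1 k).[x] * m%:R by rewrite hornerM horner_natr.
rewrite hornerM horner_natr hornerD hornerX [X in _ = _ + X]hornerM horner_natr !e !horner_c1.
have nz n : n.+1%:R != 0 :> C by rewrite pnatr_eq0.
have e1 : l.+1%:R = l%:R + 1 :> C by rewrite -addn1 natrD.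
have e2 : l.+2%:R = l%:R + 2%:R :> C by rewrite -addn2 natrD.
have e3 : (2 * l + 3)%:R = 2%:R * l%:R + 3%:R :> C by rewrite natrD natrM.
have e4 : (2 * l + 5)%:R = 2%:R * l%:R + 5%:R :> C by rewrite natrD natrM.
have e5 : (2 * l + 1)%:R = 2%:R * l%:R + 1 :> C by rewrite natrD natrM.
rewrite (_ : (2 * l.+1 + 1)%N = (2 * l + 3)%N); last by lia.
rewrite (_ : (2 * l.+1 + 3)%N = (2 * l + 5)%N); last by lia.
rewrite e1 e2 e3 e4 e5; apply: c1_rec_alg.
- by rewrite -e4 -[5%N]/(4.+1)%N addnS nz.
- by rewrite -e3 addn3 nz.
- by rewrite -e1 nz.
- by rewrite -e2 nz.
- by rewrite -e5 addn1 nz.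
Qed.

Lemma abR l : (2 * l + 5)%:R * (alR l.+1 * beR l.+2) = 'X + (2 * l + 1)%:R * (alR l * beR l.+1).
Proof. by rewrite /alR /beR !mulrNN c1_rec. Qed.

Lemma abS l : (2 * l + 5)%:R * (alS l.+1 * beS l.+2) = 'X + (2 * l + 1)%:R * (alS l * beS l.+1).
Proof. by rewrite /alS /beS !mulrNN /= ![_%:R * c1 _]mulrC c1_rec. Qed.

Lemma natrP n : (n%:R : C)%:P = n%:R :> O.
Proof. exact: (rmorph_nat (@polyC C)). Qed.

Lemma sign_alg1 (K : comNzRingType) (a b c : K) : - a * (- b * c) = - c * (b * - a).
Proof. by ring. Qed.

Lemma sign_alg2 (K : comNzRingType) (a b c : K) : b * - a * - c = - b * c * - a.
Proof. by ring. Qed.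

(** With [ka_down], the compatibility that [fisH_gH] asks for: lowering singular solutions is
    adjoint to raising regular ones, and conversely. *)
Lemma ka_up l : beS l.+1 * (ka l)%:P = (ka l.+1)%:P * ((2 * l + 1)%:R * alR l).
Proof.
rewrite kaS /ka /beS /alR /= !polyCM !polyCN natrP; exact: sign_alg1.
Qed.

Lemma ka_down l : (2 * l + 1)%:R * alS l * (ka l.+1)%:P = (ka l)%:P * beR l.+1.
Proof.
rewrite kaS /ka /alS /beR !polyCM !polyCN natrP; exact: sign_alg2.
Qed.

End LadderCoefficients.

(** * Identification of both families with the harmonic model *)

Section RegularAndSingular.
Variables (R : realType) (gamma : R).
Local Notation C := R[i].
Local Notation O := {poly C}.
Local Notation PC := (mpoly.mpoly 3 C).
Local Notation HO := (HO R).
Local Notation homog l P := (P \is mpoly.ishomog1 l mpoly.mdeg).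
Local Notation Fr lam := (fun l => Freg gamma l lam).
Local Notation Gs lam := (fun l => Gsing gamma l lam).
Implicit Types (P Q : PC) (lam : C) (v : HO).

Lemma reg_unique l lam f : regular_radial gamma l lam f ->
  forall t, 0 < t -> f t = Freg gamma l lam t.
Proof.
move=> rf t t0; have /regularP[sf af] := rf.
by rewrite (regat_eq sf af (Freg_regular gamma l lam) (Gsing_singular gamma l lam) t0) mul1r.
Qed.

Lemma reg_regat l lam h : regular_radial gamma l lam h -> regat l 1 h.
Proof. by move/regularP => []. Qed.

Lemma wr_GF l lam t : 0 < t -> wr (Gsing gamma l lam) (Freg gamma l lam) t = - (2 * l + 1)%:R.
Proof.
move=> t0; have := wr_singat (Gsing_singular gamma l lam) (Freg_sol gamma l lam) (Freg_regat gamma l lam)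
  (@reg_regat l lam) t0.
by rewrite mulr1.
Qed.

Lemma wr_FF l lam t : 0 < t -> wr (Freg gamma l lam) (Freg gamma l lam) t = 0.
Proof. exact: wr_regat (Freg_sol gamma l lam) (Freg_sol gamma l lam) (Freg_regat gamma l lam) (Freg_regat gamma l lam) t. Qed.

Lemma sing_unique l lam g : singular_radial gamma l lam g ->
  exists b, forall t, 0 < t -> g t = Gsing gamma l lam t + b * Freg gamma l lam t.
Proof.
move=> sg; have [a [b [E W]]] := sol_decomp sg.1 (Freg_regular gamma l lam) (Gsing_singular gamma l lam).
exists b => t t0; have W1 := W t t0.
have W2 := wr_singat sg (Freg_sol gamma l lam) (Freg_regat gamma l lam) (@reg_regat l lam) t0.
have n0 : - (2 * l + 1)%:R != 0 :> C by rewrite oppr_eq0 pnatr_eq0 addn1.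
have -> : g t = a * Gsing gamma l lam t + b * Freg gamma l lam t by exact: E.
suff -> : a = 1 by rewrite mul1r.
by apply: (mulfI n0); rewrite -W1 W2.
Qed.

(** The regular part [Q] drops out because regular solutions have zero Wronskian with each other:
    the form is well defined on singular classes, and independent of the radius. *)
Lemma pairing_GF lam P Q S r : 0 < r -> lap P = 0 -> lap Q = 0 -> lap S = 0 ->
  wronskian r (SO (Gs lam) P + SO (Fr lam) Q) (SO (Fr lam) S) = fis (wgt (@ka R) P) S.
Proof.
move=> r0 lP lQ lS.
have -> := wronskian_pair r0 (fun l => (Gsing_singular gamma l lam).1) (fun l => Freg_sol gamma l lam)
  (fun l => Freg_sol gamma l lam) (fun l => @wr_GF l lam r r0) (fun l => @wr_FF l lam r r0) lP lQ lS.
have -> : wgt (fun l => 0 * cc C l) Q = 0.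
  transitivity (wgt (fun=> 0) Q); first by apply: eq_wgt => l; rewrite mul0r.
  by rewrite wgt_cst scale0r.
by rewrite fis0l addr0.
Qed.

(** If the superposition vanishes, the Wronskian form with every singular solution does, and
    nondegeneracy of the weighted Fischer pairing gives [P = 0]. *)
Lemma SO_reg_inj lam P : lap P = 0 -> SO (Fr lam) P = 0 -> P = 0.
Proof.
move=> lP E; apply: (fis_nondeg (@ka_neq0 R) lP) => Q lQ; rewrite wgt_anti.
have h := pairing_GF lam (@ltr01 R) lQ (@lap0E C) lP.
have h0 := pairing_GF lam (@ltr01 R) lQ (@lap0E C) (@lap0E C).
by rewrite -h E -(SO0 (Fr lam)) h0 fis0r.
Qed.

Lemma SO_sing_inj lam P Q : lap P = 0 -> lap Q = 0 -> SO (Gs lam) P = SO (Fr lam) Q -> P = 0.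
Proof.
move=> lP lQ E; apply: (fis_nondeg (@ka_neq0 R) lP) => S lS.
have <- := pairing_GF lam (@ltr01 R) lP (@lap0E C) lS.
have := pairing_GF lam (@ltr01 R) (@lap0E C) lQ lS.
by rewrite !SO0 addr0 add0r E => ->; rewrite wgt0E fis0l.
Qed.

Definition mkreg lam P (hP : lap P = 0) : Sol gamma lam :=
  exist _ (SO (Fr lam) P) (SO_sol (fun l => Freg_sol gamma l lam) hP).
Definition mksing lam P (hP : lap P = 0) : Sol gamma lam :=
  exist _ (SO (Gs lam) P) (SO_sol (fun l => (Gsing_singular gamma l lam).1) hP).

Lemma valSolP lam c (x y : Sol gamma lam) : val (c *: x + y) = c *: val x + val y.
Proof. by []. Qed.

Lemma RA_reg_unique l lam f Y : homog l Y -> regular_radial gamma l lam f ->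
  radial_angular f Y = SO (Fr lam) Y.
Proof.
move=> hY rf; rewrite (radial_angularE f hY) (SO_homog (Fr lam) hY) /RA; apply: rp_ext => t t0.
by rewrite (reg_unique rf t0).
Qed.

Lemma RA_sing_unique l lam g Y : homog l Y -> singular_radial gamma l lam g ->
  exists b, radial_angular g Y = SO (Gs lam) Y + b *: SO (Fr lam) Y.
Proof.
move=> hY sg; have [b hb] := sing_unique sg; exists b.
rewrite (radial_angularE g hY) (SO_homog (Fr lam) hY) (SO_homog (Gs lam) hY) -[RA l (Gsing _ _ _) Y]scale1r.
by apply: RA_comb hY _ => t t0; rewrite mul1r hb.
Qed.

Lemma RegSolP lam (psi : Sol gamma lam) : RegSol psi <-> exists Q, lap Q = 0 /\ val psi = SO (Fr lam) Q.
Proof.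
split.
  move=> h; pattern psi; apply: (lspan_ind _ _ _ h) => [|c x y [Q1 [l1 e1]] [Q2 [l2 e2]]|x [l [Y [f [[hY lY] rf ->]]]]].
  - by exists 0; rewrite SO0; split=> //; exact: lap0E.
  - exists (c *: Q1 + Q2); split; first by apply: lapDE l2; exact: lapZE.
    by rewrite valSolP e1 e2 SO_lin.
  - by exists Y; split; [exact: lY | exact: RA_reg_unique hY rf].
move=> [Q [lQ E]].
suff [x [ex hx]] : exists x : Sol gamma lam, val x = SO (Fr lam) Q /\ RegSol x.
  by have -> : psi = x by apply: val_inj; rewrite ex.
move: Q lQ {E}; apply: harm_ind => [|P Q [x [ex hx]] [y [ey hy]]|l P hP lP].
- by exists 0; rewrite SO0; split=> //; exact/asboolP/(lspan_submod _).1.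
- exists (1 *: x + y); split; first by rewrite valSolP scale1r ex ey SOD.
  by apply/asboolP; apply: (lspan_submod _).2; exact/asboolP.
- exists (mkreg lam lP); split=> //; apply: mem_lspan.
  exists l, P, (Freg gamma l lam); split=> //; first exact: Freg_regular.
  by rewrite /= -(RA_reg_unique hP (Freg_regular gamma l lam)).
Qed.

Lemma sing_classP lam (x y : Sol gamma lam) : sing_class x = sing_class y <->
  exists Q, lap Q = 0 /\ val x = val y + SO (Fr lam) Q.
Proof.
split.
  move/lprojP => /RegSolP[Q [lQ E]]; exists Q; split=> //.
  by rewrite -E; have -> : val (x - y) = val x - val y by []; rewrite addrC subrK.
move=> [Q [lQ E]]; apply/lprojP/RegSolP; exists Q; split=> //.
by have -> : val (x - y) = val x - val y by []; rewrite E addrAC subrr add0r.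
Qed.

Lemma sing_classPlin lam c (x y : Sol gamma lam) :
  sing_class (c *: x + y) = c *: sing_class x + sing_class y.
Proof. by rewrite /sing_class lprojD -lprojZ. Qed.

Lemma sing_class0 lam : sing_class (0 : Sol gamma lam) = 0.
Proof.
have := sing_classPlin (-1) (0 : Sol gamma lam) 0.
by rewrite scaler0 addr0 scaleN1r addNr.
Qed.

Lemma HO_ind (Q : HO -> Prop) : Q 0 -> (forall c u v, Q u -> Q v -> Q (c *: u + v)) ->
  (forall l a, Q (@hO R l a)) -> forall v, Q v.
Proof.
move=> Q0 QD Qh v; rewrite (HO_expand (leqnn (mpoly.msize (val v)))).
have QA u w : Q u -> Q w -> Q (u + w) by move=> hu hw; rewrite -[u]scale1r; exact: QD.
apply: big_ind => // l _; apply: big_ind => // a _.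
by rewrite -[_ *: _]addr0; exact: QD.
Qed.

Lemma parametrize (V : lmodType O) (A : set V) (sec : HO -> V) :
    (forall c u v, sec (c *: u + v) = c *: sec u + sec v) ->
    (forall v, sec v = 0 -> v = 0) -> (forall l a, A (sec (@hO R l a))) ->
    (forall s, A s -> exists v, s = sec v) ->
  exists (Th : HO -> lspan_type A) (Ps : lspan_type A -> HO),
    [/\ linear Th, cancel Th Ps, cancel Ps Th & forall v, val (Th v) = sec v].
Proof.
move=> lin inj mem sur.
have sec0 : sec 0 = 0.
  by have := lin (-1) 0 0; rewrite scaler0 addr0 scaleN1r addNr.
have memA v : sec v \in lspan_pred A.
  apply/asboolP; move: v; apply: HO_ind => [|c u v hu hv|l a]; last by apply: mem_lspan; exact: mem.
    by rewrite sec0; exact/asboolP/(lspan_submod _).1.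
  by rewrite lin; apply/asboolP; apply: (lspan_submod _).2; exact/asboolP.
pose Th v : lspan_type A := exist _ (sec v) (memA v).
have surT s : exists v, Th v = s.
  have /asboolP := valP s; suff H t : lspan A t -> exists v, t = sec v.
    by move/H => [v e]; exists v; apply: val_inj.
  move=> h; pattern t; apply: (lspan_ind _ _ _ h) => [|c x y [u ->] [w ->]|x]; last exact: sur.
    by exists 0.
  by exists (c *: u + w); rewrite lin.
have /choice [Ps hPs] := surT.
have injT u v : Th u = Th v -> u = v.
  move=> /(congr1 val) /= E; apply/eqP; rewrite -subr_eq0; apply/eqP; apply: inj.
  by rewrite addrC -scaleN1r lin E scaleN1r addNr.
exists Th, Ps; split=> //; last by move=> v; apply: injT; rewrite hPs.
by move=> c u v; apply: val_inj; exact: lin.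
Qed.

Lemma lap_specv lam v : lap (spec lam (val v)) = 0.
Proof. by apply: lap_spec; exact: lap_val. Qed.

Lemma specPE lam c u v : spec lam (val (c *: u + v)) = c.[lam] *: spec lam (val u) + spec lam (val v).
Proof. by rewrite valHOD valHOZ specD specZ. Qed.

Lemma reg_param : exists (Th : HO -> RegFam gamma) (Ps : RegFam gamma -> HO),
  [/\ linear Th, cancel Th Ps, cancel Ps Th
    & forall v lam, val (val (Th v) lam) = SO (Fr lam) (spec lam (val v))].
Proof.
pose sec v : solsections gamma := fun lam => mkreg lam (lap_specv lam v).
have lin c u v : sec (c *: u + v) = c *: sec u + sec v.
  apply: functional_extensionality_dep => lam; apply: val_inj.
  by rewrite /sec /= specPE SO_lin.
have inj v : sec v = 0 -> v = 0.
  move=> E; apply: val_inj; apply: spec_inj => lam; apply: (SO_reg_inj (lam := lam) (lap_specv lam v)).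
  exact: (congr1 (fun s : solsections gamma => val (s lam)) E).
have mem l a : regfam_gen (sec (@hO R l a)).
  exists l, (@hb _ (unitC R) l a), 1, (fun lam => Freg gamma l lam); split.
  - by split; [exact: hb_homog | exact: lap_hb].
  - by move=> lam; exact: Freg_regular.
  move=> lam; rewrite hornerC scale1r /= spec_hO.
  by rewrite (RA_reg_unique (hb_homog _ _) (Freg_regular gamma l lam)).
have sur s : regfam_gen s -> exists v, s = sec v.
  move=> [l [Y [p [F [[hY lY] rF E]]]]]; have lY' : lap Y = 0 by exact: lY.
  exists (p *: liftH lY'); apply: functional_extensionality_dep => lam; apply: val_inj.
  rewrite E /= (RA_reg_unique hY (rF lam)) -SOZ; congr SO.
  by rewrite specZ spec_lift.
have [Th [Ps [h1 h2 h3 h4]]] := parametrize lin inj mem sur.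
by exists Th, Ps; split=> // v lam; rewrite h4.
Qed.

(** The second solution may be chosen differently for each [lam]; two choices differ by a multiple
    of the regular solution, which the quotient removes, so that every generator is the image of a
    harmonic polynomial with coefficients in [C[T]]. *)
Lemma sing_param : exists (Th : HO -> SingFam gamma) (Ps : SingFam gamma -> HO),
  [/\ linear Th, cancel Th Ps, cancel Ps Th
    & forall v lam, val (Th v) lam = sing_class (mksing lam (lap_specv lam v))].
Proof.
pose sec v : singsections gamma := fun lam => sing_class (mksing lam (lap_specv lam v)).
have lin c u v : sec (c *: u + v) = c *: sec u + sec v.
  apply: functional_extensionality_dep => lam; rewrite -[RHS]/(c.[lam] *: sec u lam + sec v lam).
  rewrite /sec -sing_classPlin; congr sing_class; apply: val_inj.
  by rewrite /= specPE SO_lin.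
have inj v : sec v = 0 -> v = 0.
  move=> E; apply: val_inj; apply: spec_inj => lam.
  have : sec v lam = sing_class 0.
    by rewrite sing_class0; exact: (congr1 (fun s : singsections gamma => s lam) E).
  move/sing_classP => [Q [lQ]]; rewrite /= add0r => e.
  exact: SO_sing_inj (lap_specv lam v) lQ e.
have mem l a : singfam_gen (sec (@hO R l a)).
  exists l, (@hb _ (unitC R) l a), 1, (fun lam => Gsing gamma l lam); split.
  - by split; [exact: hb_homog | exact: lap_hb].
  - by move=> lam; exact: Gsing_singular.
  move=> lam; exists (mksing lam (lap_specv lam (hO R a))); split=> //.
  rewrite hornerC scale1r /= spec_hO (radial_angularE _ (hb_homog (unitC R) a)).
  exact: SO_homog (hb_homog _ _).
have sur s : singfam_gen s -> exists v, s = sec v.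
  move=> [l [Y [p [G [[hY lY] sG E]]]]]; have lY' : lap Y = 0 by exact: lY.
  exists (p *: liftH lY'); apply: functional_extensionality_dep => lam.
  have [psi [e ->]] := E lam; apply/sing_classP.
  have [b hb] := RA_sing_unique hY (sG lam).
  exists ((p.[lam] * b) *: Y); split; first exact: lapZE.
  by rewrite e hb /= specZ spec_lift !SOZ scalerDr scalerA.
have [Th [Ps [h1 h2 h3 h4]]] := parametrize lin inj mem sur.
by exists Th, Ps; split=> // v lam; rewrite h4.
Qed.

End RegularAndSingular.

(** * Comparison of the differential operators with the harmonic model *)

Section LadderOperators.
Variables (R : realType) (gamma : R).
Local Notation C := R[i].
Local Notation Fr lam := (fun l => Freg gamma l lam).
Local Notation Gs lam := (fun l => Gsing gamma l lam).
Implicit Types (lam : C) (v : HO R).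

Lemma ladder_up_alg (K : fieldType) (n a b c : K) : a != 0 -> b != 0 -> c != 0 ->
  - (n / (a * c)) = b * - (n / (a * b * c)).
Proof. by move=> *; field; do ! (apply/andP; split). Qed.

Lemma ladder_down_alg (K : fieldType) (n a b c : K) : a != 0 -> b != 0 -> c != 0 ->
  n / (a * b) = - (c * - (n / (a * b * c))).
Proof. by move=> *; field; do ! (apply/andP; split). Qed.

Let nz n : n.+1%:R != 0 :> C. Proof. by rewrite pnatr_eq0. Qed.
Let nz1 n : (2 * n + 1)%:R != 0 :> C. Proof. by rewrite addn1 nz. Qed.
Let nz3 n : (2 * n + 3)%:R != 0 :> C. Proof. by rewrite addn3 nz. Qed.

(** The error term is zero here; it is displayed with an arbitrary [h] to fit the form of the ladder
    hypotheses shared with the singular family. *)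
Lemma reg_up lam l (h : R -> C) : exists b, forall t, 0 < t ->
  dplus gamma l (Freg gamma l lam) t =
  (2 * l + 1)%:R * (alR gamma l).[lam] * Freg gamma l.+1 lam t + b * h t.
Proof.
exists 0 => t t0; rewrite mul0r addr0.
have -> := dplus_reg (Freg_regular gamma l lam) (Gsing_singular gamma l lam) (Freg_regular gamma l.+1 lam) (Gsing_singular gamma l.+1 lam) t0.
by rewrite /alR hornerN horner_c1; congr (_ * _); exact: ladder_up_alg.
Qed.

Lemma reg_down lam l (h : R -> C) : exists b, forall t, 0 < t ->
  dminus gamma l (Freg gamma l.+1 lam) t =
  - ((2 * l + 3)%:R * (beR R l.+1).[lam]) * Freg gamma l lam t + b * h t.
Proof.
exists 0 => t t0; rewrite mul0r addr0.
have -> := dminus_reg (Freg_regular gamma l lam) (Gsing_singular gamma l lam) (Freg_regular gamma l.+1 lam) t0.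
by rewrite /beR hornerN horner_natr mulrN opprK [_ * l.+1%:R]mulrC.
Qed.

Lemma sing_up lam l : exists b, forall t, 0 < t ->
  dplus gamma l (Gsing gamma l lam) t =
  (2 * l + 1)%:R * (alS R l).[lam] * Gsing gamma l.+1 lam t + b * Freg gamma l.+1 lam t.
Proof.
have [b hb] := dplus_sing (Freg_regular gamma l lam) (Gsing_singular gamma l lam)
  (Freg_regular gamma l.+1 lam) (Gsing_singular gamma l.+1 lam).
by exists b => t t0; rewrite hb // /alS hornerN horner_natr mulrN [_ * l.+1%:R]mulrC.
Qed.

Lemma sing_down lam l : exists b, forall t, 0 < t ->
  dminus gamma l (Gsing gamma l.+1 lam) t =
  - ((2 * l + 3)%:R * (beS gamma l.+1).[lam]) * Gsing gamma l lam t + b * Freg gamma l lam t.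
Proof.
have [b hb] := dminus_sing (Freg_regular gamma l lam) (Gsing_singular gamma l lam)
  (Freg_regular gamma l.+1 lam) (Gsing_singular gamma l.+1 lam).
exists b => t t0; rewrite hb // /beS hornerN horner_c1 /=; congr (_ * _ + _).
exact: ladder_down_alg.
Qed.

Lemma dplus0 l t : dplus gamma l (fun=> 0) t = 0.
Proof. by rewrite /dplus (cder_val (cder_cst 0 t)) !(mulr0, mul0r) subr0 mulr0 addr0. Qed.

Lemma dminus0 l t : dminus gamma l (fun=> 0) t = 0.
Proof. by rewrite /dminus (cder_val (cder_cst 0 t)) !(mulr0, mul0r) addr0 mulr0 subr0. Qed.

Lemma gop_reg lam X v : gop gamma X (SO (Fr lam) (spec lam (val v))) =
  SO (Fr lam) (spec lam (val (gH (alR gamma) (beR R) X v))).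
Proof.
have s0 l : radial_solution gamma l lam (fun=> 0) := zero_sol (fun l => Freg_sol gamma l lam) l.
have z0 l : exists b, forall t, 0 < t ->
  dplus gamma l (fun=> 0) t = (2 * l + 1)%:R * 0 * 0 + b * 0.
  by exists 0 => t _; rewrite dplus0 !mulr0 addr0.
have z1 l : exists b, forall t, 0 < t ->
  dminus gamma l (fun=> 0) t = - ((2 * l + 3)%:R * 0) * 0 + b * 0.
  by exists 0 => t _; rewrite dminus0 !mulr0 addr0.
have [Q [_]] := @gop_pair R gamma lam (Fr lam) (fun _ _ => 0) (fun l => (alR gamma l).[lam])
  (fun l => (beR R l).[lam]) (fun=> 0) (fun=> 0) (fun l => Freg_sol gamma l lam) s0
  (fun l => reg_up lam l (fun=> 0)) (fun l => reg_down lam l (fun=> 0)) z0 z1 X _ _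
  (lap_specv lam v) (@lap0E C).
rewrite !SO_zero !addr0 => ->.
by congr SO; apply: esym; exact: spec_gfun.
Qed.

Lemma gop_sing lam X v Q : lap Q = 0 -> exists Q', lap Q' = 0 /\
  gop gamma X (SO (Gs lam) (spec lam (val v)) + SO (Fr lam) Q) =
  SO (Gs lam) (spec lam (val (gH (alS R) (beS gamma) X v))) + SO (Fr lam) Q'.
Proof.
move=> lQ; have [Q' [lQ' ->]] := @gop_pair R gamma lam (Gs lam) (Fr lam) (fun l => (alS R l).[lam])
  (fun l => (beS gamma l).[lam]) (fun l => (alR gamma l).[lam]) (fun l => (beR R l).[lam])
  (fun l => (Gsing_singular gamma l lam).1) (fun l => Freg_sol gamma l lam)
  (sing_up lam) (sing_down lam) (fun l => reg_up lam l (fun=> 0)) (fun l => reg_down lam l (fun=> 0))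
  X _ _ (lap_specv lam v) lQ.
by exists Q'; split=> //; congr (SO _ _ + _); apply: esym; exact: spec_gfun.
Qed.

Lemma spec_kH lam (A : 'M[R]_3) v : orthogonal_mx A ->
  spec lam (val (kH (map_mx (real_complex R) A) v)) =
  sub (rho (map_mx (real_complex R) A)) (spec lam (val v)).
Proof. by move=> oA; rewrite val_kH; [exact: spec_sub | exact: orth_mapR]. Qed.

Lemma horner_fisH lam (u v : HO R) : (fisH (@ka R) u v).[lam] =
  fis (wgt (@ka R) (spec lam (val u))) (spec lam (val v)).
Proof.
rewrite /fisH horner_fis spec_wgt; congr (fis _ _); apply: eq_wgt => l.
by rewrite hornerC.
Qed.

Lemma fisH_injl (u u' : HO R) : (forall v, fisH (@ka R) u v = fisH (@ka R) u' v) -> u = u'.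
Proof.
move=> H; apply/eqP; rewrite -subr_eq0; apply/eqP; apply: (fisH_inj (@ka_neq0 R)) => v.
rewrite addrC -scaleN1r; have -> := fisH_linearl (@ka R) v (-1) u' u.
by rewrite mulN1r H addNr.
Qed.

End LadderOperators.

Theorem theorem5p6p2 (R : realType) (gamma : R) (gamma_gt0 : 0 < gamma) :
  exists (aR : hc_family (RegFam gamma)) (aS : hc_family (SingFam gamma))
         (aD : hc_family (hc_dual (kact aR)))
         (Wr : SingFam gamma -> hc_dual (kact aR)),
    [/\ reg_pointwise aR,
        sing_pointwise aS,
        is_twisted_dual aR aD,
        forall s t, wronskian_pairing s t (val (Wr s) t)
      & hc_isomorphism aS aD Wr].
Proof.
have [TR [PR [TRl TRK PRK TRE]]] := reg_param gamma.
have [TS [PS [TSl TSK PSK TSE]]] := sing_param gamma.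
have PRl := Psi_lin TRl TRK PRK; have PSl := Psi_lin TSl TSK PSK.
pose aR := transport (hcH (abR gamma)) TRl TRK PRK.
pose aS := transport (hcH (abS gamma)) TSl TSK PSK.
have kR A t : kact aR A t = TR (kH A (PR t)) by [].
have gR X t : gact aR X t = TR (gH (alR gamma) (beR R) X (PR t)) by [].
have kS A s : kact aS A s = TS (kH A (PS s)) by [].
have gS X s : gact aS X s = TS (gH (alS R) (beS gamma) X (PS s)) by [].
have mem s : (fun t => fisH (@ka R) (PS s) (PR t)) \in hc_dual_pred (kact aR).
  apply/asboolP; split=> [p u v|]; first by rewrite PRl; exact: fisH_functional.
  have [n [w hw]] := fisH_kfinite (@ka R) (PS s).
  exists n, (fun i t => w i (PR t)) => A oA; have [c hc] := hw A oA.
  by exists c => t; rewrite kR TRK; exact: hc.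
pose Wr s : hc_dual (kact aR) := @exist (RegFam gamma -> {poly R[i]}^o) (fun xi => xi \in hc_dual_pred (kact aR)) (fun t => fisH (@ka R) (PS s) (PR t)) (mem s).
have WrE s t : val (Wr s) t = fisH (@ka R) (PS s) (PR t) by [].
have Wr_lin : linear Wr.
  move=> c s s'; apply: val_inj; apply/funext => t.
  rewrite WrE PSl; exact: (fisH_linearl (@ka R) (PR t) c (PS s) (PS s')).
have sur (xi : hc_dual (kact aR)) : exists s, Wr s = xi.
  (* Pulled back to the harmonic model, a finite functional is represented by the weighted Fischer
     pairing; this is surjectivity. *)
  have /asboolP[lin [n [w hw]]] := valP xi.
  have [||u hu] := @kfinite_represented R (@ka R) (@ka_neq0 R) (fun v => val xi (TR v)).
  - by move=> p u v; rewrite TRl; exact: lin.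
  - exists n, (fun i v => w i (TR v)) => A oA; have [c hc] := hw A oA.
    by exists c => v; have := hc (TR v); rewrite kR TRK.
  exists (TS u); apply: val_inj; apply/funext => t.
  by rewrite WrE TSK -hu PRK.
have /choice [Wi WiK] := sur.
have WrK : cancel Wr Wi.
  move=> s; have E := WiK (Wr s); apply: (can_inj PSK); apply: fisH_injl => v.
  by have := congr1 (fun xi : hc_dual (kact aR) => val xi (TR v)) E; rewrite !WrE TRK.
(* The structure on the dual is transported along [Wr], so [Wr] is an isomorphism by construction.
   What remains is that the transported actions are the contragredient ones twisted by [theta],
   which is adjointness for the Fischer pairing. *)
pose aD := transport aS Wr_lin WrK WiK.
have kD A s : kact aD A (Wr s) = Wr (kact aS A s) by rewrite -[LHS]/(Wr (kact aS A (Wi (Wr s)))) WrK.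
have gD X s : gact aD X (Wr s) = Wr (gact aS X s) by rewrite -[LHS]/(Wr (gact aS X (Wi (Wr s)))) WrK.
(* Any representative of a singular class, however chosen, is the standard one plus a regular
   superposition; the pointwise actions and the pairing are checked on this form. *)
have repS s lam (psi : Sol gamma lam) : val s lam = sing_class psi -> exists Q, lap Q = 0 /\
    val psi = SO (fun l => Gsing gamma l lam) (spec lam (val (PS s))) + SO (fun l => Freg gamma l lam) Q.
  by rewrite -{1}[s]PSK TSE => /esym/sing_classP.
exists aR, aS, aD, Wr; split.
- split=> [A oA s lam|X s lam].
    rewrite kR TRE spec_kH // -{2}[s]PRK TRE; apply: esym.
    exact: SO_kfun (fun l => Freg_sol gamma l lam) A _ oA (lap_specv lam (PR s)).
  by rewrite gR TRE -{2}[s]PRK TRE; apply: esym; exact: gop_reg.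
- split=> [A oA s lam psi hs|X s lam psi hs]; have [Q [lQ E]] := repS _ _ _ hs.
    have lQ' : lap (sub (rho (map_mx (real_complex R) A)) Q) = 0.
      by rewrite (lap_sub (rho_orth (orth_mapR oA))) lQ sub0E.
    have E' : kfun A (val psi) = SO (fun l => Gsing gamma l lam) (spec lam (val (kH (map_mx (real_complex R) A) (PS s)))) +
        SO (fun l => Freg gamma l lam) (sub (rho (map_mx (real_complex R) A)) Q).
      rewrite E kfun_add (spec_kH lam (PS s) oA); congr (_ + _).
        exact: SO_kfun (fun l => (Gsing_singular gamma l lam).1) A _ oA (lap_specv lam (PS s)).
      exact: SO_kfun (fun l => Freg_sol gamma l lam) A _ oA lQ.
    exists (mksing gamma lam (lap_specv lam (kH (map_mx (real_complex R) A) (PS s))) + mkreg gamma lam lQ').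
    split; first by rewrite E'.
    by rewrite kS TSE; apply/esym/sing_classP; eexists; split; [exact: lQ'|].
  have [Q' [lQ' E']] := @gop_sing R gamma lam X (PS s) Q lQ.
  exists (mksing gamma lam (lap_specv lam (gH (alS R) (beS gamma) X (PS s))) + mkreg gamma lam lQ').
  split; first by rewrite E E'.
  by rewrite gS TSE; apply/esym/sing_classP; eexists; split; [exact: lQ'|].
- split=> [A oA xi t|X xi t].
    by rewrite -[xi]WiK kD !WrE kS TSK kR TRK -fisH_kH.
  rewrite -[xi]WiK gD !WrE gS TSK gR TRK.
  exact: fisH_gH (@ka_up R gamma) (@ka_down R).
- move=> s t lam psi r r0 hs; have [Q [lQ E]] := repS _ _ _ hs.
  rewrite WrE horner_fisH E -{2}[t]PRK TRE.
  by apply: esym; exact: pairing_GF (lap_specv lam (PS s)) lQ (lap_specv lam (PR t)).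
- exact: transport_isomorphism.
Qed.
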